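(* Let $d\ge1$ and let $\mu$ be any Borel probability measure on $\mathbb{S}_d=\{z\in\mathbb{C}^d:|z|=1\}$. Then for $\mathbb{P}_d$-almost every $X\in\mathrm{Conf}(\mathbb{D}_d)$, simultaneously for all $f\in\mathcal{H}^2(\mathbb{D}_d;\mu)$ and all $z\in\mathbb{D}_d$, we have $$f(z)=\lim_{s\to d^+}\frac{g_X(s,z;f)}{g_X(s,z)},$$ where the convergence is uniform for $f\in\{P^b[h\mu]:\|h\|_{L^2(\mu)}\le1\}$ and locally uniform in $z\in\mathbb{D}_d$.
   Context: $\mathbb{D}_d$ is the open unit ball of $\mathbb{C}^d$, $o$ its center, $z\cdot w=\sum_k z_kw_k$, $dv_d$ is Lebesgue measure normalized so that $v_d(\mathbb{D}_d)=1$. The Bergman kernel is $K_{\mathbb{D}_d}(z,w)=(1-z\cdot\bar w)^{-(d+1)}$. $\mathbb{P}_d=\mathbb{P}_{K_{\mathbb{D}_d}}$ is the determinantal point process on $\mathbb{D}_d$ induced by $K_{\mathbb{D}_d}$: the unique simple point process (Borel probability measure on the space $\mathrm{Conf}(\mathbb{D}_d)$ of locally finite configurations $X$) whose $n$-th correlation function with respect to $dv_d$ is $\det(K_{\mathbb{D}_d}(x_i,x_j))_{1\le i,j\le n}$ for all $n\ge1$. The Bergman metric is $d_B(z,w)=\log\frac{1+|\varphi_w(z)|}{1-|\varphi_w(z)|}$, where $\varphi_o(z)=-z$ and, for $w\ne o$, $\varphi_w(z)=\frac{w-\frac{z\cdot\bar w}{|w|^2}w-\sqrt{1-|w|^2}\left(z-\frac{z\cdot\bar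 w}{|w|^2}w\right)}{1-z\cdot\bar w}$. The Poisson–Szegő kernel is $P^b(w,\zeta)=\frac{(1-|w|^2)^d}{|1-\zeta\cdot\bar w|^{2d}}$ for $w\in\mathbb{D}_d$, $\zeta\in\mathbb{S}_d$. For $h\in L^2(\mathbb{S}_d,\mu)$, $P^b[h\mu](z)=\int_{\mathbb{S}_d}P^b(z,\zeta)h(\zeta)\,d\mu(\zeta)$, and $\mathcal{H}^2(\mathbb{D}_d;\mu)=\{P^b[h\mu]:h\in L^2(\mathbb{S}_d,\mu)\}$. For $s>d$: $g_X(s,z)=\sum_{x\in X}e^{-s d_B(x,z)}$ and $g_X(s,z;f)=\sum_{x\in X}e^{-s d_B(x,z)}f(x)$; for $\mathbb{P}_d$-almost every $X$ the latter series converges absolutely simultaneously for all $f\in\mathcal{H}^2(\mathbb{D}_d;\mu)$, all $z\in\mathbb{D}_d$ and all $s>d$. *)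

(* Defs.v *)
From HB Require Import structures.
From mathcomp Require Import all_boot all_order all_algebra.
From mathcomp Require Import all_classical all_reals all_analysis.
From mathcomp Require Import measurable_realfun complex.
From mathcomp Require Import ring lra.

Set Implicit Arguments.
Unset Strict Implicit.
Unset Printing Implicit Defensive.

Import Order.TTheory GRing.Theory Num.Theory.
Import numFieldNormedType.Exports.
Import ComplexField.Normc.

Local Open Scope classical_set_scope.
Local Open Scope ring_scope.
Local Open Scope complex_scope.

(* The topology that mathcomp-analysis puts on any numClosedFieldType is not
   found by unification on R[i]; it is declared here. *)
HB.instance Definition _ (R : realType) :=
  NormedModule.copy R[i] ((R[i] : numClosedFieldType)^o).

(* Borel sigma-algebra of C^d. *)
HB.instance Definition _ (R : realType) (d : nat) :=
  Measurable.copy 'rV[R[i]]_d (g_sigma_algebraType (@open 'rV[R[i]]_d)).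

Lemma product_sigma_finite d1 d2 (T1 : measurableType d1)
    (T2 : measurableType d2) (R : realType)
    (m1 : {sigma_finite_measure set T1 -> \bar R})
    (m2 : {sigma_finite_measure set T2 -> \bar R}) :
  sigma_finite setT (m1 \x m2)%E.
Proof.
have /sigma_finiteP[F [TF ndF Foo]] := sigma_finiteT m1.
have /sigma_finiteP[G [TG ndG Goo]] := sigma_finiteT m2.
exists (fun n => F n `*` G n).
  rewrite -setXTT TF TG predeqE => -[x y]; split.
    move=> [/= [n _ Fnx] [k _ Gky]]; exists (maxn n k) => //; split.
    - by move: x Fnx; exact/subsetPset/ndF/leq_maxl.
    - by move: y Gky; exact/subsetPset/ndG/leq_maxr.
  by move=> [n _ []/= ? ?]; split; exists n.
move=> k; have [? ?] := Foo k; have [? ?] := Goo k.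
split; first exact: measurableX.
by rewrite product_measure1E// lte_mul_pinfty// ge0_fin_numE.
Qed.

Section cons_measure.
Context dT (T : measurableType dT) (R : realType) (n : nat).
Variables (mu : {sigma_finite_measure set T -> \bar R})
          (nu : {sigma_finite_measure set (n.-tuple T) -> \bar R}).

Definition tuple_cons (x : T * n.-tuple T) : n.+1.-tuple T :=
  [the n.+1.-tuple T of x.1 :: x.2].

Let tuple_uncons (x : n.+1.-tuple T) : T * n.-tuple T :=
  (tnth x ord0, [tuple of behead x]).

Lemma measurable_tuple_cons : measurable_fun [set: T * n.-tuple T] tuple_cons.
Proof. exact: measurable_cons. Qed.

Let measurable_tuple_uncons : measurable_fun [set: n.+1.-tuple T] tuple_uncons.
Proof.
apply/measurable_fun_pair; first exact: measurable_tnth.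
exact: measurable_behead.
Qed.

Let tuple_consK : cancel tuple_cons tuple_uncons.
Proof. by move=> [x t]; congr pair; apply/val_inj. Qed.

Let tuple_unconsK : cancel tuple_uncons tuple_cons.
Proof. by move=> t; rewrite /tuple_cons/= [RHS]tuple_eta. Qed.

Definition cons_measure := pushforward (mu \x nu)%E tuple_cons.

Let cons_measure0 : cons_measure set0 = 0%E.
Proof. by rewrite /cons_measure /pushforward preimage_set0 measure0. Qed.

Let cons_measure_ge0 A : (0 <= cons_measure A)%E.
Proof. by rewrite /cons_measure /pushforward; exact: measure_ge0. Qed.

Let cons_measure_sigma_additive : semi_sigma_additive cons_measure.
Proof.
move=> F mF tF mUF; rewrite /cons_measure /pushforward preimage_bigcup.
have mpre A : measurable A -> measurable (tuple_cons @^-1` A).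
  by move=> mA; rewrite -[X in measurable X]setTI; exact: measurable_tuple_cons.
apply: measure_semi_sigma_additive => [k||].
- exact: mpre.
- apply/trivIsetP => /= i j _ _ ij; rewrite -preimage_setI.
  by move/trivIsetP : tF => /(_ _ _ _ _ ij) ->//; rewrite preimage_set0.
- by rewrite -preimage_bigcup; exact: mpre.
Qed.

HB.instance Definition _ := isMeasure.Build _ _ _ cons_measure
  cons_measure0 cons_measure_ge0 cons_measure_sigma_additive.

Let cons_measure_sigma_finite : sigma_finite setT cons_measure.
Proof.
have [F TF Foo] := product_sigma_finite mu nu.
exists (fun k => tuple_uncons @^-1` F k).
  by rewrite -preimage_bigcup -TF preimage_setT.
move=> k; have [mF Fk] := Foo k; split.
  by rewrite -[X in measurable X]setTI; exact: measurable_tuple_uncons.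
rewrite /cons_measure /pushforward -comp_preimage.
by rewrite (_ : _ \o _ = idfun) //; apply/funext => x; exact: tuple_consK.
Qed.

HB.instance Definition _ := Measure_isSigmaFinite.Build _ _ _ cons_measure
  cons_measure_sigma_finite.

End cons_measure.

(* n-fold product measure mu x ... x mu *)
Fixpoint power_measure dT (T : measurableType dT) (R : realType)
    (mu : {sigma_finite_measure set T -> \bar R}) (n : nat) :
    {sigma_finite_measure set (n.-tuple T) -> \bar R} :=
  match n with
  | 0 => dirac [tuple]
  | n'.+1 => cons_measure mu (power_measure mu n')
  end.

Section ball.
Context (R : realType) (d : nat).
Implicit Types z w : 'rV[R[i]]_d.

(* Euclidean norm; `|z| is the max norm on row vectors. *)
Definition cnorm z : R := Num.sqrt (\sum_(k < d) normc (z ord0 k) ^+ 2).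

Definition unit_ball : set 'rV[R[i]]_d := [set z | cnorm z < 1].

Definition unit_sphere : set 'rV[R[i]]_d := [set z | cnorm z = 1].

Lemma normc_continuous : continuous (@normc R : R[i] -> R).
Proof.
move=> x A /nbhs_ballP[e /= e0 eA].
apply/nbhs_ballP; exists e%:C => /=; first by rewrite ltcR.
move=> y; rewrite /ball /= => xy; apply: eA; rewrite /ball /=.
have {}xy : normc (x - y) < e by move: xy; rewrite -ltcR; case: (x - y).
apply: le_lt_trans xy; rewrite ler_norml; apply/andP; split.
  rewrite lerNl opprB lerBlDl -[y in normc y](subrKC x) -[normc (x - y)]normcN.
  by rewrite opprB; exact: le_normcD.
by rewrite lerBlDr -[x in normc x](subrK y); exact: le_normcD.
Qed.

Lemma cnorm_continuous : continuous cnorm.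
Proof.
move=> z; apply: (@continuous_comp _ _ _
  (fun z => \sum_(k < d) normc (z ord0 k) ^+ 2) Num.sqrt); last first.
  exact: sqrt_continuous.
apply: continuous_big => [|k _]; first exact: add_continuous.
move=> {}z.
apply: (@continuous_comp _ _ _ (fun z : 'rV[R[i]]_d => normc (z ord0 k))
  (fun x : R => x ^+ 2)); last exact: exprn_continuous.
apply: (@continuous_comp _ _ _ (fun z : 'rV[R[i]]_d => z ord0 k) (@normc R)).
  exact: coord_continuous.
exact: normc_continuous.
Qed.

Lemma measurable_unit_ball : measurable unit_ball.
Proof.
apply: sub_sigma_algebra; rewrite (_ : unit_ball = cnorm @^-1` [set x | x < 1]) //.
by apply: open_comp => [z _|]; [exact: cnorm_continuous|exact: open_lt].
Qed.

End ball.

Section lebesgue.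
Context (R : realType) (d : nat).

Definition vec_of_coords (x : (d + d).-tuple (measurableTypeR R)) :
    'rV[R[i]]_d :=
  \row_k (tnth x (lshift d k) +i* tnth x (rshift d k)).

Let box (q : (d + d).-tuple rat * nat) : set ((d + d).-tuple (measurableTypeR R)) :=
  [set x | forall i, `|tnth x i - ratr (tnth q.1 i)| < q.2.+1%:R^-1].

Let measurable_box q : measurable (box q).
Proof.
rewrite (_ : box q = \bigcap_i
    ((fun x : (d + d).-tuple (measurableTypeR R) => tnth x i) @^-1`
      ball (ratr (tnth q.1 i) : R) q.2.+1%:R^-1)); last first.
  apply/seteqP; split => x /= xq i; first by move=> _; rewrite /ball/= distrC.
  by have := xq i Logic.I; rewrite /ball/= distrC.
apply: fin_bigcap_measurable => // i _.
rewrite -[X in measurable X]setTI; apply: measurable_tnth => //.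
by rewrite ball_itv; exact: measurable_itv.
Qed.

Lemma measurable_vec_of_coords : measurable_fun setT vec_of_coords.
Proof.
apply: (@measurability _ _ _ _ _ _ (@open 'rV[R[i]]_d)) => //.
move=> _ [U oU <-]; rewrite setTI.
pose F n := if @unpickle ((d + d).-tuple rat * nat)%type n is Some q
  then (if `[< box q `<=` vec_of_coords @^-1` U >] then box q else set0)
  else set0.
rewrite (_ : _ @^-1` U = \bigcup_n F n); last first.
  apply/seteqP; split => [x Ux|x [n _]]; rewrite /F; last first.
    by case: unpickle => // q; case: ifPn => // /asboolP; exact.
  have : nbhs (vec_of_coords x) U by exact: open_nbhs_nbhs.
  move=> /nbhs_ballP[e /= e0 eU].
  have [r r0 eE] : exists2 r : R, 0 < r & e = r%:C.
    move: e0; rewrite ltcE /= => /andP[/eqP ime re0].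
    by exists (complex.Re e) => //; case: e {eU re0} ime => a b /= ->.
  have [k] := @ltr_add_invr R 0 (r / 4) (divr_gt0 r0 (ltr0n _ 4)).
  rewrite add0r => kr.
  have /choice[q qx] : forall i, exists p : rat,
      `|tnth x i - ratr p| < k.+1%:R^-1.
    move=> i; have /rat_in_itvoo[p] :
        tnth x i - k.+1%:R^-1 < tnth x i + k.+1%:R^-1.
      by rewrite ltrD2l gtrN// invr_gt0.
    rewrite in_itv /= => /andP[p1 p2]; exists p.
    by rewrite ltr_distlC p1 p2.
  pose Q := ([tuple q i | i < d + d], k).
  have Qx : box Q x by move=> i; rewrite /Q /= tnth_mktuple; exact: qx.
  exists (pickle Q) => //; rewrite /F pickleK ifT//; apply/asboolP => y Qy /=.
  apply: eU; rewrite eE; split; first by rewrite ltcR.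
  move=> i j; rewrite /ball /= !mxE.
  have xy l : `|tnth x l - tnth y l| < r / 2.
    have := Qx l; have := Qy l; rewrite /Q /= => yl xl.
    rewrite (le_lt_trans (ler_distD (ratr (tnth [tuple q i | i < d + d] l)) _ _))//.
    rewrite distrC in yl; apply: lt_le_trans (ltrD xl yl) _.
    by apply: le_trans (ltW (ltrD kr kr)) _; lra.
  have -> : (tnth x (lshift d j) +i* tnth x (rshift d j)) -
     (tnth y (lshift d j) +i* tnth y (rshift d j)) =
     (tnth x (lshift d j) - tnth y (lshift d j))%:C +
     'i * (tnth x (rshift d j) - tnth y (rshift d j))%:C :> R[i].
    by apply/eqP; rewrite eq_complex /=; apply/andP; split; apply/eqP => /=; ring.
  apply: le_lt_trans (ler_normD _ _) _; rewrite normrM !normc_def /=.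
  rewrite !expr0n /= !addr0 add0r expr1n sqrtr1 mul1r !sqrtr_sqr -rmorphD ltcR.
  by rewrite [r]splitr ltrD.
apply: bigcup_measurable => n _; rewrite /F; case: unpickle => // q.
by case: ifPn.
Qed.

Definition lebesgue_vec : set 'rV[R[i]]_d -> \bar R :=
  pushforward (power_measure (@lebesgue_measure R) (d + d)) vec_of_coords.

Let measurable_preimage A :
  measurable A -> measurable (vec_of_coords @^-1` A).
Proof.
by move=> mA; rewrite -[X in measurable X]setTI; exact: measurable_vec_of_coords.
Qed.

Let lebesgue_vec0 : lebesgue_vec set0 = 0%E.
Proof. by rewrite /lebesgue_vec /pushforward preimage_set0 measure0. Qed.

Let lebesgue_vec_ge0 A : (0 <= lebesgue_vec A)%E.
Proof. exact: (measure_ge0 (power_measure (@lebesgue_measure R) (d + d))). Qed.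

Let lebesgue_vec_sigma_additive : semi_sigma_additive lebesgue_vec.
Proof.
move=> F mF tF mUF; rewrite /lebesgue_vec /pushforward preimage_bigcup.
apply: measure_semi_sigma_additive => [k||].
- exact: measurable_preimage.
- apply/trivIsetP => /= i j _ _ ij; rewrite -preimage_setI.
  by move/trivIsetP : tF => /(_ _ _ _ _ ij) ->//; rewrite preimage_set0.
- by rewrite -preimage_bigcup; exact: measurable_preimage.
Qed.

HB.instance Definition _ := isMeasure.Build _ _ _ lebesgue_vec
  lebesgue_vec0 lebesgue_vec_ge0 lebesgue_vec_sigma_additive.

(* The second argument of mnormalize would only be used if the ball had Lebesgue
   measure 0 or +oo, which it does not. *)
Definition ball_measure : probability 'rV[R[i]]_d R :=
  mnormalize (mrestr lebesgue_vec (@measurable_unit_ball R d))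
             (dirac (0 : 'rV[R[i]]_d)).

End lebesgue.

Section configurations.
Context (R : realType) (d : nat).
Local Notation V := 'rV[R[i]]_d.

(* Configurations without multiple points, so a point process on this space is
   simple by construction. *)
Record conf := Conf {
  conf_set :> set V;
  conf_sub : conf_set `<=` @unit_ball R d;
  conf_locally_finite : forall A : set V, compact A -> A `<=` @unit_ball R d ->
    finite_set (conf_set `&` A) }.

Let empty_conf : conf.
Proof.
by exists set0 => [|A _ _]; [exact: sub0set | rewrite set0I; exact: finite_set0].
Defined.

HB.instance Definition _ := gen_eqMixin conf.
HB.instance Definition _ := gen_choiceMixin conf.
HB.instance Definition _ := isPointed.Build conf empty_conf.

(* Counting events {X | #(X /\ A) = n}, A relatively compact Borel in the ball:
   they generate the Borel sigma-algebra of the vague topology. *)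
Definition count_events : set (set conf) :=
  [set E | exists A : set V, exists n : nat,
    [/\ measurable A,
        exists2 B, compact B /\ B `<=` @unit_ball R d & A `<=` B
      & E = [set X : conf | (X `&` A #= `I_n)%card]]].

HB.instance Definition _ :=
  Measurable.copy conf (g_sigma_algebraType count_events).

End configurations.


Definition distinct_tuples (R : realType) (d : nat) (X : set 'rV[R[i]]_d)
    (n : nat) : set (n.-tuple 'rV[R[i]]_d) :=
  [set x : n.-tuple 'rV[R[i]]_d | uniq x /\ forall i, X (tnth x i)].

Arguments distinct_tuples {R d} X n.

(* Identity against all Borel phi >= 0 on n-tuples; by monotone convergence this
   is the same as testing only bounded phi with compact support. *)
Definition has_correlation (R : realType) (d : nat)
    (P : probability (conf R d) R)
    (nu : {sigma_finite_measure set 'rV[R[i]]_d -> \bar R})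
    (n : nat) (rho : n.-tuple 'rV[R[i]]_d -> R) : Prop :=
  forall phi : n.-tuple 'rV[R[i]]_d -> \bar R,
    measurable_fun setT phi -> (forall x, (0 <= phi x)%E) ->
    (\int[P]_X (\esum_(x in distinct_tuples X n) phi x)
     = \int[power_measure nu n]_x (phi x * (rho x)%:E))%E.

(* For a Hermitian kernel the determinant is real, so complex.Re loses nothing. *)
Definition is_determinantal (R : realType) (d : nat)
    (K : 'rV[R[i]]_d -> 'rV[R[i]]_d -> R[i])
    (nu : {sigma_finite_measure set 'rV[R[i]]_d -> \bar R})
    (P : probability (conf R d) R) : Prop :=
  forall n : nat, (0 < n)%N ->
    has_correlation P nu (fun x : n.-tuple 'rV[R[i]]_d =>
      complex.Re (\det (\matrix_(i < n, j < n) K (tnth x i) (tnth x j)))).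

Section bergman.
Context (R : realType) (d : nat).
Implicit Types z w x : 'rV[R[i]]_d.

(* z . conj w *)
Definition hdot z w : R[i] := \sum_(k < d) z ord0 k * (w ord0 k)^*.

Definition bergman_kernel z w : R[i] := (1 - hdot z w) ^- d.+1.

Definition mobius w z : 'rV[R[i]]_d :=
  if w == 0 then - z
  else let p := (hdot z w / (cnorm w ^+ 2)%:C) *: w in
    (1 - hdot z w)^-1 *:
      (w - p - (Num.sqrt (1 - cnorm w ^+ 2))%:C *: (z - p)).

Definition bergman_dist z w : R :=
  ln ((1 + cnorm (mobius w z)) / (1 - cnorm (mobius w z))).

Definition poisson_szego w (zeta : 'rV[R[i]]_d) : R :=
  (1 - cnorm w ^+ 2) ^+ d / normc (1 - hdot zeta w) ^+ (2 * d).

Definition cintegral dT (T : measurableType dT)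
    (mu : {measure set T -> \bar R}) (D : set T) (f : T -> R[i]) : R[i] :=
  (\int[mu]_(t in D) complex.Re (f t)) +i* (\int[mu]_(t in D) complex.Im (f t)).

Section hardy.
Variable mu : probability 'rV[R[i]]_d R.
Implicit Types h f : 'rV[R[i]]_d -> R[i].

Definition L2norm h : \bar R := Lnorm mu 2%:E (fun zeta => (normc (h zeta))%:E).

Definition in_L2 h : Prop :=
  [/\ measurable_fun setT (fun zeta => complex.Re (h zeta)),
      measurable_fun setT (fun zeta => complex.Im (h zeta))
    & (L2norm h < +oo)%E].

Definition poisson_integral h z : R[i] :=
  cintegral mu (@unit_sphere R d)
    (fun zeta => (poisson_szego z zeta)%:C * h zeta).

Definition in_H2 f : Prop :=
  exists2 h, in_L2 h & forall z, unit_ball z -> f z = poisson_integral h z.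

End hardy.

(* Unordered sums, meaningful for absolutely summable families. *)
Definition rsum (X : set 'rV[R[i]]_d) (u : 'rV[R[i]]_d -> R) : R :=
  fine (\esum_(x in X) ((EFin \o u)^\+ x))%E
  - fine (\esum_(x in X) ((EFin \o u)^\- x))%E.

Definition csum (X : set 'rV[R[i]]_d) (u : 'rV[R[i]]_d -> R[i]) : R[i] :=
  rsum X (fun x => complex.Re (u x)) +i* rsum X (fun x => complex.Im (u x)).

Definition weight (s : R) z x : R := expR (- s * bergman_dist x z).

Definition gX (X : set 'rV[R[i]]_d) (s : R) z : R :=
  rsum X (weight s z).

Definition gXf (X : set 'rV[R[i]]_d) (s : R) z (f : 'rV[R[i]]_d -> R[i]) : R[i] :=
  csum X (fun x => (weight s z x)%:C * f x).

End bergman.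

(* Main.v *)
Require Import Defs.
From HB Require Import structures.
From mathcomp Require Import all_boot all_order all_algebra.
From mathcomp Require Import all_classical all_reals all_analysis.
From mathcomp Require Import measurable_realfun complex.
From mathcomp Require Import zify ring lra.

(** The sums are compared with their expectations. Since exp (- d_B (x, z)) is
    (1 - |phi_z(x)|) / (1 + |phi_z(x)|), the expectation of
    sum_x exp (- s d_B (x, z)) k(x) over the process is the integral of
    exp (- s d_B (x, z)) K(x, x) k(x), whose integrand is (1 - |x|^2)^(e - 1) k(x)
    times a factor continuous up to the sphere, where e = s - d. As e tends to 0, the mass
    concentrates on the sphere, where that factor tends to 4^(-d) P(z, x) with P the
    Poisson kernel. For k = 1 and for k the Poisson kernel with pole zeta, e times the
    expectation tends to a constant c times k(z), uniformly in zeta (energy_limit): when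
    k has a pole, k itself concentrates at zeta. Both cases rest on the formula for the
    mean of |1 - <x, z>|^(-2 d) over spheres (spherical_identity), obtained from
    Gaussian moments of <x, z> and a Parseval identity.

    Determinantal processes repel, so the variance of a linear statistic is at most the
    integral of its square against the intensity (variance_le), here O(1 / e). For
    fixed z, the mean square over zeta of e times the deviation is therefore O(e), which
    is summable along a sequence e_n; hence it tends to 0 almost surely along e_n
    (mean_square_ae). A point z where this holds is called typical below; almost
    surely, all points of a countable dense set are typical.

    What remains is deterministic. For f the Poisson integral of h, g_X(s, z; f) is the
    integral over zeta of h(zeta) times the sum for the pole zeta (weighted_sumE). By
    duality, the mean square over zeta controls these integrals for all h >= 0 of
    bounded second moment at once (weighted_sum_approx): this is where the
    uniformity in f comes from. Both sums decrease in s and e_n / e_(n+1) tends to 1,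
    which passes from the sequence to all e (weighted_sum_limit); the weights and the
    Poisson kernel at neighbouring points z have ratios close to 1, which passes from
    typical points to all z, locally uniformly (ratio_near). Splitting h into four
    nonnegative parts gives the theorem (quotient_near), compactness of closed balls
    its uniform form (quotient_uniform). *)

Set Implicit Arguments.
Unset Strict Implicit.
Unset Printing Implicit Defensive.

Import Order.TTheory GRing.Theory Num.Theory.
Import numFieldNormedType.Exports.
Import ComplexField.Normc.

Local Open Scope classical_set_scope.
Local Open Scope ring_scope.
Local Open Scope complex_scope.

(** * Hermitian algebra and the Bergman metric *)

Section algebra.
Context (R : realType) (d : nat).
Implicit Types (x y z w : 'rV[R[i]]_d) (a b : R[i]).

Lemma normcE a : `|a| = (normc a)%:C. Proof. by case: a. Qed.

Lemma normc_sqr a : normc a ^+ 2 = complex.Re a ^+ 2 + complex.Im a ^+ 2.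
Proof. by case: a => u v /=; rewrite sqr_sqrtr// addr_ge0// sqr_ge0. Qed.

Lemma normc_ge0 a : 0 <= normc a.
Proof. by case: a => u v /=; exact: sqrtr_ge0. Qed.

Lemma normcJ a : normc a^*%C = normc a.
Proof. by case: a => u v /=; rewrite sqrrN. Qed.

Lemma normc_sqrC a : (normc a ^+ 2)%:C = a * a^*%C.
Proof.
rewrite normc_sqr; case: a => u v; apply/eqP; rewrite eq_complex /=.
by apply/andP; split; apply/eqP; ring.
Qed.

Lemma normc_real (r : R) : normc r%:C = `|r|.
Proof. by rewrite /= expr0n /= addr0 sqrtr_sqr. Qed.

Lemma Re_le_normc a : `|complex.Re a| <= normc a.
Proof.
rewrite -ler_sqr ?nnegrE ?normc_ge0 ?normr_ge0// normc_sqr.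
by rewrite real_normK ?num_real// lerDl sqr_ge0.
Qed.

Lemma Im_le_normc a : `|complex.Im a| <= normc a.
Proof.
rewrite -ler_sqr ?nnegrE ?normc_ge0 ?normr_ge0// normc_sqr.
by rewrite real_normK ?num_real// lerDr sqr_ge0.
Qed.

Lemma ReB a b : complex.Re (a - b) = complex.Re a - complex.Re b.
Proof. by case: a => ? ?; case: b. Qed.

Lemma ReD a b : complex.Re (a + b) = complex.Re a + complex.Re b.
Proof. by case: a => ? ?; case: b. Qed.

Lemma ReC (r : R) a : complex.Re (r%:C * a) = r * complex.Re a.
Proof. by case: a => u v /=; rewrite mul0r subr0. Qed.

Lemma ImC (r : R) a : complex.Im (r%:C * a) = r * complex.Im a.
Proof. by case: a => u v /=; rewrite mul0r addr0. Qed.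

Lemma ler_normcD a b : normc (a + b) <= normc a + normc b.
Proof. exact: le_normcD. Qed.

Lemma ler_normcB a b : normc a - normc b <= normc (a - b).
Proof. by rewrite lerBlDr -{1}(subrK b a); exact: ler_normcD. Qed.

Lemma normcB a b : normc (a - b) = normc (b - a).
Proof. by rewrite -opprB normcN. Qed.

Lemma normc_1B_sqr a : normc (1 - a) ^+ 2 = 1 - complex.Re a *+ 2 + normc a ^+ 2.
Proof. by rewrite !normc_sqr; case: a => u v /=; ring. Qed.

Lemma cnorm_ge0 x : 0 <= cnorm x. Proof. exact: sqrtr_ge0. Qed.

Lemma cnorm_sqr x : cnorm x ^+ 2 = \sum_(k < d) normc (x ord0 k) ^+ 2.
Proof. by rewrite sqr_sqrtr// sumr_ge0// => k _; rewrite exprn_ge0// normc_ge0. Qed.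

Lemma hdotxx x : hdot x x = (cnorm x ^+ 2)%:C.
Proof.
rewrite cnorm_sqr rmorph_sum; apply: eq_bigr => k _.
by rewrite /= -normc_sqrC.
Qed.

Lemma hdotC x y : hdot y x = (hdot x y)^*%C.
Proof.
rewrite /hdot rmorph_sum; apply: eq_bigr => k _.
by rewrite rmorphM /= conjcK mulrC.
Qed.

Lemma hdotDl x y z : hdot (x + y) z = hdot x z + hdot y z.
Proof. by rewrite -big_split; apply: eq_bigr => k _; rewrite mxE mulrDl. Qed.

Lemma hdotNl x z : hdot (- x) z = - hdot x z.
Proof. by rewrite /hdot -sumrN; apply: eq_bigr => k _; rewrite mxE mulNr. Qed.

Lemma hdotBl x y z : hdot (x - y) z = hdot x z - hdot y z.
Proof. by rewrite hdotDl hdotNl. Qed.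

Lemma hdotZl a x z : hdot (a *: x) z = a * hdot x z.
Proof. by rewrite /hdot mulr_sumr; apply: eq_bigr => k _; rewrite mxE mulrA. Qed.

Lemma hdotZr a x z : hdot x (a *: z) = a^*%C * hdot x z.
Proof. by rewrite hdotC hdotZl rmorphM /= -hdotC. Qed.

Lemma hdotBr x y z : hdot z (x - y) = hdot z x - hdot z y.
Proof. by rewrite hdotC hdotBl rmorphB /= -!hdotC. Qed.

Lemma hdot0l z : hdot 0 z = 0.
Proof. by rewrite -(scale0r (0 : 'rV[R[i]]_d)) hdotZl mul0r. Qed.

Lemma hdot0r z : hdot z 0 = 0.
Proof. by rewrite hdotC hdot0l conjc0. Qed.

Lemma cnorm0 : cnorm (0 : 'rV[R[i]]_d) = 0.
Proof.
apply/eqP; rewrite -sqrf_eq0; apply/eqP.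
by rewrite cnorm_sqr big1// => k _; rewrite mxE normc0 expr0n.
Qed.

Lemma cnormN x : cnorm (- x) = cnorm x.
Proof. by congr Num.sqrt; apply: eq_bigr => k _; rewrite mxE normcN. Qed.

Lemma cnormZ a x : cnorm (a *: x) = normc a * cnorm x.
Proof.
apply/eqP; rewrite -(@eqrXn2 _ 2) ?mulr_ge0 ?normc_ge0 ?cnorm_ge0//; apply/eqP.
rewrite exprMn !cnorm_sqr mulr_sumr; apply: eq_bigr => k _.
by rewrite mxE normcM exprMn.
Qed.

Lemma cnorm_eq0 x : (cnorm x == 0) = (x == 0).
Proof.
apply/eqP/eqP => [x0|->]; last exact: cnorm0.
have := cnorm_sqr x; rewrite x0 expr0n /= => /esym/eqP.
rewrite psumr_eq0 => [/allP h|k _]; last by rewrite exprn_ge0// normc_ge0.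
apply/rowP => k; rewrite mxE; apply: eq0_normc.
by apply/eqP; rewrite -sqrf_eq0; apply: h; rewrite mem_index_enum.
Qed.

Lemma cnormB_sqr x y :
  cnorm (x - y) ^+ 2 = cnorm x ^+ 2 - complex.Re (hdot x y) *+ 2 + cnorm y ^+ 2.
Proof.
apply: complexI; rewrite -hdotxx hdotBl !hdotBr (hdotC x y) !hdotxx.
by case: (hdot x y) => u v; apply/eqP; rewrite eq_complex /=;
  apply/andP; split; apply/eqP; ring.
Qed.

(** Cauchy-Schwarz, from the nonnegativity of the squared norm of
    |y|^2 x - <x, y> y. *)
Lemma hdot_le x y : normc (hdot x y) <= cnorm x * cnorm y.
Proof.
have [->|y0] := eqVneq y 0; first by rewrite hdot0r normc0 mulr_ge0 ?cnorm_ge0.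
have yp : 0 < cnorm y ^+ 2.
  by rewrite exprn_gt0// lt_neqAle cnorm_ge0 andbT eq_sym cnorm_eq0.
rewrite -ler_sqr ?nnegrE ?normc_ge0 ?mulr_ge0 ?cnorm_ge0// exprMn.
have : 0 <= cnorm ((cnorm y ^+ 2)%:C *: x - hdot x y *: y) ^+ 2 by exact: sqr_ge0.
rewrite cnormB_sqr !cnormZ hdotZl hdotZr ReC.
have -> : (hdot x y)^*%C * hdot x y = (normc (hdot x y) ^+ 2)%:C.
  by rewrite normc_sqrC mulrC.
rewrite normc_real ger0_norm ?(ltW yp)// [complex.Re _]/= !exprMn.
set A := cnorm x ^+ 2; set B := cnorm y ^+ 2; set H := normc _ ^+ 2.
have -> : B ^+ 2 * A - B * H *+ 2 + H * B = B * (A * B - H) by ring.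
by rewrite pmulr_rge0// subr_ge0.
Qed.

Lemma normc_1Bhdot_ge x y : 1 - cnorm x * cnorm y <= normc (1 - hdot x y).
Proof.
have := ler_normcB 1 (hdot x y); rewrite normc1; apply: le_trans.
by rewrite lerB// hdot_le.
Qed.

Lemma normc_1Bhdot_le x y : normc (1 - hdot x y) <= 1 + cnorm x * cnorm y.
Proof.
by rewrite (le_trans (ler_normcD _ _))// normc1 normcN lerD// hdot_le.
Qed.

Lemma normc_1Bhdot_gt0 x y : cnorm x < 1 -> cnorm y <= 1 -> 0 < normc (1 - hdot x y).
Proof.
move=> x1 y1; apply: lt_le_trans (normc_1Bhdot_ge x y).
rewrite subr_gt0 (le_lt_trans _ x1)//.
by rewrite -[leRHS]mulr1 ler_wpM2l ?cnorm_ge0.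
Qed.

Lemma ball_sqr_lt1 x : cnorm x < 1 -> 0 < 1 - cnorm x ^+ 2.
Proof. by move=> x1; rewrite subr_gt0 expr_lt1// cnorm_ge0. Qed.

(** The quantity 1 - |phi_z(x)|^2. *)
Definition bergman_t z x : R :=
  (1 - cnorm z ^+ 2) * (1 - cnorm x ^+ 2) / normc (1 - hdot x z) ^+ 2.

(** Write x = p + q with p the projection on the line of z: the two terms of the numerator
    of phi_z(x) are then orthogonal, and |q|^2 = |x|^2 - |<x, z>|^2 / |z|^2. *)
Lemma mobius_sqr z x : cnorm z < 1 -> cnorm x < 1 ->
  cnorm (mobius z x) ^+ 2 = 1 - bergman_t z x.
Proof.
move=> z1 x1; rewrite /mobius /bergman_t.
have D0 : 0 < normc (1 - hdot x z) by apply: normc_1Bhdot_gt0 => //; exact: ltW.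
case: eqVneq => [->|z0].
  by rewrite cnormN hdot0r cnorm0 subr0 normc1; field.
have zp : 0 < cnorm z ^+ 2.
  by rewrite exprn_gt0// lt_neqAle cnorm_ge0 andbT eq_sym cnorm_eq0.
have zp' : cnorm z ^+ 2 != 0 by rewrite gt_eqF.
rewrite cnormZ normcV.
set l := hdot x z; set n := cnorm z ^+ 2.
set p := (l / n%:C) *: z; set s := Num.sqrt _.
have ss : s ^+ 2 = 1 - n by rewrite sqr_sqrtr// ltW// ball_sqr_lt1.
have s0 : 0 <= s by exact: sqrtr_ge0.
have qz : hdot (x - p) z = 0.
  by rewrite hdotBl hdotZl hdotxx -/l -/n mulfVK ?subrr// fmorph_eq0.
have zq : hdot z (x - p) = 0 by rewrite hdotC qz conjc0.
have pE : normc (l / n%:C) ^+ 2 = normc l ^+ 2 / n ^+ 2.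
  by rewrite normcM normcV normc_real (ger0_norm (ltW zp)) exprMn exprVn.
have q2 : cnorm (x - p) ^+ 2 = cnorm x ^+ 2 - normc l ^+ 2 / n.
  rewrite cnormB_sqr /p hdotZr -/l cnormZ exprMn pE -/n.
  have -> : (l / n%:C)^*%C * l = (normc l ^+ 2 / n)%:C.
    rewrite -fmorphV normc_sqr; case: (l) => u v; apply/eqP.
    by rewrite eq_complex /=; apply/andP; split; apply/eqP; ring.
  by rewrite [complex.Re _]/=; field.
have -> : z - p - s%:C *: (x - p) = (1 - l / n%:C) *: z - s%:C *: (x - p).
  by rewrite scalerBl scale1r.
rewrite exprMn cnormB_sqr hdotZl hdotZr zq !mulr0 !cnormZ !exprMn.
rewrite normc_real (ger0_norm s0) ss q2 (normc_1B_sqr (l / n%:C)) pE -/n.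
have -> : complex.Re (l / n%:C) = complex.Re l / n.
  by rewrite mulrC -fmorphV ReC mulrC.
have := normc_1B_sqr l; move: D0; rewrite -/l.
set D := normc (1 - l); move=> D0 DE.
have D0' : D != 0 by rewrite gt_eqF.
have D20 : D ^+ 2 != 0 by rewrite expf_neq0.
have -> : 1 - (1 - n) * (1 - cnorm x ^+ 2) / D ^+ 2 =
    D ^- 2 * (D ^+ 2 - (1 - n) * (1 - cnorm x ^+ 2)) by field.
rewrite exprVn; congr (_ * _); rewrite DE [complex.Re 0]/=; field.
exact: zp'.
Qed.

Lemma bergman_t_gt0 z x : cnorm z < 1 -> cnorm x < 1 -> 0 < bergman_t z x.
Proof.
move=> z1 x1; apply: divr_gt0; first by rewrite mulr_gt0 ?ball_sqr_lt1.
by rewrite exprn_gt0// normc_1Bhdot_gt0// ltW.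
Qed.

Lemma bergman_t_le1 z x : cnorm z < 1 -> cnorm x < 1 -> bergman_t z x <= 1.
Proof. by move=> z1 x1; rewrite -subr_ge0 -mobius_sqr// sqr_ge0. Qed.

(** exp (- d_B (x, z)), as a function of t. *)
Definition decay z x : R :=
  bergman_t z x / (1 + Num.sqrt (1 - bergman_t z x)) ^+ 2.

Lemma decay_gt0 z x : cnorm z < 1 -> cnorm x < 1 -> 0 < decay z x.
Proof.
move=> z1 x1; apply: divr_gt0; first exact: bergman_t_gt0.
by rewrite exprn_gt0// ltr_wpDr// sqrtr_ge0.
Qed.

Lemma decay_le_t z x : cnorm z < 1 -> cnorm x < 1 -> decay z x <= bergman_t z x.
Proof.
move=> z1 x1; rewrite /decay ler_piMr ?(ltW (bergman_t_gt0 _ _))//.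
by rewrite invf_le1 ?exprn_gt0 ?ltr_wpDr ?sqrtr_ge0// exprn_ege1// lerDl sqrtr_ge0.
Qed.

Lemma decay_le1 z x : cnorm z < 1 -> cnorm x < 1 -> decay z x <= 1.
Proof. by move=> z1 x1; rewrite (le_trans (decay_le_t _ _)) ?bergman_t_le1. Qed.

(** (1 - r) / (1 + r) = (1 - r^2) / (1 + r)^2 with r = |phi_z(x)|. *)
Lemma weightE s z x : cnorm z < 1 -> cnorm x < 1 -> weight s z x = decay z x `^ s.
Proof.
move=> z1 x1; rewrite /weight /bergman_dist.
have t0 := bergman_t_gt0 z1 x1.
have -> : cnorm (mobius z x) = Num.sqrt (1 - bergman_t z x).
  by rewrite -mobius_sqr// sqrtr_sqr ger0_norm ?cnorm_ge0.
rewrite /powR gt_eqF ?decay_gt0//; congr expR.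
rewrite mulNr -mulrN; congr (_ * _).
rewrite /decay; set r := Num.sqrt _.
have r0 : 0 <= r by exact: sqrtr_ge0.
have rr : r ^+ 2 = 1 - bergman_t z x by rewrite sqr_sqrtr// subr_ge0 bergman_t_le1.
have r1 : r < 1.
  by rewrite -(@ltr_pXn2r _ 2) ?nnegrE// rr expr1n ltrBlDr ltrDl.
have -> : bergman_t z x = (1 - r) * (1 + r) by rewrite -[LHS](subKr 1) -rr; ring.
rewrite -lnV; last by rewrite posrE divr_gt0// ?subr_gt0// ltr_wpDr.
congr ln; field.
by rewrite !gt_eqF ?subr_gt0// ltr_wpDr.
Qed.

End algebra.

(** * Lebesgue measure on C^d *)

Section measurable_vec.
Context (R : realType) (d : nat).
Local Notation V := 'rV[R[i]]_d.

Definition coords (x : V) : (d + d).-tuple (measurableTypeR R) :=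
  [tuple match fintype.split i with
         | inl k => complex.Re (x ord0 k)
         | inr k => complex.Im (x ord0 k)
         end | i < d + d].

Lemma coordsK : cancel coords (@vec_of_coords R d).
Proof.
move=> x; apply/rowP => k; rewrite mxE !tnth_mktuple.
case: fintype.splitP => [l /= kl|l /= kl]; last first.
  by have := ltn_ord k; rewrite kl ltnNge leq_addr.
have -> : l = k by exact/val_inj.
case: fintype.splitP => [l' /= kl'|l' /= kl'].
  by have := ltn_ord l'; rewrite -kl' ltnNge leq_addr.
have -> : l' = k by apply/val_inj/esym/(addnI kl').
by case: (x ord0 k).
Qed.

(** A vector is a measurable function of the tuple of its real coordinates, so Borel
    measurability is a matter of coordinates. *)
Lemma measurable_vec dT (T : measurableType dT) (g : T -> V) :
  (forall k, measurable_fun setT (fun t => complex.Re (g t ord0 k))) ->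
  (forall k, measurable_fun setT (fun t => complex.Im (g t ord0 k))) ->
  measurable_fun setT g.
Proof.
move=> mr mi; rewrite (_ : g = @vec_of_coords R d \o (coords \o g)); last first.
  by apply/funext => t /=; rewrite coordsK.
apply: measurableT_comp; first exact: measurable_vec_of_coords.
apply/measurable_fun_tnthP => i /=.
rewrite (_ : _ \o _ = fun t => match fintype.split i with
         | inl k => complex.Re (g t ord0 k)
         | inr k => complex.Im (g t ord0 k) end); last first.
  by apply/funext => t /=; rewrite tnth_mktuple.
by case: fintype.split => k; [exact: mr|exact: mi].
Qed.

Lemma continuous_measurable_vec (f : V -> R) :
  continuous f -> measurable_fun setT f.
Proof.
move=> cf; apply: (measurability _ (RGenOInfty.measurableE R)) => //.
move=> _ [_ [x ->] <-]; rewrite setTI; apply: sub_sigma_algebra.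
by apply: open_comp; [move=> y _; exact: cf|exact: interval_open].
Qed.

Lemma continuous_normc_lip (f : R[i] -> R) :
  (forall x y, `|f x - f y| <= normc (x - y)) -> continuous f.
Proof.
move=> fL x A /nbhs_ballP[e /= e0 eA].
apply/nbhs_ballP; exists e%:C => /=; first by rewrite ltcR.
move=> y; rewrite /ball /= => xy; apply: eA; rewrite /ball /=.
by apply: le_lt_trans (fL _ _) _; move: xy; rewrite normcE ltcR.
Qed.

Lemma continuous_Re : continuous (@complex.Re R).
Proof. by apply: continuous_normc_lip => x y; rewrite -ReB Re_le_normc. Qed.

Lemma continuous_Im : continuous (@complex.Im R).
Proof.
apply: continuous_normc_lip => x y.
by rewrite -(raddfB (@complex.Im R : {additive Rcomplex R -> R})) Im_le_normc.
Qed.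

Lemma measurable_Re_coord k : measurable_fun setT (fun x : V => complex.Re (x ord0 k)).
Proof.
apply: continuous_measurable_vec => x.
apply: (@continuous_comp _ _ _ (fun z : V => z ord0 k) (@complex.Re R)).
  exact: coord_continuous.
exact: continuous_Re.
Qed.

Lemma measurable_Im_coord k : measurable_fun setT (fun x : V => complex.Im (x ord0 k)).
Proof.
apply: continuous_measurable_vec => x.
apply: (@continuous_comp _ _ _ (fun z : V => z ord0 k) (@complex.Im R)).
  exact: coord_continuous.
exact: continuous_Im.
Qed.

Lemma measurable_cnorm : measurable_fun setT (@cnorm R d).
Proof. by apply: continuous_measurable_vec; exact: cnorm_continuous. Qed.

Section measurable_hdot.
Context dT (T : measurableType dT) (g h : T -> V).
Hypotheses (mg : measurable_fun setT g) (mh : measurable_fun setT h).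

Lemma measurable_Re_hdot : measurable_fun setT (fun t => complex.Re (hdot (g t) (h t))).
Proof.
rewrite (_ : (fun _ => _) = fun t => \sum_(k < d)
   (complex.Re (g t ord0 k) * complex.Re (h t ord0 k)
    + complex.Im (g t ord0 k) * complex.Im (h t ord0 k))); last first.
  apply/funext => t; rewrite /hdot (raddf_sum (@complex.Re R : {additive Rcomplex R -> R})).
  apply: eq_bigr => k _.
  by case: (g t ord0 k) => a b; case: (h t ord0 k) => a' b' /=; ring.
apply: measurable_sum => k; apply: measurable_funD; apply: measurable_funM.
- exact: measurableT_comp (measurable_Re_coord k) mg.
- exact: measurableT_comp (measurable_Re_coord k) mh.
- exact: measurableT_comp (measurable_Im_coord k) mg.
- exact: measurableT_comp (measurable_Im_coord k) mh.
Qed.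

Lemma measurable_Im_hdot : measurable_fun setT (fun t => complex.Im (hdot (g t) (h t))).
Proof.
rewrite (_ : (fun _ => _) = fun t => \sum_(k < d)
   (complex.Im (g t ord0 k) * complex.Re (h t ord0 k)
    - complex.Re (g t ord0 k) * complex.Im (h t ord0 k))); last first.
  apply/funext => t; rewrite /hdot (raddf_sum (@complex.Im R : {additive Rcomplex R -> R})).
  apply: eq_bigr => k _.
  by case: (g t ord0 k) => a b; case: (h t ord0 k) => a' b' /=; ring.
apply: measurable_sum => k; apply: measurable_funB; apply: measurable_funM.
- exact: measurableT_comp (measurable_Im_coord k) mg.
- exact: measurableT_comp (measurable_Re_coord k) mh.
- exact: measurableT_comp (measurable_Re_coord k) mg.
- exact: measurableT_comp (measurable_Im_coord k) mh.
Qed.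

Lemma measurable_normc (f : T -> R[i]) :
  measurable_fun setT (fun t => complex.Re (f t)) ->
  measurable_fun setT (fun t => complex.Im (f t)) ->
  measurable_fun setT (fun t => normc (f t)).
Proof.
move=> mr mi; rewrite (_ : (fun _ => _) =
    fun t => Num.sqrt (complex.Re (f t) ^+ 2 + complex.Im (f t) ^+ 2)); last first.
  by apply/funext => t; case: (f t).
apply: (measurableT_comp (continuous_measurable_fun (@sqrt_continuous R))).
by apply: measurable_funD; exact: measurable_funX.
Qed.

Lemma measurable_normc_hdot : measurable_fun setT (fun t => normc (hdot (g t) (h t))).
Proof. exact: measurable_normc measurable_Re_hdot measurable_Im_hdot. Qed.

Lemma measurable_normc_1Bhdot :
  measurable_fun setT (fun t => normc (1 - hdot (g t) (h t))).
Proof.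
apply: measurable_normc.
  rewrite (_ : (fun _ => _) = fun t => 1 - complex.Re (hdot (g t) (h t))).
    by apply: measurable_funB => //; exact: measurable_Re_hdot.
  by apply/funext => t; rewrite ReB.
rewrite (_ : (fun _ => _) = fun t => - complex.Im (hdot (g t) (h t))).
  by apply: measurableT_comp => //; exact: measurable_Im_hdot.
by apply/funext => t; case: hdot => a b /=; rewrite sub0r.
Qed.

Lemma measurable_vecD : measurable_fun setT (fun t => g t + h t).
Proof.
apply: measurable_vec => k.
  rewrite (_ : (fun _ => _) =
    fun t => complex.Re (g t ord0 k) + complex.Re (h t ord0 k)).
    apply: measurable_funD.
      exact: measurableT_comp (measurable_Re_coord k) mg.
    exact: measurableT_comp (measurable_Re_coord k) mh.
  by apply/funext => t; rewrite mxE ReD.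
rewrite (_ : (fun _ => _) =
    fun t => complex.Im (g t ord0 k) + complex.Im (h t ord0 k)).
  apply: measurable_funD.
    exact: measurableT_comp (measurable_Im_coord k) mg.
  exact: measurableT_comp (measurable_Im_coord k) mh.
by apply/funext => t; rewrite mxE; case: (g t _ _) => ? ?; case: (h t _ _).
Qed.

Lemma measurable_vecZ (c : T -> R[i]) :
  measurable_fun setT (fun t => complex.Re (c t)) ->
  measurable_fun setT (fun t => complex.Im (c t)) ->
  measurable_fun setT (fun t => c t *: g t).
Proof.
move=> mr mi; apply: measurable_vec => k.
  rewrite (_ : (fun _ => _) = fun t => complex.Re (c t) * complex.Re (g t ord0 k)
      - complex.Im (c t) * complex.Im (g t ord0 k)).
    apply: measurable_funB; apply: measurable_funM => //.
      exact: measurableT_comp (measurable_Re_coord k) mg.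
    exact: measurableT_comp (measurable_Im_coord k) mg.
  by apply/funext => t; rewrite mxE; case: (g t _ _) => ? ?; case: (c t).
rewrite (_ : (fun _ => _) = fun t => complex.Re (c t) * complex.Im (g t ord0 k)
      + complex.Im (c t) * complex.Re (g t ord0 k)).
  apply: measurable_funD; apply: measurable_funM => //.
    exact: measurableT_comp (measurable_Im_coord k) mg.
  exact: measurableT_comp (measurable_Re_coord k) mg.
by apply/funext => t; rewrite mxE; case: (g t _ _) => ? ?; case: (c t).
Qed.

End measurable_hdot.
End measurable_vec.
Local Open Scope ereal_scope.

Section power_measure_integral.
Context dT (T : measurableType dT) (R : realType).
Variable mu : {sigma_finite_measure set T -> \bar R}.

Lemma integral_power_measureS n (f : n.+1.-tuple T -> \bar R) :
  measurable_fun setT f -> (forall t, 0 <= f t) ->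
  \int[power_measure mu n.+1]_t f t =
  \int[mu]_x \int[power_measure mu n]_t f (tuple_cons (x, t)).
Proof.
move=> mf f0.
transitivity (\int[pushforward (mu \x power_measure mu n) (@tuple_cons _ T n)]_t f t).
  by [].
rewrite ge0_integral_pushforward//; last exact: measurable_tuple_cons.
rewrite preimage_setT fubini_tonelli1//; last by move=> x; exact: f0.
by apply: measurableT_comp => //; exact: measurable_tuple_cons.
Qed.

Lemma integral_power_measure0 (f : 0.-tuple T -> \bar R) :
  measurable_fun setT f ->
  \int[power_measure mu 0]_t f t = f [tuple].
Proof. by move=> mf; rewrite /= integral_dirac// diracT mul1e. Qed.

Lemma integral_power_measure_prod n (g : T -> R) (I : R) :
  measurable_fun setT g -> (forall x, 0 <= g x)%R ->
  \int[mu]_x (g x)%:E = I%:E ->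
  \int[power_measure mu n]_t (\prod_(i < n) g (tnth t i))%:E = (I ^+ n)%:E.
Proof.
move=> mg g0 gI.
have I0 : (0 <= I)%R by rewrite -lee_fin -gI integral_ge0// => x _; rewrite lee_fin.
elim: n => [|n IH].
  rewrite integral_power_measure0; first by rewrite big_ord0 expr0.
  by rewrite (_ : (fun _ => _) = cst 1)//; apply/funext => t; rewrite big_ord0.
rewrite integral_power_measureS; last 2 first.
- apply/measurable_EFinP; apply: measurable_prod => i _.
  by apply: measurableT_comp => //; exact: measurable_tnth.
- by move=> t; rewrite lee_fin prodr_ge0.
rewrite (_ : (fun x => _) = fun x => (g x)%:E * (I ^+ n)%:E); last first.
  apply/funext => x; rewrite -IH -ge0_integralZl//.
  - apply: eq_integral => t _; rewrite -EFinM big_ord_recl; congr ((_ * _)%:E).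
    by apply: eq_bigr => i _; rewrite tnthS.
  - apply/measurable_EFinP; apply: measurable_prod => i _.
    by apply: measurableT_comp => //; exact: measurable_tnth.
  - by move=> t _; rewrite lee_fin prodr_ge0.
  - by rewrite lee_fin.
rewrite ge0_integralZr//.
- by rewrite gI exprS -EFinM.
- exact/measurable_EFinP.
- by move=> x _; rewrite lee_fin.
- by rewrite lee_fin exprn_ge0.
Qed.

End power_measure_integral.

Section lebesgue_real.
Context (R : realType).
Local Notation leb := (@lebesgue_measure R).

Lemma integral_lebesgue_shift (a : R) (f : R -> \bar R) :
  measurable_fun setT f -> (forall x, 0 <= f x) ->
  \int[leb]_x f (x + a)%R = \int[leb]_x f x.
Proof.
move=> mf f0.
pose g : measurableTypeR R -> measurableTypeR R := fun x => (x + a)%R.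
have mg : measurable_fun setT g by exact: measurable_funD.
have := ge0_integral_pushforward mg leb measurableT mf.
rewrite preimage_setT => <- //; apply: eq_measure_integral => A mA _.
apply/esym/lebesgue_measure_unique => //= _ [[x y]] _ <-.
rewrite /pushforward (_ : g @^-1` _ = `](x - a)%R, (y - a)%R]%classic).
  rewrite !lebesgue_measure_itv/= !lte_fin ltrD2r; case: ifP => // _.
  by congr EFin; ring.
apply/seteqP; split => z; rewrite /g /= !in_itv /=.
  by rewrite ltrBlDr lerBrDr.
by rewrite ltrBlDr lerBrDr.
Qed.

Lemma integral_gauss (c : R) : (0 < c)%R ->
  \int[leb]_x (expR (- (c * x ^+ 2)))%:E = (Num.sqrt (pi / c))%:E.
Proof.
move=> c0; pose s := Num.sqrt ((c *+ 2)^-1).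
have s2 : (s ^+ 2 = (c *+ 2)^-1)%R by rewrite sqr_sqrtr// invr_ge0 mulrn_wge0// ltW.
have s0 : s != 0%R by rewrite gt_eqF// sqrtr_gt0 invr_gt0 mulrn_wgt0.
have c2 : (c *+ 2 != 0)%R by rewrite mulrn_eq0 /= gt_eqF.
have := integral_normal_pdf 0%R s; rewrite normal_pdfE//.
have peak0 := normal_peak_gt0 s0.
have peakE : (normal_peak s = (Num.sqrt (pi / c))^-1)%R.
  rewrite /normal_peak s2; congr (Num.sqrt _)^-1%R; field.
  by rewrite gt_eqF.
under eq_integral do rewrite EFinM.
rewrite ge0_integralZl//; last 3 first.
- apply/measurable_EFinP; exact: measurable_normal_fun.
- by move=> x _; rewrite lee_fin expR_ge0.
- by rewrite lee_fin ltW.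
under eq_integral => x _.
  have -> : (normal_fun 0 s x = expR (- (c * x ^+ 2)))%R.
    rewrite /normal_fun subr0 s2; congr expR.
    rewrite mulNr -mulr_natr; congr (- _)%R; field.
    by rewrite gt_eqF.
  over.
move=> /(congr1 (fun y => (normal_peak s)^-1%:E * y)).
rewrite muleA -EFinM mulVf ?gt_eqF// mul1e mule1 => ->.
by rewrite peakE invrK.
Qed.

End lebesgue_real.

Section lebesgue_vec_theory.
Context (R : realType) (d : nat).
Local Notation V := 'rV[R[i]]_d.
Local Notation m := (@lebesgue_vec R d).
Local Notation leb := (@lebesgue_measure R).

Lemma integral_lebesgue_vec (f : V -> \bar R) :
  measurable_fun setT f -> (forall x, 0 <= f x) ->
  \int[m]_x f x =
  \int[power_measure leb (d + d)]_t f (vec_of_coords t).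
Proof.
move=> mf f0.
have := ge0_integral_pushforward (@measurable_vec_of_coords R d)
  (power_measure leb (d + d)) measurableT mf.
by rewrite preimage_setT => <-.
Qed.

Lemma integral_power_shift n (a : n.-tuple R) (f : n.-tuple (measurableTypeR R) -> \bar R) :
  measurable_fun setT f -> (forall t, 0 <= f t) ->
  \int[power_measure leb n]_t f [tuple (tnth t i + tnth a i)%R | i < n] =
  \int[power_measure leb n]_t f t.
Proof.
elim: n a f => [|n IH] a f mf f0.
  rewrite !integral_power_measure0//; first by congr f; exact: tuple0.
  rewrite (_ : (fun _ => _) = cst (f [tuple])) //.
  by apply/funext => t; congr f; exact: tuple0.
have msh k (b : k.-tuple R) : measurable_fun setT
    (fun t : k.-tuple (measurableTypeR R) => [tuple (tnth t i + tnth b i)%R | i < k]).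
  apply/measurable_fun_tnthP => i.
  rewrite (_ : _ \o _ = fun t => (tnth t i + tnth b i)%R).
    by apply: measurable_funD => //; exact: measurable_tnth.
  by apply/funext => t /=; rewrite tnth_mktuple.
have mcons x : measurable_fun setT (fun t : n.-tuple (measurableTypeR R) => tuple_cons (x, t)).
  by apply: measurableT_comp; [exact: measurable_tuple_cons|exact: measurable_pair1].
have mfs : measurable_fun setT (fun t : n.+1.-tuple (measurableTypeR R) =>
    f [tuple (tnth t i + tnth a i)%R | i < n.+1]).
  by apply: measurableT_comp mf _; exact: msh.
rewrite (integral_power_measureS leb mf f0).
rewrite (integral_power_measureS leb mfs) => [|t]; last exact: f0.
pose b : n.-tuple R := [tuple of behead a].
apply/esym; rewrite -(@integral_lebesgue_shift _ (thead a) (fun x => \int[_]_t _)).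
- apply: eq_integral => x _.
  rewrite -(IH b (fun t => f (tuple_cons ((x + thead a)%R, t)))) //; last first.
    by apply: measurableT_comp => //; exact: mcons.
  apply: eq_integral => t _; congr f; apply/esym/eq_from_tnth => i.
  rewrite tnth_mktuple; case: (unliftP ord0 i) => [j|] ->.
    rewrite !tnthS tnth_mktuple; congr (_ + _)%R.
    by rewrite [in LHS](tuple_eta a) tnthS.
  by rewrite !tnth0.
- apply: (@measurable_fun_fubini_tonelli_F _ _ _ _ _ (power_measure leb n)
    (fun z => f (tuple_cons z))) => //.
  by apply: measurableT_comp => //; exact: measurable_tuple_cons.
- by move=> x; apply: integral_ge0.
Qed.

Lemma integral_vec_shift (a : V) (f : V -> \bar R) :
  measurable_fun setT f -> (forall x, 0 <= f x) ->
  \int[m]_x f (x + a)%R = \int[m]_x f x.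
Proof.
move=> mf f0; rewrite !integral_lebesgue_vec//; last first.
  by apply: measurableT_comp => //; exact: measurable_vecD.
apply/esym; rewrite -(integral_power_shift (coords a)) => [|//|//]; last first.
  by apply: measurableT_comp => //; exact: measurable_vec_of_coords.
apply: eq_integral => t _; congr f; apply/esym; rewrite -[in LHS](coordsK a).
apply/rowP => k; rewrite /vec_of_coords !mxE !tnth_mktuple.
by apply/eqP; rewrite eq_complex /= !eqxx.
Qed.

Lemma cnorm_vec_of_coords t :
  (cnorm (@vec_of_coords R d t) ^+ 2 = \sum_(i < d + d) tnth t i ^+ 2)%R.
Proof.
rewrite cnorm_sqr big_split_ord /= -big_split; apply: eq_bigr => k _ /=.
by rewrite normc_sqr mxE.
Qed.

Lemma measurable_gauss (c : R) :
  measurable_fun setT (fun x : V => expR (- (c * cnorm x ^+ 2))).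
Proof.
apply: measurableT_comp => //; apply: measurableT_comp => //.
by apply: measurable_funM => //; apply: measurable_funX; exact: measurable_cnorm.
Qed.

Lemma integral_vec_gauss (c : R) : (0 < c)%R ->
  \int[m]_x (expR (- (c * cnorm x ^+ 2)))%:E = ((pi / c) ^+ d)%:E.
Proof.
move=> c0; rewrite integral_lebesgue_vec//; last first.
  by apply/measurable_EFinP; exact: measurable_gauss.
have -> : ((pi / c) ^+ d = Num.sqrt (pi / c) ^+ (d + d))%R.
  by rewrite exprD -exprMn -expr2 sqr_sqrtr// divr_ge0 ?pi_ge0// ltW.
rewrite -(@integral_power_measure_prod _ _ _ leb (d + d) (fun x => expR (- (c * x ^+ 2)))%R).
- apply: eq_integral => t _; rewrite cnorm_vec_of_coords -expR_sum; congr ((expR _)%:E).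
  by rewrite mulr_sumr sumrN.
- apply: measurableT_comp => //; apply: measurableT_comp => //.
  by apply: measurable_funM => //; apply: measurable_funX.
- by move=> x; exact: expR_ge0.
- exact: integral_gauss.
Qed.

End lebesgue_vec_theory.
Section lebesgue_vec_sigma_finite.
Context (R : realType) (d : nat).
Local Notation V := 'rV[R[i]]_d.
Local Notation m := (@lebesgue_vec R d).

(** On a ball the Gaussian is bounded below, and its integral is finite. *)
Lemma lebesgue_vec_sigma_finite : sigma_finite setT m.
Proof.
pose F n : set V := [set x | (cnorm x <= n%:R)%R].
have mF n : measurable (F n).
  rewrite -[F n]setTI; apply: (@measurable_cnorm R d measurableT [set t | t <= n%:R]%R).
  by rewrite -(set_itvNyc (n%:R : R)); exact: measurable_itv.
exists F => [|n].
  apply/seteqP; split => // x _; exists (Num.truncn (cnorm x)).+1 => //.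
  by rewrite /F /= ltW// truncnS_gt.
split => //; rewrite -[X in X < _]mul1e -integral_cst//.
pose c : R := expR (n%:R ^+ 2).
apply: (@le_lt_trans _ _ (\int[m]_x (c * expR (- (1 * cnorm x ^+ 2)))%:E)).
  apply: le_trans (@ge0_subset_integral _ _ _ m (F n) setT _ _ _ _ _ _) => //.
  - apply: ge0_le_integral => //.
    + apply/measurable_EFinP; apply: measurable_funM => //.
      by apply: measurable_funS (@measurable_gauss R d 1%R).
    + move=> x xn; rewrite mul1r lee_fin -expRD -[leLHS]expR0 ler_expR subr_ge0.
      by rewrite ler_sqr ?nnegrE ?cnorm_ge0.
  - apply/measurable_EFinP; apply: measurable_funM => //; exact: measurable_gauss.
  - by move=> x _; rewrite lee_fin mulr_ge0 ?expR_ge0.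
under eq_integral do rewrite EFinM.
rewrite ge0_integralZl//.
- by rewrite integral_vec_gauss// ltry.
- by apply/measurable_EFinP; exact: measurable_gauss.
- by rewrite lee_fin expR_ge0.
Qed.

HB.instance Definition _ :=
  Measure_isSigmaFinite.Build _ _ _ (@lebesgue_vec R d) lebesgue_vec_sigma_finite.

End lebesgue_vec_sigma_finite.

Section scaling.
Context (R : realType) (d : nat).
Local Notation V := 'rV[R[i]]_d.
Local Notation m := (@lebesgue_vec R d).

Lemma measurable_vecZc (a : R[i]) : measurable_fun setT (fun x : V => (a *: x)%R).
Proof. by apply: measurable_vecZ. Qed.

Lemma tonelli_vec (f : V -> V -> \bar R) :
  measurable_fun setT (fun p : V * V => f p.1 p.2) -> (forall x y, 0 <= f x y) ->
  \int[m]_x \int[m]_y f x y = \int[m]_y \int[m]_x f x y.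
Proof.
by move=> mf f0; apply: (@fubini_tonelli _ _ _ _ _ m m (fun p => f p.1 p.2)).
Qed.

(** Uniqueness of Haar measure: the image of the Lebesgue measure by the
    additive bijection x |-> a x is translation invariant, hence proportional to
    it; the factor is read off any even test function G. *)
Lemma integral_vecZ_even (a : R[i]) (f G : V -> \bar R) : a != 0%R ->
  measurable_fun setT f -> (forall x, 0 <= f x) ->
  measurable_fun setT G -> (forall x, 0 <= G x) ->
  (forall x y, G (x - y)%R = G (y - x)%R) ->
  (\int[m]_x G x) * \int[m]_x f (a *: x)%R =
  (\int[m]_x G (a *: x)%R) * \int[m]_x f x.
Proof.
move=> a0 mf f0 mG G0 GN.
have mZ := measurable_vecZc a.
have mGZ : measurable_fun setT (fun y : V => G (a *: y)%R).
  exact: measurableT_comp mG mZ.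
have mfZ : measurable_fun setT (fun y : V => f (a *: y)%R).
  exact: measurableT_comp mf mZ.
have mZ2 : measurable_fun setT (fun p : V * V => (a *: p.2)%R).
  exact: measurableT_comp mZ measurable_snd.
have ontoa (x : V) : x = (a *: (a^-1 *: x))%R by rewrite scalerA divff// scale1r.
pose J := \int[m]_y f (a *: y)%R.
have J0 : 0 <= J by apply: integral_ge0 => y _; exact: f0.
have mfx x : measurable_fun setT (fun y : V => f (x + a *: y)%R).
  by apply: (measurableT_comp mf); apply: measurable_vecD.
have I1 x : \int[m]_y (G x * f (x + a *: y)%R) = G x * J.
  rewrite (ge0_integralZl m measurableT (mfx x)) => [|y _|]; last 2 first.
  - exact: f0.
  - exact: G0.
  congr (_ * _).
  rewrite /J -(@integral_vec_shift _ _ (a^-1 *: x) _ mfZ) => [|y]; last exact: f0.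
  by apply: eq_integral => y _; rewrite scalerDr -ontoa addrC.
have I2 y : \int[m]_x (G x * f (x + a *: y)%R) =
            \int[m]_x (G (x - a *: y)%R * f x).
  have mGf : measurable_fun setT (fun x : V => G x * f (x + a *: y)%R).
    apply: emeasurable_funM => //; apply: (measurableT_comp mf).
    exact: measurable_vecD.
  rewrite -(integral_vec_shift (- (a *: y))%R mGf) => [|x]; last exact: mule_ge0.
  by apply: eq_integral => x _; rewrite subrK.
have mGx x : measurable_fun setT (fun y : V => G (x - a *: y)%R).
  apply: (measurableT_comp mG); apply: measurable_vecD => //.
  rewrite (_ : (fun _ => _) = (fun y : V => (- a) *: y)%R); last first.
    by apply/funext => y; rewrite scaleNr.
  exact: measurable_vecZc.
pose Ga := \int[m]_y G (a *: y)%R.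
have Ga0 : 0 <= Ga by apply: integral_ge0 => y _; exact: G0.
have I3 x : \int[m]_y (G (x - a *: y)%R * f x) = Ga * f x.
  rewrite (ge0_integralZr m measurableT (mGx x)) => [|y _|]; last 2 first.
  - exact: G0.
  - exact: f0.
  congr (_ * _).
  rewrite /Ga -(@integral_vec_shift _ _ (- (a^-1 *: x))%R _ mGZ) => [|y]; last exact: G0.
  by apply: eq_integral => y _; rewrite scalerBr -ontoa GN.
have : \int[m]_x \int[m]_y (G x * f (x + a *: y)%R) =
       \int[m]_y \int[m]_x (G x * f (x + a *: y)%R).
  apply: tonelli_vec => [|x y]; last exact: mule_ge0.
  apply: emeasurable_funM.
    exact: measurableT_comp mG measurable_fst.
  by apply: (measurableT_comp mf); exact: measurable_vecD.
rewrite (funext I1) (funext I2).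
rewrite (ge0_integralZr m measurableT mG) => [|x _|//]; last exact: G0.
rewrite (tonelli_vec (f := fun y x => G (x - a *: y)%R * f x)); last 2 first.
- apply: emeasurable_funM; last exact: measurableT_comp mf measurable_snd.
  apply: (measurableT_comp mG); rewrite (_ : (fun _ => _) =
     (fun p : V * V => p.2 + (- a) *: p.1)%R); last first.
    by apply/funext => p; rewrite scaleNr.
  apply: measurable_vecD => //.
  by apply: measurable_vecZ.
- by move=> x y; exact: mule_ge0.
rewrite (funext I3).
by rewrite (ge0_integralZl m measurableT mf) => [|x _|//]; last exact: f0.
Qed.

(** The Gaussian only sees |a|; both the dilations and the rotations
    x |-> a x with |a| = 1 are covered. *)
Lemma integral_vecZ (a : R[i]) (f : V -> \bar R) : a != 0%R ->
  measurable_fun setT f -> (forall x, 0 <= f x) ->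
  \int[m]_x f (a *: x)%R = (normc a ^- (2 * d))%:E * \int[m]_x f x.
Proof.
move=> a0 mf f0.
have na0 : (0 < normc a)%R.
  by rewrite lt_neqAle normc_ge0 andbT eq_sym; apply: contra a0 => /eqP/eq0_normc->.
pose G (x : V) : \bar R := (expR (- (1 * cnorm x ^+ 2)))%:E.
have := @integral_vecZ_even a f G a0 mf f0 _ _ _.
rewrite integral_vec_gauss//.
have -> : (fun x => G (a *: x)%R) =
    (fun x => (expR (- (normc a ^+ 2 * cnorm x ^+ 2)))%:E).
  by apply/funext => x; rewrite /G cnormZ exprMn mul1r.
rewrite integral_vec_gauss ?exprn_gt0// divr1 => H.
have {H} : (pi ^+ d)%:E * \int[m]_x f (a *: x)%R =
    ((pi / normc a ^+ 2) ^+ d)%:E * \int[m]_x f x.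
  apply: H; first by apply/measurable_EFinP; exact: measurable_gauss.
  - by move=> x; rewrite lee_fin expR_ge0.
  - by move=> x y; rewrite /G -cnormN opprB.
have pi0 : (pi ^+ d != 0 :> R)%R by rewrite expf_neq0// gt_eqF// pi_gt0.
move=> /(congr1 (fun y => ((pi ^- d)%:E * y))).
rewrite !muleA -!EFinM mulVf// mul1e => ->; congr (_%:E * _).
by rewrite expr_div_n mulrA mulVf// mul1r -exprM.
Qed.

Lemma integral_vec_rot (a : R[i]) (f : V -> \bar R) : normc a = 1%R ->
  measurable_fun setT f -> (forall x, 0 <= f x) ->
  \int[m]_x f (a *: x)%R = \int[m]_x f x.
Proof.
move=> a1 mf f0; rewrite integral_vecZ//.
  by rewrite a1 expr1n invr1 mul1e.
by apply/eqP => a0; move: a1; rewrite a0 normc0 => /esym/eqP; rewrite oner_eq0.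
Qed.

Lemma integral_vec_scale (c : R) (f : V -> \bar R) : (0 < c)%R ->
  measurable_fun setT f -> (forall x, 0 <= f x) ->
  \int[m]_x f x = (c ^+ (2 * d))%:E * \int[m]_x f (c%:C *: x)%R.
Proof.
move=> c0 mf f0; rewrite integral_vecZ//; last by rewrite fmorph_eq0 gt_eqF.
rewrite muleA -EFinM normc_real (gtr0_norm c0) divff ?mul1e//.
by rewrite expf_neq0// gt_eqF.
Qed.

End scaling.

Local Close Scope ereal_scope.
Local Open Scope ereal_scope.

(** * Radial integrals of homogeneous functions *)

Lemma measurable_inv (R : realType) : measurable_fun setT (@GRing.inv R).
Proof.
rewrite -(setvU [set 0%R]); apply/measurable_funU => //.
  exact: measurableC.
split; last exact: measurable_fun_set1.
apply: open_continuous_measurable_fun => [|x].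
  by rewrite openC; exact: closed_eq.
by rewrite inE => /eqP x0; exact: inv_continuous.
Qed.

Lemma integralZ_ge0 dT (T : measurableType dT) (R : realType)
    (mu : {measure set T -> \bar R}) (f : T -> \bar R) (c : R) :
  measurable_fun setT f -> (forall x, 0 <= f x) -> (0 <= c)%R ->
  c%:E * \int[mu]_x f x = \int[mu]_x (c%:E * f x).
Proof. by move=> mf f0 c0; rewrite ge0_integralZl. Qed.

Section homogeneous.
Context (R : realType) (d : nat).
Local Notation V := 'rV[R[i]]_d.
Local Notation m := (@lebesgue_vec R d).

Definition homogeneous (k : nat) (g : V -> R) : Prop :=
  forall (c : R) x, (0 < c)%R -> (g (c%:C *: x) = c ^+ k * g x)%R.

Lemma cnorm_scale (c : R) (x : V) : (0 < c)%R -> (cnorm (c%:C *: x) = c * cnorm x)%R.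
Proof. by move=> c0; rewrite cnormZ normc_real gtr0_norm. Qed.

(** Integrals against radial weights stand for integrals over spheres: an identity valid
    for all phi is an identity between means over spheres. *)
Definition radial_int (phi : R -> R) (g : V -> R) : \bar R :=
  \int[m]_x (phi (cnorm x ^+ 2) * g x)%:E.

Definition gaussian : R -> R := fun t => expR (- t).

Lemma measurable_gaussian : measurable_fun setT gaussian.
Proof. exact: measurableT_comp. Qed.

Lemma measurable_radial (phi : R -> R) : measurable_fun setT phi ->
  measurable_fun setT (fun x : V => phi (cnorm x ^+ 2))%R.
Proof.
move=> mphi; apply: (measurableT_comp mphi).
by apply: measurable_funX; exact: measurable_cnorm.
Qed.

Definition radial_factor (k : nat) : \bar R :=
  \int[m]_v (expR (- (cnorm v ^- 2)) * cnorm v ^- (2 * d) * cnorm v ^- (2 * d + 2 * k))%:E.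

Variables (k : nat) (phi : R -> R) (g : V -> R).
Hypotheses (d0 : (0 < d)%N) (k0 : (0 < k)%N) (mphi : measurable_fun setT phi)
  (phi0 : forall t, (0 <= phi t)%R) (mg : measurable_fun setT g)
  (g0 : forall x, (0 <= g x)%R) (gk : homogeneous (2 * k) g).

Let k20 : (0 < 2 * k)%N. Proof. by rewrite muln_gt0. Qed.

Let g00 : g 0%R = 0%R.
Proof.
have := gk (0 : V)%R (ltr0n _ 2); rewrite scaler0 => /eqP.
rewrite -subr_eq0 -{1}[g 0%R]mul1r -mulrBl mulf_eq0 => /orP[|/eqP//].
by rewrite subr_eq0 lt_eqF// exprn_egt1 ?gt_eqF// ltr1n.
Qed.

Let A (x y : V) : R := (phi (cnorm y ^+ 2) * g x *
  (expR (- (cnorm x ^+ 2 / cnorm y ^+ 2)) * cnorm y ^- (2 * d)))%R.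

Let A0 x y : 0 <= (A x y)%:E.
Proof. by rewrite lee_fin !mulr_ge0 ?expR_ge0 ?invr_ge0 ?exprn_ge0 ?cnorm_ge0. Qed.

Let mA : measurable_fun setT (fun p : V * V => (A p.1 p.2)%:E).
Proof.
apply/measurable_EFinP; apply: measurable_funM; apply: measurable_funM.
- exact: measurableT_comp (measurable_radial mphi) measurable_snd.
- exact: measurableT_comp mg measurable_fst.
- apply: measurableT_comp => //; apply: measurableT_comp => //.
  apply: measurable_funM.
    by apply: measurable_funX; exact: measurableT_comp (@measurable_cnorm R d) measurable_fst.
  apply: (measurableT_comp (@measurable_inv R)).
  by apply: measurable_funX; exact: measurableT_comp (@measurable_cnorm R d) measurable_snd.
- apply: (measurableT_comp (@measurable_inv R)).
  by apply: measurable_funX; exact: measurableT_comp (@measurable_cnorm R d) measurable_snd.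
Qed.

Let mAx y : measurable_fun setT (fun x : V => (A x y)%:E).
Proof. exact: measurableT_comp mA (measurable_pair2 y). Qed.

Let mAy x : measurable_fun setT (fun y : V => (A x y)%:E).
Proof. exact: measurableT_comp mA (measurable_pair1 x). Qed.

Let N0 (x : V) : x != 0%R -> (0 < cnorm x)%R.
Proof. by move=> x0; rewrite lt_neqAle cnorm_ge0 andbT eq_sym cnorm_eq0. Qed.

Let mgauss_g : measurable_fun setT (fun x : V => (gaussian (cnorm x ^+ 2) * g x)%:E).
Proof.
apply/measurable_EFinP; apply: measurable_funM => //.
exact: measurable_radial measurable_gaussian.
Qed.

Let mphi_g : measurable_fun setT (fun x : V => (phi (cnorm x ^+ 2) * g x)%:E).
Proof.
apply/measurable_EFinP; apply: measurable_funM => //.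
exact: measurable_radial mphi.
Qed.

Let int_Ax y : \int[m]_x (A x y)%:E =
  (phi (cnorm y ^+ 2) * cnorm y ^+ (2 * k))%:E * radial_int gaussian g.
Proof.
have [->|y0] := eqVneq y 0%R.
  have zk : (cnorm (0 : V)%R ^+ (2 * k) = 0)%R by rewrite cnorm0 expr0n gtn_eqF.
  rewrite zk mulr0 mul0e integral0_eq// => x _.
  by rewrite /A cnorm0 [(0 ^+ (2 * d))%R]expr0n gtn_eqF ?muln_gt0// invr0 !mulr0.
have r0 := N0 y0; set r := cnorm y in r0 *.
rewrite (integral_vec_scale r0 (mAx y) (fun x => A0 x y)).
have r2d : (0 <= r ^+ (2 * d))%R by rewrite exprn_ge0// ltW.
have pr : (0 <= phi (r ^+ 2) * r ^+ (2 * k))%R by rewrite mulr_ge0// exprn_ge0// ltW.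
have gg x : 0 <= (gaussian (cnorm x ^+ 2) * g x)%:E.
  by rewrite lee_fin mulr_ge0// expR_ge0.
rewrite /radial_int (integralZ_ge0 _ mgauss_g gg pr).
rewrite (integralZ_ge0 _ (measurableT_comp (mAx y) (measurable_vecZc r%:C)) _ r2d);
  last by move=> x; exact: A0.
apply: eq_integral => x _; rewrite -!EFinM; congr EFin.
rewrite /A -/r gk// cnorm_scale// /gaussian.
have -> : ((r * cnorm x) ^+ 2 / r ^+ 2 = cnorm x ^+ 2)%R.
  by rewrite exprMn mulrAC divff ?mul1r// expf_neq0// gt_eqF.
have rd : (r ^+ (2 * d) != 0)%R by rewrite expf_neq0// gt_eqF.
rewrite [LHS](_ : _ = (r ^+ (2 * d) / r ^+ (2 * d)) * (phi (r ^+ 2) * r ^+ (2 * k)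
  * (expR (- cnorm x ^+ 2) * g x)))%R; last by ring.
by rewrite divff// mul1r.
Qed.

Let B (x v : V) : R := (phi (cnorm x ^+ 2 * cnorm v ^+ 2) * g x *
  (expR (- (cnorm v ^- 2)) * cnorm v ^- (2 * d)))%R.

Let B0 x y : 0 <= (B x y)%:E.
Proof. by rewrite lee_fin !mulr_ge0 ?expR_ge0 ?invr_ge0 ?exprn_ge0 ?cnorm_ge0. Qed.

Let mB : measurable_fun setT (fun p : V * V => (B p.1 p.2)%:E).
Proof.
have m1 : measurable_fun setT (fun p : V * V => cnorm p.1).
  exact: measurableT_comp (@measurable_cnorm R d) measurable_fst.
have m2 : measurable_fun setT (fun p : V * V => cnorm p.2).
  exact: measurableT_comp (@measurable_cnorm R d) measurable_snd.
apply/measurable_EFinP; apply: measurable_funM; apply: measurable_funM.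
- apply: (measurableT_comp mphi); apply: measurable_funM; exact: measurable_funX.
- exact: measurableT_comp mg measurable_fst.
- apply: measurableT_comp => //; apply: measurableT_comp => //.
  apply: (measurableT_comp (@measurable_inv R)).
  exact: measurable_funX.
- apply: (measurableT_comp (@measurable_inv R)); exact: measurable_funX.
Qed.

Let int_Ay x : \int[m]_y (A x y)%:E = \int[m]_v (B x v)%:E.
Proof.
have [->|x0] := eqVneq x 0%R.
  by rewrite !integral0_eq// => y _; rewrite /A /B g00 mulr0 mul0r.
have r0 := N0 x0; set r := cnorm x in r0 *.
rewrite (integral_vec_scale r0 (mAy x) (A0 x)).
have r2d : (0 <= r ^+ (2 * d))%R by rewrite exprn_ge0// ltW.
rewrite (integralZ_ge0 _ (measurableT_comp (mAy x) (measurable_vecZc r%:C)) _ r2d);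
  last by move=> y; exact: A0.
apply: eq_integral => y _; rewrite -!EFinM; congr EFin.
rewrite /A /B -/r cnorm_scale//.
have -> : (r ^+ 2 / (r * cnorm y) ^+ 2 = cnorm y ^- 2)%R.
  by rewrite exprMn invfM mulrA divff ?mul1r// expf_neq0// gt_eqF.
have rd : (r ^+ (2 * d) != 0)%R by rewrite expf_neq0// gt_eqF.
rewrite [((r * _) ^+ _)%R]exprMn [((r * _) ^+ (2 * d))%R]exprMn.
rewrite mulrCA; congr (_ * _)%R.
by rewrite mulrCA [((r ^+ _ * _)^-1)%R]invfM [X in (_ * X)%R]mulrA divff ?mul1r.
Qed.

Let int_Bx v : \int[m]_x (B x v)%:E = (expR (- (cnorm v ^- 2)) *
  cnorm v ^- (2 * d) * cnorm v ^- (2 * d + 2 * k))%:E * radial_int phi g.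
Proof.
have [->|v0] := eqVneq v 0%R.
  have z : (cnorm (0 : V)%R ^- (2 * d) = 0)%R.
    by rewrite cnorm0 expr0n gtn_eqF ?muln_gt0// invr0.
  rewrite z mulr0 mul0r mul0e integral0_eq// => x _.
  by rewrite /B z !mulr0.
have r0 := N0 v0; set r := cnorm v in r0 *.
rewrite /radial_int (integral_vec_scale r0 mphi_g) => [|x]; last first.
  by rewrite lee_fin mulr_ge0.
have c0 : (0 <= expR (- r ^- 2) * r ^- (2 * d) * r ^- (2 * d + 2 * k))%R.
  by rewrite !mulr_ge0 ?expR_ge0 ?invr_ge0 ?exprn_ge0// ltW.
have m1 : measurable_fun setT
   (fun x : V => (phi (cnorm (r%:C *: x) ^+ 2) * g (r%:C *: x)%R)%:E).
  by apply: measurableT_comp mphi_g _; exact: measurable_vecZc.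
have c1 : (0 <= expR (- r ^- 2) * r ^- (2 * d) * r ^- (2 * d + 2 * k) * r ^+ (2 * d))%R.
  by rewrite mulr_ge0// exprn_ge0// ltW.
rewrite muleA -EFinM (integralZ_ge0 _ m1 _ c1) => [|x]; last first.
  by rewrite lee_fin mulr_ge0.
apply: eq_integral => x _; rewrite -!EFinM; congr EFin.
rewrite /B -/r gk// cnorm_scale// exprMn (mulrC (cnorm x ^+ 2)%R).
rewrite exprD invfM.
have rd : (r ^+ (2 * d) != 0)%R by rewrite expf_neq0// gt_eqF.
have rk : (r ^+ (2 * k) != 0)%R by rewrite expf_neq0// gt_eqF.
by field; rewrite rk rd.
Qed.

(** The measures g dx and |x|^(2 k) dx are integrated against the same family of
    radial functions: computing the integral over x and y of
    phi(|y|^2) g(x) exp(-|x|^2 / |y|^2) |y|^(-2 d) in the two orders, with x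
    rescaled by |y| in one of them and y by |x| in the other, shows that their
    radial integrals only differ by a factor that does not depend on phi. *)
Lemma radial_int_homogeneous_aux :
  radial_factor k * radial_int phi g =
  radial_int phi (fun x => cnorm x ^+ (2 * k))%R * radial_int gaussian g.
Proof.
have Q0 (v : V) : 0 <= (expR (- (cnorm v ^- 2)) * cnorm v ^- (2 * d) *
    cnorm v ^- (2 * d + 2 * k))%:E.
  by rewrite lee_fin !mulr_ge0 ?expR_ge0 ?invr_ge0 ?exprn_ge0 ?cnorm_ge0.
have mN := @measurable_cnorm R d.
have mi n : measurable_fun setT (fun v : V => cnorm v ^- n).
  apply: (measurableT_comp (@measurable_inv R)); exact: measurable_funX.
have := tonelli_vec mA A0.
rewrite (funext int_Ax) (funext int_Ay) (tonelli_vec mB B0) (funext int_Bx).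
have mQ : measurable_fun setT (fun v : V => (expR (- (cnorm v ^- 2)) *
    cnorm v ^- (2 * d) * cnorm v ^- (2 * d + 2 * k))%:E).
  apply/measurable_EFinP; apply: measurable_funM => //; apply: measurable_funM => //.
  by apply: measurableT_comp => //; apply: measurableT_comp.
have mp : measurable_fun setT
    (fun y : V => (phi (cnorm y ^+ 2) * cnorm y ^+ (2 * k))%:E).
  apply/measurable_EFinP; apply: measurable_funM.
    exact: measurable_radial.
  exact: measurable_funX.
rewrite (ge0_integralZr m measurableT mQ) => [|x _|]; last 2 first.
- exact: Q0.
- by apply: integral_ge0 => x _; rewrite lee_fin mulr_ge0.
rewrite /radial_factor => ->; rewrite (ge0_integralZr m measurableT mp)// => [x _|].
  by rewrite lee_fin mulr_ge0// exprn_ge0// cnorm_ge0.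
by apply: integral_ge0 => x _; rewrite lee_fin mulr_ge0// expR_ge0.
Qed.

End homogeneous.

(** The constant of radial_int_homogeneous_aux is determined by taking for both functions
    the Gaussian and |x|^(2 k). *)
Lemma radial_int_homogeneous (R : realType) (d k : nat) (phi : R -> R)
    (g : 'rV[R[i]]_d -> R) (U : R) :
  (0 < d)%N -> (0 < k)%N -> measurable_fun setT phi -> (forall t, 0 <= phi t)%R ->
  measurable_fun setT g -> (forall x, 0 <= g x)%R -> homogeneous (2 * k) g ->
  (0 < U)%R ->
  radial_int (@gaussian R) (fun x : 'rV[R[i]]_d => cnorm x ^+ (2 * k))%R = U%:E ->
  U%:E * radial_int phi g =
  radial_int phi (fun x : 'rV[R[i]]_d => cnorm x ^+ (2 * k))%R * radial_int (@gaussian R) g.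
Proof.
move=> d0 k0 mphi phi0 mg g0 gk U0 UE.
rewrite -(radial_int_homogeneous_aux d0 k0 mphi phi0 mg g0 gk); congr (_ * _).
have := @radial_int_homogeneous_aux R d k (@gaussian R)
  (fun x : 'rV[R[i]]_d => cnorm x ^+ (2 * k))%R d0 k0
  (@measurable_gaussian R) (fun=> expR_ge0 _) _ _ _.
rewrite UE => H; have {}H : radial_factor R d k * U%:E = U%:E * U%:E.
  apply: H => [|x|c x c0].
  - by apply: measurable_funX; exact: measurable_cnorm.
  - by rewrite exprn_ge0// cnorm_ge0.
  - by rewrite cnorm_scale// exprMn.
move/(congr1 (fun y => y * (U^-1)%:E)): H.
by rewrite -!muleA -!EFinM divff ?gt_eqF// mulr1 mule1 => ->.
Qed.
Local Open Scope ring_scope.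

(** * Averages over roots of unity *)

Section roots_of_unity.
Context (R : realType).
Local Notation C := R[i].

(** Taking the order of the root to be a power of 2, primitivity amounts to
    w^(N / 2) <> 1. *)
Lemma exists_prim_root (n : nat) :
  exists (N : nat) (w : C), (n < N)%N /\ N.-primitive_root w.
Proof.
pose w : C := (2 ^ n)%N.-root (-1).
have w1 : w ^+ (2 ^ n) = -1 by rewrite rootCK// expn_gt0.
exists (2 ^ n.+1)%N, w; split.
  by rewrite (leq_trans (ltn_expl n (ltnSn 1)))// leq_exp2l.
have wN : w ^+ (2 ^ n.+1) = 1 by rewrite expnSr exprM w1 sqrrN expr1n.
have [m mw mN] := prim_order_exists (expn_gt0 2 n.+1) wN.
have [k kn mE] := dvdn_pfactor m n.+1 (isT : prime 2) mN.
move: kn; rewrite leq_eqVlt => /predU1P[kn|kn]; first by rewrite -kn -mE.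
have := prim_expr_order mw; rewrite mE => wk.
have : w ^+ (2 ^ n) = 1.
  by rewrite -(subnKC (kn : (k <= n)%N)) expnD exprM wk expr1n.
by rewrite w1 => /eqP; rewrite eq_sym -subr_eq0 opprK -[1 + 1]/(2%:R) pnatr_eq0.
Qed.

Variables (N : nat) (w : C).
Hypothesis wN : N.-primitive_root w.

Let N0 : (0 < N)%N. Proof. exact: prim_order_gt0 wN. Qed.

Lemma normc_prim_root : normc w = 1.
Proof.
have := congr1 (@normc R) (prim_expr_order wN); rewrite normc1.
have -> : normc (w ^+ N) = normc w ^+ N.
  by elim: (N) => [|n IH]; rewrite ?expr0 ?normc1// !exprS normcM IH.
by move/eqP; rewrite pexpr_eq1 ?normc_ge0// => /eqP.
Qed.

Lemma normcX (a : C) n : normc (a ^+ n) = normc a ^+ n.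
Proof. by elim: n => [|n IH]; rewrite ?expr0 ?normc1// !exprS normcM IH. Qed.

Lemma sum_prim_root (l : C) (j k : nat) : (j < N)%N -> (k < N)%N ->
  \sum_(i < N) (w ^+ i * l) ^+ j * ((w ^+ i * l)^*)%C ^+ k =
  if j == k then N%:R * ((normc l ^+ (2 * k))%:C) else 0.
Proof.
move=> jN kN.
have ww : w * (w^*)%C = 1 by rewrite -normc_sqrC normc_prim_root expr1n.
pose z := w ^+ j * (w^*)%C ^+ k.
have -> : \sum_(i < N) (w ^+ i * l) ^+ j * ((w ^+ i * l)^*)%C ^+ k =
    (\sum_(i < N) z ^+ i) * (l ^+ j * (l^*)%C ^+ k).
  rewrite mulr_suml; apply: eq_bigr => i _.
  rewrite rmorphM rmorphXn /= !exprMn /z -!exprM !(mulnC i) !exprM.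
  by ring.
have [jk|jk] := eqVneq j k.
  have -> : z = 1 by rewrite /z jk -exprMn ww expr1n.
  rewrite jk.
  rewrite (eq_bigr (fun=> 1)) => [|i _]; last by rewrite expr1n.
  by rewrite sumr_const card_ord -exprMn -normc_sqrC exprM [in RHS]rmorphXn.
suff -> : \sum_(i < N) z ^+ i = 0 by rewrite mul0r.
have zN : z ^+ N = 1.
  rewrite /z exprMn -!exprM !(mulnC _ N) !exprM (prim_expr_order wN).
  have := congr1 (@conjc R) (prim_expr_order wN).
  by rewrite rmorphXn rmorph1 /= => ->; rewrite !expr1n mulr1.
have z1 : z - 1 != 0.
  rewrite subr_eq0; apply: contra jk => /eqP z1.
  have : w ^+ j = w ^+ k.
    by rewrite -[RHS]mul1r -z1 /z -mulrA -exprMn mulrC [_ * w]mulrC ww expr1n mul1r.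
  by move/eqP; rewrite (eq_prim_root_expr wN) !modn_small.
by apply: (mulfI z1); rewrite -subrX1 zN subrr mulr0.
Qed.

Let mul_conj (a b : R) (u : C) (j k : nat) :
  (a%:C * u ^+ j) * ((b%:C * u ^+ k)^*)%C = (a * b)%:C * (u ^+ j * (u^*)%C ^+ k).
Proof.
have cM (x y : C) : conjc (x * y) = conjc x * conjc y by rewrite rmorphM.
have cX (x : C) n : conjc (x ^+ n) = conjc x ^+ n by rewrite rmorphXn.
have cR (x : R) : conjc x%:C = x%:C :> C by rewrite /= oppr0.
have -> : (a * b)%:C = a%:C * b%:C :> C by rewrite rmorphM.
by rewrite cM cX cR; ring.
Qed.

(** Parseval identity for the points w^i l: powers of w with distinct exponents below N
    are orthogonal. *)
Lemma parseval (p : {poly R}) (M : nat) (l : C) : (size p <= M <= N)%N ->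
  \sum_(i < N) normc ((map_poly (real_complex R) p).[w ^+ i * l]) ^+ 2 =
  N%:R * \sum_(k < M) p`_k ^+ 2 * normc l ^+ (2 * k).
Proof.
move=> /andP[pM pN]; apply: complexI; rewrite rmorph_sum rmorphM rmorph_nat rmorph_sum /=.
under eq_bigr => i _.
  rewrite normc_sqrC (@horner_coef_wide _ M) ?size_map_poly// rmorph_sum mulr_suml.
  under eq_bigr do rewrite mulr_sumr.
  over.
rewrite exchange_big mulr_sumr; apply: eq_bigr => j _.
rewrite exchange_big (bigD1 j)//= [X in _ + X]big1 => [|k kj].
  under eq_bigr do rewrite coef_map mul_conj.
  rewrite -mulr_sumr sum_prim_root ?eqxx ?(leq_trans (ltn_ord j))//.
  by rewrite addr0 mulrCA -expr2 -rmorphM.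
under eq_bigr do rewrite !coef_map mul_conj.
rewrite -mulr_sumr sum_prim_root ?(leq_trans (ltn_ord _))//.
by rewrite val_eqE eq_sym (negbTE kj) mulr0.
Qed.

(** In the binomial expansion of (u + conj u)^(2 k), only the middle term is invariant
    under rotations of u. *)
Lemma sum_prim_root_Re (l : C) (k : nat) : (2 * k < N)%N ->
  \sum_(i < N) (2 * complex.Re (w ^+ i * l)) ^+ (2 * k) =
  N%:R * ('C(2 * k, k)%:R * normc l ^+ (2 * k)).
Proof.
move=> kN; apply: complexI; rewrite rmorph_sum !rmorphM !rmorph_nat /=.
under eq_bigr => i _.
  rewrite rmorphXn rmorphM rmorph_nat /= -addcJ exprDn.
  over.
have kk : (k < (2 * k).+1)%N by rewrite ltnS mul2n -addnn leq_addl.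
rewrite exchange_big (bigD1 (Ordinal kk))//= [X in _ + X]big1 => [|j jk].
  have k2 : (2 * k - k = k)%N by rewrite mul2n -addnn addnK.
  have kN' : (k < N)%N by exact: leq_ltn_trans kN.
  rewrite sumrMnl k2 sum_prim_root// eqxx addr0.
  by rewrite [in RHS]mulrCA [in RHS]mulr_natl.
have j2k : (j <= 2 * k)%N by rewrite -ltnS.
rewrite sumrMnl sum_prim_root ?(leq_ltn_trans _ kN)// ?leq_subr//.
case: eqP => [e|]; last by rewrite mul0rn.
case/eqP: jk; apply/val_inj => /=; move: e; lia.
Qed.

End roots_of_unity.

(** * Power series *)

Section geometric_power.
Context (R : realType).

(** Polynomials approximating (1 - X)^(-d), to which the discrete Parseval identity applies.
    Their value at w is ((1 - w^n) / (1 - w))^d, and their first n coefficients are those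
    of the series. *)
Definition geom_pow (F : comNzRingType) (d n : nat) : {poly F} :=
  (\sum_(k < n) 'X^k) ^+ d.

(** The coefficient of X^k in (1 - X)^(-d). *)
Definition szego_coef (d k : nat) : nat := 'C((k + d).-1, k).

Lemma sum_szego_coef d k :
  (\sum_(j < k.+1) szego_coef d j = szego_coef d.+1 k)%N.
Proof.
elim: k => [|k IH]; first by rewrite big_ord1 /szego_coef add0n !bin0.
by rewrite big_ord_recr /= IH /szego_coef !addSn !addnS /= binS addnC.
Qed.

Lemma szego_coef_gt0 d k : (0 < d)%N -> (0 < szego_coef d k)%N.
Proof. by case: d => // d _; rewrite /szego_coef addnS /= bin_gt0 leq_addr. Qed.

Lemma geom_pow_coef (F : comNzRingType) d n k :
  exists c : nat, [/\ (geom_pow F d n)`_k = c%:R, (c <= szego_coef d k)%N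
                    & (k < n)%N -> c = szego_coef d k].
Proof.
elim: d k => [|d IH] k.
  exists (k == 0)%N; rewrite /geom_pow expr0 coef1; split => //.
    by case: k => // k; rewrite /szego_coef bin0.
  by case: k => [_|k _]; rewrite /szego_coef ?bin0// addn0 /= bin_small.
have [c Hc] : exists c : nat -> nat, forall j,
    [/\ (geom_pow F d n)`_j = (c j)%:R, (c j <= szego_coef d j)%N
      & (j < n)%N -> c j = szego_coef d j].
  by have /choice[c Hc] := IH; exists c.
exists (\sum_(j < k.+1 | (k - j < n)%N) c j)%N; split.
- rewrite /geom_pow exprSr coefM natr_sum [RHS]big_mkcond /=.
  apply: eq_bigr => j _; have [-> _ _] := Hc j.
  rewrite coef_sum; case: ifPn => kj.
    rewrite (bigD1 (Ordinal kj))//= coefXn eqxx big1 ?addr0 ?mulr1// => i ik.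
    by rewrite coefXn eq_sym; move: ik; rewrite -val_eqE /= => /negbTE ->.
  rewrite big1 ?mulr0// => i _; rewrite coefXn.
  by have := ltn_ord i; case: eqP => // <- /(negP kj).
- rewrite -sum_szego_coef (leq_trans (n := \sum_(j < k.+1) c j))//.
    by rewrite [leqRHS](bigID (fun j : 'I_k.+1 => (k - j < n)%N)) /= leq_addr.
  by apply: leq_sum => j _; have [] := Hc j.
- move=> kn; rewrite -sum_szego_coef; apply: eq_big => j.
    by rewrite (leq_ltn_trans _ kn)// leq_subr.
  by move=> _; have [_ _ ->] := Hc j => //; rewrite (leq_ltn_trans _ kn)// -ltnS.
Qed.

Lemma size_geom_pow (F : comNzRingType) d n : (size (geom_pow F d n) <= (d * n).+1)%N.
Proof.
apply: leq_trans (size_poly_exp_leq _ _) _; rewrite ltnS mulnC leq_mul2l; apply/orP; right.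
apply: (@leq_trans n); last by [].
have : (size (\sum_(k < n) 'X^k : {poly F})%R <= n)%N.
  by apply: (leq_trans (size_sum _ _ _)); apply/bigmax_leqP => i _; rewrite size_polyXn.
by apply: leq_trans; rewrite leq_pred.
Qed.

Lemma geom_pow_horner (F : fieldType) d n (q : F) : 1 - q != 0 ->
  (geom_pow F d n).[q] = ((1 - q ^+ n) / (1 - q)) ^+ d.
Proof.
move=> q1; rewrite /geom_pow horner_exp horner_sum; congr (_ ^+ d).
under eq_bigr do rewrite hornerXn.
have := subrX1 q n; rewrite -[q ^+ n - 1]opprB -[q - 1]opprB mulNr.
by move/oppr_inj => ->; rewrite mulrAC divff ?mul1r.
Qed.

Lemma map_geom_pow (F F' : comNzRingType) (f : {rmorphism F -> F'}) d n :
  map_poly f (geom_pow F d n) = geom_pow F' d n.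
Proof.
rewrite rmorphXn rmorph_sum; congr (_ ^+ d).
by apply: eq_bigr => k _ /=; rewrite map_polyXn.
Qed.

Lemma geom_pow_le (d n : nat) (q : R) : 0 <= q < 1 ->
  (geom_pow R d n).[q] <= (1 - q) ^- d.
Proof.
move=> /andP[q0 q1]; rewrite geom_pow_horner ?gt_eqF ?subr_gt0//.
rewrite expr_div_n ler_piMl// ?invr_ge0 ?exprn_ge0 ?subr_ge0 ?(ltW q1)//.
by rewrite exprn_ile1// ?subr_ge0 ?exprn_ile1 ?(ltW q1)// lerBlDr lerDl exprn_ge0.
Qed.

Lemma geom_pow_sum (d n : nat) (q : R) :
  (geom_pow R d n).[q] =
  \sum_(k < size (geom_pow R d n)) (geom_pow R d n)`_k * q ^+ k.
Proof. exact: horner_coef. Qed.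

Lemma sum_szego_le (d n : nat) (q : R) : 0 <= q < 1 ->
  \sum_(k < n) (szego_coef d k)%:R * q ^+ k <= (1 - q) ^- d.
Proof.
move=> /[dup] q01 /andP[q0 q1]; apply: le_trans (geom_pow_le d n q01).
pose p := geom_pow R d n.
have -> : p.[q] = \sum_(k < maxn n (size p)) p`_k * q ^+ k.
  by apply: horner_coef_wide; rewrite leq_maxr.
rewrite -(big_mkord xpredT (fun k => (szego_coef d k)%:R * q ^+ k)).
rewrite -(big_mkord xpredT (fun k => p`_k * q ^+ k)).
rewrite [leRHS](big_cat_nat (n := n))//= ?leq_maxl//.
rewrite (_ : \sum_(0 <= i < n) (szego_coef d i)%:R * q ^+ i =
             \sum_(0 <= i < n) p`_i * q ^+ i).
  rewrite lerDl sumr_ge0// => k _.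
  by have [c [-> _ _]] := geom_pow_coef R d n k; rewrite mulr_ge0// exprn_ge0.
rewrite !big_nat; apply: eq_bigr => k /andP[_ kn].
by have [c [-> _ ->]] := geom_pow_coef R d n k.
Qed.

Lemma geom_pow_le_sum (d n m : nat) (q : R) : 0 <= q -> (d * n < m)%N ->
  (geom_pow R d n).[q] <= \sum_(k < m) (szego_coef d k)%:R * q ^+ k.
Proof.
move=> q0 nm; rewrite (@horner_coef_wide _ m); last first.
  exact: leq_trans (size_geom_pow _ _ _) nm.
apply: ler_sum => k _; have [c [-> cd _]] := geom_pow_coef R d n k.
by rewrite ler_wpM2r ?exprn_ge0// ler_nat.
Qed.

Lemma cvg_geom_pow (d : nat) (q : R) : 0 <= q < 1 ->
  (geom_pow R d n).[q] @[n --> \oo] --> (1 - q) ^- d.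
Proof.
move=> /andP[q0 q1]; rewrite (_ : (fun n => _) = fun n => ((1 - q ^+ n) / (1 - q)) ^+ d).
  have H : (fun n => (1 - q ^+ n) / (1 - q)) @ \oo --> (1 - 0) / (1 - q).
    apply: cvgMl; apply: cvgB; first exact: cvg_cst.
    by apply: cvg_expr; rewrite ger0_norm.
  rewrite subr0 div1r in H; rewrite -exprVn.
  by apply: (cvg_comp _ (fun x : R => x ^+ d) H); exact: exprn_continuous.
by apply/funext => n; rewrite geom_pow_horner// gt_eqF// subr_gt0.
Qed.

Lemma szego_series (d : nat) (q : R) : 0 <= q < 1 ->
  (\sum_(0 <= k <oo) ((szego_coef d k)%:R * q ^+ k)%:E = ((1 - q) ^- d)%:E)%E.
Proof.
move=> /[dup] q01 /andP[q0 q1].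
have t0 k : (0 <= ((szego_coef d k)%:R * q ^+ k)%:E)%E.
  by rewrite lee_fin mulr_ge0// exprn_ge0.
apply/eqP; rewrite eq_le; apply/andP; split.
  apply: lime_le; first by apply: is_cvg_nneseries.
  by apply: nearW => n; rewrite sumEFin lee_fin big_mkord sum_szego_le.
have H : ((geom_pow R d n).[q])%:E @[n --> \oo] --> ((1 - q) ^- d)%:E.
  by apply: cvg_EFin; [exact: nearW|exact: cvg_geom_pow].
apply: (cvge_to_le H); apply: nearW => n; rewrite (le_trans _ (nneseries_lim_ge (d * n).+1 _))//.
by rewrite sumEFin lee_fin big_mkord geom_pow_le_sum.
Qed.

End geometric_power.

Section power_series.
Context (R : realType).
Implicit Types (a b : nat -> R).

(** Once the first n terms are cancelled, dividing by t^n leaves a n up to O(t) on one side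
    and b n up to O(t) on the other. *)
Lemma power_series_le a b (rho C : R) (n : nat) : 0 < rho ->
  (forall k, 0 <= a k) -> (forall k, 0 <= b k) ->
  (forall t, 0 < t <= rho -> (\sum_(0 <= k <oo) (a k * t ^+ k)%:E =
                              \sum_(0 <= k <oo) (b k * t ^+ k)%:E)%E) ->
  (\sum_(0 <= k <oo) (b k * rho ^+ k)%:E <= C%:E)%E ->
  (forall k, (k < n)%N -> a k = b k) -> a n <= b n.
Proof.
move=> r0 a0 b0 ab bC abn.
have t0 (c : nat -> R) t k : (forall k, 0 <= c k) -> 0 < t -> (0 <= (c k * t ^+ k)%:E)%E.
  by move=> c0 tt; rewrite lee_fin mulr_ge0// exprn_ge0// ltW.
have C0 : 0 <= C.
  by rewrite -lee_fin (le_trans _ bC)// nneseries_ge0// => k _ _; exact: t0.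
have key t : 0 < t <= rho -> a n <= b n + t * (C / rho ^+ n.+1).
  move=> /andP[tp tr]; have := ab t; rewrite tp tr => /(_ isT).
  rewrite (nneseries_split 0 n) => [|k _]; last exact: t0.
  rewrite [in X in _ = X](nneseries_split 0 n) => [|k _]; last exact: t0.
  rewrite add0n; have -> : (\sum_(0 <= k < n) (a k * t ^+ k)%:E =
      \sum_(0 <= k < n) (b k * t ^+ k)%:E)%E.
    by rewrite !big_nat; apply: eq_bigr => k /andP[_ kn]; rewrite abn.
  set p := (\sum_(0 <= k < n) (b k * t ^+ k)%:E)%E.
  have pf : p \is a fin_num by rewrite /p sumEFin.
  set Ta := (\sum_(n <= k <oo) _)%E; set Tb := (\sum_(n <= k <oo) _)%E => E.
  have {E} TE : Ta = Tb.
    by apply/eqP; rewrite eq_le -(leeD2lE _ _ pf) E -(leeD2lE Tb _ pf) E !lexx.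
  have aT : ((a n * t ^+ n)%:E <= Ta)%E.
    apply: le_trans (nneseries_lim_ge n.+1 _) => [|k _ _]; last exact: t0.
    by rewrite big_nat1.
  have tail : (\sum_(n.+1 <= k <oo) (b k * t ^+ k)%:E <=
      ((t / rho) ^+ n.+1)%:E * C%:E)%E.
    have tr1 : 0 <= t / rho <= 1.
      by rewrite divr_ge0 ?(ltW tp) ?(ltW r0)//= ler_pdivrMr// mul1r.
    have /andP[tr0 tr1'] := tr1.
    have q0 : 0 <= (t / rho) ^+ n.+1 by rewrite exprn_ge0.
    apply: (@le_trans _ _ (((t / rho) ^+ n.+1)%:E *
        \sum_(0 <= k <oo) (b k * rho ^+ k)%:E)%E); last first.
      by rewrite lee_wpmul2l// lee_fin.
    rewrite -nneseriesZl; last by move=> k _; exact: t0.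
    rewrite (nneseries_split 0 n.+1) => [|k _]; last first.
      by rewrite -EFinM lee_fin mulr_ge0// mulr_ge0// exprn_ge0// ltW.
    rewrite add0n -[leLHS]add0e leeD//.
      by apply: sume_ge0 => k _; rewrite -EFinM lee_fin mulr_ge0// mulr_ge0// exprn_ge0// ltW.
    rewrite -[leLHS]nneseries_addn => [|k]; last exact: t0.
    rewrite -[leRHS]nneseries_addn => [|k]; last first.
      by rewrite -EFinM lee_fin mulr_ge0// mulr_ge0// exprn_ge0// ltW.
    apply: lee_nneseries => [k _ _|k _]; first exact: t0.
    rewrite -EFinM lee_fin [leRHS]mulrCA ler_wpM2l//.
    have -> : t ^+ (k + n.+1) = (t / rho) ^+ (k + n.+1) * rho ^+ (k + n.+1).
      by rewrite -exprMn divfK// gt_eqF.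
    rewrite ler_wpM2r ?exprn_ge0 ?(ltW r0)//.
    by rewrite addnC exprD ler_piMr// exprn_ile1.
  have := aT; rewrite TE /Tb (nneseries_split n 1) => [|k _]; last exact: t0.
  rewrite addn1 big_nat1 => /le_trans/(_ (leeD2l _ tail)).
  rewrite -EFinM -EFinD lee_fin expr_div_n.
  have -> : b n * t ^+ n + t ^+ n.+1 / rho ^+ n.+1 * C =
            (b n + t * (C / rho ^+ n.+1)) * t ^+ n by rewrite exprS; ring.
  by rewrite ler_pM2r// exprn_gt0.
set D := C / rho ^+ n.+1 in key.
have D0 : 0 <= D by rewrite divr_ge0// exprn_ge0// ltW.
apply/ler_addgt0Pr => e e0.
pose t := Num.min rho (e / (D + 1)).
have D1 : 0 < D + 1 by rewrite ltr_wpDl.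
have tp : 0 < t by rewrite lt_min r0 divr_gt0.
have := key t; rewrite tp ge_min lexx => /(_ isT)/le_trans; apply.
rewrite lerD2l (@le_trans _ _ (e / (D + 1) * D))//.
  by rewrite ler_wpM2r// ge_min lexx orbT.
by rewrite -mulrA ler_piMr ?(ltW e0)// mulrC ler_pdivrMr// mul1r lerDl.
Qed.

(** Identity theorem for power series with nonnegative coefficients. *)
Lemma power_series_inj a b (rho C : R) : 0 < rho ->
  (forall k, 0 <= a k) -> (forall k, 0 <= b k) ->
  (forall t, 0 < t <= rho -> (\sum_(0 <= k <oo) (a k * t ^+ k)%:E =
                              \sum_(0 <= k <oo) (b k * t ^+ k)%:E)%E) ->
  (\sum_(0 <= k <oo) (b k * rho ^+ k)%:E <= C%:E)%E ->
  a =1 b.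
Proof.
move=> r0 a0 b0 ab bC n; elim/ltn_ind: n => n IH.
apply/eqP; rewrite eq_le (power_series_le r0 a0 b0 ab bC IH) /=.
apply: (@power_series_le b a rho C n r0 b0 a0) => [t /ab//||k /IH//].
by rewrite ab// r0 lexx.
Qed.

Lemma expR_series (x : R) : 0 <= x ->
  (\sum_(0 <= k <oo) (x ^+ k / k`!%:R)%:E = (expR x)%:E)%E.
Proof.
move=> x0; apply/cvg_lim => //.
rewrite (_ : (fun n => _) = (fun n => (series (exp_coeff x) n)%:E)); last first.
  by apply/funext => n; rewrite sumEFin.
by apply: cvg_EFin; [exact: nearW|exact: is_cvg_series_exp_coeff].
Qed.

Lemma cosh_series (x : R) :
  (\sum_(0 <= k <oo) (x ^+ (2 * k) / (2 * k)`!%:R)%:E =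
   ((expR x + expR (- x)) / 2)%:E)%E.
Proof.
apply/cvg_lim => //.
pose s n := (series (exp_coeff x) n + series (exp_coeff (- x)) n) / 2.
have sE n : \sum_(0 <= k < n) x ^+ (2 * k) / (2 * k)`!%:R = s (2 * n)%N.
  elim: n => [|n IH].
    by rewrite big_nil /s muln0 /series /= !big_nil addr0 mul0r.
  rewrite big_nat_recr //= IH mulnS /s /series /= !big_nat_recr //= /exp_coeff.
  have e1 : (- x) ^+ (2 * n) = x ^+ (2 * n) by rewrite !exprM sqrrN.
  have e2 : (- x) ^+ (2 * n).+1 = - x ^+ (2 * n).+1 by rewrite !exprS e1 mulNr.
  rewrite /= e1 e2 mulNr; set A := \sum_(_ <= _ < _) _; set B := \sum_(_ <= _ < _) _.
  by set X := x ^+ (2 * n) / _; set Y := x ^+ (2 * n).+1 / _; field.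
rewrite (_ : (fun n => _) = (fun n => (s (2 * n)%N)%:E)); last first.
  by apply/funext => n; rewrite sumEFin sE.
apply: cvg_EFin; first exact: nearW.
have sc : s @ \oo --> (expR x + expR (- x)) / 2.
  by apply: cvgMl; apply: cvgD; exact: is_cvg_series_exp_coeff.
apply: cvg_comp sc; apply/cvgnyPge => A; near=> n.
by rewrite (@leq_trans n)//; [near: n; exact: nbhs_infty_ge|rewrite leq_pmull].
Unshelve. all: by end_near. Qed.

End power_series.
Local Open Scope ereal_scope.

(** * Gaussian and spherical moments *)

Section moments.
Context (R : realType) (d : nat).
Local Notation V := 'rV[R[i]]_d.
Local Notation m := (@lebesgue_vec R d).
Local Notation g := (fun x : V => gaussian (cnorm x ^+ 2)).

Let g0 x : (0 <= g x)%R. Proof. exact: expR_ge0. Qed.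

Let mg : measurable_fun setT g.
Proof. by apply: measurable_radial; exact: measurable_gaussian. Qed.

(** Moments are determined by their generating function; the weights w allow
    exponential generating functions. *)
Lemma gaussian_moments (T : V -> R) (w b : nat -> R) (rho C : R) :
  measurable_fun setT T -> (forall x, 0 <= T x)%R ->
  (forall k, 0 < w k)%R -> (forall k, 0 <= b k)%R -> (0 < rho)%R ->
  (forall t, (0 < t <= rho)%R ->
    \int[m]_x ((g x)%:E * \sum_(0 <= k <oo) ((t * T x) ^+ k * w k)%:E) =
    \sum_(0 <= k <oo) (b k * t ^+ k)%:E) ->
  \sum_(0 <= k <oo) (b k * rho ^+ k)%:E <= C%:E ->
  forall k, radial_int (@gaussian R) (fun x : V => T x ^+ k)%R = (b k / w k)%:E.
Proof.
move=> mT T0 w0 b0 r0 H bC.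
pose U k := radial_int (@gaussian R) (fun x : V => T x ^+ k)%R.
have U0 k : 0 <= U k.
  by apply: integral_ge0 => x _; rewrite lee_fin mulr_ge0 ?exprn_ge0.
have mgT k : measurable_fun setT (fun x : V => (g x * T x ^+ k)%:E).
  by apply/measurable_EFinP; apply: measurable_funM => //; exact: measurable_funX.
have E t : (0 < t <= rho)%R -> \sum_(0 <= k <oo) ((w k * t ^+ k)%:E * U k) =
    \sum_(0 <= k <oo) (b k * t ^+ k)%:E.
  move=> /[dup] /H <- /andP[t0 _].
  pose f k (x : V) := (w k * t ^+ k)%:E * (g x * T x ^+ k)%:E.
  have wt k : (0 <= w k * t ^+ k)%R by rewrite mulr_ge0 ?exprn_ge0 ?(ltW t0)// ltW.
  have f0 k x : 0 <= f k x.
    by rewrite mule_ge0// lee_fin// mulr_ge0// exprn_ge0.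
  transitivity (\int[m]_x \sum_(0 <= k <oo) f k x).
    rewrite integral_nneseries//; last first.
      by move=> k; apply: emeasurable_funM.
    apply: eq_eseriesr => k _; rewrite integralZ_ge0// => x.
    by rewrite lee_fin mulr_ge0// exprn_ge0.
  apply: eq_integral => x _; rewrite -nneseriesZl; last first.
    by move=> k _; rewrite lee_fin mulr_ge0 ?exprn_ge0 ?mulr_ge0// ltW.
  apply: eq_eseriesr => k _; rewrite /f -!EFinM exprMn; congr EFin; ring.
have Ufin k : U k \is a fin_num.
  rewrite ge0_fin_numE//.
  have : (w k * rho ^+ k)%:E * U k < +oo.
    have := E rho; rewrite r0 lexx => /(_ isT) Er.
    apply: le_lt_trans (ltry C); apply: le_trans bC; rewrite -Er.
    apply: le_trans (nneseries_lim_ge k.+1 _) => [|j _ _]; last first.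
      by rewrite mule_ge0// lee_fin mulr_ge0 ?exprn_ge0// ltW.
    rewrite big_nat_recr//= leeDr// sume_ge0// => j _.
    by rewrite mule_ge0// lee_fin mulr_ge0 ?exprn_ge0// ltW.
  have wr : (0 < w k * rho ^+ k)%R by rewrite mulr_gt0 ?exprn_gt0.
  move: (U0 k); case: (U k) => [r _ _| _|//]; first by rewrite ltry.
  by rewrite gt0_muley// ltxx.
move=> k; rewrite -/(U k) -(fineK (Ufin k)); congr EFin.
have wk : (w k != 0)%R by rewrite gt_eqF.
apply: (canRL (mulfK wk)); move: k {wk}.
apply: (@power_series_inj R (fun k => fine (U k) * w k)%R b rho C r0 _ b0 _ bC).
  by move=> k; rewrite mulr_ge0// ?fine_ge0// ltW.
move=> t tr; rewrite -E//; apply: eq_eseriesr => k _.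
by rewrite -(fineK (Ufin k)) -EFinM; congr EFin; rewrite /=; ring.
Qed.

Lemma gaussian_moment_cnorm k :
  radial_int (@gaussian R) (fun x : V => cnorm x ^+ (2 * k))%R =
  (pi ^+ d * (szego_coef d k)%:R * k`!%:R)%:E.
Proof.
have mN2 : measurable_fun setT (fun x : V => cnorm x ^+ 2)%R.
  by apply: measurable_funX; exact: measurable_cnorm.
have S t : (0 < t <= 2^-1)%R ->
    \sum_(0 <= k <oo) (pi ^+ d * (szego_coef d k)%:R * t ^+ k)%:E =
    (pi ^+ d * (1 - t) ^- d)%:E.
  move=> /andP[t0 t2]; rewrite EFinM -szego_series; last first.
    by rewrite ltW//= (le_lt_trans t2)// invf_lt1// ltr1n.
  rewrite -nneseriesZl => [|j _]; last by rewrite lee_fin mulr_ge0// exprn_ge0// ltW.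
  by apply: eq_eseriesr => j _; rewrite -EFinM mulrA.
have := @gaussian_moments (fun x => cnorm x ^+ 2)%R (fun k => k`!%:R^-1)%R
  (fun k => pi ^+ d * (szego_coef d k)%:R)%R (2^-1) (pi ^+ d * (1 - 2^-1) ^- d)
  mN2 (fun=> sqr_ge0 _) _ _ _ _ _ k.
rewrite invrK (_ : (fun x : V => _) = (fun x : V => cnorm x ^+ (2 * k))%R); last first.
  by apply/funext => x; rewrite exprM.
apply=> // [j|t t2|].
- by rewrite mulr_ge0// exprn_ge0// pi_ge0.
- rewrite S//; move: t2 => /andP[t0 t2].
  have t1 : (0 < 1 - t)%R by rewrite subr_gt0 (le_lt_trans t2)// invf_lt1// ltr1n.
  rewrite -exprVn -exprMn -integral_vec_gauss//; apply: eq_integral => x _.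
  rewrite expR_series; last by rewrite mulr_ge0 ?sqr_ge0// ltW.
  by rewrite -EFinM -expRD; congr (expR _)%:E; ring.
- by rewrite S// invr_gt0 ltr0n lexx.
Qed.

(** Completing the square: translation of the Gaussian by t z. *)
Lemma gaussian_exp_hdot (t : R) (z : V) :
  \int[m]_x (g x * expR (2 * t * complex.Re (hdot x z)))%:E =
  (pi ^+ d * expR (t ^+ 2 * cnorm z ^+ 2))%:E.
Proof.
rewrite [(pi ^+ d * _)%R]mulrC EFinM.
have -> : (pi ^+ d)%:E = \int[m]_x (expR (- (1 * cnorm x ^+ 2)))%:E.
  by rewrite integral_vec_gauss// divr1.
have mG : measurable_fun setT (fun x : V => (expR (- (1 * cnorm x ^+ 2)))%:E).
  by apply/measurable_EFinP; exact: measurable_gauss.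
have G0 (x : V) : 0 <= (expR (- (1 * cnorm x ^+ 2)))%:E by rewrite lee_fin expR_ge0.
rewrite -(integral_vec_shift (- (t%:C *: z))%R mG G0) integralZ_ge0; last 2 first.
- by move=> x; rewrite lee_fin expR_ge0.
- exact: expR_ge0.
  apply: eq_integral => x _; rewrite -EFinM -!expRD; congr (expR _)%:E.
  rewrite mul1r cnormB_sqr cnormZ normc_real hdotZr.
  have -> : (t%:C)^*%C = t%:C :> R[i] by rewrite /= oppr0.
  by rewrite ReC exprMn real_normK ?num_real//; ring.
by apply: (measurableT_comp mG); apply: measurable_vecD.
Qed.

(** Even moments are the coefficients of the mean of cosh, which gaussian_exp_hdot
    computes. *)
Lemma gaussian_moment_Re k (z : V) :
  radial_int (@gaussian R) (fun x : V => (2 * complex.Re (hdot x z)) ^+ (2 * k))%R =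
  (pi ^+ d * cnorm z ^+ (2 * k) / k`!%:R * (2 * k)`!%:R)%:E.
Proof.
have mT : measurable_fun setT (fun x : V => (2 * complex.Re (hdot x z)) ^+ 2)%R.
  apply: measurable_funX; apply: measurable_funM => //.
  by apply: measurable_Re_hdot.
have S t : (0 < t <= 1)%R ->
    \sum_(0 <= k <oo) (pi ^+ d * cnorm z ^+ (2 * k) / k`!%:R * t ^+ k)%:E =
    (pi ^+ d * expR (t * cnorm z ^+ 2))%:E.
  move=> /andP[t0 t1]; rewrite EFinM -expR_series; last first.
    by rewrite mulr_ge0 ?sqr_ge0// ltW.
  rewrite -nneseriesZl => [|j _]; last first.
    by rewrite lee_fin mulr_ge0 ?invr_ge0// exprn_ge0// mulr_ge0 ?sqr_ge0// ltW.
  by apply: eq_eseriesr => j _; rewrite -EFinM exprMn exprM; congr EFin; ring.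
have := @gaussian_moments (fun x => (2 * complex.Re (hdot x z)) ^+ 2)%R
  (fun k => (2 * k)`!%:R^-1)%R
  (fun k => pi ^+ d * cnorm z ^+ (2 * k) / k`!%:R)%R 1%R
  (pi ^+ d * expR (1 * cnorm z ^+ 2)) mT (fun=> sqr_ge0 _) _ _ _ _ _ k.
rewrite invrK (_ : (fun x : V => _) =
  (fun x : V => (2 * complex.Re (hdot x z)) ^+ (2 * k))%R); last first.
  by apply/funext => x; rewrite exprM.
apply=> // [j|t t2|].
- by rewrite !mulr_ge0 ?invr_ge0 ?exprn_ge0 ?pi_ge0 ?cnorm_ge0.
- rewrite S//; move: t2 => /andP[t0 _].
  pose s := Num.sqrt t; have s2 : (s ^+ 2 = t)%R by rewrite sqr_sqrtr// ltW.
  pose h (s : R) (x : V) := (g x * expR (2 * s * complex.Re (hdot x z)))%:E.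
  have mh r : measurable_fun setT (h r).
    apply/measurable_EFinP; apply: measurable_funM => //.
    apply: measurableT_comp => //; apply: measurable_funM => //.
    by apply: measurable_Re_hdot.
  have h0 r x : 0 <= h r x by rewrite lee_fin mulr_ge0// expR_ge0.
  transitivity (\int[m]_x (2^-1%:E * (h s x + h (- s)%R x))).
    apply: eq_integral => x _.
    rewrite (_ : \sum_(0 <= k <oo) _ = \sum_(0 <= k <oo)
      ((2 * s * complex.Re (hdot x z)) ^+ (2 * k) / (2 * k)`!%:R)%:E); last first.
      apply: eq_eseriesr => j _; rewrite -s2; congr ((_ / _)%R%:E).
      by rewrite !exprM; congr (_ ^+ j)%R; ring.
    rewrite cosh_series /h -EFinD -!EFinM; congr EFin.
    rewrite (_ : - (2 * s * _) = 2 * - s * complex.Re (hdot x z))%R; last by ring.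
    by ring.
  rewrite -integralZ_ge0//; first last.
  - by move=> x; exact: adde_ge0.
  - exact: emeasurable_funD.
  rewrite ge0_integralD// /h !gaussian_exp_hdot sqrrN s2 -EFinD -EFinM.
  by congr EFin; field.
- by rewrite S// ltr01 lexx.
Qed.

(** The Gaussian is invariant under rotations by roots of unity, over which the average of
    (2 Re <x, z>)^(2 k) is a multiple of |<x, z>|^(2 k). *)
Lemma gaussian_moment_hdot k (z : V) :
  radial_int (@gaussian R) (fun x : V => normc (hdot x z) ^+ (2 * k))%R =
  (pi ^+ d * cnorm z ^+ (2 * k) * k`!%:R)%:E.
Proof.
have [N [w [kN wN]]] := exists_prim_root R (2 * k).
have w1 := normc_prim_root wN.
pose f (x : V) := (g x * (2 * complex.Re (hdot x z)) ^+ (2 * k))%:E.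
have f0 x : 0 <= f x.
  by rewrite lee_fin mulr_ge0// exprM exprn_ge0// sqr_ge0.
have mf : measurable_fun setT f.
  apply/measurable_EFinP; apply: measurable_funM => //.
  apply: measurable_funX; apply: measurable_funM => //.
  by apply: measurable_Re_hdot.
pose h (x : V) := (g x * normc (hdot x z) ^+ (2 * k))%:E.
have h0 x : 0 <= h x.
  by rewrite lee_fin mulr_ge0// exprn_ge0// normc_ge0.
have mh : measurable_fun setT h.
  apply/measurable_EFinP; apply: measurable_funM => //.
  by apply: measurable_funX; apply: measurable_normc_hdot.
have N0 : (0 < N%:R :> R)%R by rewrite ltr0n (prim_order_gt0 wN).
have w0 i : normc (w ^+ i)%R = 1%R by rewrite normcX w1 expr1n.
have wi i : (w ^+ i != 0)%R.
  by apply/eqP => e; have := w0 i; rewrite e normc0 => /esym/eqP; rewrite oner_eq0.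
have : \sum_(i < N) \int[m]_x f (w ^+ i *: x)%R =
       \int[m]_x ((N%:R * 'C(2 * k, k)%:R)%:E * h x).
  rewrite -ge0_integral_sum//; last first.
    by move=> i; apply: measurableT_comp mf _; exact: measurable_vecZc.
  apply: eq_integral => x _.
  rewrite sumEFin -EFinM; congr EFin.
  rewrite (eq_bigr (fun i : 'I_N => g x * (2 * complex.Re (w ^+ i * hdot x z)) ^+ (2 * k))%R).
    by rewrite -mulr_sumr sum_prim_root_Re//; ring.
  by move=> i _; rewrite cnormZ w0 mul1r hdotZl.
have fE : \int[m]_x f x =
    (pi ^+ d * cnorm z ^+ (2 * k) / k`!%:R * (2 * k)`!%:R)%:E.
  exact: gaussian_moment_Re.
rewrite (eq_bigr (fun=> (pi ^+ d * cnorm z ^+ (2 * k) / k`!%:R * (2 * k)`!%:R)%:E)); last first.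
  by move=> i _; rewrite -fE; exact: integral_vec_rot.
rewrite sumEFin sumr_const card_ord -integralZ_ge0// => E.
have D0 : (N%:R * 'C(2 * k, k)%:R != 0 :> R)%R.
  by rewrite mulf_neq0 ?gt_eqF// ltr0n bin_gt0 leq_pmull.
move/(congr1 (fun y => (N%:R * 'C(2 * k, k)%:R)^-1%:E * y)): E.
rewrite muleA -!EFinM mulVf// mul1e => E.
transitivity (\int[m]_x h x); [by []|rewrite -E].
congr EFin; move: D0.
have -> : 'C(2 * k, k)%:R = ((2 * k)`!%:R / (k`!%:R * k`!%:R) :> R)%R.
  have kk : (k <= 2 * k)%N by rewrite leq_pmull.
  have := bin_fact kk; rewrite [(2 * k - k)%N](_ : _ = k); last first.
    by rewrite mul2n -addnn addnK.
  by move=> <-; rewrite !natrM mulfK// mulf_neq0// pnatr_eq0 -lt0n fact_gt0.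
move=> D0; rewrite -mulr_natl; field.
by rewrite !pnatr_eq0 -!lt0n !fact_gt0 (prim_order_gt0 wN).
Qed.

(** By homogeneity, the ratio of the two radial integrals is the same for phi as for
    the Gaussian. Thus the mean of |<x, z>|^(2 k) over the sphere |x| = r is
    r^(2 k) |z|^(2 k) / C(k + d - 1, k). *)
Lemma spherical_moment (phi : R -> R) k (z : V) : (0 < d)%N ->
  measurable_fun setT phi -> (forall t, 0 <= phi t)%R ->
  (szego_coef d k)%:R%:E * radial_int phi (fun x : V => normc (hdot x z) ^+ (2 * k))%R =
  (cnorm z ^+ (2 * k))%:E * radial_int phi (fun x : V => cnorm x ^+ (2 * k))%R.
Proof.
move=> d0 mphi phi0; have [->|k0] := posnP k.
  by rewrite /szego_coef bin0 muln0 expr0.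
have pd : (pi ^+ d != 0 :> R)%R by rewrite expf_neq0// gt_eqF// pi_gt0.
have fk : (k`!%:R != 0 :> R)%R by rewrite pnatr_eq0 -lt0n fact_gt0.
have U0 : (0 < pi ^+ d * (szego_coef d k)%:R * k`!%:R :> R)%R.
  by rewrite !mulr_gt0 ?exprn_gt0 ?pi_gt0// ltr0n ?szego_coef_gt0 ?fact_gt0.
have := @radial_int_homogeneous R d k phi (fun x => normc (hdot x z) ^+ (2 * k))%R _
  d0 k0 mphi phi0 _ _ _ U0 (gaussian_moment_cnorm k).
rewrite gaussian_moment_hdot => H.
have {}H : (pi ^+ d * (szego_coef d k)%:R * k`!%:R)%:E *
    radial_int phi (fun x : V => normc (hdot x z) ^+ (2 * k))%R =
    radial_int phi (fun x : V => cnorm x ^+ (2 * k))%R *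
    (pi ^+ d * cnorm z ^+ (2 * k) * k`!%:R)%:E.
  apply: H => [|x|c x c0].
  - by apply: measurable_funX; apply: measurable_normc_hdot.
  - by rewrite exprn_ge0// normc_ge0.
  - by rewrite hdotZl normcM normc_real gtr0_norm// exprMn.
move/(congr1 (fun y => ((pi ^+ d * k`!%:R)^-1)%:E * y)): H.
rewrite [in X in _ = X -> _](muleC (radial_int _ _)) !muleA -!EFinM.
have -> : ((pi ^+ d * k`!%:R)^-1 * (pi ^+ d * (szego_coef d k)%:R * k`!%:R) =
  (szego_coef d k)%:R :> R)%R by field; rewrite fk pd.
have -> // : ((pi ^+ d * k`!%:R)^-1 * (pi ^+ d * cnorm z ^+ (2 * k) * k`!%:R) =
  cnorm z ^+ (2 * k) :> R)%R by field; rewrite fk pd.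
Qed.

End moments.

Local Close Scope ereal_scope.
Local Open Scope ereal_scope.

(** * The spherical mean of |1 - <x, z>|^(-2 d) *)

Section spherical_identity.
Context (R : realType) (d : nat) (d0 : (0 < d)%N).
Local Notation V := 'rV[R[i]]_d.
Local Notation m := (@lebesgue_vec R d).
Variable phi : R -> R.
Hypotheses (mphi : measurable_fun setT phi) (phi0 : forall t, (0 <= phi t)%R).

Lemma measurable_radial_int (h : V -> R) : measurable_fun setT h ->
  measurable_fun setT (fun x : V => (phi (cnorm x ^+ 2) * h x)%:E).
Proof.
move=> mh; apply/measurable_EFinP; apply: measurable_funM => //.
exact: measurable_radial.
Qed.

Lemma radial_int_le (g h : V -> R) : measurable_fun setT g -> measurable_fun setT h ->
  (forall x, phi (cnorm x ^+ 2) != 0%R -> (0 <= g x <= h x)%R) ->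
  radial_int phi g <= radial_int phi h.
Proof.
move=> mg mh gh; apply: ge0_le_integral => //.
- move=> x _; rewrite lee_fin.
  have [->|/gh/andP[g0 _]] := eqVneq (phi (cnorm x ^+ 2)) 0%R; first by rewrite mul0r.
  by rewrite mulr_ge0.
- exact: measurable_radial_int.
- exact: measurable_radial_int.
- move=> x _; rewrite lee_fin.
  have [->|/gh/andP[g0 gh']] := eqVneq (phi (cnorm x ^+ 2)) 0%R; first by rewrite !mul0r.
  by rewrite ler_wpM2l.
Qed.

Lemma radial_int_ge0 (g : V -> R) : (forall x, 0 <= g x)%R -> 0 <= radial_int phi g.
Proof. by move=> g0; apply: integral_ge0 => x _; rewrite lee_fin mulr_ge0. Qed.

Lemma radial_intZ (g : V -> R) (c : R) : measurable_fun setT g -> (forall x, 0 <= g x)%R ->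
  (0 <= c)%R -> c%:E * radial_int phi g = radial_int phi (fun x => c * g x)%R.
Proof.
move=> mg g0 c0; rewrite /radial_int integralZ_ge0//; last first.
- by move=> x; rewrite lee_fin mulr_ge0.
- exact: measurable_radial_int.
by apply: eq_integral => x _; rewrite -EFinM mulrCA.
Qed.

Lemma radial_int_sum n (g : nat -> V -> R) (c : nat -> R) :
  (forall k, measurable_fun setT (g k)) -> (forall k x, 0 <= g k x)%R ->
  (forall k, 0 <= c k)%R ->
  \sum_(k < n) (c k)%:E * radial_int phi (g k) =
  radial_int phi (fun x => \sum_(k < n) c k * g k x)%R.
Proof.
move=> mg g0 c0; rewrite /radial_int.
under [in RHS]eq_integral do rewrite mulr_sumr -sumEFin.
rewrite ge0_integral_sum//; last 2 first.
- move=> k; apply: measurable_radial_int; apply: measurable_funM => //.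
- by move=> k x _; rewrite lee_fin !mulr_ge0.
by apply: eq_bigr => k _; rewrite -/(radial_int phi (g k)) radial_intZ.
Qed.

Variable z : V.

Let mhdot k : measurable_fun setT (fun x : V => normc (hdot x z) ^+ k)%R.
Proof. by apply: measurable_funX; apply: measurable_normc_hdot. Qed.

Let mN k : measurable_fun setT (fun x : V => cnorm x ^+ k)%R.
Proof. by apply: measurable_funX; exact: measurable_cnorm. Qed.

Let hdot0 k x : (0 <= normc (hdot x z) ^+ k)%R.
Proof. by rewrite exprn_ge0 ?normc_ge0. Qed.

Lemma measurable_horner_hdot (p : {poly R}) : measurable_fun setT
  (fun x : V => normc ((map_poly (real_complex R) p).[hdot x z]) ^+ 2)%R.
Proof.
apply: measurable_funX.
have H : forall q : {poly R},
    measurable_fun setT (fun x : V => complex.Re ((map_poly (real_complex R) q).[hdot x z])) /\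
    measurable_fun setT (fun x : V => complex.Im ((map_poly (real_complex R) q).[hdot x z])).
  elim/poly_ind => [|q c [mr mi]].
    by split; rewrite (_ : (fun _ => _) = cst 0%R)//; apply/funext => x;
      rewrite rmorph0 horner0.
  have Re_ : (fun x : V => complex.Re ((map_poly (real_complex R) (q * 'X + c%:P)).[hdot x z]))
    = (fun x : V => complex.Re ((map_poly (real_complex R) q).[hdot x z]) * complex.Re (hdot x z)
       - complex.Im ((map_poly (real_complex R) q).[hdot x z]) * complex.Im (hdot x z) + c)%R.
    apply/funext => x; rewrite rmorphD rmorphM /= map_polyX map_polyC !hornerE /=.
    by case: (_.[_]) => a b; case: (hdot x z).
  have Im_ : (fun x : V => complex.Im ((map_poly (real_complex R) (q * 'X + c%:P)).[hdot x z]))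
    = (fun x : V => complex.Re ((map_poly (real_complex R) q).[hdot x z]) * complex.Im (hdot x z)
       + complex.Im ((map_poly (real_complex R) q).[hdot x z]) * complex.Re (hdot x z))%R.
    apply/funext => x; rewrite rmorphD rmorphM /= map_polyX map_polyC !hornerE /=.
    by case: (_.[_]) => a b; case: (hdot x z) => a' b' /=; rewrite addr0.
  have mRe : measurable_fun setT (fun x : V => complex.Re (hdot x z)) by exact: measurable_Re_hdot.
  have mIm : measurable_fun setT (fun x : V => complex.Im (hdot x z)) by exact: measurable_Im_hdot.
  rewrite Re_ Im_; split.
    by apply: measurable_funD => //; apply: measurable_funB; apply: measurable_funM.
  by apply: measurable_funD; apply: measurable_funM.
by have [] := H p; exact: measurable_normc.
Qed.

(** Different monomials in <x, z> are orthogonal for a radial measure, by invariance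
    under roots of unity and the discrete Parseval identity. *)
Lemma radial_int_horner (p : {poly R}) M : (size p <= M)%N ->
  radial_int phi (fun x => normc ((map_poly (real_complex R) p).[hdot x z]) ^+ 2)%R =
  \sum_(k < M) (p`_k ^+ 2)%:E * radial_int phi (fun x : V => normc (hdot x z) ^+ (2 * k))%R.
Proof.
move=> pM; have [N [w [kN wN]]] := exists_prim_root R M.
have w0 i : normc (w ^+ i)%R = 1%R by rewrite normcX (normc_prim_root wN) expr1n.
pose G (x : V) : R := (normc ((map_poly (real_complex R) p).[hdot x z]) ^+ 2)%R.
have G0 x : (0 <= G x)%R by exact: sqr_ge0.
have mG : measurable_fun setT G by exact: measurable_horner_hdot.
have N0 : (N%:R != 0 :> R)%R by rewrite pnatr_eq0 -lt0n (prim_order_gt0 wN).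
rewrite (radial_int_sum M (fun k => mhdot (2 * k)) (fun k x => hdot0 (2 * k) x) (fun k => sqr_ge0 p`_k)).
have pMN : (size p <= M <= N)%N by rewrite pM ltnW.
have E : \sum_(i < N) radial_int phi G = N%:R%:E * radial_int phi
    (fun x => \sum_(k < M) p`_k ^+ 2 * normc (hdot x z) ^+ (2 * k))%R.
  rewrite radial_intZ//; last first.
  - by move=> x; rewrite sumr_ge0// => k _; rewrite mulr_ge0// sqr_ge0.
  - by apply: measurable_sum => k; exact: measurable_funM.
  rewrite (eq_bigr (fun i : 'I_N => radial_int phi (fun x => G (w ^+ i *: x)%R))).
    rewrite (eq_bigr (fun i : 'I_N => 1%:E * radial_int phi (fun x => G (w ^+ i *: x)%R))).
      rewrite (@radial_int_sum N (fun i x => G (w ^+ i *: x)%R) (fun=> 1%R))//.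
        apply: eq_integral => x _; congr ((_ * _)%:E).
        rewrite -(parseval wN (hdot x z) pMN).
        by apply: eq_bigr => i _; rewrite mul1r /G hdotZl.
      move=> k; apply: (measurableT_comp mG); exact: measurable_vecZc.
    by move=> i _; rewrite mul1e.
  move=> i _; rewrite /radial_int.
  rewrite -[LHS](@integral_vec_rot _ _ (w ^+ i)%R)//.
  - by apply: eq_integral => x _; rewrite cnormZ w0 mul1r.
  - exact: measurable_radial_int.
  - by move=> x; rewrite lee_fin mulr_ge0.
move/(congr1 (fun y => N%:R^-1%:E * y)): E.
rewrite muleA -EFinM mulVf// mul1e => <-.
rewrite (eq_bigr (fun i : 'I_N => 1%:E * radial_int phi G)) => [|i _]; last by rewrite mul1e.
rewrite (@radial_int_sum N (fun=> G) (fun=> 1%R))// radial_intZ//; last first.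
- by move=> x; rewrite sumr_ge0// => i _; rewrite mul1r.
- by apply: measurable_sum => k; exact: measurable_funM.
apply: eq_integral => x _; congr ((_ * _)%:E).
rewrite (eq_bigr (fun=> G x)) => [|i _]; last by rewrite mul1r.
by rewrite sumr_const card_ord -[(G x *+ N)%R]mulr_natl mulrA mulVf ?mul1r.
Qed.

Section truncated.
Variable rho : R.
Hypotheses (rho0 : (0 <= rho < 1)%R) (z1 : (cnorm z <= 1)%R)
  (phi_rho : forall t, (rho < t)%R -> phi t = 0%R).

Let szego (x : V) : R := (normc (1 - hdot x z) ^- (2 * d))%R.
Let radial_szego (x : V) : R := ((1 - cnorm x ^+ 2 * cnorm z ^+ 2) ^- d)%R.
Let sigma := Num.sqrt rho.
Let p n := geom_pow R d n.
Let A k := radial_int phi (fun x : V => normc (hdot x z) ^+ (2 * k))%R.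
Let B k := radial_int phi (fun x : V => cnorm x ^+ (2 * k))%R.

Let sigma01 : (0 <= sigma < 1)%R.
Proof.
move/andP: rho0 => [r0 r1]; rewrite sqrtr_ge0/=.
by rewrite -(ltr_pXn2r (_ : 0 < 2)%N) ?nnegrE ?sqrtr_ge0// sqr_sqrtr// expr1n.
Qed.

Let phi_supp (x : V) : phi (cnorm x ^+ 2) != 0%R -> (cnorm x <= sigma)%R.
Proof.
apply: contraNT; rewrite -ltNge => sx; apply/eqP/phi_rho.
move/andP: rho0 => [r0 r1]; rewrite -(sqr_sqrtr r0).
by rewrite ltr_pXn2r// nnegrE ?sqrtr_ge0// cnorm_ge0.
Qed.

Let hdot_sigma (x : V) : phi (cnorm x ^+ 2) != 0%R -> (normc (hdot x z) <= sigma)%R.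
Proof.
move/phi_supp => xs; apply: le_trans (hdot_le _ _) _.
by rewrite -[leRHS]mulr1 ler_pM ?cnorm_ge0.
Qed.

Let q_sigma (x : V) : phi (cnorm x ^+ 2) != 0%R ->
  (0 <= cnorm x ^+ 2 * cnorm z ^+ 2 <= sigma ^+ 2)%R.
Proof.
move/phi_supp => xs; have /andP[s0 _] := sigma01.
rewrite mulr_ge0 ?sqr_ge0//= -[leRHS]mulr1 ler_pM ?sqr_ge0//.
  by rewrite lerXn2r// nnegrE cnorm_ge0.
by rewrite expr_le1// cnorm_ge0.
Qed.

Let sigma2 : (sigma ^+ 2 < 1)%R.
Proof. by move/andP: sigma01 => [s0 s1]; rewrite expr_lt1. Qed.

Let msz : measurable_fun setT szego.
Proof.
apply: (measurableT_comp (@measurable_inv R)); apply: measurable_funX.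
exact: measurable_normc_1Bhdot.
Qed.

Let mq : measurable_fun setT (fun x : V => cnorm x ^+ 2 * cnorm z ^+ 2)%R.
Proof. exact: measurable_funM. Qed.

Let mrs : measurable_fun setT radial_szego.
Proof.
apply: (measurableT_comp (@measurable_inv R)); apply: measurable_funX.
exact: measurable_funB.
Qed.

Let P n := radial_int phi
  (fun x => normc ((map_poly (real_complex R) (p n)).[hdot x z]) ^+ 2)%R.

Let one_sub0 (x : V) : phi (cnorm x ^+ 2) != 0%R -> (0 < normc (1 - hdot x z))%R.
Proof.
move=> /hdot_sigma h; have /andP[s0 s1] := sigma01.
apply: lt_le_trans (ler_normcB _ _); rewrite normc1 subr_gt0.
exact: le_lt_trans s1.
Qed.

Let PE n (x : V) : phi (cnorm x ^+ 2) != 0%R ->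
  (normc ((map_poly (real_complex R) (p n)).[hdot x z]) ^+ 2 =
   normc (1 - hdot x z ^+ n) ^+ (2 * d) * szego x)%R.
Proof.
move=> x0; rewrite map_geom_pow geom_pow_horner; last first.
  by apply/eqP => e; have := one_sub0 x0; rewrite e normc0 ltxx.
rewrite normcX normcM normcV /szego -exprM mulnC exprMn -exprVn.
by [].
Qed.

Let hn n (x : V) : phi (cnorm x ^+ 2) != 0%R -> (normc (hdot x z ^+ n) <= sigma ^+ n)%R.
Proof.
move=> /hdot_sigma h; rewrite normcX lerXn2r// nnegrE ?normc_ge0//.
by case/andP: sigma01.
Qed.

Let sn01 n : (0 <= sigma ^+ n <= 1)%R.
Proof. by case/andP: sigma01 => s0 s1; rewrite exprn_ge0//= exprn_ile1// ltW. Qed.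

Let sz0 x : (0 <= szego x)%R.
Proof. by rewrite invr_ge0 exprn_ge0 ?normc_ge0. Qed.

Let mP n : measurable_fun setT
  (fun x : V => normc ((map_poly (real_complex R) (p n)).[hdot x z]) ^+ 2)%R.
Proof. exact: measurable_horner_hdot. Qed.

Let P_lower n : ((1 - sigma ^+ n) ^+ (2 * d))%:E * radial_int phi szego <= P n.
Proof.
have /andP[s0 s1] := sn01 n.
rewrite radial_intZ//; last by rewrite exprn_ge0// subr_ge0.
apply: radial_int_le => //; first exact: measurable_funM.
move=> x x0; rewrite mulr_ge0 ?exprn_ge0 ?subr_ge0//= PE// ler_wpM2r//.
rewrite lerXn2r// ?nnegrE ?subr_ge0 ?normc_ge0//.
apply: le_trans (ler_normcB _ _); rewrite normc1 lerB//; exact: hn.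
Qed.

Let P_upper n : P n <= ((1 + sigma ^+ n) ^+ (2 * d))%:E * radial_int phi szego.
Proof.
have /andP[s0 s1] := sn01 n.
rewrite radial_intZ//; last by rewrite exprn_ge0// addr_ge0.
apply: radial_int_le => //; first exact: measurable_funM.
move=> x x0; rewrite sqr_ge0 /= PE// ler_wpM2r//.
rewrite lerXn2r// ?nnegrE ?addr_ge0 ?normc_ge0//.
by apply: le_trans (ler_normcD _ _) _; rewrite normc1 normcN lerD2l; exact: hn.
Qed.

Let A0 k : 0 <= A k.
Proof. by apply: radial_int_ge0 => x; exact: hdot0. Qed.

Let moment k : (szego_coef d k)%:R%:E * A k = (cnorm z ^+ (2 * k))%:E * B k.
Proof. exact: spherical_moment. Qed.

Let P_le n : P n <= radial_int phi radial_szego.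
Proof.
rewrite /P (radial_int_horner (leqnn _)).
apply: (@le_trans _ _ (\sum_(k < size (p n)) ((p n)`_k * cnorm z ^+ (2 * k))%:E * B k)).
  apply: lee_sum => k _; have [c [-> cd _]] := geom_pow_coef R d n k.
  rewrite [X in _ <= X * _]EFinM -muleA -moment muleA -EFinM lee_wpmul2r//; first exact: A0.
  by rewrite lee_fin expr2 ler_wpM2l// ler_nat.
rewrite (@radial_int_sum _ (fun k x => cnorm x ^+ (2 * k))%R
  (fun k => (p n)`_k * cnorm z ^+ (2 * k))%R)//; last 2 first.
- by move=> k x; rewrite exprn_ge0// cnorm_ge0.
- move=> k; have [c [-> _ _]] := geom_pow_coef R d n k.
  by rewrite mulr_ge0// exprn_ge0// cnorm_ge0.
apply: radial_int_le => //.
  by apply: measurable_sum => k; exact: measurable_funM.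
move=> x /q_sigma/andP[q0 qs]; apply/andP; split.
  apply: sumr_ge0 => k _; have [c [-> _ _]] := geom_pow_coef R d n k.
  by rewrite !mulr_ge0// exprn_ge0// cnorm_ge0.
have q01 : (0 <= cnorm x ^+ 2 * cnorm z ^+ 2 < 1)%R by rewrite q0 (le_lt_trans qs).
apply: le_trans (geom_pow_le d n q01); rewrite geom_pow_sum.
by apply: ler_sum => k _; rewrite exprMn -!exprM -mulrA (mulrC (cnorm z ^+ _)%R).
Qed.

Let P_ge n : ((1 - sigma ^+ (2 * n)) ^+ d)%:E * radial_int phi radial_szego
  <= P (d * n).+1.
Proof.
have /andP[s0 s1] := sn01 (2 * n).
pose M := maxn (d * n).+1 (size (p (d * n).+1)).
rewrite /P (@radial_int_horner (p (d * n).+1) M) ?leq_maxr//.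
apply: (@le_trans _ _ (\sum_(k < (d * n).+1)
    ((szego_coef d k)%:R * cnorm z ^+ (2 * k))%:E * B k)); last first.
  rewrite -(big_mkord xpredT (fun k => ((szego_coef d k)%:R * cnorm z ^+ (2 * k))%:E * B k)).
  rewrite -(big_mkord xpredT (fun k => ((p (d * n).+1)`_k ^+ 2)%:E * A k)).
  rewrite [leRHS](big_cat_nat (n := (d * n).+1))//= ?leq_maxl//.
  rewrite -[leLHS]adde0 leeD//; last first.
    by apply: sume_ge0 => k _; rewrite mule_ge0// lee_fin sqr_ge0.
  rewrite !big_nat; apply: lee_sum => k /andP[_ kn].
  have [c [-> _ ->//]] := geom_pow_coef R d (d * n).+1 k.
  by rewrite [X in X * _ <= _]EFinM -muleA -moment muleA -EFinM expr2.
rewrite (@radial_int_sum _ (fun k x => cnorm x ^+ (2 * k))%R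
  (fun k => (szego_coef d k)%:R * cnorm z ^+ (2 * k))%R)//; last 2 first.
- by move=> k x; rewrite exprn_ge0// cnorm_ge0.
- by move=> k; rewrite mulr_ge0// exprn_ge0// cnorm_ge0.
have c0 : (0 <= (1 - sigma ^+ (2 * n)) ^+ d)%R by rewrite exprn_ge0// subr_ge0.
rewrite /radial_int integralZ_ge0//; last 2 first.
- exact: measurable_radial_int.
- move=> x; rewrite lee_fin; have [->|/q_sigma/andP[q0 qs]] := eqVneq (phi (cnorm x ^+ 2)) 0%R.
    by rewrite mul0r.
  by rewrite mulr_ge0// invr_ge0 exprn_ge0// subr_ge0 (le_trans qs)// ltW.
under eq_integral do rewrite -EFinM mulrCA.
apply: radial_int_le.
- exact: measurable_funM.
- by apply: measurable_sum => k; exact: measurable_funM.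
move=> x /q_sigma/andP[q0 qs].
have q1 : (0 < 1 - cnorm x ^+ 2 * cnorm z ^+ 2)%R by rewrite subr_gt0 (le_lt_trans qs).
rewrite (mulr_ge0 c0) ?invr_ge0 ?exprn_ge0 ?(ltW q1)//=.
apply: (@le_trans _ _ (geom_pow R d n).[cnorm x ^+ 2 * cnorm z ^+ 2]%R).
  rewrite geom_pow_horner ?gt_eqF// expr_div_n ler_wpM2r ?invr_ge0 ?exprn_ge0 ?(ltW q1)//.
  have qn : ((cnorm x ^+ 2 * cnorm z ^+ 2) ^+ n <= sigma ^+ (2 * n))%R.
    by rewrite exprM lerXn2r// nnegrE sqr_ge0.
  rewrite lerXn2r// ?nnegrE; last by rewrite lerB.
    by rewrite subr_ge0.
  by rewrite subr_ge0 (le_trans qn).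
apply: le_trans (geom_pow_le_sum q0 (ltnSn (d * n))) _.
by apply: ler_sum => k _; rewrite exprMn -!exprM -mulrA (mulrC (cnorm z ^+ _)%R).
Qed.

Let cvg_sigma (f : nat -> nat) : (forall n, n <= f n)%N ->
  (sigma ^+ f n)%R @[n --> \oo] --> (0%R : R).
Proof.
move=> fn; have /andP[s0 s1] := sigma01.
apply: (@squeeze_cvgr _ _ _ _ (fun=> 0%R) (fun n => sigma ^+ n)%R).
- apply: nearW => n; rewrite exprn_ge0//=.
  by rewrite -(subnKC (fn n)) exprD ler_piMr ?exprn_ge0// exprn_ile1// ltW.
- exact: cvg_cst.
- by apply: cvg_expr; rewrite ger0_norm.
Qed.

(** P n, the integral of the square modulus of the polynomial geom_pow at <x, z>, is
    compared with the left side through |1 - <x, z>^n|, which is close to 1 as phi lives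
    in |x|^2 <= rho < 1. By Parseval and spherical_moment, P n is the sum over k of
    p_k^2 / C(k + d - 1, k) times the integral of |z|^(2 k) |x|^(2 k), where p_k is
    equal to C(k + d - 1, k) for small k and at most that for large k: this compares
    it with the right side. *)
Lemma spherical_identity_truncated :
  radial_int phi szego = radial_int phi radial_szego.
Proof.
apply/eqP; rewrite eq_le; apply/andP; split.
  apply/lee_mul01Pr => [|r /andP[r0 r1]]; first exact: radial_int_ge0.
  have : \forall n \near \oo, (r < (1 - sigma ^+ n) ^+ (2 * d))%R.
    have H : ((1 - sigma ^+ n) ^+ (2 * d))%R @[n --> \oo] --> ((1 - 0) ^+ (2 * d) : R)%R.
      have H1 : (1 - sigma ^+ n)%R @[n --> \oo] --> (1 - 0 : R)%R.
        by apply: cvgB; [exact: cvg_cst|exact: (cvg_sigma (f := id))].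
      by apply: (cvg_comp _ (fun x : R => x ^+ (2 * d))%R H1); exact: exprn_continuous.
    by apply: (cvgr_gt _ H); rewrite subr0 expr1n.
  move=> [n _ /(_ n (leqnn n)) rn].
  apply: le_trans (le_trans (P_lower n) (P_le n)).
  by rewrite lee_wpmul2r ?radial_int_ge0// lee_fin ltW.
have rs0 : 0 <= radial_int phi radial_szego.
  apply: integral_ge0 => x _; rewrite lee_fin.
  have [->|/q_sigma/andP[q0 qs]] := eqVneq (phi (cnorm x ^+ 2)) 0%R; first by rewrite mul0r.
  by rewrite mulr_ge0// invr_ge0 exprn_ge0// subr_ge0 (le_trans qs)// ltW.
apply/lee_mul01Pr => // r /andP[r0 r1].
have : \forall n \near \oo,
    (r < (1 - sigma ^+ (2 * n)) ^+ d / (1 + sigma ^+ (d * n).+1) ^+ (2 * d))%R.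
  have H1 : (1 - sigma ^+ (2 * n))%R @[n --> \oo] --> (1 - 0 : R)%R.
    by apply: cvgB; [exact: cvg_cst|apply: cvg_sigma => n; rewrite leq_pmull].
  have H2 : (1 + sigma ^+ (d * n).+1)%R @[n --> \oo] --> (1 + 0 : R)%R.
    apply: cvgD; [exact: cvg_cst|apply: cvg_sigma => n].
    by rewrite (leq_trans (leq_pmull n d0)).
  have H : ((1 - sigma ^+ (2 * n)) ^+ d / (1 + sigma ^+ (d * n).+1) ^+ (2 * d))%R
      @[n --> \oo] --> ((1 - 0) ^+ d / (1 + 0) ^+ (2 * d) : R)%R.
    apply: cvgM.
      by apply: (cvg_comp _ (fun x : R => x ^+ d)%R H1); exact: exprn_continuous.
    apply: cvgV; first by rewrite addr0 expr1n oner_eq0.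
    by apply: (cvg_comp _ (fun x : R => x ^+ (2 * d))%R H2); exact: exprn_continuous.
  by apply: (cvgr_gt _ H); rewrite subr0 addr0 !expr1n divr1.
move=> [n _ /(_ n (leqnn n)) rn].
have /andP[s0 s1] := sn01 (d * n).+1.
have D0 : (0 < (1 + sigma ^+ (d * n).+1) ^+ (2 * d))%R.
  by rewrite exprn_gt0// ltr_wpDr.
have PP := le_trans (P_ge n) (P_upper (d * n).+1).
apply: (@le_trans _ _ (((1 + sigma ^+ (d * n).+1) ^- (2 * d))%:E *
  (((1 - sigma ^+ (2 * n)) ^+ d)%:E * radial_int phi radial_szego))).
  by rewrite muleA -EFinM lee_wpmul2r// lee_fin mulrC ltW.
apply: le_trans (lee_wpmul2l _ PP) _; first by rewrite lee_fin invr_ge0 ltW.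
by rewrite muleA -EFinM mulVf ?gt_eqF// mul1e.
Qed.

End truncated.

End spherical_identity.

Section spherical_identity_full.
Context (R : realType) (d : nat) (d0 : (0 < d)%N).
Local Notation V := 'rV[R[i]]_d.
Local Notation m := (@lebesgue_vec R d).
Variable phi : R -> R.
Hypotheses (mphi : measurable_fun setT phi) (phi0 : forall t, (0 <= phi t)%R)
  (phi1 : forall t, (1 <= t)%R -> phi t = 0%R).

Let cut (j : nat) (t : R) : R := if (t <= 1 - j.+1%:R^-1)%R then phi t else 0%R.

Let mcut j : measurable_fun setT (cut j).
Proof. by apply: measurable_fun_ifT => //; exact: measurable_fun_ler. Qed.

Let cut0 j t : (0 <= cut j t)%R.
Proof. by rewrite /cut; case: ifP. Qed.

Let cut_lim (t : R) : \forall j \near \oo, cut j t = phi t.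
Proof.
have [t1|/phi1 t1] := ltP t 1%R; last first.
  by apply: nearW => j; rewrite /cut t1 if_same.
have t0 : (0 < 1 - t)%R by rewrite subr_gt0.
near=> j; rewrite /cut ifT// lerBrDr -lerBrDl.
by apply: ltW; near: j; exact: (near_infty_natSinv_lt (PosNum t0)).
Unshelve. all: by end_near. Qed.

Let radial_cut (h : V -> R) : measurable_fun setT h ->
  (forall x, phi (cnorm x ^+ 2) != 0%R -> (0 <= h x)%R) ->
  radial_int phi h = limn (fun j => radial_int (cut j) h).
Proof.
move=> mh h0; rewrite /radial_int -monotone_convergence//.
- apply: eq_integral => x _; apply/esym/cvg_lim => //.
  apply: cvg_near_cst; apply: filterS (cut_lim (cnorm x ^+ 2)%R) => j ->.
  by [].
- by move=> j; apply: measurable_radial_int.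
- move=> j x _; rewrite lee_fin /cut; case: ifP => _; last by rewrite mul0r.
  have [->|/h0 hx] := eqVneq (phi (cnorm x ^+ 2)) 0%R; first by rewrite mul0r.
  by rewrite mulr_ge0.
- move=> x _ i j ij; rewrite lee_fin /cut.
  have [e|/h0 hx] := eqVneq (phi (cnorm x ^+ 2)) 0%R.
    by rewrite e !if_same.
  rewrite ler_wpM2r//; case: ifP => [xi|_]; last by case: ifP.
  rewrite ifT// (le_trans xi)// lerD2l lerN2 lef_pV2 ?posrE ?ltr0n//.
  by rewrite ler_nat ltnS.
Qed.

(** The truncated case passes to the limit by monotone convergence, so that phi may charge
    all radii below 1, near which the integrands blow up when |z| = 1. Thus the mean of
    |1 - <x, z>|^(-2 d) over the sphere |x| = r is (1 - r^2 |z|^2)^(-d). *)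
Lemma spherical_identity (z : V) : (cnorm z <= 1)%R ->
  radial_int phi (fun x => normc (1 - hdot x z) ^- (2 * d))%R =
  radial_int phi (fun x : V => (1 - cnorm x ^+ 2 * cnorm z ^+ 2) ^- d)%R.
Proof.
move=> z1; rewrite !radial_cut.
- congr (limn _); apply/funext => j.
  apply: (@spherical_identity_truncated _ _ d0 _ (mcut j) (cut0 j) z (1 - j.+1%:R^-1)) => //.
    by rewrite subr_ge0 invf_le1// ler1n /= ltrBlDr ltrDl invr_gt0.
  by move=> t jt; rewrite /cut leNgt jt.
- apply: (measurableT_comp (@measurable_inv R)); apply: measurable_funX.
  apply: measurable_funB => //; apply: measurable_funM => //.
  by apply: measurable_funX; exact: measurable_cnorm.
- move=> x; apply: contraNle => h; apply/eqP/phi1; rewrite leNgt; apply/negP => x1.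
  move: h; rewrite ltNge invr_ge0 exprn_ge0// subr_ge0 -[leRHS]mulr1.
  by rewrite ler_pM ?sqr_ge0 ?(ltW x1)// expr_le1// cnorm_ge0.
- apply: (measurableT_comp (@measurable_inv R)); apply: measurable_funX.
  by apply: measurable_normc_1Bhdot.
- by move=> x _; rewrite invr_ge0 exprn_ge0// normc_ge0.
Qed.

End spherical_identity_full.

Local Close Scope ereal_scope.

(** * The mass of (1 - |x|^2)^(e - 1) as e tends to 0 *)

Section power_integral.
Context (R : realType).
Local Notation leb := (@lebesgue_measure R).

Lemma continuous_powR_gt0 (c x : R) : 0 < x -> {for x, continuous (fun y : R => y `^ c)}.
Proof.
move=> x0; apply: differentiable_continuous; apply/derivable1_diffP.
by have [] := is_derive1_powR c x0.
Qed.

Lemma integral_powR_itv (c a b : R) : 0 < c -> 0 < a -> a < b ->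
  (\int[leb]_(r in `[a, b]) (r `^ (c - 1))%:E = ((b `^ c - a `^ c) / c)%:E)%E.
Proof.
move=> c0 a0 ab; pose F : R -> R := fun r : R => r `^ c / c.
have dF (x : R) : 0 < x -> is_derive x 1 F (x `^ (c - 1)).
  move=> x0; have := is_derive1_powR c x0 => H.
  rewrite (_ : F = c^-1 \*: ((@powR R)^~ c)); last first.
    by apply/funext => r; rewrite /F mulrC.
  apply: (is_derive_eq (is_deriveZ c^-1 H)).
  by rewrite /GRing.scale /= mulKf// gt_eqF.
have cF (x : R) : 0 < x -> {for x, continuous F}.
  move=> x0; apply: differentiable_continuous; apply/derivable1_diffP.
  by have [] := dF x x0.
rewrite (@continuous_FTC2 _ _ F)//.
- by rewrite -EFinB /F -mulrBl.
- apply: continuous_in_subspaceT => x; rewrite inE /= in_itv /= => /andP[ax _].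
  by apply: continuous_powR_gt0; exact: lt_le_trans ax.
- split.
  + move=> x; rewrite in_itv /= => /andP[ax _].
    by have [] := dF x (lt_trans a0 ax).
  + by apply: cvg_at_right_filter; exact: cF.
  + by apply: cvg_at_left_filter; exact: cF (lt_trans a0 ab).
- move=> x; rewrite in_itv /= => /andP[ax _].
  have [_ <-] := dF x (lt_trans a0 ax).
  by rewrite derive1E.
Qed.

Lemma integral_powR (c b : R) : 0 < c -> 0 < b ->
  (\int[leb]_(r in `]0%R, b]) (r `^ (c - 1))%:E = (b `^ c / c)%:E)%E.
Proof.
move=> c0 b0.
pose F n := `[b / n.+2%:R, b]%classic : set R.
have Fb : \bigcup_n F n = `]0, b]%classic.
  apply/seteqP; split => [x [n _]|x]; rewrite /F /= !in_itv /=.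
    by move=> /andP[nx ->]; rewrite andbT (lt_le_trans _ nx)// divr_gt0.
  move=> /andP[x0 xb]; exists (Num.truncn (b / x)) => //=.
  rewrite in_itv /= xb andbT ler_pdivrMr// mulrC -ler_pdivrMr// ltW//.
  by rewrite (lt_trans (truncnS_gt _))// ltr_nat.
have mp D : measurable_fun D (fun r : R => (r `^ (c - 1))%:E).
  by apply/measurable_EFinP; apply: measurable_funTS; exact: measurable_powR.
have Fpos n : 0 < b / n.+2%:R by rewrite divr_gt0.
have Flt n : b / n.+2%:R < b.
  by rewrite ltr_pdivrMr// ltr_pMr// ltr1n.
have H : (\int[leb]_(r in F n) (r `^ (c - 1))%:E)%E @[n --> \oo] -->
    (\int[leb]_(r in \bigcup_n F n) (r `^ (c - 1))%:E)%E.
  apply: ge0_nondecreasing_set_cvg_integral => //.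
  - move=> i j ij; apply/subsetPset => r; rewrite /F /= !in_itv /= => /andP[ir ->].
    rewrite andbT (le_trans _ ir)// ler_pM2l// lef_pV2 ?posrE ?ltr0n//.
    by rewrite ler_nat !ltnS.
  - by move=> i; exact: measurable_itv.
  - by move=> i; exact: mp.
  - by move=> i x _; rewrite lee_fin powR_ge0.
rewrite -Fb; apply: (cvg_unique _ H) => //.
rewrite (_ : (fun n => _) =
    (fun n => ((b `^ c - (b / n.+2%:R) `^ c) / c)%:E)); last first.
  by apply/funext => n; rewrite integral_powR_itv.
suff H0 : (b / n.+2%:R) `^ c @[n --> \oo] --> (0 : R).
  have H1 : (b `^ c - (b / n.+2%:R) `^ c) / c @[n --> \oo] --> (b `^ c - 0) / c.
    by apply: cvgMl; apply: cvgB => //; exact: cvg_cst.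
  by rewrite subr0 in H1; apply: cvg_EFin; [exact: nearW|exact: H1].
apply/cvgrPdist_lt => e e0.
have ec : 0 < e `^ c^-1 / b by rewrite divr_gt0// powR_gt0.
near=> n; rewrite sub0r normrN ger0_norm ?powR_ge0//.
have -> : e = (e `^ c^-1) `^ c.
  by rewrite -powRrM mulVf ?gt_eqF// powRr1// ltW.
apply: gt0_ltr_powR => //; rewrite ?inE ?nnegrE ?divr_ge0 ?powR_ge0 ?(ltW b0)//.
rewrite mulrC -ltr_pdivlMr//; apply: (@le_lt_trans _ _ n.+1%:R^-1).
  by rewrite lef_pV2 ?posrE ?ltr0n// ler_nat.
by near: n; exact: (near_infty_natSinv_lt (PosNum ec)).
Unshelve. all: by end_near. Qed.

End power_integral.

Local Open Scope ereal_scope.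

Section ball_mass.
Context (R : realType) (d : nat) (d0 : (0 < d)%N).
Local Notation V := 'rV[R[i]]_d.
Local Notation m := (@lebesgue_vec R d).
Local Notation leb := (@lebesgue_measure R).

(** radial_int (ball_weight e) g is the integral over the ball of
    (1 - |x|^2)^(e - 1) g(x). *)
Definition ball_weight (e t : R) : R := if (t < 1)%R then ((1 - t) `^ (e - 1))%R else 0%R.

Lemma ball_weight_ge0 e t : (0 <= ball_weight e t)%R.
Proof. by rewrite /ball_weight; case: ifP => // _; exact: powR_ge0. Qed.

Lemma measurable_ball_weight e : measurable_fun setT (ball_weight e).
Proof.
apply: measurable_fun_ifT => //; first exact: measurable_fun_ltr.
by apply: (measurableT_comp (measurable_powR _)); exact: measurable_funB.
Qed.

Lemma ball_weight1 e t : (1 <= t)%R -> ball_weight e t = 0%R.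
Proof. by move=> t1; rewrite /ball_weight ltNge t1. Qed.

Definition ball_mass (e : R) : \bar R := radial_int (ball_weight e) (fun _ : V => 1%R).

Let f (e r : R) : R := if (0 < r)%R then (r `^ (e - 1))%R else 0%R.

Let f0 e r : (0 <= f e r)%R.
Proof. by rewrite /f; case: ifP => // _; exact: powR_ge0. Qed.

Let mf e : measurable_fun setT (f e).
Proof.
by apply: measurable_fun_ifT => //; exact: measurable_fun_ltr.
Qed.

Let f_weight e t : f e (1 - t)%R = ball_weight e t.
Proof. by rewrite /f /ball_weight subr_gt0. Qed.

Let ind (r : R) : R := (if 0 < r <= 1 then 1 else 0)%R.

Let mind : measurable_fun setT ind.
Proof.
apply: measurable_fun_ifT => //; apply: measurable_and.
  exact: measurable_fun_ltr.
exact: measurable_fun_ler.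
Qed.

Let ind0 r : (0 <= ind r)%R. Proof. by rewrite /ind; case: ifP. Qed.

Let int_itv e (b : R) : (0 < e)%R -> (0 < b)%R ->
  \int[leb]_r (if 0 < r <= b then r `^ (e - 1) else 0)%R%:E = (b `^ e / e)%:E.
Proof.
move=> e0 b0; rewrite -integral_powR// [RHS]integral_mkcond.
apply: eq_integral => r _; rewrite patchE mem_setE in_itv /=.
by case: ifP.
Qed.

Let int_rho e (q : R) : (0 < e)%R -> (0 <= q)%R ->
  \int[leb]_r (ind r * f e (r - q))%:E = (e^-1 * ball_weight (1 + e) q)%:E.
Proof.
move=> e0 q0.
rewrite -(@integral_lebesgue_shift _ q (fun r => (ind r * f e (r - q))%:E)); last 2 first.
- apply/measurable_EFinP; apply: measurable_funM => //.
  by apply: (measurableT_comp (mf e)); exact: measurable_funB.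
- by move=> r; rewrite lee_fin mulr_ge0.
have [q1|q1] := ltP q 1%R; last first.
  rewrite ball_weight1// mulr0 integral0_eq// => r _; congr EFin.
  rewrite addrK /ind /f; case: ifPn => [/andP[_ rq]|]; last by rewrite mul0r.
  rewrite ifF ?mulr0//; apply/negbTE; rewrite -leNgt.
  by rewrite -(lerD2r q) add0r (le_trans rq).
rewrite /ball_weight q1 mulrC addrAC subrr add0r -int_itv// ?subr_gt0//.
apply: eq_integral => r _; congr EFin; rewrite addrK /ind /f lerBrDr.
have [r0|r0] := ltP 0%R r; last by rewrite mulr0.
by rewrite (ltr_wpDr q0 r0) /=; case: ifP; rewrite ?mul1r ?mul0r.
Qed.

Let int_x e (r : R) : (0 < e)%R ->
  \int[m]_x (ind r * f e (r - cnorm x ^+ 2))%:E =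
  (if 0 < r <= 1 then r `^ (d%:R + e - 1) else 0)%R%:E * ball_mass e.
Proof.
move=> e0; rewrite /ind; case: ifPn => [/andP[r0 r1]|_]; last first.
  by rewrite mul0e integral0_eq// => x _; rewrite mul0r.
have s0 : (0 < Num.sqrt r)%R by rewrite sqrtr_gt0.
have mg : measurable_fun setT (fun x : V => (f e (r - cnorm x ^+ 2))%:E).
  apply/measurable_EFinP; apply: (measurableT_comp (mf e)).
  apply: measurable_funB => //; apply: measurable_funX; exact: measurable_cnorm.
under eq_integral do rewrite mul1r.
rewrite (integral_vec_scale s0 mg) => [|x]; last by rewrite lee_fin.
rewrite exprM sqr_sqrtr ?(ltW r0)//.
have -> : (r `^ (d%:R + e - 1) = r ^+ d * r `^ (e - 1))%R.
  by rewrite -addrA powRD ?powR_mulrn ?(ltW r0)//; apply/implyP => _; rewrite gt_eqF.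
rewrite EFinM -muleA; congr (_ * _); rewrite /ball_mass /radial_int integralZ_ge0.
- apply: eq_integral => x _; rewrite -EFinM mulr1 -f_weight; congr EFin.
  rewrite cnorm_scale// exprMn sqr_sqrtr ?(ltW r0)// -[X in (X - _)%R]mulr1 -mulrBr.
  rewrite /f pmulr_rgt0//; case: ifP => [x0|_]; last by rewrite mulr0.
  by rewrite powRM// ltW.
- by apply: measurable_radial_int => //; exact: measurable_ball_weight.
- by move=> x; rewrite mulr1 lee_fin ball_weight_ge0.
- exact: powR_ge0.
Qed.

Lemma ball_mass_ge0 e : 0 <= ball_mass e.
Proof. by apply: integral_ge0 => x _; rewrite mulr1 lee_fin ball_weight_ge0. Qed.

(** Both sides are the integral of (r - |x|^2)^(e - 1) over |x|^2 < r <= 1. *)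
Lemma ball_mass_rec e : (0 < e)%R ->
  e%:E * ball_mass e = (e + d%:R)%:E * ball_mass (1 + e).
Proof.
move=> e0; pose D (r : R) (x : V) := (ind r * f e (r - cnorm x ^+ 2))%:E.
have mD : measurable_fun setT (fun p : R * V => D p.1 p.2).
  apply/measurable_EFinP; apply: measurable_funM.
    exact: measurableT_comp mind measurable_fst.
  apply: (measurableT_comp (mf e)); apply: measurable_funB => //.
  by apply: measurable_funX; apply: measurableT_comp (@measurable_cnorm R d) _.
have D0 p : 0 <= D p.1 p.2 by rewrite lee_fin mulr_ge0.
have := @fubini_tonelli _ _ _ _ _ leb m (fun p => D p.1 p.2) mD D0.
rewrite /fubini_F /fubini_G /= /D (funext (fun r => int_x r e0)).
rewrite (funext (fun x : V => int_rho e0 (sqr_ge0 (cnorm x)))).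
clear D mD D0 => E.
have de0 : (0 < d%:R + e)%R by rewrite ltr_wpDl.
have mI : measurable_fun setT
    (fun r : R => (if 0 < r <= 1 then r `^ (d%:R + e - 1) else 0)%R%:E).
  apply/measurable_EFinP; apply: measurable_fun_ifT => //.
  by apply: measurable_and; [exact: measurable_fun_ltr|exact: measurable_fun_ler].
have I0 r : 0 <= (if 0 < r <= 1 then r `^ (d%:R + e - 1) else 0)%R%:E.
  by rewrite lee_fin; case: ifP => // _; exact: powR_ge0.
rewrite (ge0_integralZr leb measurableT mI (fun r _ => I0 r) (ball_mass_ge0 e)) in E.
rewrite (int_itv de0 ltr01) powR1 div1r in E.
have F : \int[m]_x (e^-1 * ball_weight (1 + e) (cnorm x ^+ 2))%:E =
    e^-1%:E * ball_mass (1 + e).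
  rewrite /ball_mass /radial_int integralZ_ge0.
  - by apply: eq_integral => x _; rewrite -EFinM mulr1.
  - by apply: measurable_radial_int => //; exact: measurable_ball_weight.
  - by move=> x; rewrite mulr1 lee_fin ball_weight_ge0.
  - by rewrite invr_ge0 ltW.
rewrite F in E; move: E; clear F mI I0.
move: (ball_mass e) (ball_mass (1 + e)) => X Y.
move=> /(congr1 (fun y => (e * (d%:R + e))%:E * y)).
rewrite !muleA -!EFinM mulfK ?(gt_eqF de0)// => ->.
by rewrite mulrAC mulfV ?(gt_eqF e0)// mul1r addrC.
Qed.

End ball_mass.

Section ball_mass_limit.
Context (R : realType) (d : nat) (d0 : (0 < d)%N).
Local Notation V := 'rV[R[i]]_d.
Local Notation m := (@lebesgue_vec R d).
Local Notation ball_mass := (@ball_mass R d).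

Lemma ball_weight_le (e e' t : R) : (e <= e')%R -> (0 <= t)%R ->
  (ball_weight e' t <= ball_weight e t)%R.
Proof.
move=> ee t0; rewrite /ball_weight; case: ifP => // t1.
apply: ger_powR; last by rewrite lerB.
by rewrite subr_gt0 t1 /= lerBlDr lerDl.
Qed.

Lemma ball_mass_le (e e' : R) : (e <= e')%R -> ball_mass e' <= ball_mass e.
Proof.
move=> ee; apply: ge0_le_integral => //.
- by move=> x _; rewrite mulr1 lee_fin ball_weight_ge0.
- by apply: measurable_radial_int => //; exact: measurable_ball_weight.
- by apply: measurable_radial_int => //; exact: measurable_ball_weight.
- by move=> x _; rewrite lee_fin !mulr1 ball_weight_le// sqr_ge0.
Qed.

Lemma cnorm_lt1 (x : V) : (cnorm x ^+ 2 < 1)%R = (cnorm x < 1)%R.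
Proof. by rewrite expr_lt1// cnorm_ge0. Qed.

Lemma ball_mass1E : ball_mass 1 = m (@unit_ball R d).
Proof.
rewrite -[RHS]mul1e -integral_cst; last exact: measurable_unit_ball.
rewrite [RHS]integral_mkcond; apply: eq_integral => x _.
rewrite patchE /ball_weight subrr powRr0 cnorm_lt1 mulr1.
have -> : (x \in @unit_ball R d) = (cnorm x < 1)%R by apply/idP/idP; rewrite inE.
by case: ifP.
Qed.

Lemma ball_mass1_lty : ball_mass 1 < +oo.
Proof.
have := @integral_vec_gauss R d 1 ltr01 => G.
apply: (@le_lt_trans _ _ ((expR 1)%:E * (pi ^+ d)%:E)); last by rewrite -EFinM ltry.
rewrite -[X in (X ^+ d)%R]divr1 -G integralZ_ge0.
- apply: ge0_le_integral => //.
  + by move=> x _; rewrite mulr1 lee_fin ball_weight_ge0.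
  + by apply: measurable_radial_int => //; exact: measurable_ball_weight.
  + by apply/measurable_EFinP; apply: measurable_funM => //; exact: measurable_gauss.
  + move=> x _; rewrite -EFinM lee_fin mulr1 -expRD /ball_weight subrr powRr0 mul1r.
    case: ifP => [x1|_]; last exact: expR_ge0.
    by rewrite -[leLHS]expR0 ler_expR subr_ge0 ltW.
- by apply/measurable_EFinP; exact: measurable_gauss.
- by move=> x; rewrite lee_fin expR_ge0.
- exact: expR_ge0.
Qed.

Lemma ball_mass1_gt0 : 0 < ball_mass 1.
Proof.
rewrite lt0e ball_mass_ge0 andbT; apply/eqP => b0.
pose g (x : V) := (expR (- (1 * cnorm x ^+ 2)))%:E.
have mg : measurable_fun setT g by apply/measurable_EFinP; exact: measurable_gauss.
pose F n : set V := [set x | (cnorm x < n.+1%:R)%R].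
have mF n : measurable (F n).
  rewrite -[F n]setTI; apply: (@measurable_cnorm R d measurableT [set t | t < n.+1%:R]%R).
  by rewrite -(set_itvNyo (n.+1%:R : R)); exact: measurable_itv.
have FT : \bigcup_n F n = setT.
  apply/seteqP; split => // x _; exists (Num.truncn (cnorm x)) => //.
  by rewrite /F /= truncnS_gt.
have mh (n : nat) : measurable_fun setT (fun x : V => (if cnorm x < n.+1%:R then 1 else 0 : R)%R%:E).
  apply/measurable_EFinP; apply: measurable_fun_ifT => //.
  by apply: measurable_fun_ltr => //; exact: measurable_cnorm.
have F0 (n : nat) : \int[m]_x (if cnorm x < n.+1%:R then 1 else 0 : R)%R%:E = 0.
  have n0 : (0 < n.+1%:R :> R)%R by [].
  rewrite (integral_vec_scale n0 (mh n)) => [|x]; last by rewrite lee_fin; case: ifP.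
  suff -> : \int[m]_x (if cnorm (n.+1%:R%:C *: x)%R < n.+1%:R then 1 else 0 : R)%R%:E =
      ball_mass 1 by rewrite b0 mule0.
  apply: eq_integral => x _; rewrite /ball_weight subrr powRr0 cnorm_lt1 mulr1.
  by rewrite cnorm_scale// gtr_pMr.
have H : (\int[m]_(x in F n) g x)%E @[n --> \oo] --> (\int[m]_(x in \bigcup_n F n) g x)%E.
  apply: ge0_nondecreasing_set_cvg_integral => //.
  - move=> i j ij; apply/subsetPset => x; rewrite /F /= => /lt_le_trans; apply.
    by rewrite ler_nat ltnS.
  - by move=> i; exact: measurable_funS mg.
  - by move=> i x _; rewrite lee_fin expR_ge0.
have Z n : \int[m]_(x in F n) g x = 0.
  apply/eqP; rewrite eq_le integral_ge0 ?andbT => [|x _]; last by rewrite lee_fin expR_ge0.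
  rewrite -(F0 n) integral_mkcond; apply: ge0_le_integral => //.
  - by move=> x _; rewrite patchE; case: ifP => // _; rewrite lee_fin expR_ge0.
  - by apply/(measurable_restrictT g (mF n)); apply: measurable_funTS.
  - move=> x _; rewrite patchE; case: ifPn => [|_]; last by rewrite lee_fin; case: ifP.
    rewrite inE /F /= => ->; rewrite lee_fin -[leRHS]expR0 ler_expR mul1r oppr_le0.
    exact: sqr_ge0.
move: H; rewrite FT integral_vec_gauss// divr1 (funext Z) => H.
have : (0 : \bar R) = (pi ^+ d)%:E by apply: (cvg_unique _ _ H) => //; exact: cvg_cst.
by move=> [/esym/eqP]; rewrite expf_eq0 (gt_eqF (pi_gt0 R)) andbF.
Qed.

Lemma ball_mass_lty e : (0 < e)%R -> ball_mass e < +oo.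
Proof.
move=> e0; have := ball_mass_rec d e0.
have : ball_mass (1 + e) < +oo.
  by apply: le_lt_trans ball_mass1_lty; apply: ball_mass_le; rewrite lerDl ltW.
have := ball_mass_ge0 d e; have := ball_mass_ge0 d (1 + e).
move: (ball_mass e) (ball_mass (1 + e)) => [x| |] [y| |] //= _ _ _; rewrite ?ltry//.
by rewrite gt0_muley// -EFinM.
Qed.

Definition bmass (e : R) : R := fine (ball_mass e).

Lemma bmassE e : (0 < e)%R -> ball_mass e = (bmass e)%:E.
Proof.
by move=> e0; rewrite fineK// ge0_fin_numE ?ball_mass_lty// ball_mass_ge0.
Qed.

Lemma bmass_ge0 e : (0 <= bmass e)%R.
Proof. by rewrite fine_ge0// ball_mass_ge0. Qed.

Lemma bmass1_gt0 : (0 < bmass 1)%R.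
Proof. by rewrite -lte_fin -bmassE// ball_mass1_gt0. Qed.

Lemma bmass_le e e' : (0 < e)%R -> (e <= e')%R -> (bmass e' <= bmass e)%R.
Proof.
move=> e0 ee; rewrite -lee_fin -(bmassE e0) -(bmassE (lt_le_trans e0 ee)).
exact: ball_mass_le.
Qed.

Lemma bmass_rec e : (0 < e)%R -> (e * bmass e = (e + d%:R) * bmass (1 + e))%R.
Proof.
move=> e0; have := ball_mass_rec d e0.
rewrite (bmassE e0) (bmassE (addr_gt0 ltr01 e0)) => H.
exact (EFin_inj H).
Qed.

(** By convexity of exp, with u = 1 - |x|^2: 1 - u^e <= - e log u <= 2 e u^(-1/2). *)
Lemma bmass_near1 e : (0 < e)%R -> (bmass 1 - bmass (1 + e) <= 2 * e * bmass 2^-1)%R.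
Proof.
move=> e0; have h0 : (0 < 2^-1 :> R)%R by rewrite invr_gt0.
have mw := @measurable_ball_weight R.
have mr k : measurable_fun setT (fun x : V => (ball_weight k (cnorm x ^+ 2) * 1)%:E).
  exact: measurable_radial_int.
have w0 k (x : V) : 0 <= (ball_weight k (cnorm x ^+ 2) * 1)%:E.
  by rewrite mulr1 lee_fin ball_weight_ge0.
have c0 : (0 <= 2 * e)%R by rewrite mulr_ge0// ltW.
rewrite lerBlDl -lee_fin EFinD EFinM -(bmassE ltr01) -(bmassE (addr_gt0 ltr01 e0)) -(bmassE h0).
rewrite {2}/ball_mass /radial_int (integralZ_ge0 _ (mr _) (w0 _) c0).
rewrite -(ge0_integralD m measurableT (fun x _ => w0 _ x) (mr _)); last 2 first.
- by move=> x _; rewrite mule_ge0// lee_fin.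
- by apply: emeasurable_funM.
apply: ge0_le_integral => //.
- by apply: emeasurable_funD => //; exact: emeasurable_funM.
move=> x _; rewrite -EFinM -EFinD lee_fin !mulr1 /ball_weight.
case: ifP => [x1|_]; last by rewrite mulr0 addr0.
have u0 : (0 < 1 - cnorm x ^+ 2)%R by rewrite subr_gt0.
rewrite subrr powRr0 addrAC subrr add0r /powR (gt_eqF u0).
set L := ln _.
have -> : ((2^-1 - 1) * L = - (L / 2))%R by field.
(* 1 + x <= exp x at x = e L and at x = - L / 2 *)
apply: (@le_trans _ _ (1 + e * L + 2 * e * (1 - L / 2))%R); last first.
  by rewrite lerD ?ler_wpM2l// expR_ge1Dx.
rewrite -addrA lerDl.
have -> : (e * L + 2 * e * (1 - L / 2) = 2 * e)%R by field.
exact: c0.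
Qed.

(** By the recursion, e bmass e = (e + d) bmass (1 + e), where bmass is continuous at 1. *)
Lemma bmass_asymp e : (0 < e)%R ->
  (`|e * bmass e - d%:R * bmass 1| <= (bmass 1 + d%:R * 2 * bmass 2^-1) * e)%R.
Proof.
move=> e0; rewrite bmass_rec//.
have b1 := bmass_le ltr01 (_ : 1 <= 1 + e)%R; have {}b1 := b1 (ltac:(by rewrite lerDl ltW)).
have b2 := bmass_near1 e0; have b3 := bmass_ge0 (1 + e); have b4 := bmass_ge0 2^-1.
have d1 : (0 <= d%:R :> R)%R by [].
move: (bmass 1) (bmass (1 + e)) (bmass 2^-1) (d%:R : R) b1 b2 b3 b4 d1.
move=> X Y Z D b1 b2 b3 b4 d1.
have -> : ((e + D) * Y - D * X = e * Y - D * (X - Y))%R by ring.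
have h1 : (e * Y <= e * X)%R by rewrite ler_pM2l.
have h2 : (D * (X - Y) <= D * (2 * e * Z))%R by rewrite ler_wpM2l.
have h3 : (0 <= D * (X - Y))%R by rewrite mulr_ge0// subr_ge0.
have h4 : (0 <= e * Y)%R by rewrite mulr_ge0// ltW.
have h5 : (0 <= D * (2 * e * Z))%R by exact: le_trans h2.
have h6 : (0 <= e * X)%R by exact: le_trans h1.
have -> : ((X + D * 2 * Z) * e = e * X + D * (2 * e * Z))%R by ring.
rewrite ler_norml; apply/andP; split; lra.
Qed.

End ball_mass_limit.

#[global] Opaque bmass.

Local Close Scope ereal_scope.

(** * Boundary behaviour of the weights and of the Poisson kernel *)

Section pointwise.
Context (R : realType) (d : nat).
Local Notation V := 'rV[R[i]]_d.

Lemma normrX_sub_le (n : nat) (M a b : R) : 1 <= M -> 0 <= a <= M -> 0 <= b <= M ->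
  `|a ^+ n - b ^+ n| <= n%:R * M ^+ n * `|a - b|.
Proof.
move=> M1 /andP[a0 aM] /andP[b0 bM]; have M0 : 0 <= M by exact: le_trans M1.
elim: n => [|n IH]; first by rewrite !expr0 subrr normr0 !mul0r.
have -> : a ^+ n.+1 - b ^+ n.+1 = a * (a ^+ n - b ^+ n) + (a - b) * b ^+ n.
  by rewrite !exprS; ring.
apply: le_trans (ler_normD _ _) _; rewrite !normrM (ger0_norm a0) (ger0_norm (exprn_ge0 n b0)).
rewrite -natr1 mulrDl mulrDl mul1r; apply: lerD.
  rewrite exprS; apply: le_trans (ler_pM a0 (normr_ge0 _) aM IH) _.
  by rewrite le_eqVlt; apply/orP; left; apply/eqP; ring.
rewrite mulrC; apply: ler_wpM2r => //.
apply: le_trans (lerXn2r n _ _ bM) _; rewrite ?nnegrE//.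
by rewrite ler_weXn2l.
Qed.

Lemma powR_sub1_le (L y e : R) : 0 < y -> `|ln y| <= L -> 0 <= e -> e * L <= 2^-1 ->
  `|y `^ e - 1| <= 2 * L * e.
Proof.
move=> y0 yL e0 eL; rewrite /powR gt_eqF//; set t := e * ln y.
have tL : `|t| <= e * L by rewrite normrM (ger0_norm e0) ler_wpM2l.
have t2 := le_trans tL eL.
have := expR_ge1Dx t; have := expR_ge1Dx (- t); rewrite expRN.
have E0 := expR_gt0 t; move: tL t2; rewrite !ler_norml => /andP[t3 t4] /andP[t5 t6].
rewrite -(div1r (expR t)) ler_pdivlMr// => h1 h2.
by apply/andP; split; nra.
Qed.

(** The ratio (1 - |phi_z(x)|^2) / (1 - |x|^2), the Poisson kernel to the power 1 / d
    when x is on the sphere. *)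
Definition jac (z x : V) : R := (1 - cnorm z ^+ 2) / normc (1 - hdot x z) ^+ 2.

Lemma bergman_tE z x : bergman_t z x = jac z x * (1 - cnorm x ^+ 2).
Proof. by rewrite /bergman_t /jac mulrAC. Qed.

Lemma jac_sphere z zeta : normc (1 - hdot zeta z) != 0 ->
  jac z zeta ^+ d = poisson_szego z zeta.
Proof. by move=> n0; rewrite /jac /poisson_szego expr_div_n -exprM. Qed.

Section fixed.
Variables (z : V) (z1 : cnorm z < 1).

Let A x : cnorm x <= 1 -> 1 - cnorm z <= normc (1 - hdot x z) <= 2.
Proof.
move=> x1; apply/andP; split.
  apply: le_trans (normc_1Bhdot_ge x z); rewrite lerB//.
  by rewrite ler_piMl// cnorm_ge0.
apply: le_trans (normc_1Bhdot_le x z) _.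
by rewrite lerD2l// mulr_ile1 ?cnorm_ge0// ltW.
Qed.

Lemma jac_bounds : exists q0 q1 : R, [/\ 0 < q0, 1 <= q1 &
  forall x, cnorm x <= 1 -> q0 <= jac z x <= q1].
Proof.
have z0 := cnorm_ge0 z; have u0 := ball_sqr_lt1 z1.
have v0 : 0 < 1 - cnorm z by rewrite subr_gt0.
exists ((1 - cnorm z ^+ 2) / 2 ^+ 2), ((1 - cnorm z ^+ 2) / (1 - cnorm z) ^+ 2).
split; first by rewrite divr_gt0// exprn_gt0.
  by rewrite ler_pdivlMr ?exprn_gt0// mul1r; nra.
move=> x /A/andP[x2 x3]; have x0 := lt_le_trans v0 x2.
rewrite /jac; apply/andP; split; apply: ler_wpM2l; rewrite ?(ltW u0)//.
  by rewrite lef_pV2 ?posrE ?exprn_gt0// lerXn2r// nnegrE ltW.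
by rewrite lef_pV2 ?posrE ?exprn_gt0// lerXn2r// nnegrE ltW.
Qed.

Lemma jac_lip : exists2 L, 0 <= L & forall x y, cnorm x <= 1 -> cnorm y <= 1 ->
  `|jac z x - jac z y| <= L * cnorm (x - y).
Proof.
have z0 := cnorm_ge0 z; have u0 := ball_sqr_lt1 z1.
have v0 : 0 < 1 - cnorm z by rewrite subr_gt0.
have V4 : 0 < (1 - cnorm z) ^+ 4 by rewrite exprn_gt0.
exists ((1 - cnorm z ^+ 2) * 4 / (1 - cnorm z) ^+ 4).
  by rewrite divr_ge0 ?mulr_ge0 ?ltW.
move=> x y /A/andP[x2 x3] /A/andP[y2 y3]; rewrite /jac.
have D : `|normc (1 - hdot x z) - normc (1 - hdot y z)| <= cnorm (x - y).
  apply: (@le_trans _ _ (normc (hdot (x - y) z))).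
    have E a b : normc (1 - hdot a z) - normc (1 - hdot b z) <= normc (hdot (a - b) z).
      by apply: le_trans (ler_normcB _ _) _; rewrite hdotBl normcB le_eqVlt; apply/orP; left; apply/eqP; congr normc; ring.
    rewrite ler_norml E andbT lerNl opprB; apply: le_trans (E _ _) _.
    by rewrite -[y - x]opprB hdotNl normcN.
  apply: le_trans (hdot_le _ _) _; rewrite ler_piMr ?cnorm_ge0// ltW//.
move: (normc _) (normc (1 - hdot y z)) D x2 x3 y2 y3 => a b D x2 x3 y2 y3.
have a0 := lt_le_trans v0 x2; have b0 := lt_le_trans v0 y2.
have -> : (1 - cnorm z ^+ 2) / a ^+ 2 - (1 - cnorm z ^+ 2) / b ^+ 2 =
   (1 - cnorm z ^+ 2) * ((b + a) * (b - a) / (a ^+ 2 * b ^+ 2)).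
  by field; rewrite !gt_eqF.
rewrite normrM (gtr0_norm u0) -2!(mulrA (1 - cnorm z ^+ 2)); apply: ler_wpM2l; first exact: ltW.
rewrite normrM normrM normfV (gtr0_norm (addr_gt0 b0 a0)) (@gtr0_norm _ (a ^+ 2 * b ^+ 2)); last first.
  by rewrite mulr_gt0// exprn_gt0.
rewrite [leRHS]mulrAC; apply: ler_pM.
- by rewrite mulr_ge0// ltW// addr_gt0.
- by rewrite invr_ge0 ltW// mulr_gt0// exprn_gt0.
- by rewrite distrC in D; apply: ler_pM => //; lra.
- rewrite lef_pV2 ?posrE ?mulr_gt0 ?exprn_gt0//.
  rewrite [_ ^+ 4](_ : _ = (1 - cnorm z) ^+ 2 * (1 - cnorm z) ^+ 2); last by rewrite -exprD.
  by apply: ler_pM; rewrite ?exprn_ge0 ?(ltW v0)// lerXn2r ?nnegrE ?(ltW v0) ?(ltW a0) ?(ltW b0).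
Qed.

(** As x tends to the sphere, 1 - |phi_z(x)| is equivalent to half of jac z x (1 - |x|^2). *)
Lemma decay_ratio x : cnorm x < 1 -> let y := decay z x / (1 - cnorm x ^+ 2) in
  [/\ jac z x / 4 <= y, y <= jac z x &
   y - jac z x / 4 <= jac z x ^+ 2 * (1 - cnorm x ^+ 2)].
Proof.
move=> x1 /=; have u0 := ball_sqr_lt1 x1.
have t0 := bergman_t_gt0 z1 x1; have t1 := bergman_t_le1 z1 x1.
have -> : decay z x / (1 - cnorm x ^+ 2) = jac z x / (1 + Num.sqrt (1 - bergman_t z x)) ^+ 2.
  rewrite /decay bergman_tE; have r0 : 0 < 1 + Num.sqrt (1 - jac z x * (1 - cnorm x ^+ 2)).
    by rewrite ltr_wpDr// sqrtr_ge0.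
  by rewrite mulrAC mulfK// gt_eqF.
have r0 := sqrtr_ge0 (1 - bergman_t z x).
have r2 : Num.sqrt (1 - bergman_t z x) ^+ 2 = 1 - bergman_t z x by rewrite sqr_sqrtr ?subr_ge0.
move: r0 r2 t0 t1; rewrite bergman_tE; set q := jac z x; set u := 1 - cnorm x ^+ 2.
move: (Num.sqrt _) => r r0 r2 t0 t1; have q0 : 0 < q by move: t0; rewrite pmulr_lgt0.
have r1 : r <= 1 by rewrite -(@expr_le1 _ 2)// r2 gerBl ltW.
have p0 : 0 < (1 + r) ^+ 2 by rewrite exprn_gt0// ltr_wpDr.
split.
- by rewrite ler_pM2l// lef_pV2 ?posrE//; nra.
- by rewrite ler_pdivrMr// ler_peMr ?(ltW q0)//; nra.
have -> : q ^+ 2 * u = q * (1 - r ^+ 2) by rewrite r2; ring.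
have -> : q / (1 + r) ^+ 2 - q / 4 = q * ((1 + r) ^- 2 - 4^-1) by ring.
rewrite ler_pM2l//.
have -> : (1 + r) ^- 2 - 4^-1 = (1 - r) * (3 + r) / (4 * (1 + r) ^+ 2).
  by field; rewrite gt_eqF// ltr_wpDr.
by rewrite ler_pdivrMr ?mulr_gt0//; nra.
Qed.

(** The exponent e costs little since the ratio stays in a compact subset of the positive
    half-line, where its logarithm is bounded; the rest is decay_ratio. *)
Lemma decay_powR_approx eta : 0 < eta -> exists C e0, [/\ 0 <= C, 0 < e0 &
  forall (e : R) x, 0 < e < e0 -> cnorm x < 1 ->
  `|(decay z x / (1 - cnorm x ^+ 2)) `^ (d%:R + e) - (jac z x / 4) ^+ d|
    <= eta + C * (1 - cnorm x ^+ 2)].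
Proof.
move=> eta0; have [q0 [q1 [q00 q11 qx]]] := jac_bounds.
pose L := Num.max 1 (Num.max `|ln (q0 / 4)| `|ln q1|).
have L1 : 1 <= L by rewrite le_max lexx.
have q10 : 0 < q1 by exact: lt_le_trans q11.
have lnL y : q0 / 4 <= y -> y <= q1 -> `|ln y| <= L.
  move=> y0 y1; have yp : 0 < y by apply: lt_le_trans y0; rewrite divr_gt0.
  have h1 : ln (q0 / 4) <= ln y by rewrite ler_ln// posrE divr_gt0.
  have h2 : ln y <= ln q1 by rewrite ler_ln// posrE.
  have h3 : `|ln (q0 / 4)| <= L by rewrite !le_max lexx orbT.
  have h4 : `|ln q1| <= L by rewrite !le_max lexx !orbT.
  by move: h3 h4; rewrite !ler_norml => /andP[? ?] /andP[? ?]; apply/andP; split; lra.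
exists (d%:R * q1 ^+ d * q1 ^+ 2), (Num.min (2^-1 / L) (eta / (q1 ^+ d * 2 * L))).
have L0 : 0 < L by exact: lt_le_trans L1.
have q1d : 0 < q1 ^+ d by rewrite exprn_gt0.
split.
- by rewrite !mulr_ge0 ?exprn_ge0 ?(ltW q10).
- by rewrite lt_min !divr_gt0// !mulr_gt0.
move=> e x /andP[e0 ee] x1; have [y1 y2 y3] := decay_ratio x1.
have /andP[j0 j1] := qx x (ltW x1); have u0 := ball_sqr_lt1 x1.
move: ee; rewrite lt_min => /andP[eL eeta].
set y := decay z x / _ in y1 y2 y3 *; set q := jac z x in y1 y2 y3 j0 j1 *.
have y0 : 0 < y by apply: lt_le_trans y1; rewrite divr_gt0// (lt_le_trans q00).
have yq1 := le_trans y2 j1.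
rewrite powRD; last by rewrite (gt_eqF y0) implybT.
rewrite powR_mulrn ?(ltW y0)//.
have -> : y ^+ d * y `^ e - (q / 4) ^+ d = y ^+ d * (y `^ e - 1) + (y ^+ d - (q / 4) ^+ d).
  by ring.
apply: le_trans (ler_normD _ _) _; apply: lerD.
  rewrite normrM ger0_norm ?exprn_ge0 ?(ltW y0)//.
  have h : `|y `^ e - 1| <= 2 * L * e.
    apply: powR_sub1_le => //; [|exact: ltW|].
      by apply: lnL => //; apply: le_trans y1; rewrite ler_pM2r.
    by rewrite -ler_pdivlMr// ltW.
  apply: (@le_trans _ _ (q1 ^+ d * (2 * L * e))).
    by apply: ler_pM => //; [rewrite exprn_ge0// ltW|rewrite lerXn2r// nnegrE ltW].
  rewrite mulrA mulrA mulrC -ler_pdivlMr ?mulr_gt0//; exact: ltW.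
have q40 : 0 <= q / 4 by rewrite divr_ge0// (le_trans (ltW q00)).
apply: le_trans (@normrX_sub_le d q1 _ _ _ _ _) _ => //.
- by rewrite (ltW y0).
- by rewrite q40 (le_trans y1).
rewrite -[leRHS]mulrA; apply: ler_wpM2l; first by rewrite mulr_ge0// ltW.
rewrite ger0_norm ?subr_ge0//.
apply: le_trans y3 _; rewrite ler_pM2r// lerXn2r ?nnegrE ?(ltW q10)//.
by rewrite (le_trans (ltW q00)).
Qed.

(** Near zeta the Poisson kernel with pole zeta concentrates: away from zeta it is
    dominated by the power of |1 - <x, zeta>|. *)
Lemma jac_poisson_approx eta : 0 < eta -> exists2 C, 0 <= C &
  forall x zeta, cnorm x < 1 -> cnorm zeta = 1 ->
  `|jac z x ^+ d - jac z zeta ^+ d| <= eta + C * normc (1 - hdot x zeta) ^+ (2 * d).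
Proof.
move=> eta0; have [q0 [q1 [q00 q11 qx]]] := jac_bounds; have [L L0 lip] := jac_lip.
pose M := d%:R * q1 ^+ d * L + 1.
have q10 : 0 < q1 by exact: lt_le_trans q11.
have M0 : 0 < M by rewrite ltr_wpDl// !mulr_ge0 ?exprn_ge0 ?(ltW q10).
pose del := (eta / M) ^+ 2 / 2.
have del0 : 0 < del by rewrite divr_gt0// exprn_gt0// divr_gt0.
exists (M * 2 / del ^+ (2 * d)).
  by rewrite divr_ge0 ?mulr_ge0 ?exprn_ge0// ltW.
move=> x zeta x1 zeta1; have eq_le1 : cnorm zeta = 1 -> cnorm zeta <= 1 by move=> ->.
have H : `|jac z x ^+ d - jac z zeta ^+ d| <= M * cnorm (x - zeta).
  apply: (@le_trans _ _ (d%:R * q1 ^+ d * L * cnorm (x - zeta))); last first.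
    by rewrite ler_wpM2r ?cnorm_ge0// lerDl.
  have /andP[a0 a1] := qx x (ltW x1); have /andP[b0 b1] := qx zeta (eq_le1 zeta1).
  apply: le_trans (@normrX_sub_le d q1 _ _ _ _ _) _ => //.
  - by rewrite a1 (le_trans (ltW q00)).
  - by rewrite b1 (le_trans (ltW q00)).
  by rewrite -[leRHS]mulrA ler_wpM2l ?mulr_ge0 ?exprn_ge0 ?(ltW q10)// lip ?zeta1// ltW.
have N : cnorm (x - zeta) ^+ 2 <= 2 * normc (1 - hdot x zeta).
  have := Re_le_normc (1 - hdot x zeta); rewrite ler_norml ReB /= => /andP[_ h].
  rewrite cnormB_sqr zeta1 expr1n -mulr_natl.
  have : cnorm x ^+ 2 <= 1 by rewrite expr_le1 ?cnorm_ge0// ltW.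
  by move: h; move: (complex.Re _) (normc _) (cnorm x ^+ 2) => ? ? ?; lra.
have [small|big] := leP (cnorm (x - zeta)) (eta / M).
  apply: le_trans H _; apply: (@le_trans _ _ eta).
    by rewrite mulrC -ler_pdivlMr.
  by rewrite lerDl mulr_ge0 ?exprn_ge0 ?normc_ge0// divr_ge0 ?mulr_ge0 ?exprn_ge0// ltW.
have dn : del <= normc (1 - hdot x zeta).
  rewrite /del ler_pdivrMr// [leRHS]mulrC; apply: (le_trans _ N).
  by rewrite lerXn2r ?nnegrE ?cnorm_ge0 ?divr_ge0 ?(ltW eta0) ?(ltW M0) ?ltW.
apply: le_trans H _; apply: (@le_trans _ _ (M * 2)).
  rewrite ler_pM2l//; apply: (@le_trans _ _ (cnorm x + cnorm zeta)); last by rewrite zeta1; lra.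
  have h : cnorm (x - zeta) ^+ 2 <= (cnorm x + cnorm zeta) ^+ 2.
    rewrite cnormB_sqr; have := Re_le_normc (hdot x zeta); rewrite ler_norml => /andP[h1 _].
    have := hdot_le x zeta; rewrite -mulr_natl sqrrD -(mulr_natl (_ * _)) => h2.
    by move: h1 h2; move: (complex.Re _) (normc _) (cnorm x * _) => ? ? ?; lra.
  by move: h; rewrite ler_pXn2r// ?nnegrE ?addr_ge0 ?cnorm_ge0.
apply: ler_wpDl; first exact: ltW.
rewrite -[leRHS]mulrA ler_peMr ?mulr_ge0 ?(ltW M0)//.
rewrite mulrC ler_pdivlMr ?exprn_gt0// mul1r.
by rewrite lerXn2r ?nnegrE ?normc_ge0// ltW.
Qed.

End fixed.
End pointwise.

(** * Asymptotics of the expectations *)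

Section ball_asymptotics.
Context (R : realType) (d : nat) (d0 : (0 < d)%N).
Local Notation V := 'rV[R[i]]_d.
Local Notation m := (@lebesgue_vec R d).
Local Notation bmass := (@bmass R d).
Local Notation ball_mass := (@ball_mass R d).

Lemma ball_weight_mul_ge0 e (x : V) (r : R) : (cnorm x < 1 -> 0 <= r) ->
  0 <= ball_weight e (cnorm x ^+ 2) * r.
Proof.
move=> r0; have [x1|x1] := ltP (cnorm x) 1; first by rewrite mulr_ge0 ?r0 ?ball_weight_ge0.
by rewrite ball_weight1 ?mul0r// expr_ge1// cnorm_ge0.
Qed.

Lemma ball_weight_shift e (n : nat) (x : V) (r : R) :
  ball_weight e (cnorm x ^+ 2) * ((1 - cnorm x ^+ 2) ^+ n * r) =
  ball_weight (n%:R + e) (cnorm x ^+ 2) * r.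
Proof.
have [x1|x1] := ltP (cnorm x ^+ 2) 1; last by rewrite !ball_weight1// !mul0r.
have u0 : 0 < 1 - cnorm x ^+ 2 by rewrite subr_gt0.
rewrite /ball_weight x1 mulrA; congr (_ * _).
by rewrite -addrA [RHS]powRD ?(gt_eqF u0) ?implybT// powR_mulrn ?(ltW u0)// mulrC.
Qed.

Lemma radial_int_shift e (n : nat) (g : V -> R) :
  radial_int (ball_weight e) (fun x => (1 - cnorm x ^+ 2) ^+ n * g x) =
  radial_int (ball_weight (n%:R + e)) g.
Proof. by apply: eq_integral => x _; rewrite ball_weight_shift. Qed.

Lemma ereal_close (F G : \bar R) (a : R) : (0 <= F)%E -> (0 <= G)%E -> (G < +oo)%E ->
  (F <= G + a%:E)%E -> (G <= F + a%:E)%E -> (F < +oo)%E /\ `|fine F - fine G| <= a.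
Proof.
move: F G => [F| |] [G| |] //= _ _ _; rewrite -!EFinD !lee_fin => h1 h2.
by split; [exact: ltry|rewrite ler_norml; apply/andP; split; lra].
Qed.

Lemma radial_approx_le e (f g k l : V -> R) (eta C : R) : 0 <= eta -> 0 <= C ->
  measurable_fun setT f -> measurable_fun setT g ->
  measurable_fun setT k -> measurable_fun setT l ->
  (forall x, cnorm x < 1 -> [/\ 0 <= f x, 0 <= g x, 0 <= k x & 0 <= l x]) ->
  (forall x, cnorm x < 1 -> f x <= g x + eta * k x + C * l x) ->
  (radial_int (ball_weight e) f <= radial_int (ball_weight e) g +
     (eta%:E * radial_int (ball_weight e) k + C%:E * radial_int (ball_weight e) l))%E.
Proof.
move=> eta0 C0 mf mg mk ml p0 le.
have mi (h : V -> R) : measurable_fun setT h ->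
    measurable_fun setT (fun x : V => (ball_weight e (cnorm x ^+ 2) * h x)%:E).
  by apply: measurable_radial_int => //; exact: measurable_ball_weight.
have pf x : (0 <= (ball_weight e (cnorm x ^+ 2) * f x)%:E)%E.
  by rewrite lee_fin ball_weight_mul_ge0// => /p0[].
have pg x : (0 <= (ball_weight e (cnorm x ^+ 2) * g x)%:E)%E.
  by rewrite lee_fin ball_weight_mul_ge0// => /p0[].
have pk x : (0 <= (ball_weight e (cnorm x ^+ 2) * k x)%:E)%E.
  by rewrite lee_fin ball_weight_mul_ge0// => /p0[].
have pl x : (0 <= (ball_weight e (cnorm x ^+ 2) * l x)%:E)%E.
  by rewrite lee_fin ball_weight_mul_ge0// => /p0[].
have mek : measurable_fun setT (fun x : V => eta%:E * (ball_weight e (cnorm x ^+ 2) * k x)%:E)%E.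
  by apply: emeasurable_funM => //; exact: mi.
have mcl : measurable_fun setT (fun x : V => C%:E * (ball_weight e (cnorm x ^+ 2) * l x)%:E)%E.
  by apply: emeasurable_funM => //; exact: mi.
rewrite addeA /radial_int (integralZ_ge0 _ (mi _ mk) pk eta0) (integralZ_ge0 _ (mi _ ml) pl C0).
have pek x : (0 <= eta%:E * (ball_weight e (cnorm x ^+ 2) * k x)%:E)%E by rewrite mule_ge0.
have pcl x : (0 <= C%:E * (ball_weight e (cnorm x ^+ 2) * l x)%:E)%E by rewrite mule_ge0.
rewrite -(ge0_integralD m measurableT (fun x _ => pg x) (mi _ mg) (fun x _ => pek x) mek).
rewrite -(ge0_integralD m measurableT (fun x _ => adde_ge0 (pg x) (pek x)) _ (fun x _ => pcl x) mcl); last first.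
  by apply: emeasurable_funD => //; exact: mi.
apply: ge0_le_integral => //; [exact: mi| |].
  by apply: emeasurable_funD => //; apply: emeasurable_funD => //; exact: mi.
move=> x _; rewrite -!EFinM -!EFinD lee_fin.
have [x1|x1] := ltP (cnorm x ^+ 2) 1; last by rewrite ball_weight1// !mul0r !mulr0 !addr0.
rewrite cnorm_lt1 in x1; apply: le_trans (ler_wpM2l (ball_weight_ge0 _ _) (le x x1)) _.
by rewrite le_eqVlt; apply/orP; left; apply/eqP; ring.
Qed.

(** Transfers a pointwise approximation to integrals. The second error term carries a factor
    1 - |x|^2, which raises the exponent e - 1 to e: its integral stays bounded as e tends
    to 0, unlike the mass of (1 - |x|^2)^(e - 1). *)
Lemma radial_approx e (f g k l : V -> R) (eta C : R) : 0 < e -> 0 <= eta -> 0 <= C ->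
  measurable_fun setT f -> measurable_fun setT g ->
  measurable_fun setT k -> measurable_fun setT l ->
  (forall x, cnorm x < 1 -> [/\ 0 <= f x, 0 <= g x, 0 <= k x & 0 <= l x]) ->
  radial_int (ball_weight e) k = ball_mass e ->
  radial_int (ball_weight (1 + e)) l = ball_mass (1 + e) ->
  (forall x, cnorm x < 1 -> `|f x - g x| <= eta * k x + C * ((1 - cnorm x ^+ 2) * l x)) ->
  (radial_int (ball_weight e) g < +oo)%E ->
  (radial_int (ball_weight e) f < +oo)%E /\
  `|fine (radial_int (ball_weight e) f) - fine (radial_int (ball_weight e) g)| <=
    eta * bmass e + C * bmass 1.
Proof.
move=> e0 eta0 C0 mf mg mk ml p0 kE lE fg goo.
have mul : measurable_fun setT (fun x : V => (1 - cnorm x ^+ 2) * l x).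
  apply: measurable_funM => //; apply: measurable_funB => //.
  by apply: measurable_funX; exact: measurable_cnorm.
have p1 x : cnorm x < 1 -> [/\ 0 <= f x, 0 <= g x, 0 <= k x & 0 <= (1 - cnorm x ^+ 2) * l x].
  by move=> x1; have [? ? ? ?] := p0 x x1; split => //; rewrite mulr_ge0// ltW// ball_sqr_lt1.
have h1 := @radial_approx_le e f g k _ eta C eta0 C0 mf mg mk mul p1.
have h2 := @radial_approx_le e g f k _ eta C eta0 C0 mg mf mk mul.
have {}h1 := h1 (fun x x1 => ltac:(by move: (fg x x1); rewrite ler_norml => /andP[_]; rewrite lerBlDl addrA)).
have {}h2 := h2 (fun x x1 => ltac:(by have [] := p1 x x1)).
have {}h2 := h2 (fun x x1 => ltac:(by move: (fg x x1); rewrite ler_norml => /andP[+ _]; rewrite lerNl opprB lerBlDl addrA)).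
have lE' : radial_int (ball_weight e) (fun x => (1 - cnorm x ^+ 2) * l x) = ball_mass (1 + e).
  rewrite -lE -(radial_int_shift e 1 l) /radial_int.
  by apply: eq_integral => x _; rewrite expr1.
move: h1 h2; rewrite kE lE' (bmassE d e0) (bmassE d (addr_gt0 ltr01 e0)).
have b1 : bmass (1 + e) <= bmass 1 by apply: bmass_le => //; rewrite lerDl ltW.
have f0 : (0 <= radial_int (ball_weight e) f)%E.
  by apply: integral_ge0 => x _; rewrite lee_fin ball_weight_mul_ge0// => /p0[].
have g0 : (0 <= radial_int (ball_weight e) g)%E.
  by apply: integral_ge0 => x _; rewrite lee_fin ball_weight_mul_ge0// => /p0[].
rewrite -!EFinM -EFinD => h1 h2.
have h3 : eta * bmass e + C * bmass (1 + e) <= eta * bmass e + C * bmass 1.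
  by rewrite lerD2l; exact: ler_wpM2l.
have [foo h] := ereal_close f0 g0 goo h1 h2.
by split; [exact: foo|exact: le_trans h h3].
Qed.

(** The pole None stands for the constant 1: g_X and g_X(.; f) are then treated
    together. *)
Definition pole_kernel (o : option V) (x : V) : R :=
  if o is Some zeta then poisson_szego x zeta else 1.

Definition is_pole (o : option V) : Prop :=
  if o is Some zeta then cnorm zeta = 1 else True.

Lemma pole_kernel_ge0 o x : cnorm x < 1 -> 0 <= pole_kernel o x.
Proof.
case: o => [zeta|] //= x1; rewrite /poisson_szego.
by rewrite divr_ge0// exprn_ge0 ?normc_ge0// ltW// ball_sqr_lt1.
Qed.

Lemma measurable_poisson dT (T : measurableType dT) (g h : T -> V) :
  measurable_fun setT g -> measurable_fun setT h ->
  measurable_fun setT (fun t => poisson_szego (g t) (h t)).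
Proof.
move=> mg mh; apply: measurable_funM.
  apply: measurable_funX; apply: measurable_funB => //; apply: measurable_funX.
  exact: (measurableT_comp (@measurable_cnorm R d) mg).
apply: (measurableT_comp (@measurable_inv R)); apply: measurable_funX.
exact: measurable_normc_1Bhdot.
Qed.

Lemma measurable_pole_kernel o : measurable_fun setT (pole_kernel o).
Proof. case: o => [zeta|]; last exact: measurable_cst.
exact: (@measurable_poisson _ V idfun (fun=> zeta) (@measurable_id _ _ _) (measurable_cst _)). Qed.

Lemma measurable_jac z : measurable_fun setT (@jac R d z).
Proof.
apply: measurable_funM => //; apply: (measurableT_comp (@measurable_inv R)).
by apply: measurable_funX; exact: measurable_normc_1Bhdot.
Qed.

Lemma measurable_decay z : measurable_fun setT (@decay R d z).
Proof.
have mt : measurable_fun setT (@bergman_t R d z).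
  rewrite (funext (bergman_tE z)); apply: measurable_funM; first exact: measurable_jac.
  by apply: measurable_funB => //; apply: measurable_funX; exact: measurable_cnorm.
apply: measurable_funM => //; apply: (measurableT_comp (@measurable_inv R)).
apply: measurable_funX; apply: measurable_funD => //.
by apply: (measurableT_comp (continuous_measurable_fun (@sqrt_continuous R))); exact: measurable_funB.
Qed.

Lemma normc_1Bhdot_sym (x y : V) : normc (1 - hdot x y) = normc (1 - hdot y x).
Proof. by rewrite -(normcJ (1 - hdot x y)) rmorphB rmorph1 /= -hdotC. Qed.

Lemma poisson_szegoE (zeta x : V) :
  poisson_szego x zeta = (1 - cnorm x ^+ 2) ^+ d * normc (1 - hdot x zeta) ^- (2 * d).
Proof. by rewrite /poisson_szego normc_1Bhdot_sym. Qed.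

(** For |zeta| = 1 the spherical mean of |1 - <x, zeta>|^(-2 d) is (1 - |x|^2)^(-d), which
    cancels the numerator of the Poisson kernel. *)
Lemma poisson_mean (zeta : V) e : cnorm zeta = 1 -> 0 < e ->
  radial_int (ball_weight e) (fun x => poisson_szego x zeta) = ball_mass e.
Proof.
move=> zeta1 e0; rewrite (funext (poisson_szegoE zeta)) radial_int_shift.
rewrite (spherical_identity d0 (@measurable_ball_weight R _)) ?zeta1//; last 2 first.
- by move=> t; exact: ball_weight_ge0.
- by move=> t; exact: ball_weight1.
rewrite -radial_int_shift; apply: eq_integral => x _.
have [x1|x1] := ltP (cnorm x ^+ 2) 1; last by rewrite !ball_weight1// !mul0r.
by rewrite expr1n mulr1 mulfV// expf_neq0// gt_eqF// subr_gt0.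
Qed.

Lemma pole_kernel_mean o e : is_pole o -> 0 < e ->
  radial_int (ball_weight e) (pole_kernel o) = ball_mass e.
Proof. by case: o => [zeta|] //= zeta1 e0; exact: poisson_mean. Qed.

Lemma jac_mean (z : V) e : cnorm z < 1 ->
  radial_int (ball_weight e) (fun x => jac z x ^+ d) =
  radial_int (ball_weight e)
    (fun x : V => (1 - cnorm z ^+ 2) ^+ d * (1 - cnorm x ^+ 2 * cnorm z ^+ 2) ^- d).
Proof.
move=> z1; have z0 := exprn_ge0 d (ltW (ball_sqr_lt1 z1)).
have mp (h : V -> R) : measurable_fun setT h ->
    measurable_fun setT (fun x : V => (ball_weight e (cnorm x ^+ 2) * h x)%:E).
  by apply: measurable_radial_int => //; exact: measurable_ball_weight.
have E1 : radial_int (ball_weight e) (fun x => jac z x ^+ d) =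
    (((1 - cnorm z ^+ 2) ^+ d)%:E * radial_int (ball_weight e) (fun x => (normc (1 - hdot x z) ^- (2 * d))%R))%E.
  rewrite /radial_int integralZ_ge0//; last first.
  - by move=> x; rewrite lee_fin mulr_ge0 ?ball_weight_ge0// invr_ge0 exprn_ge0 ?normc_ge0.
  - apply: mp; apply: (measurableT_comp (@measurable_inv R)).
    by apply: measurable_funX; exact: measurable_normc_1Bhdot.
  apply: eq_integral => x _; rewrite -EFinM; congr EFin.
  by rewrite /jac expr_div_n -exprM; ring.
rewrite E1 (spherical_identity d0 (@measurable_ball_weight R _)) ?ltW//; last 2 first.
- by move=> t; exact: ball_weight_ge0.
- by move=> t; exact: ball_weight1.
rewrite /radial_int integralZ_ge0//.
- by apply: eq_integral => x _; rewrite -EFinM; congr EFin; rewrite mulrCA.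
- apply: mp; apply: (measurableT_comp (@measurable_inv R)).
  apply: measurable_funX; apply: measurable_funB => //; apply: measurable_funM => //.
  by apply: measurable_funX; exact: measurable_cnorm.
- move=> x; rewrite lee_fin ball_weight_mul_ge0// => x1.
  rewrite invr_ge0 exprn_ge0// subr_ge0 mulr_ile1 ?sqr_ge0// expr_le1 ?cnorm_ge0//; exact: ltW.
Qed.

Lemma radial_intC e (c : R) : 0 < e -> 0 <= c ->
  radial_int (ball_weight e) (fun _ : V => c) = (c * bmass e)%:E.
Proof.
move=> e0 c0; rewrite EFinM -(bmassE d e0) /ball_mass /radial_int integralZ_ge0//.
- by apply: eq_integral => x _; rewrite -EFinM mulr1 mulrC.
- by apply: measurable_radial_int => //; exact: measurable_ball_weight.
- by move=> x; rewrite lee_fin mulr1 ball_weight_ge0.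
Qed.

Lemma poisson_meanZ e (c : R) (zeta : V) : cnorm zeta = 1 -> 0 < e -> 0 <= c ->
  radial_int (ball_weight e) (fun x : V => c * poisson_szego x zeta) = (c * bmass e)%:E.
Proof.
move=> zeta1 e0 c0; rewrite EFinM -(bmassE d e0) -(poisson_mean zeta1 e0) /radial_int integralZ_ge0//.
- by apply: eq_integral => x _; rewrite -EFinM mulrCA.
- by apply: measurable_radial_int; [exact: measurable_ball_weight|exact: (measurable_pole_kernel (Some zeta))].
- by move=> x; rewrite lee_fin ball_weight_mul_ge0// => /(@pole_kernel_ge0 (Some zeta)).
Qed.

(** With a pole zeta, the mass of the Poisson kernel concentrates at zeta, where jac z ^+ d
    takes the value of the Poisson kernel at z. Without a pole, the spherical mean of
    jac z ^+ d is explicit and tends to 1 at the sphere. *)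
Lemma pole_jac_asymp (z : V) eta : cnorm z < 1 -> 0 < eta -> exists2 C, 0 <= C &
  forall e o, 0 < e -> is_pole o ->
  (radial_int (ball_weight e) (fun x => ((jac z x / 4) ^+ d * pole_kernel o x)%R) < +oo)%E /\
  `|fine (radial_int (ball_weight e) (fun x => (jac z x / 4) ^+ d * pole_kernel o x)) -
    4 ^- d * pole_kernel o z * bmass e| <= eta * bmass e + C.
Proof.
move=> z1 eta0; have u0 := ball_sqr_lt1 z1.
have [C2 C20 H2] := @jac_poisson_approx R d z z1 eta eta0.
pose C3 : R := d%:R / (1 - cnorm z ^+ 2).
have C30 : 0 <= C3 by rewrite divr_ge0// ltW.
have b10 := ltW (bmass1_gt0 R d).
have f4 : 0 <= (4 ^- d : R) <= 1 by rewrite invr_ge0 exprn_ge0//= invf_le1 ?exprn_gt0// exprn_ege1// ler1n.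
have /andP[f40 f41] := f4.
have jac0 x : 0 <= jac z x by rewrite divr_ge0 ?exprn_ge0 ?normc_ge0// ltW.
exists ((C2 + C3) * bmass 1); first by rewrite mulr_ge0// addr_ge0.
move=> e [zeta|] e0 /= po.
  have T0 : 0 <= poisson_szego z zeta by exact: (@pole_kernel_ge0 (Some zeta)).
  have gE := poisson_meanZ po e0 (mulr_ge0 f40 T0).
  have := @radial_approx e (fun x => (jac z x / 4) ^+ d * poisson_szego x zeta)
    (fun x => 4 ^- d * poisson_szego z zeta * poisson_szego x zeta)
    (fun x => poisson_szego x zeta) (fun=> 1) eta C2 e0 (ltW eta0) C20.
  rewrite gE /= => /(_ _ _ _ _ _ _ _ _ _)[].
  - apply: measurable_funM; last exact: (measurable_pole_kernel (Some zeta)).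
    by apply: measurable_funX; apply: measurable_funM => //; exact: measurable_jac.
  - by apply: measurable_funM => //; exact: (measurable_pole_kernel (Some zeta)).
  - exact: (measurable_pole_kernel (Some zeta)).
  - by [].
  - move=> x x1; have p0 := @pole_kernel_ge0 (Some zeta) x x1.
    split => //; first by apply: mulr_ge0 => //; apply: exprn_ge0; exact: mulr_ge0.
    by apply: mulr_ge0 => //; exact: mulr_ge0.
  - exact: poisson_mean.
  - by [].
  - move=> x x1; rewrite expr_div_n -(mulrA (jac z x ^+ d)) (mulrC (jac z x ^+ d)) -!(mulrA (4 ^- d)).
    rewrite (mulrC (poisson_szego x zeta)) -mulrBr -mulrBl normrM (ger0_norm f40) mulr1.
    have p0 := @pole_kernel_ge0 (Some zeta) x x1; rewrite /= in p0.
    have n0 : 0 < normc (1 - hdot x zeta) by rewrite normc_1Bhdot_gt0 ?po.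
    have := H2 x zeta x1 po; rewrite (@jac_sphere R d z zeta); last first.
      by rewrite normc_1Bhdot_sym gt_eqF// normc_1Bhdot_gt0 ?po.
    move=> h; rewrite normrM (ger0_norm p0).
    apply: (@le_trans _ _ (1 * (`|jac z x ^+ d - poisson_szego z zeta| * poisson_szego x zeta))).
      by rewrite ler_wpM2r// mulr_ge0.
    rewrite mul1r; apply: le_trans (ler_wpM2r p0 h) _; rewrite mulrDl lerD2l -mulrA ler_wpM2l//.
    rewrite poisson_szegoE mulrCA mulfV ?mulr1 ?expf_neq0 ?gt_eqF//.
    have ux := ball_sqr_lt1 x1; rewrite -[leRHS]expr1 ler_wiXn2l ?(ltW ux)//.
    by rewrite gerBl sqr_ge0.
  - exact: ltry.
  move=> h1 h2; split => //; apply: le_trans h2 _.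
  by rewrite lerD2l ler_wpM2r// lerDl.
have -> : (fun x => (jac z x / 4) ^+ d * 1) = (fun x => 4 ^- d * jac z x ^+ d).
  by apply/funext => x; rewrite mulr1 expr_div_n mulrC.
have gE := radial_intC e0 f40; rewrite mulr1.
pose g (x : V) := (1 - cnorm z ^+ 2) ^+ d * (1 - cnorm x ^+ 2 * cnorm z ^+ 2) ^- d.
have mg : measurable_fun setT g.
  apply: measurable_funM => //; apply: (measurableT_comp (@measurable_inv R)).
  apply: measurable_funX; apply: measurable_funB => //; apply: measurable_funM => //.
  by apply: measurable_funX; exact: measurable_cnorm.
have g0 x : cnorm x < 1 -> 0 <= g x.
  move=> x1; rewrite mulr_ge0 ?exprn_ge0 ?(ltW u0)// invr_ge0 exprn_ge0// subr_ge0.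
  rewrite mulr_ile1 ?sqr_ge0// expr_le1 ?cnorm_ge0//; exact: ltW.
have -> : radial_int (ball_weight e) (fun x => 4 ^- d * jac z x ^+ d) =
    radial_int (ball_weight e) (fun x => 4 ^- d * g x).
  have mj : measurable_fun setT (fun x => jac z x ^+ d).
    by apply: measurable_funX; exact: measurable_jac.
  have Z (h : V -> R) : measurable_fun setT h -> (forall x, cnorm x < 1 -> 0 <= h x) ->
     radial_int (ball_weight e) (fun x => 4 ^- d * h x) = ((4 ^- d)%:E * radial_int (ball_weight e) h)%E.
    move=> mh h0; rewrite /radial_int integralZ_ge0//.
    - by apply: eq_integral => x _; rewrite -EFinM mulrCA.
    - by apply: measurable_radial_int => //; exact: measurable_ball_weight.
    - by move=> x; rewrite lee_fin ball_weight_mul_ge0// => /h0.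
  rewrite !Z//; first by rewrite jac_mean.
  by move=> x _; exact: exprn_ge0.
have := @radial_approx e (fun x => 4 ^- d * g x) (fun=> 4 ^- d) (fun=> 1) (fun=> 1) eta C3 e0 (ltW eta0) C30.
rewrite gE /= => /(_ _ _ _ _ _ _ _ _ _)[].
- exact: measurable_funM.
- by [].
- by [].
- by [].
- by move=> x x1; split => //; rewrite mulr_ge0// g0.
- by [].
- by [].
- move=> x x1; rewrite !mulr1 -[X in `|_ - X|]mulr1 -mulrBr normrM (ger0_norm f40).
  have ux := ball_sqr_lt1 x1.
  have x20 := sqr_ge0 (cnorm x); have z20 := sqr_ge0 (cnorm z).
  have vx : 0 < 1 - cnorm x ^+ 2 * cnorm z ^+ 2 by nra.
  have G : g x = ((1 - cnorm z ^+ 2) / (1 - cnorm x ^+ 2 * cnorm z ^+ 2)) ^+ d.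
    by rewrite expr_div_n.
  have G1 : (1 - cnorm z ^+ 2) / (1 - cnorm x ^+ 2 * cnorm z ^+ 2) <= 1.
    by rewrite ler_pdivrMr// mul1r; nra.
  have h : `|g x - 1| <= d%:R * `|(1 - cnorm z ^+ 2) / (1 - cnorm x ^+ 2 * cnorm z ^+ 2) - 1|.
    rewrite G; move: (_ / _) (divr_ge0 (ltW u0) (ltW vx)) G1 => q q0 q1.
    have := @normrX_sub_le R d 1 q 1; rewrite !expr1n mulr1 ler01 lexx q0 q1; exact.
  have : `|(1 - cnorm z ^+ 2) / (1 - cnorm x ^+ 2 * cnorm z ^+ 2) - 1| <=
     (1 - cnorm x ^+ 2) / (1 - cnorm z ^+ 2).
    rewrite distrC ger0_norm ?subr_ge0//.
    have -> : 1 - (1 - cnorm z ^+ 2) / (1 - cnorm x ^+ 2 * cnorm z ^+ 2) =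
      (cnorm z ^+ 2 * (1 - cnorm x ^+ 2)) / (1 - cnorm x ^+ 2 * cnorm z ^+ 2).
      have /eqP := lt0r_neq0 vx; move: (cnorm x ^+ 2) (cnorm z ^+ 2) => a b /eqP ab.
      by field; exact: ab.
    rewrite ler_pdivrMr// [leRHS]mulrAC ler_pdivlMr//.
    move: (cnorm x ^+ 2) (cnorm z ^+ 2) ux u0 x20 z20 => a b a1 b1 a0 b0; rewrite -subr_ge0.
    have -> : (1 - a) * (1 - a * b) - b * (1 - a) * (1 - b) =
       (1 - a) * ((1 - b) ^+ 2 + b * (1 - a)) by ring.
    by rewrite mulr_ge0 ?(ltW a1)// addr_ge0 ?sqr_ge0// mulr_ge0// ltW.
  move=> h'; apply: (@le_trans _ _ (1 * `|g x - 1|)); first by rewrite ler_wpM2r.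
  rewrite mul1r; apply: le_trans h _; apply: le_trans (ler_wpM2l _ h') _ => //.
  rewrite -[leLHS]add0r; apply: lerD; first exact: ltW.
  by rewrite /C3 -!mulrA (mulrC (_^-1)).
- exact: ltry.
move=> h1 h2; split => //; apply: le_trans h2 _.
by rewrite lerD2l ler_wpM2r// lerDr.
Qed.

(** The integral over the ball, against Lebesgue measure, of
    exp (- s d_B (x, z)) K (x, x) k (x), for s = d + e and k the kernel of the pole o. *)
Definition energy (e : R) (z : V) (o : option V) : \bar R :=
  radial_int (ball_weight e)
    (fun x => (decay z x / (1 - cnorm x ^+ 2)) `^ (d%:R + e) * pole_kernel o x).

Lemma measurable_decay_powR z (s : R) :
  measurable_fun setT (fun x : V => (decay z x / (1 - cnorm x ^+ 2)) `^ s).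
Proof.
apply: (measurableT_comp (measurable_powR _)); apply: measurable_funM; first exact: measurable_decay.
apply: (measurableT_comp (@measurable_inv R)); apply: measurable_funB => //.
by apply: measurable_funX; exact: measurable_cnorm.
Qed.

Lemma energy_asymp (z : V) eta : cnorm z < 1 -> 0 < eta -> exists C e0, [/\ 0 <= C, 0 < e0 &
  forall e o, 0 < e < e0 -> is_pole o ->
  (energy e z o < +oo)%E /\
  `|fine (energy e z o) - 4 ^- d * pole_kernel o z * bmass e| <= eta * bmass e + C].
Proof.
move=> z1 eta0; have eta20 : 0 < eta / 2 by rewrite divr_gt0.
have [C1 [e1 [C10 e10 H1]]] := @decay_powR_approx R d z z1 (eta / 2) eta20.
have [C2 C20 H2] := pole_jac_asymp z1 eta20.
have u0 := ball_sqr_lt1 z1.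
have jac0 x : 0 <= jac z x by rewrite divr_ge0 ?exprn_ge0 ?normc_ge0// ltW.
have b10 := ltW (bmass1_gt0 R d).
exists (C1 * bmass 1 + C2), e1; split => //; first by rewrite addr_ge0// mulr_ge0.
move=> e o ee po; have /andP[e0 ee1] := ee; have [foo fle] := H2 e o e0 po.
have mo := measurable_pole_kernel o.
have := @radial_approx e
    (fun x => (decay z x / (1 - cnorm x ^+ 2)) `^ (d%:R + e) * pole_kernel o x)
    (fun x => (jac z x / 4) ^+ d * pole_kernel o x)
    (pole_kernel o) (pole_kernel o) (eta / 2) C1 e0 (ltW eta20) C10.
move=> /(_ _ _ _ _ _ _ _ _ _)[].
- by apply: measurable_funM => //; exact: measurable_decay_powR.
- by apply: measurable_funM => //; apply: measurable_funX; apply: measurable_funM => //; exact: measurable_jac.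
- by [].
- by [].
- move=> x x1; have p0 := pole_kernel_ge0 o x1.
  split => //; first by rewrite mulr_ge0 ?powR_ge0.
  by apply: mulr_ge0 => //; apply: exprn_ge0; exact: mulr_ge0.
- exact: pole_kernel_mean.
- by apply: pole_kernel_mean => //; exact: addr_gt0.
- move=> x x1; have p0 := pole_kernel_ge0 o x1.
  rewrite -mulrBl normrM (ger0_norm p0) mulrA -mulrDl ler_wpM2r//; exact: H1.
- exact: foo.
move=> h1 h2; split; first exact: h1.
apply: le_trans (ler_distD _ _ _) _; apply: le_trans (lerD h2 fle) _.
by rewrite addrACA -mulrDl -splitr.
Qed.

(** By bmass_asymp, e bmass e tends to d bmass 1, while the bounded part of the error in
    energy_asymp disappears after multiplication by e. *)
Lemma energy_limit (z : V) eta : cnorm z < 1 -> 0 < eta -> exists2 e0, 0 < e0 &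
  forall e o, 0 < e < e0 -> is_pole o ->
  (energy e z o < +oo)%E /\
  `|e * (fine (energy e z o) / bmass 1) - 4 ^- d * d%:R * pole_kernel o z| <= eta.
Proof.
move=> z1 eta0; have b10 := bmass1_gt0 R d.
have [q0 [q1 [q00 q11 qx]]] := jac_bounds z1.
pose T := 4 ^- d * q1 ^+ d.
have q10 : 0 < q1 by exact: lt_le_trans q11.
have T0 : 0 <= T by rewrite mulr_ge0 ?invr_ge0 ?exprn_ge0// ltW.
pose K := bmass 1 + d%:R * 2 * bmass 2^-1.
have K0 : 0 <= K by rewrite addr_ge0 ?mulr_ge0 ?bmass_ge0.
pose D := d%:R * bmass 1 + K.
have D0 : 0 < D by rewrite ltr_wpDl ?mulr_ge0 ?ltr_wpDr ?mulr_ge0 ?bmass_ge0 ?(ltW b10).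
pose eta' := eta * bmass 1 / (2 * D).
have eta'0 : 0 < eta' by rewrite divr_gt0 ?mulr_gt0.
have [C [e1 [C0 e10 H]]] := energy_asymp z1 eta'0.
have CT0 : 0 < C + T * K + 1 by rewrite ltr_wpDl// addr_ge0// mulr_ge0.
exists (Num.min 1 (Num.min e1 (eta * bmass 1 / (2 * (C + T * K + 1))))).
  by rewrite !lt_min ltr01 e10 divr_gt0 ?mulr_gt0.
move=> e o /andP[e0]; rewrite !lt_min => /and3P[ee1 ee2 ee3] po.
have [foo h] := H e o (introT andP (conj e0 ee2)) po; split => //.
have t0 := pole_kernel_ge0 o z1.
have tT : 4 ^- d * pole_kernel o z <= T.
  rewrite ler_wpM2l ?invr_ge0 ?exprn_ge0//; case: {h foo t0} o po => [zeta|] /= po; last first.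
    exact: exprn_ege1.
  rewrite -(@jac_sphere R d z zeta); last first.
    by rewrite normc_1Bhdot_sym gt_eqF// normc_1Bhdot_gt0 ?po.
  have /andP[j0 j1] : q0 <= jac z zeta <= q1 by apply: qx; rewrite po.
  by apply: lerXn2r => //; rewrite nnegrE ?(ltW q10)// (le_trans (ltW q00)).
have {}t0 : 0 <= 4 ^- d * pole_kernel o z by rewrite mulr_ge0 ?invr_ge0 ?exprn_ge0.
have ba := bmass_asymp d e0; rewrite -/K in ba.
rewrite [4 ^- d * _ * _]mulrAC.
move: h t0 tT; move: (4 ^- d * _) (fine _) => t F h t0 tT.
have bn : 0 <= bmass e by exact: bmass_ge0.
have eb : e * bmass e <= D.
  move: ba; rewrite ler_norml => /andP[_]; rewrite lerBlDr => /le_trans; apply.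
  by rewrite addrC lerD2l ler_piMr// ltW.
have -> : e * (F / bmass 1) - t * d%:R =
  (e * (F - t * bmass e) + t * (e * bmass e - d%:R * bmass 1)) / bmass 1.
  by field; rewrite gt_eqF.
rewrite normrM normfV (gtr0_norm b10) ler_pdivrMr//.
apply: le_trans (ler_normD _ _) _; rewrite !normrM (gtr0_norm e0) (ger0_norm t0).
apply: (@le_trans _ _ (e * (eta' * bmass e + C) + T * (K * e))).
  by apply: lerD; [rewrite ler_pM2l|apply: ler_pM].
have -> : e * (eta' * bmass e + C) + T * (K * e) = eta' * (e * bmass e) + e * (C + T * K) by ring.
rewrite [leRHS](_ : _ = eta' * D + eta * bmass 1 / 2); last first.
  by rewrite /eta'; field; rewrite gt_eqF.
apply: lerD; first by rewrite ler_pM2l.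
apply: (@le_trans _ _ (e * (C + T * K + 1))); first by rewrite ler_pM2l// lerDl.
move: ee3; rewrite ltr_pdivlMr ?mulr_gt0// mulrCA; clear; lra.
Qed.

End ball_asymptotics.

Local Close Scope ereal_scope.

(** * Configurations as counting measures *)

Section exhaustion.
Context (R : realType) (d : nat).
Local Notation V := 'rV[R[i]]_d.

Lemma closed_cnorm_le (r : R) : closed [set x : V | cnorm x <= r].
Proof.
apply: (@closed_comp _ _ (@cnorm R d) [set t | t <= r]); last exact: closed_le.
by move=> x _; exact: cnorm_continuous.
Qed.

Lemma continuous_complex : continuous (fun p : R * R => p.1 +i* p.2 : R[i]).
Proof.
move=> p A /nbhs_ballP[e /= e0 eA].
have [r r0 eE] : exists2 r : R, 0 < r & e = r%:C.
  move: e0; rewrite ltcE /= => /andP[/eqP ime re0].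
  by exists (complex.Re e) => //; case: e {eA re0} ime => a b /= ->.
apply/nbhs_ballP; exists (r / 2) => /=; first by rewrite divr_gt0.
move=> q [pq1 pq2]; apply: eA; rewrite eE /ball /=.
have -> : (p.1 +i* p.2) - (q.1 +i* q.2) =
   (p.1 - q.1)%:C + 'i * (p.2 - q.2)%:C :> R[i].
  by apply/eqP; rewrite eq_complex /=; apply/andP; split; apply/eqP => /=; ring.
apply: le_lt_trans (ler_normD _ _) _; rewrite normrM !normc_def /=.
rewrite !expr0n /= !addr0 add0r expr1n sqrtr1 mul1r !sqrtr_sqr -rmorphD ltcR.
by rewrite [r]splitr ltrD.
Qed.

Lemma compact_cnorm_le (r : R) : compact [set x : V | cnorm x <= r].
Proof.
pose D : set R[i] := (fun p : R * R => p.1 +i* p.2) @` (`[- r, r] `*` `[- r, r]).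
have cD : compact D.
  apply: continuous_compact; first exact/continuous_subspaceT/continuous_complex.
  by apply: compact_setX; exact: segment_compact.
have cP : compact [set v : V | forall i, D (v ord0 i)] by exact: (rV_compact (fun=> cD)).
apply: (subclosed_compact (@closed_cnorm_le r) cP) => x /= xr i.
have ni : normc (x ord0 i) <= r.
  apply: le_trans xr; rewrite -ler_sqr ?nnegrE ?normc_ge0 ?cnorm_ge0// cnorm_sqr.
  by rewrite (bigD1 i)//= lerDl sumr_ge0// => k _; rewrite exprn_ge0 ?normc_ge0.
exists (complex.Re (x ord0 i), complex.Im (x ord0 i)); last by case: (x ord0 i).
have := Re_le_normc (x ord0 i); have := Im_le_normc (x ord0 i).
rewrite !ler_norml => /andP[? ?] /andP[? ?].
by split; rewrite /= in_itv /=; apply/andP; split; lra.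
Qed.

(** A partition of the ball into relatively compact shells: each contains finitely many
    points of a configuration. *)
Definition shell (n : nat) : set V :=
  [set x | cnorm x < 1 /\ n%:R <= (1 - cnorm x)^-1 < n.+1%:R].

Lemma shell_sub n : shell n `<=` [set x | cnorm x <= 1 - n.+1%:R^-1].
Proof.
move=> x [x1 /andP[_ xn]] /=; rewrite lerBrDl -lerBrDr.
have u0 : 0 < 1 - cnorm x by rewrite subr_gt0.
by rewrite -[leRHS]invrK lef_pV2 ?posrE ?invr_gt0// ltW.
Qed.

Lemma measurable_shell n : measurable (shell n).
Proof.
have mc : measurable_fun setT (fun x : V => (1 - cnorm x)^-1).
  apply: (measurableT_comp (@measurable_inv R)); apply: measurable_funB => //.
  exact: measurable_cnorm.
rewrite [X in measurable X](_ : _ = @unit_ball R d `&`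
   ((fun x : V => (1 - cnorm x)^-1) @^-1` `[n%:R, n.+1%:R[%classic)).
  apply: measurableI; first exact: measurable_unit_ball.
  by rewrite -[X in measurable X]setTI; exact: mc.
by apply/seteqP; split => x /=; rewrite /shell /unit_ball /= in_itv.
Qed.

Lemma shell_bigcup : \bigcup_n shell n = @unit_ball R d.
Proof.
apply/seteqP; split => [x [n _ []] //|x x1]; exists (Num.truncn (1 - cnorm x)^-1) => //.
split => //; have u0 : 0 <= (1 - cnorm x)^-1 by rewrite invr_ge0 subr_ge0 ltW.
by rewrite truncnS_gt andbT truncn_le.
Qed.

Lemma trivIset_shell : trivIset setT shell.
Proof.
apply/trivIsetP => i j _ _ ij; apply/seteqP; split => // x [[_ /andP[a b]] [_ /andP[e f]]].
have := le_lt_trans a f; have := le_lt_trans e b; rewrite !ltr_nat !ltnS => h1 h2.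
by move: ij; rewrite eqn_leq h1 h2.
Qed.

Lemma closed_point (x : V) : closed [set x].
Proof.
rewrite [X in closed X](_ : _ = (fun y : V => cnorm (y - x)) @^-1` [set t | t <= 0]).
  apply: closed_comp; last exact: closed_le.
  move=> y _; apply: (@continuous_comp _ _ _ (fun y : V => y - x) (@cnorm R d)).
    by apply: continuousB => //; exact: cst_continuous.
  exact: cnorm_continuous.
apply/seteqP; split => [y ->|y] /=; first by rewrite subrr cnorm0.
by rewrite le_eqVlt ltNge cnorm_ge0 orbF cnorm_eq0 subr_eq0 => /eqP.
Qed.

Lemma measurable_point (x : V) : measurable [set x].
Proof.
rewrite -[X in measurable X]setCK; apply: measurableC; apply: sub_sigma_algebra.
exact/closed_openC/closed_point.
Qed.

End exhaustion.

Local Open Scope ereal_scope.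

Section counting_config.
Context (R : realType) (d : nat).
Local Notation V := 'rV[R[i]]_d.

(** Encoded as a sum of ones rather than a cardinal, so that it is a measure in A even
    when D is infinite. *)
Definition point_count (D A : set V) : \bar R := \esum_(x in D `&` A) 1.

Let pc0 D : point_count D set0 = 0.
Proof. by rewrite /point_count setI0 esum_set0. Qed.

Let pc_ge0 D A : 0 <= point_count D A.
Proof. by apply: esum_ge0. Qed.

Let pc_sigma_additive D : semi_sigma_additive (point_count D).
Proof.
move=> F mF tF mUF; rewrite /point_count setI_bigcupr esum_bigcupT//.
  rewrite -nneseries_esumT => [|n]; last exact: esum_ge0.
  by apply: is_cvg_nneseries => n _ _; exact: esum_ge0.
exact: trivIset_setIl.
Qed.

HB.instance Definition _ D := isMeasure.Build _ _ _ (point_count D)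
  (pc0 D) (pc_ge0 D) (@pc_sigma_additive D).

Lemma countable_singletons (D : set V) : countable D -> exists F : nat -> set V,
  [/\ trivIset setT F, \bigcup_n F n = D &
      forall n, F n = set0 \/ exists2 x, D x & F n = [set x]].
Proof.
move=> /countable_injP[g ginj]; exists (fun n => [set x | D x /\ g x = n]); split.
- apply/trivIsetP => i j _ _ ij; apply/seteqP; split => // x [[_ xi] [_ xj]].
  by rewrite -xi -xj eqxx in ij.
- by apply/seteqP; split => [x [n _ []]//|x Dx]; exists (g x).
- move=> n; have [->|/set0P[x [Dx gx]]] := eqVneq [set x | D x /\ g x = n] set0; [by left|right].
  exists x => //; apply/seteqP; split => [y [Dy gy]|y ->] //=.
  by apply: ginj; rewrite ?inE// gy.
Qed.

Lemma integral_point_count (D : set V) (f : V -> \bar R) : countable D ->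
  measurable_fun setT f -> (forall x, 0 <= f x) ->
  \int[point_count D]_x f x = \esum_(x in D) f x.
Proof.
move=> cD mf f0; have [F [tF DF F1]] := countable_singletons cD.
have mF n : measurable (F n).
  by have [->|[x _ ->]] := F1 n => //; exact: measurable_point.
have mD : measurable D by rewrite -DF; exact: bigcup_measurable.
rewrite -(setUv D) ge0_integral_setU//; last 3 first.
- exact: measurableC.
- by rewrite setUv.
- by apply/disj_setPS; rewrite setICr.
rewrite [X in _ + X]null_set_integral ?adde0//; last 3 first.
- exact: measurableC.
- exact: measurable_funTS.
- by rewrite /= /point_count setICr esum_set0.
rewrite -[in LHS]DF ge0_integral_bigcup//; last by exact: measurable_funTS.
rewrite -[in RHS]DF esum_bigcupT// -nneseries_esumT; last by move=> n; exact: esum_ge0.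
apply: eq_eseriesr => n _; have [->|[x Dx Fx]] := F1 n.
  by rewrite integral_set0 esum_set0.
rewrite Fx esum_set1//.
rewrite (@eq_integral _ _ _ _ _ (cst (f x))) => [|y]; last by rewrite inE => ->.
rewrite integral_cst; last exact: measurable_point.
have P1 : point_count D [set x] = 1.
  rewrite /point_count (_ : D `&` [set x] = [set x]) ?esum_set1//.
  by apply/seteqP; split => [y []//|y ->]; split.
transitivity (f x * 1); last by rewrite mule1.
by congr (_ * _); rewrite DF; exact: P1.
Qed.

Lemma point_count_card (D A : set V) (j : nat) :
  (D `&` A #= `I_j)%card -> point_count D A = j%:R%:E.
Proof.
move=> DA; have fin : finite_set (D `&` A) by exists j.
rewrite /point_count esum_fset// fsbig_finite//= big_const_seq count_predT.
rewrite (card_fset_set DA); elim: j {DA} => //= j ->.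
by rewrite -EFinD -natr1 addrC.
Qed.

Lemma point_count_shell (X : conf R d) (A : set V) n : exists j,
  (X `&` shell n `&` A #= `I_j)%card.
Proof.
apply/finite_setP; apply: sub_finite_set (conf_locally_finite X (@compact_cnorm_le R d (1 - n.+1%:R^-1)) _).
  by move=> x [[Xx /shell_sub xn] _].
by move=> x /= /le_lt_trans; apply; rewrite ltrBlDr ltrDl invr_gt0.
Qed.

Lemma conf_countable (X : conf R d) : countable X.
Proof.
rewrite (_ : conf_set X = \bigcup_n (X `&` shell n)).
  apply: bigcup_countable => // n _; apply: finite_set_countable.
  by have [j] := point_count_shell X setT n; rewrite setIT => ?; exists j.
by rewrite -setI_bigcupr shell_bigcup; apply/seteqP; split => [x Xx|x []//]; split => //; exact: conf_sub Xx.
Qed.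

(** The counting variables of Borel subsets of a shell are measurable, by definition of
    the sigma-algebra on configurations. *)
Lemma measurable_point_count n (A : set V) : measurable A ->
  measurable_fun setT (fun X : conf R d => point_count (X `&` shell n) A).
Proof.
move=> mA _ Y mY; rewrite setTI.
rewrite (_ : _ @^-1` _ = \bigcup_(j in [set j | Y j%:R%:E])
   [set X : conf R d | (X `&` (shell n `&` A) #= `I_j)%card]).
  apply: bigcup_measurable => j _; apply: sub_sigma_algebra.
  exists (shell n `&` A), j; split => //.
    by apply: measurableI => //; exact: measurable_shell.
  exists [set x | (cnorm x <= 1 - n.+1%:R^-1)%R]; last by move=> x [/shell_sub].
  split; first exact: compact_cnorm_le.
  by move=> x /= /le_lt_trans; apply; rewrite ltrBlDr ltrDl invr_gt0.
apply/seteqP; split => X /=.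
  have [j Xj] := point_count_shell X A n; rewrite (point_count_card Xj) => Yj.
  by exists j => //=; rewrite setIA.
by move=> [j Yj /=]; rewrite setIA => Xj; rewrite (point_count_card Xj).
Qed.

End counting_config.

Section config_kernel.
Context (R : realType) (d : nat) dT (T : measurableType dT) (g : T -> conf R d).
Local Notation V := 'rV[R[i]]_d.

(** The part in the n-th shell of the counting measure of g t, cut off unless it has
    exactly j points: this makes it a uniformly bounded kernel. *)
Definition shell_kernel (mg : measurable_fun setT g) (n j : nat) (t : T) :
    {measure set V -> \bar R} :=
  if point_count (g t `&` shell n) setT == j%:R%:E then (point_count (g t `&` shell n) : {measure set V -> \bar R}) else mzero.

Hypothesis mg : measurable_fun setT g.

Lemma shell_kernelE n j t (A : set V) : shell_kernel mg n j t A =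
  if point_count (g t `&` shell n) setT == j%:R%:E
  then point_count (g t `&` shell n) A else 0.
Proof. by rewrite /shell_kernel; case: ifP. Qed.

Let measurable_shell_kernel n j U : measurable U ->
  measurable_fun setT (shell_kernel mg n j ^~ U).
Proof.
move=> mU; rewrite (funext (fun t => shell_kernelE n j t U)).
have mc A : measurable A -> measurable_fun setT (fun t => point_count (g t `&` shell n) A).
  by move=> mA; exact: (measurableT_comp (measurable_point_count n mA) mg).
apply: measurable_fun_ifT; [|exact: mc|exact: measurable_cst].
by apply: measurable_fun_eqe => //; exact: mc.
Qed.

HB.instance Definition _ n j := isKernel.Build _ _ _ _ _ (shell_kernel mg n j)
  (@measurable_shell_kernel n j).

Let shell_kernel_uub n j : measure_fam_uub (shell_kernel mg n j).
Proof.
exists j.+1%:R => t; rewrite shell_kernelE; case: ifP => [/eqP->|_].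
  by rewrite lte_fin ltr_nat.
by rewrite lte_fin.
Qed.

HB.instance Definition _ n j := Kernel_isFinite.Build _ _ _ _ _ (shell_kernel mg n j)
  (shell_kernel_uub n j).

Definition config_kernel : R.-sfker T ~> V :=
  kseries (fun n => kseries (shell_kernel mg n)).

(** Seeing a configuration as an s-finite kernel makes sums over it measurable, jointly with
    parameters. *)
Lemma integral_config_kernel (t : T) (f : V -> \bar R) : measurable_fun setT f ->
  (forall x, 0 <= f x) -> \int[config_kernel t]_x f x = \esum_(x in g t) f x.
Proof.
move=> mf f0; rewrite /config_kernel integral_kseries//.
rewrite [in RHS](_ : conf_set (g t) = \bigcup_n (g t `&` shell n)); last first.
  rewrite -setI_bigcupr shell_bigcup; apply/seteqP; split => [x Xx|x []//].
  by split => //; exact: conf_sub Xx.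
rewrite nneseries_sum_bigcup//; last exact/trivIset_setIl/trivIset_shell.
apply: eq_eseriesr => n _; rewrite integral_kseries//.
have [j Xj] := point_count_shell (g t) setT n.
have cn : countable (g t `&` shell n).
  by apply: sub_countable (conf_countable (g t)); apply: subset_card_le => x [].
rewrite (@eq_eseriesr _ _ (fun i => if i == j then \esum_(x in g t `&` shell n) f x else 0)).
  rewrite nneseries_esumT => [|i]; last by case: ifP => // _; exact: esum_ge0.
  transitivity (\esum_(i in [set j]) \esum_(x in g t `&` shell n) f x); last first.
    by rewrite esum_set1//; exact: esum_ge0.
  rewrite [RHS]esum_mkcond; apply: eq_esum => i _; congr (if _ then _ else _).
  by apply/eqP/idP; rewrite inE.
move=> i _; transitivity (\int[shell_kernel mg n i t]_y f y); first by [].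
rewrite /shell_kernel (point_count_card Xj) eqe eqr_nat eq_sym.
case: (i == j); first exact: integral_point_count.
by rewrite integral_measure_zero.
Qed.

End config_kernel.

(** * Correlation functions and the variance of linear statistics *)

Section ball_measure_integral.
Context (R : realType) (d : nat).
Local Notation V := 'rV[R[i]]_d.
Local Notation m := (@lebesgue_vec R d).

Lemma integral_ball_support (mu : {measure set V -> \bar R}) (f : V -> \bar R) :
  (forall x, ~ unit_ball x -> f x = 0) ->
  \int[mu]_x f x = \int[mu]_(x in @unit_ball R d) f x.
Proof.
move=> f0; rewrite [RHS]integral_mkcond; apply: eq_integral => x _; rewrite patchE.
by case: ifPn => //; rewrite notin_setE => /f0.
Qed.

Lemma integral_ball_measure (f : V -> \bar R) : measurable_fun setT f ->
  (forall x, 0 <= f x) -> (forall x, ~ unit_ball x -> f x = 0) ->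
  \int[ball_measure R d]_x f x = ((bmass d 1)^-1)%:E * \int[m]_x f x.
Proof.
move=> mf f0 fB; have mB := @measurable_unit_ball R d; rewrite !integral_ball_support//.
have b0 := bmass1_gt0 R d.
have k0 : (0 <= (bmass d 1)^-1 :> R)%R by rewrite invr_ge0 ltW.
rewrite -[((bmass d 1)^-1)%R]/((NngNum k0)%:num) -ge0_integral_mscale//; last exact: measurable_funTS.
apply: eq_measure_integral => A mA AB.
have E : m (@unit_ball R d) = (bmass d 1)%:E by rewrite -ball_mass1E bmassE.
rewrite /= /mnormalize /= /mscale /= /mrestr /= setTI E eqe (gt_eqF b0) /=.
by rewrite muleC; congr (_ * m _); apply/seteqP; split => [x []//|x Ax]; split => //; exact: AB.
Qed.

End ball_measure_integral.

Section correlation.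
Context (R : realType) (d : nat).
Local Notation V := 'rV[R[i]]_d.
Local Notation nu := (ball_measure R d).
Variable P : probability (conf R d) R.
Hypothesis hP : is_determinantal (@bergman_kernel R d) nu P.

(** The intensity K(x, x). *)
Definition intensity (x : V) : R := ((1 - cnorm x ^+ 2) ^- d.+1)%R.

Lemma intensity_gt0 (x : V) : unit_ball x -> (0 < intensity x)%R.
Proof. by move=> x1; rewrite invr_gt0 exprn_gt0// ball_sqr_lt1. Qed.

Lemma measurable_intensity : measurable_fun setT intensity.
Proof.
apply: (measurableT_comp (@measurable_inv R)); apply: measurable_funX.
by apply: measurable_funB => //; apply: measurable_funX; exact: measurable_cnorm.
Qed.

Lemma bergman_kernel_diag (x : V) : bergman_kernel x x = (intensity x)%:C.
Proof.
rewrite /bergman_kernel /intensity hdotxx.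
have -> : (1 - (cnorm x ^+ 2)%:C = (1 - cnorm x ^+ 2)%:C :> R[i])%R by rewrite rmorphB rmorph1.
by rewrite -rmorphXn -fmorphV.
Qed.

Lemma bergman_kernelC (x y : V) : bergman_kernel y x = ((bergman_kernel x y)^*)%C.
Proof. by rewrite /bergman_kernel fmorphV rmorphXn rmorphB rmorph1 /= -hdotC. Qed.

Lemma normcV_exp (a : R[i]) n : normc (a ^- n) = (normc a ^- n)%R.
Proof. by apply: complexI; rewrite -normcE normfV normrX normcE fmorphV rmorphXn. Qed.

(** This is 1 - |phi_y(x)|^2 <= 1, to the power d + 1. *)
Lemma bergman_kernel_le (x y : V) : unit_ball x -> unit_ball y ->
  (normc (bergman_kernel x y) ^+ 2 <= intensity x * intensity y)%R.
Proof.
rewrite /unit_ball /= => x1 y1; rewrite /bergman_kernel /intensity.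
have n0 := normc_1Bhdot_gt0 x1 (ltW y1).
rewrite normcV_exp exprVn -!exprM mulnC exprM.
have ux := ball_sqr_lt1 x1; have uy := ball_sqr_lt1 y1.
rewrite -invfM -exprMn lef_pV2 ?posrE ?exprn_gt0 ?mulr_gt0//.
apply: lerXn2r; rewrite ?nnegrE ?sqr_ge0 ?mulr_ge0 ?(ltW ux) ?(ltW uy)//.
have := bergman_t_le1 y1 x1; rewrite /bergman_t ler_pdivrMr ?exprn_gt0// mul1r.
by rewrite mulrC.
Qed.

Let tnth1 : measurable_fun setT (fun t : 1.-tuple V => tnth t ord0).
Proof. exact: measurable_tnth. Qed.

(** Campbell's formula: K(x, x) is the density of the mean number of points. *)
Lemma correlation1 (f : V -> \bar R) : measurable_fun setT f -> (forall x, 0 <= f x) ->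
  (forall x, ~ unit_ball x -> f x = 0) ->
  (\int[P]_X \esum_(x in X) f x) = \int[nu]_x (f x * (intensity x)%:E).
Proof.
move=> mf f0 fB.
have H := hP (ltn0Sn 0) (measurableT_comp mf tnth1) (fun t => f0 (tnth t ord0)).
transitivity (\int[P]_X \esum_(t in distinct_tuples X 1) f (tnth t ord0)).
  apply: eq_integral => X _.
  rewrite (@reindex_esum R V (1.-tuple V) X (distinct_tuples X 1) (fun x => [tuple x])).
    by apply: eq_esum => x _; rewrite (tnth_nth x).
  split.
  - move=> x Xx; split => //= i; rewrite ord1 (tnth_nth x) //.
  - by move=> x y _ _ /(congr1 (fun t => tnth t ord0)); rewrite !(tnth_nth x).
  - move=> t [_ Xt]; exists (tnth t ord0) => //.
    by apply/val_inj; case: t {Xt} => [[|a [|//]]] //= ?; rewrite (tnth_nth a).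
rewrite H; have mg : measurable_fun setT (fun x : V => f x * (intensity x)%:E).
  by apply: emeasurable_funM => //; apply/measurable_EFinP; exact: measurable_intensity.
pose g (t : 1.-tuple V) : \bar R := f (tnth t ord0) * (intensity (tnth t ord0))%:E.
have mg1 : measurable_fun setT g by exact: (measurableT_comp mg tnth1).
have g0 t : 0 <= g t.
  rewrite /g; have [x1|/fB ->] := pselect (unit_ball (tnth t ord0)); last by rewrite mul0e.
  by rewrite mule_ge0// lee_fin ltW// intensity_gt0.
transitivity (\int[power_measure nu 1]_t g t).
  by apply: eq_integral => t _; rewrite det_mx11 mxE bergman_kernel_diag.
rewrite (@integral_power_measureS _ _ _ nu 0 g mg1 g0); apply: eq_integral => x _.
rewrite integral_power_measure0; first by rewrite /g /= !(tnth_nth x).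
by apply: (measurableT_comp mg1); apply: (measurableT_comp (@measurable_tuple_cons _ V 0)).
Qed.

Lemma esumZl (D : set V) (c : \bar R) (f : V -> \bar R) : countable D -> 0 <= c ->
  measurable_fun setT f -> (forall x, 0 <= f x) ->
  (\esum_(x in D) (c * f x)) = c * \esum_(x in D) f x.
Proof.
move=> cD c0 mf f0; rewrite -!integral_point_count//; first exact: ge0_integralZl.
  by apply: emeasurable_funM.
by move=> x; rewrite mule_ge0.
Qed.

Lemma det22 (A : 'M[R[i]]_2) :
  (\det A = A ord0 ord0 * A ord_max ord_max - A ord0 ord_max * A ord_max ord0)%R.
Proof.
rewrite (expand_det_row _ ord0) !big_ord_recl big_ord0 /cofactor !det_mx11 !mxE /=.
have -> : lift ord0 (0%R : 'I_1) = ord_max :> 'I_2 by exact/val_inj.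
have -> : lift ord_max (0%R : 'I_1) = ord0 :> 'I_2 by exact/val_inj.
by rewrite /= expr0 expr1 mul1r mulN1r mulrN addr0.
Qed.

(** The two-point correlation function is at most K(x, x) K(y, y): points repel. *)
Lemma correlation2_le (phi : V -> R) : measurable_fun setT phi -> (forall x, 0 <= phi x)%R ->
  (forall x, ~ unit_ball x -> phi x = 0%R) ->
  (\int[P]_X \esum_(x in X) ((phi x)%:E * \esum_(y in X `\ x) (phi y)%:E)) <=
  (\int[nu]_x (phi x * intensity x)%:E) * (\int[nu]_x (phi x * intensity x)%:E).
Proof.
move=> mphi phi0 phiB.
have m2 (i : 'I_2) : measurable_fun setT (fun t : 2.-tuple V => phi (tnth t i)).
  by apply: (measurableT_comp mphi); exact: measurable_tnth.
pose F (t : 2.-tuple V) : \bar R := (phi (tnth t ord0) * phi (tnth t ord_max))%:E.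
have mF : measurable_fun setT F.
  by apply/measurable_EFinP; apply: measurable_funM; exact: m2.
have F0 t : 0 <= F t by rewrite lee_fin mulr_ge0.
have H := hP (ltn0Sn 1) mF F0.
have -> : (\int[P]_X \esum_(x in X) ((phi x)%:E * \esum_(y in X `\ x) (phi y)%:E)) =
    \int[P]_X \esum_(t in distinct_tuples X 2) F t.
  apply: eq_integral => X _.
  transitivity (\esum_(x in X) \esum_(y in X `\ x) (phi x * phi y)%:E).
    apply: eq_esum => x Xx; rewrite -esumZl//.
    - apply: sub_countable (conf_countable X); by apply: subset_card_le => y [].
    - by rewrite lee_fin.
    - exact/measurable_EFinP.
  rewrite esum_esum; last by move=> x y _ _; rewrite lee_fin mulr_ge0.
  rewrite (@reindex_esum R (V * V)%type (2.-tuple V) (X `*`` (fun x => X `\ x))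
     (distinct_tuples X 2) (fun p => [tuple p.1; p.2])).
    by apply: eq_esum => p _; rewrite /F !(tnth_nth p.1).
  split.
  - move=> [x y] [/= Xx [Xy /= yx]]; split.
      by rewrite /= inE andbT eq_sym; apply/eqP.
    by move=> i; rewrite (tnth_nth x); case: i => [[|[|//]]].
  - move=> [x y] [x' y'] _ _ E.
    have := congr1 (fun t => tnth t ord0) E; have := congr1 (fun t => tnth t ord_max) E.
    by rewrite !(tnth_nth x) /= => -> ->.
  - move=> t [/= ut Xt]; exists (tnth t ord0, tnth t ord_max).
      split => //=; split => //= e; move: ut e; case: t {Xt} => [[|a [|b [|//]]]] //= ?.
      by rewrite !(tnth_nth a) /= inE andbT => /eqP ab ba; apply: ab.
    by apply/val_inj; case: t {Xt ut} => [[|a [|b [|//]]]].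
rewrite H.
pose G (t : 2.-tuple V) : \bar R := ((phi (tnth t ord0) * intensity (tnth t ord0)) *
   (phi (tnth t ord_max) * intensity (tnth t ord_max)))%:E.
have mpi : measurable_fun setT (fun x => phi x * intensity x)%R.
  by apply: measurable_funM => //; exact: measurable_intensity.
have pi0 x : (0 <= phi x * intensity x)%R.
  have [x1|/phiB ->] := pselect (unit_ball x); last by rewrite mul0r.
  by rewrite mulr_ge0// ltW// intensity_gt0.
have mG : measurable_fun setT G.
  by apply/measurable_EFinP; apply: measurable_funM;
    apply: (measurableT_comp mpi); exact: measurable_tnth.
have G0 t : 0 <= G t by rewrite lee_fin mulr_ge0.
pose rho (t : 2.-tuple V) : R := complex.Re (\det (\matrix_(i < 2, j < 2) bergman_kernel (tnth t i) (tnth t j))).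
have rhoE t : rho t = (intensity (tnth t ord0) * intensity (tnth t ord_max) -
    normc (bergman_kernel (tnth t ord0) (tnth t ord_max)) ^+ 2)%R.
  rewrite /rho det22 !mxE !bergman_kernel_diag -rmorphM ReB.
  by rewrite (bergman_kernelC (tnth t ord0) (tnth t ord_max)) -normc_sqrC.
have mrho : measurable_fun setT rho.
  have mi i : measurable_fun setT (fun t : 2.-tuple V => intensity (tnth t i)).
    by apply: (measurableT_comp measurable_intensity); exact: measurable_tnth.
  rewrite (funext rhoE); apply: measurable_funB; first exact: measurable_funM.
  rewrite (_ : (fun _ => _) = fun t : 2.-tuple V =>
     (normc (1 - hdot (tnth t ord0) (tnth t ord_max)) ^- (2 * d.+1))%R); last first.
    apply/funext => t; rewrite /bergman_kernel normcV_exp.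
    by rewrite exprVn -exprM mulnC.
  apply: (measurableT_comp (@measurable_inv R)); apply: measurable_funX.
  by apply: measurable_normc_1Bhdot; exact: measurable_tnth.
have le t : F t * (rho t)%:E <= G t.
  rewrite -EFinM lee_fin rhoE.
  rewrite [leRHS](_ : _ = phi (tnth t ord0) * phi (tnth t ord_max) *
    (intensity (tnth t ord0) * intensity (tnth t ord_max)))%R; last by ring.
  by rewrite ler_wpM2l ?mulr_ge0// gerBl sqr_ge0.
have ge t : 0 <= F t * (rho t)%:E.
  rewrite -EFinM lee_fin rhoE.
  have [x1|/phiB ->] := pselect (unit_ball (tnth t ord0)); last by rewrite !mul0r.
  have [y1|/phiB ->] := pselect (unit_ball (tnth t ord_max)); last by rewrite mulr0 mul0r.
  by rewrite mulr_ge0 ?mulr_ge0// subr_ge0 bergman_kernel_le.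
rewrite [leLHS](_ : _ = \int[power_measure nu 2]_t (F t * (rho t)%:E))//.
apply: (@le_trans _ _ (\int[power_measure nu 2]_t G t)).
  apply: ge0_le_integral => //.
  by apply: emeasurable_funM => //; exact/measurable_EFinP.
rewrite (@integral_power_measureS _ _ _ nu 1 G mG G0).
have I0 : 0 <= \int[nu]_x (phi x * intensity x)%:E by apply: integral_ge0 => x _; rewrite lee_fin.
have mE : measurable_fun setT (fun x => (phi x * intensity x)%:E) by exact/measurable_EFinP.
rewrite -(ge0_integralZr nu measurableT mE _ I0); last by move=> x _; rewrite lee_fin.
rewrite le_eqVlt; apply/orP; left; apply/eqP; apply: eq_integral => x _.
have mGx : measurable_fun setT (fun t : 1.-tuple V => G (tuple_cons (x, t))).
  apply: (measurableT_comp mG); apply: (measurableT_comp (@measurable_tuple_cons _ V 1)).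
  exact: measurable_pair1.
rewrite (@integral_power_measureS _ _ _ nu 0 _ mGx) => [|t]; last exact: G0.
rewrite -(ge0_integralZl nu measurableT mE); last 2 first.
- by move=> y _; rewrite lee_fin.
- by rewrite lee_fin.
apply: eq_integral => y _; rewrite integral_power_measure0.
  by rewrite /G !(tnth_nth x).
apply: (measurableT_comp mGx); apply: (measurableT_comp (@measurable_tuple_cons _ V 0)).
exact: measurable_pair1.
Qed.

End correlation.

Section linear_statistics.
Context (R : realType) (d : nat).
Local Notation V := 'rV[R[i]]_d.
Local Notation nu := (ball_measure R d).

Definition lin_stat (phi : V -> R) (X : set V) : \bar R := \esum_(x in X) (phi x)%:E.

Lemma lin_stat_ge0 phi X : (forall x, 0 <= phi x)%R -> 0 <= lin_stat phi X.
Proof. by move=> phi0; apply: esum_ge0 => x _; rewrite lee_fin. Qed.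

Lemma measurable_esum_conf dW (W : measurableType dW) (g : W -> conf R d)
    (f : W -> V -> \bar R) : measurable_fun setT g ->
  measurable_fun setT (fun p : W * V => f p.1 p.2) -> (forall w x, 0 <= f w x) ->
  measurable_fun setT (fun w => \esum_(x in g w) f w x).
Proof.
move=> mg mf f0.
have := measurable_fun_integral_sfinite_kernel (fun p : W * V => f p.1 p.2)
  (config_kernel mg) (fun p => f0 p.1 p.2) mf.
congr (measurable_fun _ _); apply/funext => w /=.
by rewrite integral_config_kernel//; exact: (measurableT_comp mf (measurable_pair1 w)).
Qed.

Lemma measurable_lin_stat dW (W : measurableType dW) (phi : W -> V -> R) :
  measurable_fun setT (fun p : W * V => phi p.1 p.2) -> (forall w x, 0 <= phi w x)%R ->
  measurable_fun setT (fun p : conf R d * W => lin_stat (phi p.2) p.1).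
Proof.
move=> mphi phi0; apply: measurable_esum_conf => //; last by move=> w x; rewrite lee_fin.
apply/measurable_EFinP.
apply: (measurableT_comp mphi (g := fun p : conf R d * W * V => (p.1.2, p.2))).
by apply/measurable_fun_pair => //; exact: (measurableT_comp measurable_snd measurable_fst).
Qed.

Variable P : probability (conf R d) R.
Hypothesis hP : is_determinantal (@bergman_kernel R d) nu P.

(** Negative correlations bound the variance of a linear statistic as if the points
    were independent. *)
Lemma variance_le (phi : V -> R) (m : R) : measurable_fun setT phi ->
  (forall x, 0 <= phi x)%R -> (forall x, ~ unit_ball x -> phi x = 0%R) ->
  \int[nu]_x (phi x * intensity x)%:E = m%:E ->
  (\int[P]_X ((lin_stat phi X - m%:E) * (lin_stat phi X - m%:E))) <=
  \int[nu]_x (phi x ^+ 2 * intensity x)%:E.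
Proof.
move=> mphi phi0 phiB mE.
have pe0 x : 0 <= (phi x)%:E by rewrite lee_fin.
have mpe : measurable_fun setT (fun x => (phi x)%:E) by exact/measurable_EFinP.
have m0 : (0 <= m)%R.
  rewrite -lee_fin -mE; apply: integral_ge0 => x _; rewrite lee_fin.
  have [x1|/phiB ->] := pselect (unit_ball x); last by rewrite mul0r.
  by rewrite mulr_ge0// ltW// intensity_gt0.
pose S (X : conf R d) := lin_stat phi X.
have mS : measurable_fun setT S.
  apply: (measurable_esum_conf (g := idfun) (f := fun _ x => (phi x)%:E)).
  - exact: measurable_id.
  - exact: (measurableT_comp mpe measurable_snd).
  - by [].
have S0 X : 0 <= S X by exact: lin_stat_ge0.
pose N (X : conf R d) := \esum_(x in X) (phi x ^+ 2)%:E.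
have mp2 : measurable_fun setT (fun x => (phi x ^+ 2)%:E).
  by apply/measurable_EFinP; exact: measurable_funX.
have mN : measurable_fun setT N.
  apply: (measurable_esum_conf (g := idfun) (f := fun _ x => (phi x ^+ 2)%:E)).
  - exact: measurable_id.
  - exact: (measurableT_comp mp2 measurable_snd).
  - by move=> _ x; rewrite lee_fin sqr_ge0.
have N0 X : 0 <= N X by apply: esum_ge0 => x _; rewrite lee_fin sqr_ge0.
(* The sum over the other points is S X - phi x, which is measurable in (X, x); the
   absolute value keeps the summand nonnegative when x is not a point of X. *)
pose F (X : conf R d) (x : V) : \bar R := (phi x)%:E * `|S X - (phi x)%:E|.
have F0 X x : 0 <= F X x by rewrite mule_ge0.
pose Q (X : conf R d) := \esum_(x in X) F X x.
have mQ : measurable_fun setT Q.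
  apply: (measurable_esum_conf (g := idfun)) => //; first exact: measurable_id.
  have mx : measurable_fun setT (fun p : conf R d * V => (phi p.2)%:E).
    exact: (measurableT_comp mpe measurable_snd).
  apply: emeasurable_funM => //; apply: measurableT_comp => //.
  by apply: emeasurable_funB => //; exact: (measurableT_comp mS measurable_fst).
have Q0 X : 0 <= Q X by exact: esum_ge0.
have split1 X x : conf_set X x -> S X = (phi x)%:E + \esum_(y in X `\ x) (phi y)%:E.
  move=> Xx; rewrite /S /lin_stat (esumID [set x])//; congr (_ + _).
  by rewrite (_ : _ `&` _ = [set x]) ?esum_set1//; apply/seteqP; split => [y []//|y ->].
have QE X : Q X = \esum_(x in X) ((phi x)%:E * \esum_(y in X `\ x) (phi y)%:E).
  apply: eq_esum => x Xx; rewrite /F (split1 _ _ Xx) [X in `|X - _|]addeC addeK//.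
  by rewrite gee0_abs//; apply: esum_ge0.
have SS X : S X * S X = N X + Q X.
  rewrite {1}/S /lin_stat muleC -esumZl//; last exact: conf_countable.
  rewrite QE -esumD; last 2 first.
  - by move=> x _; rewrite lee_fin sqr_ge0.
  - by move=> x _; rewrite mule_ge0//; exact: esum_ge0.
  apply: eq_esum => x Xx; rewrite (split1 _ _ Xx) muleC ge0_muleDr//; exact: esum_ge0.
have EN : (\int[P]_X N X) = \int[nu]_x (phi x ^+ 2 * intensity x)%:E.
  rewrite /N (@correlation1 _ _ _ hP (fun x => (phi x ^+ 2)%:E))//.
    by move=> x; rewrite lee_fin sqr_ge0.
  by move=> x /phiB ->; rewrite expr0n.
have EQ : (\int[P]_X Q X) <= (m ^+ 2)%:E.
  by rewrite (funext QE) expr2 EFinM -mE; exact: (correlation2_le hP).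
have ES : (\int[P]_X S X) = m%:E.
  rewrite /S /lin_stat (@correlation1 _ _ _ hP (fun x => (phi x)%:E))//.
  by move=> x /phiB ->.
have D0 X : 0 <= (S X - m%:E) * (S X - m%:E).
  by move: (S0 X); case: (S X) => [r| |] //= _; rewrite -EFinB -EFinM lee_fin -expr2 sqr_ge0.
have mD : measurable_fun setT (fun X => (S X - m%:E) * (S X - m%:E)).
  by apply: emeasurable_funM; exact: emeasurable_funB.
have id X : (S X - m%:E) * (S X - m%:E) + (2 * m)%:E * S X = N X + Q X + (m ^+ 2)%:E.
  rewrite -SS; move: (S0 X); case: (S X) => [r| |] //= _.
    by rewrite -EFinB -!EFinM -!EFinD; congr EFin; ring.
  rewrite mulyy addye//.
  by have [->|mn] := eqVneq m 0%R; [rewrite mulr0 mul0e|rewrite gt0_muley// lte_fin mulr_gt0// lt_neqAle eq_sym mn].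
have EC : (\int[P]__ (m ^+ 2)%:E) = (m ^+ 2)%:E.
  transitivity ((m ^+ 2)%:E * P setT); first exact: integral_cst.
  by rewrite probability_setT mule1.
have m20 : (0 <= 2 * m)%R by rewrite mulr_ge0.
have : (\int[P]_X ((S X - m%:E) * (S X - m%:E))) + (2 * m ^+ 2)%:E <=
    \int[nu]_x (phi x ^+ 2 * intensity x)%:E + (2 * m ^+ 2)%:E.
  have -> : (2 * m ^+ 2)%:E = \int[P]_X ((2 * m)%:E * S X).
    by rewrite ge0_integralZl// ES -EFinM; congr EFin; ring.
  rewrite -ge0_integralD//; last 2 first.
  - by move=> X _; rewrite mule_ge0.
  - exact: emeasurable_funM.
  rewrite (funext id) ge0_integralD//; last 3 first.
  - by move=> X _; rewrite adde_ge0.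
  - exact: emeasurable_funD.
  - by move=> X _; rewrite lee_fin sqr_ge0.
  rewrite ge0_integralD// EC EN.
  rewrite ge0_integralZl// ES -EFinM -addeA leeD2l//.
  apply: (@le_trans _ _ ((m ^+ 2)%:E + (m ^+ 2)%:E)); first by rewrite leeD2r.
  by rewrite -EFinD lee_fin; lra.
by rewrite leeD2rE.
Qed.

(** Tonelli: the bound on the variance passes to a mean square over a parameter. *)
Lemma mean_square_le dW (W : measurableType dW) (pi : probability W R)
    (phi : W -> V -> R) (m : W -> R) (v : R) : (0 <= v)%R ->
  measurable_fun setT (fun p : W * V => phi p.1 p.2) -> (forall w x, 0 <= phi w x)%R ->
  (forall w x, ~ unit_ball x -> phi w x = 0%R) ->
  (forall w, \int[nu]_x (phi w x * intensity x)%:E = (m w)%:E) ->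
  (forall w, \int[nu]_x (phi w x ^+ 2 * intensity x)%:E <= v%:E) ->
  measurable_fun setT m /\
  measurable_fun setT (fun X : conf R d => \int[pi]_w ((lin_stat (phi w) X - (m w)%:E) * (lin_stat (phi w) X - (m w)%:E))) /\
  (\int[P]_X \int[pi]_w ((lin_stat (phi w) X - (m w)%:E) * (lin_stat (phi w) X - (m w)%:E)))
    <= v%:E.
Proof.
move=> v0 mphi phi0 phiB mE vE.
have pi0 w x : (0 <= phi w x * intensity x)%R.
  have [x1|/phiB ->] := pselect (unit_ball x); last by rewrite mul0r.
  by rewrite mulr_ge0// ltW// intensity_gt0.
have mm : measurable_fun setT m.
  apply/measurable_EFinP; rewrite (_ : EFin \o m = fun w => \int[nu]_x (phi w x * intensity x)%:E); last first.
    by apply/funext => w; rewrite mE.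
  apply: (@measurable_fun_fubini_tonelli_F _ _ _ _ _ nu (fun p : W * V => (phi p.1 p.2 * intensity p.2)%:E)).
    apply/measurable_EFinP; apply: measurable_funM => //.
    exact: (measurableT_comp (@measurable_intensity R d) measurable_snd).
  by move=> p; rewrite lee_fin.
pose G (p : conf R d * W) : \bar R := (lin_stat (phi p.2) p.1 - (m p.2)%:E) * (lin_stat (phi p.2) p.1 - (m p.2)%:E).
have mG : measurable_fun setT G.
  have h : measurable_fun setT (fun p : conf R d * W => lin_stat (phi p.2) p.1 - (m p.2)%:E).
    apply: emeasurable_funB; first exact: measurable_lin_stat.
    by apply/measurable_EFinP; exact: (measurableT_comp mm measurable_snd).
  exact: emeasurable_funM.
have G0 p : 0 <= G p.
  rewrite /G; move: (lin_stat_ge0 p.1 (phi0 p.2)); case: (lin_stat _ _) => [r| |] //= _.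
  by rewrite -EFinB -EFinM lee_fin -expr2 sqr_ge0.
split => //; split; first exact: (@measurable_fun_fubini_tonelli_F _ _ _ _ _ pi G mG G0).
rewrite (@fubini_tonelli _ _ _ _ _ P pi G mG G0).
rewrite -[leRHS]mule1 -(probability_setT pi) -integral_cst//.
apply: ge0_le_integral => //.
- by move=> w _; apply: integral_ge0 => X _; exact: G0.
- exact: (@measurable_fun_fubini_tonelli_G _ _ _ _ _ P G mG G0).
- move=> w _; have mw : measurable_fun setT (phi w).
    exact: (measurableT_comp mphi (measurable_pair1 w)).
  exact: le_trans (variance_le mw (phi0 w) (phiB w) (mE w)) (vE w).
Qed.

End linear_statistics.

(** * Almost sure convergence along a sequence *)

Section test_functions.
Context (R : realType) (d : nat) (d0 : (0 < d)%N).
Local Notation V := 'rV[R[i]]_d.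
Local Notation nu := (ball_measure R d).

Definition pole (b : bool) (zeta : V) : option V := if b then Some zeta else None.

Definition good_pole (b : bool) (zeta : V) : bool := b ==> (cnorm zeta == 1%R).

Lemma good_poleP b zeta : good_pole b zeta -> is_pole (pole b zeta).
Proof. by case: b => //= /eqP. Qed.

(** Extended by 0 outside the ball and the sphere, so that integrals over x and zeta
    need no restriction of their domains. *)
Definition test_fun (b : bool) (s : R) (z zeta x : V) : R :=
  if (cnorm x < 1)%R && good_pole b zeta
  then (decay z x `^ s * pole_kernel (pole b zeta) x)%R else 0%R.

Lemma test_fun_ge0 b s z zeta x : (0 <= test_fun b s z zeta x)%R.
Proof.
rewrite /test_fun; case: ifP => // /andP[x1 _].
by rewrite mulr_ge0 ?powR_ge0 ?pole_kernel_ge0.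
Qed.

Lemma test_fun_out b s z zeta x : ~ unit_ball x -> test_fun b s z zeta x = 0%R.
Proof. by rewrite /unit_ball /test_fun /=; case: ltP. Qed.

Lemma measurable_test_fun b s z :
  measurable_fun setT (fun p : V * V => test_fun b s z p.1 p.2).
Proof.
have mc := @measurable_cnorm R d.
apply: measurable_fun_ifT.
- apply: measurable_and.
    by apply: measurable_fun_ltr => //; exact: (measurableT_comp mc measurable_snd).
  case: b => /=; last exact: measurable_cst.
  by apply: measurable_fun_eqr => //; exact: (measurableT_comp mc measurable_fst).
- apply: measurable_funM.
    apply: (measurableT_comp (measurable_powR _)).
    exact: (measurableT_comp (@measurable_decay R d z) measurable_snd).
  case: b => /=; last exact: measurable_cst.
  by apply: measurable_poisson.
- exact: measurable_cst.
Qed.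

(** The expectation of the linear statistic of the test function at s = d + e. *)
Definition test_mean (b : bool) (e : R) (z zeta : V) : R :=
  if good_pole b zeta then (fine (energy e z (pole b zeta)) / bmass d 1)%R else 0%R.

Lemma test_fun_intensity b e z zeta : (cnorm z < 1)%R -> good_pole b zeta ->
  (energy e z (pole b zeta) < +oo) ->
  \int[nu]_x (test_fun b (d%:R + e) z zeta x * intensity x)%:E = (test_mean b e z zeta)%:E.
Proof.
move=> z1 gp foo.
have mt : measurable_fun setT (fun x => test_fun b (d%:R + e) z zeta x).
  exact: (measurableT_comp (measurable_test_fun b (d%:R + e) z) (measurable_pair1 zeta)).
rewrite integral_ball_measure; last 3 first.
- by apply/measurable_EFinP; apply: measurable_funM => //; exact: measurable_intensity.
- move=> x; have [x1|/(test_fun_out b (d%:R + e) z zeta) ->] := pselect (unit_ball x); last by rewrite mul0r.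
  by rewrite lee_fin mulr_ge0 ?test_fun_ge0// ltW// intensity_gt0.
- by move=> x /(test_fun_out b (d%:R + e) z zeta) ->; rewrite mul0r.
rewrite /test_mean gp.
have -> : (\int[@lebesgue_vec R d]_x (test_fun b (d%:R + e) z zeta x * intensity x)%:E) = energy e z (pole b zeta).
  apply: eq_integral => x _; congr EFin; rewrite /test_fun gp andbT /ball_weight cnorm_lt1.
  case: ifP => [x1|_]; last by rewrite !mul0r.
  have u0 := ball_sqr_lt1 x1; have e0 := decay_gt0 z1 x1.
  rewrite mulrA mulrAC; congr (_ * _)%R; rewrite /intensity.
  set u := (1 - cnorm x ^+ 2)%R in u0 *.
  rewrite powRM ?invr_ge0 ?(ltW u0) ?(ltW e0)// mulrCA; congr (_ * _)%R.
  rewrite -powR_mulrn ?(ltW u0)// -powRN -(powR_inv1 (ltW u0)) -powRrM -powRD ?(gt_eqF u0) ?implybT//.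
  by congr (_ `^ _)%R; rewrite -natr1; ring.
have e0 : 0 <= energy e z (pole b zeta).
  apply: integral_ge0 => x _; rewrite lee_fin ball_weight_mul_ge0// => x1.
  by rewrite mulr_ge0 ?powR_ge0 ?pole_kernel_ge0.
by move: foo e0; case: (energy _ _ _) => [r| |] //= _ _; rewrite -EFinM mulrC.
Qed.

(** At s = d the decay compensates the growth of the Poisson kernel, which is at most
    2^d (1 - |x|)^(-d). *)
Lemma test_fun_bounded z : (cnorm z < 1)%R -> exists2 C : R, (0 <= C)%R &
  forall b e zeta x, (0 <= e)%R -> (test_fun b (d%:R + e) z zeta x <= C)%R.
Proof.
move=> z1; have [q0 [q1 [q00 q11 qx]]] := jac_bounds z1.
have q10 : (0 < q1)%R by exact: lt_le_trans q11.
have C1 : (1 <= 4 ^+ d * q1 ^+ d)%R.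
  by rewrite -exprMn exprn_ege1//; apply: le_trans q11 _; rewrite ler_peMl ?(ltW q10)// ler1n.
exists (4 ^+ d * q1 ^+ d)%R; first exact: le_trans C1.
move=> b e zeta x e0; rewrite /test_fun; case: ifP => [/andP[x1 gp]|_]; last exact: le_trans C1.
have u0 := ball_sqr_lt1 x1; have y0 := decay_gt0 z1 x1; have y1 := decay_le1 z1 x1.
have E1 : (decay z x `^ (d%:R + e) <= decay z x ^+ d)%R.
  by rewrite -powR_mulrn ?(ltW y0)//; apply: ger_powR; rewrite ?y0// lerDl.
case: b gp => /= gp; last first.
  rewrite mulr1; apply: le_trans E1 _; apply: le_trans C1.
  by rewrite exprn_ile1// ltW.
move/eqP: gp => zeta1.
have p0 := @pole_kernel_ge0 R d (Some zeta) x x1; rewrite /= in p0.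
apply: le_trans (ler_wpM2r p0 E1) _.
have n0 : (0 < normc (1 - hdot x zeta))%R by rewrite normc_1Bhdot_gt0 ?zeta1.
have n1 : (1 - cnorm x <= normc (1 - hdot x zeta))%R.
  by apply: le_trans (normc_1Bhdot_ge x zeta); rewrite zeta1 mulr1.
have /andP[j0 j1] := qx x (ltW x1).
have yq : (decay z x <= q1 * (1 - cnorm x ^+ 2))%R.
  by apply: le_trans (decay_le_t z1 x1) _; rewrite bergman_tE ler_pM2r.
have c0 := cnorm_ge0 x.
rewrite poisson_szegoE exprM -exprVn -!exprMn; apply: lerXn2r; rewrite ?nnegrE.
- by rewrite mulr_ge0 ?(ltW y0)// mulr_ge0 ?(ltW u0)// invr_ge0 sqr_ge0.
- by rewrite mulr_ge0// ltW.
rewrite mulrA ler_pdivrMr ?exprn_gt0//.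
apply: (@le_trans _ _ (q1 * (1 - cnorm x ^+ 2) * (1 - cnorm x ^+ 2)))%R.
  by rewrite ler_pM2r.
have u2 : (1 - cnorm x ^+ 2 <= 2 * normc (1 - hdot x zeta))%R.
  by apply: (@le_trans _ _ (2 * (1 - cnorm x))%R); [nra|rewrite ler_pM2l].
rewrite -[leLHS]mulrA (mulrC 4%R q1) -[leRHS]mulrA ler_pM2l//.
move: u0 u2 n0; move: (1 - _)%R (normc _) => u n u0 u2 n0; nra.
Qed.

Lemma test_mean_limit z (eta : R) : (cnorm z < 1)%R -> (0 < eta)%R -> exists2 e0 : R, (0 < e0)%R &
  forall b (e : R) zeta, (0 < e < e0)%R -> good_pole b zeta ->
  (energy e z (pole b zeta) < +oo) /\
  (`|e * test_mean b e z zeta - 4 ^- d * d%:R * pole_kernel (pole b zeta) z| <= eta)%R.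
Proof.
move=> z1 eta0; have [e0 e00 H] := energy_limit d0 z1 eta0.
by exists e0 => // b e zeta ee gp; rewrite /test_mean gp; apply: H => //; exact: good_poleP.
Qed.

Lemma pole_kernel_bounded z : (cnorm z < 1)%R -> exists2 T : R, (0 <= T)%R &
  forall b zeta, good_pole b zeta -> (pole_kernel (pole b zeta) z <= T)%R.
Proof.
move=> z1; have [q0 [q1 [q00 q11 qx]]] := jac_bounds z1.
exists (q1 ^+ d)%R; first by rewrite exprn_ge0// (le_trans _ q11).
move=> [] zeta /=; last by rewrite exprn_ege1.
move=> /eqP zeta1; rewrite -(@jac_sphere R d z zeta); last first.
  by rewrite normc_1Bhdot_sym gt_eqF// normc_1Bhdot_gt0 ?zeta1.
have /andP[j0 j1] : (q0 <= jac z zeta <= q1)%R by apply: qx; rewrite zeta1.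
by apply: lerXn2r => //; rewrite nnegrE ?(le_trans _ q11)// (le_trans (ltW q00)).
Qed.

(** As the test function is bounded, its second moment is at most a multiple of the first,
    which is O(1 / e) by energy_limit. *)
Lemma test_fun_moments z : (cnorm z < 1)%R -> exists C e0 : R, [/\ (0 <= C)%R, (0 < e0)%R &
  forall b (e : R) zeta, (0 < e < e0)%R ->
  \int[nu]_x (test_fun b (d%:R + e) z zeta x * intensity x)%:E = (test_mean b e z zeta)%:E /\
  \int[nu]_x (test_fun b (d%:R + e) z zeta x ^+ 2 * intensity x)%:E <= (C / e)%:E].
Proof.
move=> z1; have [e0 e00 H] := test_mean_limit z1 ltr01.
have [T T0 HT] := pole_kernel_bounded z1; have [B B0 HB] := test_fun_bounded z1.
pose K := (4 ^- d * d%:R * T + 1)%R.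
have c0 : (0 <= 4 ^- d * d%:R :> R)%R by rewrite mulr_ge0// invr_ge0 exprn_ge0.
have K0 : (0 <= K)%R by rewrite addr_ge0 ?mulr_ge0.
exists (B * K)%R, e0; split => //; first exact: mulr_ge0.
move=> b e zeta ee; have /andP[ep _] := ee.
have Z n : (0 < n)%N -> ~~ good_pole b zeta ->
    \int[nu]_x (test_fun b (d%:R + e) z zeta x ^+ n * intensity x)%:E = 0.
  move=> n0 gp; rewrite integral0_eq// => x _.
  by rewrite /test_fun (negbTE gp) andbF expr0n (gtn_eqF n0) mul0r.
have [gp|gp] := boolP (good_pole b zeta); last first.
  split; last by rewrite Z// lee_fin divr_ge0 ?mulr_ge0// ltW.
  by apply: eq_trans (Z 1%N isT gp) _; rewrite /test_mean (negbTE gp).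
have [foo h] := H b e zeta ee gp.
have E := test_fun_intensity z1 gp foo; split => //.
have mt : measurable_fun setT (fun x => test_fun b (d%:R + e) z zeta x).
  exact: (measurableT_comp (measurable_test_fun b (d%:R + e) z) (measurable_pair1 zeta)).
have mi := @measurable_intensity R d.
have t0 x : (0 <= test_fun b (d%:R + e) z zeta x * intensity x)%R.
  have [x1|/(test_fun_out b (d%:R + e) z zeta) ->] := pselect (unit_ball x); last by rewrite mul0r.
  by rewrite mulr_ge0 ?test_fun_ge0// ltW// intensity_gt0.
apply: (@le_trans _ _ (\int[nu]_x (B%:E * (test_fun b (d%:R + e) z zeta x * intensity x)%:E))).
  apply: ge0_le_integral => //.
  - move=> x _; rewrite expr2 lee_fin -mulrA mulr_ge0 ?test_fun_ge0//; exact: t0.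
  - by apply/measurable_EFinP; apply: measurable_funM => //; exact: measurable_funX.
  - by apply: emeasurable_funM => //; apply/measurable_EFinP; exact: measurable_funM.
  - move=> x _; rewrite -EFinM lee_fin expr2 -mulrA; apply: ler_wpM2r; first exact: t0.
    by apply: HB; exact: ltW.
rewrite ge0_integralZl//; last 2 first.
- by apply/measurable_EFinP; exact: measurable_funM.
- by move=> x _; rewrite lee_fin; exact: t0.
rewrite E -EFinM lee_fin -mulrA ler_wpM2l// ler_pdivlMr// mulrC.
move: h; rewrite ler_norml => /andP[_]; rewrite lerBlDr => /le_trans; apply.
by rewrite addrC lerD2r ler_wpM2l// HT.
Qed.

End test_functions.

Section almost_sure.
Context (R : realType) (d : nat) (d0 : (0 < d)%N).
Local Notation V := 'rV[R[i]]_d.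
Local Notation nu := (ball_measure R d).
Variable P : probability (conf R d) R.
Hypothesis hP : is_determinantal (@bergman_kernel R d) nu P.
Variable mu : probability V R.

(** The sequence e_n = s_n - d: summable, and such that e_n / e_(n+1) tends to 1. *)
Definition gap (n : nat) : R := (n.+1%:R^-1 - n.+2%:R^-1)%R.

Lemma gapE n : gap n = ((n.+1%:R * n.+2%:R)^-1)%R.
Proof.
rewrite /gap; have : (n.+2%:R = n.+1%:R + 1 :> R)%R by rewrite natr1.
have : (n.+1%:R != 0 :> R)%R by []; have : (n.+2%:R != 0 :> R)%R by [].
move: (n.+1%:R : R) (n.+2%:R : R) => a c c0 a0 ca; rewrite ca in c0 *.
by field; rewrite c0.
Qed.

Lemma gap_gt0 n : (0 < gap n)%R.
Proof. by rewrite gapE invr_gt0 mulr_gt0. Qed.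

Lemma gap_le n : (gap n <= n.+1%:R^-1)%R.
Proof. by rewrite /gap gerBl invr_ge0. Qed.

Lemma gap_small (e0 : R) : (0 < e0)%R -> \forall n \near \oo, (gap n < e0)%R.
Proof.
move=> e00; near=> n; apply: le_lt_trans (gap_le n) _.
by near: n; exact: (near_infty_natSinv_lt (PosNum e00)).
Unshelve. all: by end_near. Qed.

Lemma gap_summable n0 : \sum_(0 <= k <oo) (gap (k + n0))%:E <= 1.
Proof.
apply: lime_le; first by apply: is_cvg_nneseries => n _ _; rewrite lee_fin ltW ?gap_gt0.
apply: nearW => n; rewrite sumEFin lee_fin.
rewrite [leLHS](_ : _ = - \sum_(0 <= k < n) ((k.+1 + n0).+1%:R^-1 - (k + n0).+1%:R^-1))%R; last first.
  by rewrite -sumrN; apply: eq_bigr => k _; rewrite opprB addSn.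
rewrite (@telescope_sumr _ 0 n (fun k => (k + n0).+1%:R^-1)%R)// opprB add0n.
apply: (@le_trans _ _ n0.+1%:R^-1)%R; first by rewrite gerBl invr_ge0.
by rewrite invf_le1// ler1n.
Qed.

Definition mean_square (b : bool) (e : R) (z : V) (X : conf R d) : \bar R :=
  \int[mu]_zeta
    ((lin_stat (test_fun b (d%:R + e) z zeta) X - (test_mean b e z zeta)%:E) *
     (lin_stat (test_fun b (d%:R + e) z zeta) X - (test_mean b e z zeta)%:E)).

Lemma mean_square_ge0 b e z X : 0 <= mean_square b e z X.
Proof.
apply: integral_ge0 => zeta _.
have := lin_stat_ge0 X (test_fun_ge0 b (d%:R + e) z zeta).
by case: (lin_stat _ _) => [r| |] //= _; rewrite -EFinB -EFinM lee_fin -expr2 sqr_ge0.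
Qed.

(** The left side has expectation at most C e_n, since the variance is at most C / e_n; the sum over n
    has finite expectation, so it converges almost surely. *)
Lemma mean_square_ae b z : (cnorm z < 1)%R -> {ae P, forall X,
  forall eps : R, (0 < eps)%R -> \forall n \near \oo, (gap n ^+ 2)%:E * mean_square b (gap n) z X <= eps%:E}.
Proof.
move=> z1; have [C [e0 [C0 e00 H]]] := test_fun_moments d0 z1.
have [n0 _ Hn0] := gap_small e00.
have G k : (0 < gap (k + n0) < e0)%R by rewrite gap_gt0 Hn0//= leq_addl.
pose D k X := (gap (k + n0) ^+ 2)%:E * mean_square b (gap (k + n0)) z X.
have MS k : measurable_fun setT (mean_square b (gap (k + n0)) z) /\
    (\int[P]_X mean_square b (gap (k + n0)) z X) <= (C / gap (k + n0))%:E.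
  have [||||||_ [m1 m2]] := @mean_square_le R d P hP _ V mu
    (fun zeta x => test_fun b (d%:R + gap (k + n0)) z zeta x)
    (fun zeta => test_mean b (gap (k + n0)) z zeta) (C / gap (k + n0))%R; last by split.
  - by rewrite divr_ge0// ltW// gap_gt0.
  - exact: measurable_test_fun.
  - by move=> *; exact: test_fun_ge0.
  - by move=> *; exact: test_fun_out.
  - by move=> zeta; have [] := H b _ zeta (G k).
  - by move=> zeta; have [] := H b _ zeta (G k).
have D0 k X : 0 <= D k X by rewrite mule_ge0 ?mean_square_ge0// lee_fin sqr_ge0.
have mD k : measurable_fun setT (D k) by apply: emeasurable_funM => //; have [] := MS k.
have ID k : (\int[P]_X D k X) <= C%:E * (gap (k + n0))%:E.
  have [m1 m2] := MS k; rewrite /D ge0_integralZl//; last 2 first.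
  - by move=> X _; exact: mean_square_ge0.
  - by rewrite lee_fin sqr_ge0.
  apply: le_trans (lee_wpmul2l _ m2) _; first by rewrite lee_fin sqr_ge0.
  rewrite -!EFinM lee_fin expr2 le_eqVlt; apply/orP; left; apply/eqP.
  by field; rewrite gt_eqF// gap_gt0.
pose S X := \sum_(0 <= k <oo) D k X.
have S0 X : 0 <= S X by apply: nneseries_ge0.
have mS : measurable_fun setT S by apply: ge0_emeasurable_sum.
have IS : (\int[P]_X S X) < +oo.
  rewrite integral_nneseries//; apply: (@le_lt_trans _ _ C%:E); last exact: ltry.
  apply: (@le_trans _ _ (\sum_(0 <= k <oo) (C%:E * (gap (k + n0))%:E))).
    by apply: lee_nneseries => [k _ _|k _]; [apply: integral_ge0|exact: ID].
  rewrite nneseriesZl//; last by move=> k _; rewrite lee_fin ltW// gap_gt0.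
  rewrite -[leRHS]mule1 lee_wpmul2l ?lee_fin//; exact: gap_summable.
have iS : P.-integrable setT S.
  by apply/integrableP; split => //; under eq_integral do rewrite gee0_abs//.
have := integrable_ae measurableT iS.
apply: filterS => X /(_ Logic.I) SX eps eps0.
have Soo : S X < +oo by rewrite ltey_eq SX.
have /fine_cvgP[TN /cvgrPdist_le /(_ eps eps0) T0] := nneseries_tail_cvg Soo (fun k _ => D0 k X).
have [N _ HN] : \forall N \near \oo, \sum_(N <= k <oo) D k X <= eps%:E.
  near=> N.
  have f : \sum_(N <= k <oo) D k X \is a fin_num by near: N; exact: TN.
  have h : (`|0 - fine (\sum_(N <= k <oo) D k X)| <= eps)%R by near: N; exact: T0.
  by rewrite -(fineK f) lee_fin; move: h; rewrite sub0r normrN => /ler_normlW.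
exists (N + n0)%N => //= n nN.
have n0n : (n0 <= n)%N by rewrite (leq_trans _ nN)// leq_addl.
have -> : (gap n ^+ 2)%:E * mean_square b (gap n) z X = D (n - n0)%N X.
  by rewrite /D subnK.
apply: (le_trans _ (HN (n - n0)%N _)); last by rewrite /= leq_subRL// addnC.
have := @nneseries_lim_ge _ (fun k => D k X) xpredT (n - n0)%N (n - n0).+1 (fun k _ _ => D0 k X).
by rewrite big_nat1.
Unshelve. all: by end_near. Qed.

End almost_sure.

Local Close Scope ereal_scope.

(** * Dependence on the base point *)

Section closeness.
Context (R : realType) (d : nat).
Local Notation V := 'rV[R[i]]_d.

Lemma ler_cnormD (x y : V) : cnorm (x + y) <= cnorm x + cnorm y.
Proof.
have h : cnorm (x + y) ^+ 2 <= (cnorm x + cnorm y) ^+ 2.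
  rewrite -[y]opprK cnormB_sqr cnormN (_ : hdot x (- y) = - hdot x y); last first.
    by rewrite hdotC hdotNl rmorphN /= -hdotC.
  have := Re_le_normc (hdot x y); rewrite ler_norml => /andP[_ h1].
  have := hdot_le x y; rewrite opprK -mulr_natl sqrrD -(mulr_natl (_ * _)) => h2.
  have -> : complex.Re (- hdot x y) = - complex.Re (hdot x y) by case: (hdot x y).
  by move: h1 h2; move: (complex.Re _) (normc _) (cnorm x * _) => ? ? ?; lra.
by move: h; rewrite ler_pXn2r// ?nnegrE ?addr_ge0 ?cnorm_ge0.
Qed.

Lemma ler_cnormB (x y : V) : cnorm x - cnorm y <= cnorm (x - y).
Proof. by rewrite lerBlDr -{1}(subrK y x) ler_cnormD. Qed.

Lemma cnormC (x y : V) : cnorm (x - y) = cnorm (y - x).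
Proof. by rewrite -opprB cnormN. Qed.

Lemma sqrtD_le (a c : R) : 0 <= a -> 0 <= c -> Num.sqrt (a + c) <= Num.sqrt a + Num.sqrt c.
Proof.
move=> a0 c0; rewrite -ler_sqr ?nnegrE ?addr_ge0 ?sqrtr_ge0//.
rewrite sqr_sqrtr ?addr_ge0// sqrrD !sqr_sqrtr// addrAC lerDl.
by rewrite mulrn_wge0// mulr_ge0 ?sqrtr_ge0.
Qed.

(** t |-> t / (1 + sqrt (1 - t))^2 has a multiplicative modulus of continuity, even at
    t = 1 where the square root is not Lipschitz. *)
Lemma decay_ratio_le (k t t' : R) : 1 <= k -> 0 < t <= 1 -> 0 < t' <= 1 -> t' <= k * t ->
  t' / (1 + Num.sqrt (1 - t')) ^+ 2 <=
  k * (1 + Num.sqrt (k - 1)) ^+ 2 * (t / (1 + Num.sqrt (1 - t)) ^+ 2).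
Proof.
move=> k1 /andP[t0 t1] /andP[t'0 t'1] tk.
have h : Num.sqrt (1 - t) <= Num.sqrt (1 - t') + Num.sqrt (k - 1).
  apply: le_trans (sqrtD_le _ _); rewrite ?subr_ge0//.
  by apply: ler_wsqrtr; nra.
have r0 := sqrtr_ge0 (1 - t); have r'0 := sqrtr_ge0 (1 - t'); have q0 := sqrtr_ge0 (k - 1).
move: (Num.sqrt _) (Num.sqrt (1 - t')) (Num.sqrt (k - 1)) h r0 r'0 q0 => r r' q h r0 r'0 q0.
have p0 : 0 < 1 + r by rewrite ltr_wpDr.
have p'0 : 0 < 1 + r' by rewrite ltr_wpDr.
have E : 1 + r <= (1 + q) * (1 + r').
  have -> : (1 + q) * (1 + r') = 1 + (r' + q) + q * r' by ring.
  by rewrite -[leLHS]addr0; apply: lerD; [rewrite lerD2l|exact: mulr_ge0].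
have E2 : (1 + r) ^+ 2 <= (1 + q) ^+ 2 * (1 + r') ^+ 2.
  by rewrite -exprMn; apply: lerXn2r => //; rewrite nnegrE ?mulr_ge0 ?addr_ge0.
rewrite ler_pdivrMr ?exprn_gt0//.
apply: le_trans tk _.
rewrite (_ : k * (1 + q) ^+ 2 * (t / (1 + r) ^+ 2) * (1 + r') ^+ 2 =
   k * t * ((1 + q) ^+ 2 * (1 + r') ^+ 2 / (1 + r) ^+ 2)); last by ring.
by rewrite ler_peMr ?mulr_ge0 ?(ltW t0) ?(le_trans _ k1)// ler_pdivlMr ?exprn_gt0// mul1r.
Qed.

(** Closeness is multiplicative so that it passes to sums and integrals of nonnegative
    terms; bounding s makes the factor r uniform in s. *)
Definition close (r : R) (z z' : V) : Prop :=
  (forall x s, cnorm x < 1 -> 0 <= s <= d.+1%:R -> decay z x `^ s <= r * decay z' x `^ s) /\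
  (forall zeta, cnorm zeta = 1 -> poisson_szego z zeta <= r * poisson_szego z' zeta).

Lemma close_le (r r' : R) (z z' : V) : cnorm z' < 1 -> r <= r' -> close r z z' -> close r' z z'.
Proof.
move=> z1 rr [h1 h2]; split=> [x s x1 sd|zeta zeta1].
  by apply: le_trans (h1 x s x1 sd) _; rewrite ler_wpM2r// powR_ge0.
apply: le_trans (h2 zeta zeta1) _; rewrite ler_wpM2r//.
exact: (@pole_kernel_ge0 R d (Some zeta)).
Qed.

Lemma close_jac (k : R) (z z' : V) : cnorm z < 1 -> cnorm z' < 1 -> 1 <= k ->
  (forall x, cnorm x <= 1 -> jac z x <= k * jac z' x) ->
  close ((k * (1 + Num.sqrt (k - 1)) ^+ 2) ^+ d.+1) z z'.
Proof.
move=> z1 z'1 k1 H; have k0 : 0 <= k by exact: le_trans k1.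
have q0 := sqrtr_ge0 (k - 1).
have K1 : 1 <= k * (1 + Num.sqrt (k - 1)) ^+ 2.
  by rewrite -[leLHS]mulr1; apply: ler_pM => //; rewrite exprn_ege1// lerDl.
have K0 : 0 <= k * (1 + Num.sqrt (k - 1)) ^+ 2 by exact: le_trans K1.
split=> [x s x1 /andP[s0 sd]|zeta zeta1].
  have D : decay z x <= k * (1 + Num.sqrt (k - 1)) ^+ 2 * decay z' x.
    apply: decay_ratio_le; rewrite ?bergman_t_gt0 ?bergman_t_le1//.
    rewrite !bergman_tE mulrA ler_pM2r ?ball_sqr_lt1//; exact/H/ltW.
  have e0 := ltW (decay_gt0 z1 x1); have e'0 := ltW (decay_gt0 z'1 x1).
  apply: (@le_trans _ _ ((k * (1 + Num.sqrt (k - 1)) ^+ 2 * decay z' x) `^ s)).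
    by apply: ge0_ler_powR => //; rewrite nnegrE//; exact: mulr_ge0.
  rewrite powRM//; apply: ler_wpM2r; first exact: powR_ge0.
  by rewrite -powR_mulrn//; apply: ler_powR.
have n0 w : cnorm w < 1 -> normc (1 - hdot zeta w) != 0.
  by move=> w1; rewrite normc_1Bhdot_sym gt_eqF// normc_1Bhdot_gt0 ?zeta1.
rewrite -!jac_sphere ?n0//.
have j0 w : cnorm w < 1 -> 0 <= jac w zeta.
  by move=> w1; rewrite divr_ge0 ?exprn_ge0 ?normc_ge0// ltW// ball_sqr_lt1.
have h : jac z zeta <= k * jac z' zeta by apply: H; rewrite zeta1.
apply: (@le_trans _ _ ((k * jac z' zeta) ^+ d)).
  by apply: lerXn2r => //; rewrite nnegrE ?j0//; apply: mulr_ge0 => //; exact: j0.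
rewrite exprMn; apply: ler_wpM2r; first by rewrite exprn_ge0 ?j0.
apply: (@le_trans _ _ ((k * (1 + Num.sqrt (k - 1)) ^+ 2) ^+ d)).
  by apply: lerXn2r; rewrite ?nnegrE// ler_peMr// exprn_ege1// lerDl.
by rewrite ler_weXn2l.
Qed.

(** 1 - |z|^2 and |1 - <x, z>| are Lipschitz in z and at least a multiple of 1 - |z1|, for
    all x in the closed ball. *)
Lemma jac_close (z z1 : V) (th : R) : cnorm z1 < 1 -> 0 <= th <= 1 ->
  cnorm (z - z1) <= th * (1 - cnorm z1) / 4 -> cnorm z < 1 /\
  forall x, cnorm x <= 1 -> jac z x <= (1 + th) ^+ 3 * jac z1 x /\
    jac z1 x <= (1 + th) ^+ 3 * jac z x.
Proof.
move=> z11 /andP[th0 th1] zz; set v := 1 - cnorm z1 in zz.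
have v0 : 0 < v by rewrite subr_gt0.
have h1 := ler_cnormB z z1; have h2 := ler_cnormB z1 z; rewrite cnormC in h2.
have c0 := cnorm_ge0 z; have c10 := cnorm_ge0 z1.
set dl := cnorm (z - z1) in zz h1 h2.
have dl0 : 0 <= dl by exact: cnorm_ge0.
have dlv : 4 * dl <= th * v by rewrite mulrC -ler_pdivlMr.
have dlv4 : 4 * dl <= v by apply: le_trans dlv _; rewrite ler_piMl// ltW.
have zv : cnorm z <= 1 - v / 2 by move: dlv4 h1; rewrite /v; lra.
have z1' : cnorm z < 1 by apply: le_lt_trans zv _; rewrite gtrBl divr_gt0.
split => // x x1.
have D w w' : normc (1 - hdot x w) - normc (1 - hdot x w') <= cnorm (w - w').
  apply: le_trans (ler_normcB _ _) _.
  have -> : 1 - hdot x w - (1 - hdot x w') = hdot x (w' - w) by rewrite hdotBr; ring.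
  apply: le_trans (hdot_le _ _) _; rewrite cnormC ler_piMl// cnorm_ge0//.
have a0 : v / 2 <= normc (1 - hdot x z).
  apply: le_trans (normc_1Bhdot_ge x z).
  have : cnorm x * cnorm z <= cnorm z by rewrite ler_piMl.
  by lra.
have b0 : v <= normc (1 - hdot x z1).
  apply: le_trans (normc_1Bhdot_ge x z1); rewrite lerB//.
  by rewrite ler_piMl.
have ab := D z z1; have ba := D z1 z; rewrite cnormC in ba; rewrite -/dl in ab ba.
rewrite /jac; move: (normc _) (normc (1 - hdot x z1)) a0 b0 ab ba => a b a0 b0 ab ba.
have ap : 0 < a by apply: lt_le_trans a0; rewrite divr_gt0.
have bp : 0 < b by exact: lt_le_trans b0.
have A0 : v / 2 <= 1 - cnorm z ^+ 2 by nra.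
have B0 : v <= 1 - cnorm z1 ^+ 2 by rewrite /v; nra.
have AB : (1 - cnorm z ^+ 2) - (1 - cnorm z1 ^+ 2) <= 2 * dl by nra.
have BA : (1 - cnorm z1 ^+ 2) - (1 - cnorm z ^+ 2) <= 2 * dl by nra.
move: (1 - _) (1 - cnorm z1 ^+ 2) A0 B0 AB BA => A B A0 B0 AB BA.
have Ap : 0 < A by apply: lt_le_trans A0; rewrite divr_gt0.
have Bp : 0 < B by exact: lt_le_trans B0.
have a1 : a <= (1 + th) * b by nra.
have b1 : b <= (1 + th) * a by nra.
have A1 : A <= (1 + th) * B by nra.
have B1 : B <= (1 + th) * A by nra.
have t1 : 0 <= 1 + th by rewrite addr_ge0.
split; rewrite ler_pdivrMr ?exprn_gt0//.
  rewrite (_ : _ * _ * _ = (1 + th) * B * (((1 + th) * a) ^+ 2 / b ^+ 2)); last by rewrite exprMn; ring.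
  apply: le_trans A1 _; rewrite ler_peMr ?mulr_ge0 ?(ltW Bp)// ler_pdivlMr ?exprn_gt0// mul1r.
  by apply: lerXn2r => //; rewrite nnegrE ?mulr_ge0 ?(ltW ap) ?(ltW bp).
rewrite (_ : _ * _ * _ = (1 + th) * A * (((1 + th) * b) ^+ 2 / a ^+ 2)); last by rewrite exprMn; ring.
apply: le_trans B1 _; rewrite ler_peMr ?mulr_ge0 ?(ltW Ap)// ler_pdivlMr ?exprn_gt0// mul1r.
by apply: lerXn2r => //; rewrite nnegrE ?mulr_ge0 ?(ltW ap) ?(ltW bp).
Qed.

Lemma close_near (z1 : V) (r : R) : cnorm z1 < 1 -> 1 < r -> exists2 del, 0 < del &
  forall z, cnorm (z - z1) < del -> [/\ cnorm z < 1, close r z z1 & close r z1 z].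
Proof.
move=> z11 r1.
pose k (t : R) := (1 + t) ^+ 3.
pose F (t : R) : R := (k t * (1 + Num.sqrt (k t - 1)) ^+ 2) ^+ d.+1.
have ck : continuous k.
  move=> t; apply: (@continuous_comp R R R (fun t : R => 1 + t) (fun y : R => y ^+ 3)).
    by apply: continuousD; [exact: cst_continuous|exact: id].
  exact: exprn_continuous.
have cF : continuous F.
  move=> t; apply: (@continuous_comp R R R (fun t : R => k t * (1 + Num.sqrt (k t - 1)) ^+ 2)
    (fun y : R => y ^+ d.+1)); last exact: exprn_continuous.
  apply: continuousM; first exact: ck.
  apply: (@continuous_comp R R R (fun t : R => 1 + Num.sqrt (k t - 1)) (fun y : R => y ^+ 2)).
    apply: continuousD; first exact: cst_continuous.
    apply: (@continuous_comp R R R (fun t : R => k t - 1) Num.sqrt); last exact: sqrt_continuous.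
    by apply: continuousB; [exact: ck|exact: cst_continuous].
  exact: exprn_continuous.
have F0 : F 0 = 1 by rewrite /F /k addr0 expr1n subrr sqrtr0 addr0 expr1n mulr1 expr1n.
have : \forall t \near (0 : R), F t < r.
  by have /cvgr_lt := cF 0; apply; rewrite F0.
move=> /nbhs_ballP[e /= e0 He].
pose th := Num.min 1 (e / 2).
have th0 : 0 < th by rewrite lt_min ltr01 divr_gt0.
have th1 : th <= 1 by rewrite ge_min lexx.
have Fr : F th <= r.
  apply/ltW/He; rewrite /ball /= sub0r normrN gtr0_norm//.
  by rewrite gt_min orbC ltr_pdivrMr// ltr_pMr// ltr1n.
exists (th * (1 - cnorm z1) / 4); first by rewrite divr_gt0// mulr_gt0// subr_gt0.
move=> z zz; have [z1' H] := @jac_close z z1 th z11 (introT andP (conj (ltW th0) th1)) (ltW zz).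
have k1 : 1 <= k th by rewrite exprn_ege1// lerDl ltW.
split => //.
  by apply: (close_le z11 Fr); apply: close_jac => // x /H[].
by apply: (close_le z1' Fr); apply: close_jac => // x /H[].
Qed.

End closeness.

Local Open Scope ereal_scope.

(** * Weighted sums against densities on the sphere *)

Section weighted_sums.
Context (R : realType) (d : nat) (d0 : (0 < d)%N).
Local Notation V := 'rV[R[i]]_d.
Local Notation nu := (ball_measure R d).
Local Notation sphere := (@unit_sphere R d).
Variable mu : probability V R.

Lemma measurable_unit_sphere : measurable sphere.
Proof.
rewrite (_ : sphere = (@cnorm R d) @^-1` [set 1%R]); last by [].
by rewrite -[X in measurable X]setTI; exact: measurable_cnorm.
Qed.

Definition density (B : R) (h : V -> R) : Prop :=
  [/\ measurable_fun setT h, forall zeta, (0 <= h zeta)%R &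
      \int[mu]_(zeta in sphere) (h zeta ^+ 2)%:E <= B%:E].

(** The value at z of the Poisson integral of h, respectively the integral of h; likewise
    weighted_sum is the sum over X for that function. For b = false and h = 1 these are 1
    and g_X. *)
Definition kernel_mean (b : bool) (z : V) (h : V -> R) : \bar R :=
  \int[mu]_(zeta in sphere) (pole_kernel (pole b zeta) z * h zeta)%:E.

Variable X : conf R d.

Definition weighted_sum (b : bool) (s : R) (z : V) (h : V -> R) : \bar R :=
  \int[mu]_(zeta in sphere) ((h zeta)%:E * lin_stat (test_fun b s z zeta) X).

Lemma measurable_stat b s z :
  measurable_fun setT (fun zeta => lin_stat (test_fun b s z zeta) X).
Proof.
have := measurable_lin_stat (measurable_test_fun b s z) (test_fun_ge0 b s z).
by move=> m; exact: (measurableT_comp m (measurable_pair1 X)).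
Qed.

Lemma good_pole_sphere b (zeta : V) : sphere zeta -> good_pole b zeta.
Proof. by rewrite /unit_sphere /= => z1; apply/implyP => _; apply/eqP. Qed.

Lemma measurable_pole b z : measurable_fun setT (fun zeta : V => pole_kernel (pole b zeta) z).
Proof.
case: b => /=; last exact: measurable_cst.
by apply: (@measurable_poisson R d _ V (fun=> z) idfun); [exact: measurable_cst|exact: measurable_id].
Qed.

Lemma density_quadratic B h (p q : R) : density B h -> (0 <= p)%R -> (0 <= q)%R ->
  \int[mu]_(zeta in sphere) (p + q * h zeta ^+ 2)%:E <= (p + q * B)%:E.
Proof.
move=> [mh h0 hB] p0 q0; have mS := measurable_unit_sphere.
have m2 : measurable_fun sphere (fun zeta => (h zeta ^+ 2)%:E).
  by apply/measurable_EFinP; apply: measurable_funX; exact: measurable_funTS.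
under eq_integral do rewrite EFinD EFinM.
rewrite ge0_integralD//; last 2 first.
- by move=> zeta _; rewrite mule_ge0 ?lee_fin ?sqr_ge0.
- exact: emeasurable_funM.
rewrite EFinD EFinM leeD//.
  rewrite (integral_cst mu mS p%:E) -[leRHS]mule1 lee_wpmul2l ?lee_fin//.
  exact: probability_le1.
rewrite ge0_integralZl//; last by move=> zeta _; rewrite lee_fin sqr_ge0.
by rewrite lee_wpmul2l ?lee_fin.
Qed.

Lemma kernel_mean_ge0 b z h : (cnorm z < 1)%R -> (forall zeta, 0 <= h zeta)%R ->
  0 <= kernel_mean b z h.
Proof.
by move=> z1 h0; apply: integral_ge0 => zeta _; rewrite lee_fin mulr_ge0 ?pole_kernel_ge0.
Qed.

(** Here h <= 1 + h^2 and mu is a probability. *)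
Lemma kernel_mean_bounded z : (cnorm z < 1)%R -> exists2 K : R, (0 <= K)%R &
  forall b B h, (0 <= B)%R -> density B h -> kernel_mean b z h <= (K * (1 + B))%:E.
Proof.
move=> z1; have [K K0 H] := pole_kernel_bounded z1; exists K => // b B h B0 hh.
have [mh h0 hB] := hh; have mS := measurable_unit_sphere.
have := density_quadratic hh K0 K0; rewrite -[X in (X + _)%R]mulr1 -mulrDr; apply: le_trans.
apply: ge0_le_integral => //.
- by move=> zeta _; rewrite lee_fin mulr_ge0 ?pole_kernel_ge0.
- apply/measurable_EFinP; apply: measurable_funTS; apply: measurable_funM => //.
  exact: measurable_pole.
- by apply/measurable_EFinP; apply: measurable_funTS; apply: measurable_funD => //;
    apply: measurable_funM => //; exact: measurable_funX.
- move=> zeta /(good_pole_sphere b) gp; rewrite lee_fin -[X in (_ <= X + _)%R]mulr1 -mulrDr.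
  apply: ler_pM => //; [exact: pole_kernel_ge0|exact: H|].
  have := sqr_ge0 (h zeta - 2^-1)%R; move: (h zeta) => x; nra.
Qed.

Lemma weighted_sum_ge0 b s z h : (forall zeta, 0 <= h zeta)%R -> 0 <= weighted_sum b s z h.
Proof.
move=> h0; apply: integral_ge0 => zeta _; rewrite mule_ge0 ?lee_fin//.
by apply: lin_stat_ge0 => x; exact: test_fun_ge0.
Qed.

(** The mean square of the deviation controls the weighted sums of all densities at
    once: h a <= lam h^2 + a^2 / lam replaces the Cauchy-Schwarz inequality. *)
Lemma weighted_sum_approx b (e : R) z (eta lam del B : R) h :
  (cnorm z < 1)%R -> (0 < e)%R -> (0 <= eta)%R -> (0 < lam)%R -> (0 <= B)%R ->
  measurable_fun setT (test_mean b e z) ->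
  (e ^+ 2)%:E * mean_square mu b e z X <= del%:E ->
  (forall zeta, good_pole b zeta ->
    (`|e * test_mean b e z zeta - 4 ^- d * d%:R * pole_kernel (pole b zeta) z| <= eta)%R) ->
  density B h ->
  weighted_sum b (d%:R + e) z h < +oo /\
  (`|e * fine (weighted_sum b (d%:R + e) z h) - 4 ^- d * d%:R * fine (kernel_mean b z h)|
     <= eta + (eta + lam) * B + del / lam)%R.
Proof.
move=> z1 e0 eta0 lam0 B0 mm ms tm hh; have [mh h0 hB] := hh.
have mS := measurable_unit_sphere.
set c := (4 ^- d * d%:R)%R in tm *.
have c0 : (0 <= c)%R by rewrite mulr_ge0// invr_ge0 exprn_ge0.
pose g zeta := lin_stat (test_fun b (d%:R + e) z zeta) X.
have g0 zeta : 0 <= g zeta by apply: lin_stat_ge0 => x; exact: test_fun_ge0.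
have mg : measurable_fun setT g by exact: measurable_stat.
pose A zeta := (g zeta - (test_mean b e z zeta)%:E) * (g zeta - (test_mean b e z zeta)%:E).
have A0 zeta : 0 <= A zeta.
  rewrite /A; move: (g0 zeta); case: (g zeta) => [r| |] //= _.
  by rewrite -EFinB -EFinM lee_fin -expr2 sqr_ge0.
have mA : measurable_fun setT A.
  by apply: emeasurable_funM; apply: emeasurable_funB => //; exact/measurable_EFinP.
have el0 : (0 <= e ^+ 2 / lam)%R by rewrite divr_ge0 ?sqr_ge0// ltW.
pose err zeta := (eta + (eta + lam) * h zeta ^+ 2)%:E + (e ^+ 2 / lam)%:E * A zeta.
have err1 zeta : 0 <= (eta + (eta + lam) * h zeta ^+ 2)%:E.
  by rewrite lee_fin addr_ge0// mulr_ge0 ?sqr_ge0// addr_ge0// ltW.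
have err2 zeta : 0 <= (e ^+ 2 / lam)%:E * A zeta by rewrite mule_ge0.
have err0 zeta : 0 <= err zeta by exact: adde_ge0.
have merr1 : measurable_fun setT (fun zeta => (eta + (eta + lam) * h zeta ^+ 2)%:E).
  apply/measurable_EFinP; apply: measurable_funD => //.
  by apply: measurable_funM => //; exact: measurable_funX.
have merr2 : measurable_fun setT (fun zeta => (e ^+ 2 / lam)%:E * A zeta) by exact: emeasurable_funM.
have merr : measurable_fun setT err by exact: emeasurable_funD.
have ierr : (\int[mu]_(zeta in sphere) err zeta) <= (eta + (eta + lam) * B + del / lam)%:E.
  rewrite /err ge0_integralD//; last 2 first.
  - exact: measurable_funTS.
  - exact: measurable_funTS.
  rewrite [in leRHS]EFinD; apply: leeD.
    by apply: density_quadratic => //; rewrite addr_ge0// ltW.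
  apply: (@le_trans _ _ (\int[mu]_zeta ((e ^+ 2 / lam)%:E * A zeta))).
    by apply: ge0_subset_integral.
  rewrite ge0_integralZl//.
  have -> : (e ^+ 2 / lam)%:E = (lam^-1)%:E * (e ^+ 2)%:E by rewrite -EFinM mulrC.
  rewrite -muleA (mulrC del) [leRHS]EFinM; apply: lee_wpmul2l => //.
  by rewrite lee_fin invr_ge0 ltW.
pose U zeta := (h zeta)%:E * g zeta.
have U0 zeta : 0 <= U zeta by rewrite mule_ge0// lee_fin.
have mU : measurable_fun setT U by apply: emeasurable_funM => //; exact/measurable_EFinP.
pose W zeta := (pole_kernel (pole b zeta) z * h zeta)%:E.
have W0 zeta : 0 <= W zeta by rewrite lee_fin mulr_ge0 ?pole_kernel_ge0.
have mW : measurable_fun setT W.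
  by apply/measurable_EFinP; apply: measurable_funM => //; exact: measurable_pole.
(* the arithmetic-geometric mean inequality, with weight lam *)
have AM (x a : R) : (0 <= x)%R -> (x * a <= lam * x ^+ 2 + a ^+ 2 / lam)%R.
  move=> x0; have := sqr_ge0 (lam * x - a / 2)%R => h1.
  rewrite -(ler_pM2l lam0) mulrDr mulrCA [(lam * (_ / lam))%R]mulrC mulfVK ?gt_eqF//.
  have := sqr_ge0 a; nra.
have pt zeta : sphere zeta -> e%:E * U zeta <= c%:E * W zeta + err zeta /\
    c%:E * W zeta <= e%:E * U zeta + err zeta.
  move=> /(good_pole_sphere b) gp; have := tm zeta gp.
  rewrite /U /W /err /A; move: (g0 zeta); case: (g zeta) => [r| |] // _; last first.
    move=> _; rewrite mulyy; have h2 := h0 zeta.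
    have ep : (0 < e ^+ 2 / lam)%R by rewrite divr_gt0 ?exprn_gt0.
    have E : (e ^+ 2 / lam)%:E * +oo = +oo :> \bar R by rewrite gt0_muley ?lte_fin.
    have N : e%:E * ((h zeta)%:E * +oo) != -oo.
      by rewrite gt_eqF// (lt_le_trans (ltNyr 0))// !mule_ge0 ?lee_fin ?(ltW e0).
    by rewrite E !addey// !leey.
  move: (test_mean b e z zeta) (pole_kernel _ _) => m p tm1.
  rewrite -EFinB -!EFinM -!EFinD !lee_fin; have h2 := h0 zeta.
  move: (h zeta) h2 => x x0.
  have hp := AM x (e * (r - m))%R x0; have hn := AM x (- (e * (r - m)))%R x0.
  rewrite sqrrN in hn; rewrite !exprMn in hp hn.
  have E : (e ^+ 2 / lam * ((r - m) * (r - m)) = e ^+ 2 * (r - m) ^+ 2 / lam)%R by ring.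
  rewrite E; have x2 : (x <= 1 + x ^+ 2)%R by nra.
  have t1 : (x * (e * m - c * p) <= eta * (1 + x ^+ 2))%R.
    apply: (@le_trans _ _ (x * eta))%R; last by rewrite mulrC ler_wpM2l.
    by rewrite ler_wpM2l//; move: tm1; rewrite ler_norml => /andP[].
  have t2 : (- (x * (e * m - c * p)) <= eta * (1 + x ^+ 2))%R.
    apply: (@le_trans _ _ (x * eta))%R; last by rewrite mulrC ler_wpM2l.
    by rewrite -mulrN ler_wpM2l// lerNl; move: tm1; rewrite ler_norml => /andP[].
  move: hp hn t1 t2; move: (e ^+ 2 * _ / lam)%R => Y; clear; move=> hp hn t1 t2.
  by split; lra.
have [K K0 HK] := kernel_mean_bounded z1.
have Woo : kernel_mean b z h < +oo by apply: le_lt_trans (HK b B h B0 hh) (ltry _).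
have mSU := measurable_funTS mU (D := sphere).
have mSW := measurable_funTS mW (D := sphere).
have mSe := measurable_funTS merr (D := sphere).
have c0e : 0 <= c%:E by rewrite lee_fin.
have e0e : 0 <= e%:E by rewrite lee_fin ltW.
have I1 : e%:E * weighted_sum b (d%:R + e) z h <= c%:E * kernel_mean b z h + (eta + (eta + lam) * B + del / lam)%:E.
  rewrite /weighted_sum /kernel_mean -(ge0_integralZl mu mS mSU (fun x _ => U0 x)) ?lee_fin ?(ltW e0)//.
  rewrite -(ge0_integralZl mu mS mSW (fun x _ => W0 x)) ?lee_fin//.
  apply: (le_trans _ (leeD (lexx _) ierr)); rewrite -ge0_integralD//; last 2 first.
  - by move=> zeta _; exact: mule_ge0 c0e (W0 zeta).
  - exact: emeasurable_funM.
  apply: ge0_le_integral => //.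
  - by move=> zeta _; exact: mule_ge0 e0e (U0 zeta).
  - exact: emeasurable_funM.
  - by apply: emeasurable_funD => //; exact: emeasurable_funM.
  - by move=> zeta /pt[].
have I2 : c%:E * kernel_mean b z h <= e%:E * weighted_sum b (d%:R + e) z h + (eta + (eta + lam) * B + del / lam)%:E.
  rewrite /weighted_sum /kernel_mean -(ge0_integralZl mu mS mSU (fun x _ => U0 x)) ?lee_fin ?(ltW e0)//.
  rewrite -(ge0_integralZl mu mS mSW (fun x _ => W0 x)) ?lee_fin//.
  apply: (le_trans _ (leeD (lexx _) ierr)); rewrite -ge0_integralD//; last 2 first.
  - by move=> zeta _; exact: mule_ge0 e0e (U0 zeta).
  - exact: emeasurable_funM.
  apply: ge0_le_integral => //.
  - by move=> zeta _; exact: mule_ge0 c0e (W0 zeta).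
  - exact: emeasurable_funM.
  - by apply: emeasurable_funD => //; exact: emeasurable_funM.
  - by move=> zeta /pt[].
have [F0 G0] : 0 <= e%:E * weighted_sum b (d%:R + e) z h /\ 0 <= c%:E * kernel_mean b z h.
  by split; apply: mule_ge0; rewrite ?lee_fin ?weighted_sum_ge0 ?kernel_mean_ge0 ?(ltW e0).
have Goo : c%:E * kernel_mean b z h < +oo by apply: lte_mul_pinfty; rewrite ?lee_fin.
have [foo H] := ereal_close F0 G0 Goo I1 I2.
have Too : weighted_sum b (d%:R + e) z h < +oo.
  have := weighted_sum_ge0 b (d%:R + e) z h0.
  by move: foo; case: (weighted_sum _ _ _ _) => [r| |] //=; rewrite ?ltry// gt0_muley.
split => //; rewrite !fineM// in H; first by rewrite ge0_fin_numE// kernel_mean_ge0.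
by rewrite ge0_fin_numE// weighted_sum_ge0.
Qed.

End weighted_sums.

Section limits.
Context (R : realType) (d : nat) (d0 : (0 < d)%N).
Local Notation V := 'rV[R[i]]_d.
Local Notation nu := (ball_measure R d).
Local Notation sphere := (@unit_sphere R d).
Local Notation c := (4 ^- d * d%:R : R)%R.
Variable mu : probability V R.

Lemma test_mean_measurable (z : V) : (cnorm z < 1)%R -> exists2 e0 : R, (0 < e0)%R &
  forall b (e : R), (0 < e < e0)%R -> measurable_fun setT (test_mean b e z).
Proof.
move=> z1; have [C [e0 [C0 e00 H]]] := test_fun_moments d0 z1; exists e0 => // b e ee.
apply/measurable_EFinP.
rewrite (_ : _ \o _ = fun w => \int[nu]_x (test_fun b (d%:R + e) z w x * intensity x)%:E); last first.
  by apply/funext => w; rewrite /=; have [->] := H b e w ee.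
apply: (@measurable_fun_fubini_tonelli_F _ _ _ _ _ nu
  (fun p : V * V => (test_fun b (d%:R + e) z p.1 p.2 * intensity p.2)%:E)).
  apply/measurable_EFinP; apply: measurable_funM; first exact: measurable_test_fun.
  exact: (measurableT_comp (@measurable_intensity R d) measurable_snd).
move=> p; have [x1|/(test_fun_out b (d%:R + e) z p.1) ->] := pselect (unit_ball p.2); last by rewrite mul0r.
by rewrite lee_fin mulr_ge0 ?test_fun_ge0// ltW// intensity_gt0.
Qed.

Variable X : conf R d.

(** The almost sure event of mean_square_ae at the point z; from here on the configuration
    is fixed. *)
Definition typical (z : V) : Prop := forall b (eps : R), (0 < eps)%R ->
  \forall n \near \oo, (gap R n ^+ 2)%:E * mean_square mu b (gap R n) z X <= eps%:E.

Lemma weighted_sum_gap b z (B eps : R) : (cnorm z < 1)%R -> typical z -> (0 <= B)%R ->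
  (0 < eps)%R -> \forall n \near \oo, forall h, density mu B h ->
  weighted_sum mu X b (d%:R + gap R n) z h < +oo /\
  (`|gap R n * fine (weighted_sum mu X b (d%:R + gap R n) z h) - c * fine (kernel_mean mu b z h)| <= eps)%R.
Proof.
move=> z1 typ B0 eps0; pose lam := (eps / (4 * (1 + B)))%R.
have B1 : (0 < 1 + B)%R by rewrite ltr_wpDr.
have lam0 : (0 < lam)%R by rewrite divr_gt0// mulr_gt0.
have [e1 e10 H1] := test_mean_measurable z1.
have [e2 e20 H2] := test_mean_limit d0 z1 lam0.
have del0 : (0 < lam * (eps / 4))%R by rewrite mulr_gt0// divr_gt0.
near=> n => h hh.
have g0 : (0 < gap R n)%R by exact: gap_gt0.
have := @weighted_sum_approx R d mu X b (gap R n) z lam lam (lam * (eps / 4))%R B h z1 g0 (ltW lam0) lam0 B0.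
move=> /(_ _ _ _ hh)[].
- by apply: H1; rewrite g0; near: n; exact: gap_small.
- by near: n; exact: typ.
- move=> zeta gp; have [] // := H2 b (gap R n) zeta _ gp.
  by rewrite g0; near: n; exact: gap_small.
move=> h1 h2; split => //; apply: le_trans h2 _.
have -> : (lam * (eps / 4) / lam = eps / 4)%R by field; rewrite gt_eqF.
have -> : (lam + (lam + lam) * B = lam * (1 + B) + lam * B)%R by ring.
have E : (lam * (1 + B) = eps / 4)%R by rewrite /lam; field; rewrite gt_eqF.
have : (lam * B <= lam * (1 + B))%R by rewrite ler_pM2l// lerDr.
by rewrite E; lra.
Unshelve. all: by end_near. Qed.

Lemma weighted_sum_le b z (s s' : R) (h : V -> R) : (cnorm z < 1)%R -> (s <= s')%R ->
  (measurable_fun setT h) -> (forall zeta, 0 <= h zeta)%R ->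
  weighted_sum mu X b s' z h <= weighted_sum mu X b s z h.
Proof.
move=> z1 ss mh h0; have mS := @measurable_unit_sphere R d.
apply: ge0_le_integral => //.
- move=> zeta _; rewrite mule_ge0 ?lee_fin//.
  by apply: lin_stat_ge0 => x; exact: test_fun_ge0.
- apply: measurable_funTS; apply: emeasurable_funM; first exact/measurable_EFinP.
  exact: measurable_stat.
- apply: measurable_funTS; apply: emeasurable_funM; first exact/measurable_EFinP.
  exact: measurable_stat.
- move=> zeta _; apply: lee_wpmul2l; first by rewrite lee_fin.
  apply: le_esum => x _; rewrite lee_fin /test_fun; case: ifP => // /andP[x1 _].
  apply: ler_wpM2r; first exact: pole_kernel_ge0.
  by apply: ger_powR => //; rewrite decay_gt0//= decay_le1.
Qed.

Lemma gap_lt n : (gap R n.+1 < gap R n)%R.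
Proof. by rewrite !gapE ltf_pV2 ?posrE ?mulr_gt0// -!natrM ltr_nat; nia. Qed.

Lemma gap_between N (e : R) : (0 < e < gap R N)%R ->
  exists2 n, (N <= n)%N & (gap R n.+1 <= e < gap R n)%R.
Proof.
move=> /andP[e0 eN].
have ex : exists k, (gap R k <= e)%R.
  by have [k _ /(_ k (leqnn k)) /ltW] := gap_small e0; exists k.
have gap_le_gap i j : (i <= j)%N -> (gap R j <= gap R i)%R.
  elim: j => [|j IH]; first by rewrite leqn0 => /eqP ->.
  by rewrite leq_eqVlt => /predU1P[->//|/IH]; apply: le_trans; exact/ltW/gap_lt.
case: (ex_minnP ex) => -[|k] ke kmin.
  by have := lt_le_trans eN (le_trans (gap_le_gap 0%N N (leq0n _)) ke); rewrite ltxx.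
exists k.
  rewrite leqNgt; apply/negP => kN.
  by have := lt_le_trans eN (le_trans (gap_le_gap _ _ kN) ke); rewrite ltxx.
by rewrite ke /= ltNge; apply/negP => /kmin; rewrite ltnn.
Qed.

Lemma gap_ratio n : (gap R n = (1 + 2 / n.+1%:R) * gap R n.+1)%R.
Proof.
rewrite !gapE.
have -> : (n.+2%:R = n.+1%:R + 1 :> R)%R by rewrite natr1.
have -> : (n.+3%:R = n.+1%:R + 2 :> R)%R by rewrite -natrD addn2.
have : (0 < n.+1%:R :> R)%R by [].
move: (n.+1%:R : R)%R => a a0; field.
by rewrite !gt_eqF// ltr_wpDr.
Qed.

(** A function t decreasing in s, between its values t1 and t2 at two consecutive terms g and
    g1 = g / (1 + r) of the sequence. *)
Lemma interpolation (eps eps' M r g g1 e q t1 t t2 : R) :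
  (`|g * t1 - q| <= eps')%R -> (`|g1 * t2 - q| <= eps')%R ->
  (t1 <= t)%R -> (t <= t2)%R -> (0 <= t1)%R -> (0 <= q)%R -> (q <= M - 1)%R ->
  (r * M <= eps / 2)%R -> (eps' <= 1)%R -> (eps' <= eps / 2)%R -> (0 < eps')%R -> (0 < r)%R ->
  g = ((1 + r) * g1)%R -> (g1 <= e)%R -> (e <= g)%R -> (0 < e)%R -> (`|e * t - q| <= eps)%R.
Proof.
rewrite !ler_norml => /andP[a1 a2] /andP[b1 b2] T1 T2 T0 Q1 QK rn e1 e2 e'0 r0 gr en1 en e0.
have g10 : (0 < g1)%R.
  by have := lt_le_trans e0 en; rewrite gr pmulr_rgt0// addr_gt0.
have t20 : (0 <= t2)%R by apply: le_trans T2; exact: le_trans T1.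
have t0 : (0 <= t)%R by exact: le_trans T1.
have U : (e * t <= (1 + r) * (g1 * t2))%R.
  by rewrite mulrA -gr; apply: ler_pM => //; exact: ltW.
have L : (g * t1 <= (1 + r) * (e * t))%R.
  rewrite gr -mulrA ler_pM2l ?addr_gt0//; by apply: ler_pM => //; exact: ltW.
have et0 : (0 <= e * t)%R by rewrite mulr_ge0// ltW.
apply/andP; split.
  have h1 : (q - eps' <= (1 + r) * (e * t))%R by lra.
  have [small|big] := leP (e * t)%R M.
    have : (r * (e * t) <= r * M)%R by rewrite ler_pM2l.
    by lra.
  by lra.
have h1 : (g1 * t2 <= M)%R by lra.
have : (r * (g1 * t2) <= r * M)%R by rewrite ler_pM2l.
by lra.
Qed.

(** Monotonicity in s fills the gaps between the s_n, since e_n / e_(n+1) -> 1. *)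
Lemma weighted_sum_limit b z (B eps : R) : (cnorm z < 1)%R -> typical z -> (0 <= B)%R ->
  (0 < eps)%R -> exists2 e1 : R, (0 < e1)%R & forall e h, (0 < e < e1)%R -> density mu B h ->
  weighted_sum mu X b (d%:R + e) z h < +oo /\
  (`|e * fine (weighted_sum mu X b (d%:R + e) z h) - c * fine (kernel_mean mu b z h)| <= eps)%R.
Proof.
move=> z1 typ B0 eps0; have [K K0 HK] := kernel_mean_bounded mu z1.
have c0 : (0 <= c)%R by rewrite mulr_ge0// invr_ge0 exprn_ge0.
pose eps' := Num.min 1%R (eps / 2)%R.
have eps'0 : (0 < eps')%R by rewrite lt_min ltr01 divr_gt0.
pose M := (c * (K * (1 + B)) + 1)%R.
have M0 : (0 < M)%R by rewrite ltr_wpDl// !mulr_ge0// addr_ge0.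
have [N1 _ HN1] := weighted_sum_gap b z1 typ B0 eps'0.
have q0 : (0 < eps / (4 * M))%R by rewrite divr_gt0// mulr_gt0.
have [N2 _ HN2] := near_infty_natSinv_lt (PosNum q0).
exists (gap R (maxn N1 N2)); first exact: gap_gt0.
move=> e h /gap_between[n Nn /andP[en1 en]] hh; have [mh h0 hB] := hh.
have e0 : (0 < e)%R by exact: lt_le_trans (gap_gt0 R n.+1) en1.
have [foo1 H1] := HN1 n (leq_trans (leq_maxl _ _) Nn) h hh.
have [foo2 H2] := HN1 n.+1 (leqW (leq_trans (leq_maxl _ _) Nn)) h hh.
have rn : (2 / n.+1%:R * M <= eps / 2)%R.
  have /= := HN2 n (leq_trans (leq_maxr _ _) Nn); rewrite ltr_pdivlMr ?mulr_gt0// => /ltW h4.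
  have -> : (2 / n.+1%:R * M = 2^-1 * (n.+1%:R^-1 * (4 * M)))%R by field.
  by rewrite mulrC ler_pM2r.
have Tle1 : weighted_sum mu X b (d%:R + gap R n) z h <= weighted_sum mu X b (d%:R + e) z h.
  by apply: weighted_sum_le => //; rewrite lerD2l ltW.
have Tle2 : weighted_sum mu X b (d%:R + e) z h <= weighted_sum mu X b (d%:R + gap R n.+1) z h.
  by apply: weighted_sum_le => //; rewrite lerD2l.
have foo : weighted_sum mu X b (d%:R + e) z h < +oo by exact: le_lt_trans foo2.
split => //.
have F s : weighted_sum mu X b s z h < +oo -> weighted_sum mu X b s z h \is a fin_num.
  by move=> ?; rewrite (ge0_fin_numE (weighted_sum_ge0 mu X b s z h0)).
have T1 := fine_le (F _ foo1) (F _ foo) Tle1; have T2 := fine_le (F _ foo) (F _ foo2) Tle2.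
have T0 : (0 <= fine (weighted_sum mu X b (d%:R + gap R n) z h))%R.
  exact/fine_ge0/(weighted_sum_ge0 mu X b _ z h0).
have Q0 : (0 <= fine (kernel_mean mu b z h))%R by exact/fine_ge0/(kernel_mean_ge0 mu b z1 h0).
have QK : (c * fine (kernel_mean mu b z h) <= M - 1)%R.
  rewrite addrK ler_wpM2l//; have := HK b B h B0 hh.
  rewrite -[X in X <= _ -> _]fineK//; last first.
    by rewrite (ge0_fin_numE (kernel_mean_ge0 mu b z1 h0)) (le_lt_trans (HK b B h B0 hh) (ltry _)).
have Q1 : (0 <= c * fine (kernel_mean mu b z h))%R by exact: mulr_ge0.
have e1 : (eps' <= 1)%R by rewrite ge_min lexx.
have e2 : (eps' <= eps / 2)%R by rewrite ge_min lexx orbT.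
have gr := gap_ratio n; have g0 := gap_gt0 R n.+1.
have r0 : (0 < 2 / n.+1%:R :> R)%R by rewrite divr_gt0.
exact: (interpolation H1 H2 T1 T2 T0 Q1 QK rn e1 e2 eps'0 r0 gr en1 (ltW en) e0).
Qed.

Lemma weighted_sum_close b z z' (r s : R) (h : V -> R) : (0 <= r)%R -> (0 <= s <= d.+1%:R)%R ->
  close r z z' -> measurable_fun setT h -> (forall zeta, 0 <= h zeta)%R ->
  weighted_sum mu X b s z h <= r%:E * weighted_sum mu X b s z' h.
Proof.
move=> r0 sd [cl _] mh h0; have mS := @measurable_unit_sphere R d.
have U0 w zeta : 0 <= (h zeta)%:E * lin_stat (test_fun b s w zeta) X.
  by rewrite mule_ge0 ?lee_fin//; apply: lin_stat_ge0 => x; exact: test_fun_ge0.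
have mU w : measurable_fun sphere (fun zeta => (h zeta)%:E * lin_stat (test_fun b s w zeta) X).
  apply: measurable_funTS; apply: emeasurable_funM; first exact/measurable_EFinP.
  exact: measurable_stat.
rewrite /weighted_sum -ge0_integralZl//.
apply: ge0_le_integral => //; first exact: emeasurable_funM.
move=> zeta _; rewrite muleCA; apply: lee_wpmul2l; first by rewrite lee_fin.
rewrite /lin_stat -esumZl//.
- apply: le_esum => x _; rewrite -EFinM lee_fin /test_fun; case: ifP => [/andP[x1 _]|_]; last by rewrite mulr0.
  rewrite mulrA; apply: ler_wpM2r; first exact: pole_kernel_ge0.
  exact: cl.
- exact: conf_countable.
- apply/measurable_EFinP.
  exact: (measurableT_comp (measurable_test_fun b s z') (measurable_pair1 zeta)).
- by move=> x; rewrite lee_fin test_fun_ge0.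
Qed.

Lemma kernel_mean_close z z' (r : R) (h : V -> R) : (cnorm z < 1)%R -> (cnorm z' < 1)%R ->
  (0 <= r)%R -> close r z z' -> measurable_fun setT h -> (forall zeta, 0 <= h zeta)%R ->
  kernel_mean mu true z h <= r%:E * kernel_mean mu true z' h.
Proof.
move=> z1 z'1 r0 [_ cl] mh h0; have mS := @measurable_unit_sphere R d.
have W0 w zeta : (cnorm w < 1)%R -> 0 <= (pole_kernel (pole true zeta) w * h zeta)%:E.
  by move=> w1; rewrite lee_fin mulr_ge0 ?pole_kernel_ge0.
have mW w : measurable_fun sphere (fun zeta => (pole_kernel (pole true zeta) w * h zeta)%:E).
  apply/measurable_EFinP; apply: measurable_funTS; apply: measurable_funM => //.
  exact: measurable_pole.
rewrite /kernel_mean -ge0_integralZl//; last by move=> zeta _; exact: W0.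
apply: ge0_le_integral => //.
- by move=> zeta _; exact: W0.
- exact: emeasurable_funM.
- move=> zeta z2; rewrite -EFinM lee_fin mulrA; apply: ler_wpM2r => //; exact: cl.
Qed.

End limits.

(** * Convergence of the quotients *)

Section ratio.
Context (R : realType) (d : nat) (d0 : (0 < d)%N).
Local Notation V := 'rV[R[i]]_d.
Local Notation sphere := (@unit_sphere R d).
Variable mu : probability V R.
Hypothesis hmu : mu (@unit_sphere R d) = 1.

(** Quotients are stable under multiplicative perturbations of numerator and denominator: a and
    g at a typical point, a' and g' at a nearby point. *)
Lemma ratio_stable (c e a g q a' g' q' r M eps : R) : (0 < c)%R -> (0 < e)%R -> (1 < r)%R ->
  (`|e * a - c * q| <= c * (r - 1) / r)%R -> (`|e * g - c| <= c * (r - 1) / r)%R ->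
  (a' <= r * a)%R -> (a <= r * a')%R -> (g' <= r * g)%R -> (g <= r * g')%R ->
  (q <= r * q')%R -> (q' <= r * q)%R -> (0 <= a')%R -> (0 <= q')%R -> (q' <= M)%R ->
  ((r ^+ 4 - 1) * M + r ^+ 3 * (r - 1) <= eps)%R ->
  (0 < g')%R /\ (`|a' / g' - q'| <= eps)%R.
Proof.
move=> c0 e0 r1 ha hg a1 a2 g1 g2 q1 q2 a'0 q'0 qM he.
have r0 : (0 < r)%R by exact: lt_trans r1.
have k1 : (c * (r - 1) / r <= c * (r - 1))%R.
  by rewrite ler_pdivrMr// ler_peMr// ?ltW// mulr_gt0// subr_gt0.
have k2 : (c - c * (r - 1) / r = c / r)%R by field; rewrite gt_eqF.
move: ha hg; rewrite !ler_norml => /andP[ha1 ha2] /andP[hg1 hg2].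
have eg1 : (c / r <= e * g)%R by rewrite -k2; lra.
have eg2 : (e * g <= c * r)%R by lra.
have ea1 : (e * a <= c * (q + (r - 1)))%R by rewrite mulrDr; lra.
have ea2 : (c * (q - (r - 1)) <= e * a)%R by rewrite mulrBr; lra.
have g0 : (0 < g)%R by rewrite -(pmulr_rgt0 _ e0); apply: lt_le_trans eg1; rewrite divr_gt0.
have g'0 : (0 < g')%R by rewrite -(pmulr_rgt0 _ r0); exact: lt_le_trans g2.
split => //.
have r30 : (0 < r ^+ 3)%R by rewrite exprn_gt0.
have q0 : (0 <= q)%R by rewrite -(pmulr_rge0 _ r0); exact: le_trans q2.
have up : (a' / g' <= r ^+ 3 * (q + (r - 1)))%R.
  rewrite ler_pdivrMr// -(ler_pM2l e0).
  have h1 : (e * a' <= r * (c * (q + (r - 1))))%R.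
    by apply: (@le_trans _ _ (e * (r * a)))%R; [rewrite ler_pM2l|rewrite mulrCA ler_pM2l].
  apply: le_trans h1 _.
  have h2 : (c <= r ^+ 2 * (e * g'))%R.
    move: eg1; rewrite ler_pdivrMr// => /le_trans; apply.
    have : (e * g * r <= e * (r * g') * r)%R by rewrite ler_pM2r// ler_pM2l.
    by move=> /le_trans; apply; rewrite le_eqVlt; apply/orP; left; apply/eqP; ring.
  have h3 : (0 <= q + (r - 1))%R by rewrite addr_ge0// subr_ge0 ltW.
  have : (r * (q + (r - 1)) * c <= r * (q + (r - 1)) * (r ^+ 2 * (e * g')))%R.
    by rewrite ler_wpM2l// mulr_ge0// ltW.
  by rewrite (_ : r * (c * _) = r * (q + (r - 1)) * c)%R; [move=> /le_trans; apply; rewrite le_eqVlt; apply/orP; left; apply/eqP; ring|ring].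
have lo : (q <= r ^+ 3 * (a' / g') + (r - 1))%R.
  rewrite -lerBlDr mulrA ler_pdivlMr// -(ler_pM2l c0).
  have h1 : (c * (q - (r - 1)) <= e * (r * a'))%R by apply: le_trans ea2 _; rewrite ler_pM2l.
  have h2 : (e * g' <= c * r ^+ 2)%R.
    apply: (@le_trans _ _ (e * (r * g)))%R; first by rewrite ler_pM2l.
    by rewrite mulrCA expr2 [leRHS]mulrA [leRHS]mulrC ler_pM2l.
  rewrite mulrA; apply: (@le_trans _ _ (e * (r * a') * g'))%R; first by rewrite ler_pM2r.
  have : (r * a' * (e * g') <= r * a' * (c * r ^+ 2))%R by rewrite ler_wpM2l// mulr_ge0// ltW.
  by rewrite (_ : e * _ * _ = r * a' * (e * g'))%R; [move=> /le_trans; apply; rewrite le_eqVlt; apply/orP; left; apply/eqP; ring|ring].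
have ag0 : (0 <= a' / g')%R by rewrite divr_ge0// ltW.
move: (a' / g')%R up lo ag0 => p up lo p0.
have r41 : (1 <= r ^+ 4)%R by rewrite exprn_ege1// ltW.
have rr : (r <= r ^+ 3)%R by rewrite -[leLHS]expr1 ler_weXn2l// ltW.
have D0 : (0 <= r - 1)%R by rewrite subr_ge0 ltW.
have s1 : ((r ^+ 4 - 1) * q' <= (r ^+ 4 - 1) * M)%R by rewrite ler_wpM2l// subr_ge0.
have s2 : (r ^+ 3 * (q + (r - 1)) <= r ^+ 4 * q' + r ^+ 3 * (r - 1))%R.
  have -> : (r ^+ 4 * q' = r ^+ 3 * (r * q'))%R by ring.
  by rewrite mulrDr lerD2r ler_pM2l.
have s3 : (q' <= r ^+ 4 * p + r * (r - 1))%R.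
  have -> : (r ^+ 4 * p + r * (r - 1) = r * (r ^+ 3 * p + (r - 1)))%R by ring.
  by apply: le_trans q2 _; rewrite ler_pM2l.
have s4 : (r * (r - 1) <= r ^+ 3 * (r - 1))%R by rewrite ler_wpM2r.
apply/andP; split; last first.
  by move: s1; rewrite !mulrBl !mul1r in he *; lra.
have [pq|qp] := leP p q'; last first.
  have e00 : (0 <= eps)%R.
    apply: le_trans he; apply: addr_ge0; last by rewrite mulr_ge0// ltW.
    by rewrite mulr_ge0 ?subr_ge0// (le_trans q'0).
  by lra.
have s5 : ((r ^+ 4 - 1) * p <= (r ^+ 4 - 1) * M)%R.
  by apply: le_trans s1; rewrite ler_wpM2l// subr_ge0.
by move: s5; rewrite !mulrBl !mul1r in he *; lra.
Qed.

Lemma ratio_param (M eps : R) : (0 <= M)%R -> (0 < eps)%R -> exists2 r, (1 < r <= 2)%R &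
  (((r ^+ 2) ^+ 4 - 1) * M + (r ^+ 2) ^+ 3 * (r ^+ 2 - 1) <= eps)%R.
Proof.
(* (1 + 3 t) (1 + 63 t) <= 1 + 255 t; naming 255 prevents its computation in unary *)
move=> M0 eps0; have [K KE] : exists K : R, K = 255%R by exists 255%R.
have K0 : (0 < K)%R by rewrite KE ltr0n.
have M1 : (0 < M + 1)%R by rewrite ltr_wpDl.
pose t := Num.min 1%R (eps / (K * (M + 1)))%R.
have t0 : (0 < t)%R by rewrite lt_min ltr01 divr_gt0// mulr_gt0.
have t1 : (t <= 1)%R by rewrite ge_min lexx.
have te : (t * (K * (M + 1)) <= eps)%R.
  by rewrite -ler_pdivlMr ?mulr_gt0// ge_min lexx orbT.
exists (1 + t)%R; first by rewrite ltrDl t0 lerD2l.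
move: t t0 t1 te => t t0 t1 te.
have h2 : ((1 + t) ^+ 2 <= 1 + 3 * t)%R by nra.
have h1 : (1 <= (1 + t) ^+ 2)%R by rewrite exprn_ege1// lerDl ltW.
move: ((1 + t) ^+ 2)%R h1 h2 => r h1 h2.
have r3 : (r ^+ 3 <= 1 + 63 * t)%R.
  apply: (@le_trans _ _ ((1 + 3 * t) ^+ 3))%R.
    by apply: lerXn2r => //; rewrite nnegrE; lra.
  have : (t ^+ 2 <= t)%R by nra.
  have : (t ^+ 3 <= t)%R by rewrite exprS ler_piMr ?(ltW t0)// exprn_ile1// ltW.
  have -> : ((1 + 3 * t) ^+ 3 = 1 + 9 * t + 27 * t ^+ 2 + 27 * t ^+ 3)%R by ring.
  by lra.
have r4 : (r ^+ 4 <= 1 + K * t)%R.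
  rewrite exprS; apply: (@le_trans _ _ ((1 + 3 * t) * (1 + 63 * t)))%R; last by rewrite KE; nra.
  by apply: ler_pM => //; [lra|rewrite exprn_ge0//; lra].
apply: le_trans te; rewrite (_ : t * _ = K * t * M + K * t)%R; last by ring.
apply: lerD; first by rewrite ler_wpM2r//; lra.
apply: (@le_trans _ _ (64 * (3 * t)))%R; last by rewrite KE; lra.
by apply: ler_pM; [rewrite exprn_ge0//; lra|lra|lra|lra].
Qed.

Variable X : conf R d.
Hypothesis typX : forall (z1 : V) (del : R), (cnorm z1 < 1)%R -> (0 < del)%R ->
  exists z, [/\ (cnorm (z - z1)%R < del)%R, (cnorm z < 1)%R & typical mu X z].

Lemma density1 : density mu 1 (fun=> 1%R).
Proof.
split => //.
rewrite (integral_cst mu (@measurable_unit_sphere R d) (1 ^+ 2)%:E) expr1n mul1e.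
by apply: probability_le1; exact: measurable_unit_sphere.
Qed.

Lemma kernel_mean1 z : kernel_mean mu false z (fun=> 1%R) = 1.
Proof.
rewrite /kernel_mean /= mulr1.
by rewrite (integral_cst mu (@measurable_unit_sphere R d) 1) mul1e.
Qed.

(** The convergence at a typical point near z1 extends to all points near z1, as their sums
    and Poisson integrals only differ by factors close to 1. *)
Lemma ratio_near (z1 : V) (B eps : R) : (cnorm z1 < 1)%R -> (0 <= B)%R -> (0 < eps)%R ->
  exists del e1 : R, [/\ (0 < del)%R, (0 < e1)%R & forall z e h,
    (cnorm (z - z1)%R < del)%R -> (0 < e < e1)%R -> density mu B h ->
    [/\ (cnorm z < 1)%R, weighted_sum mu X true (d%:R + e) z h < +oo,
      weighted_sum mu X false (d%:R + e) z (fun=> 1%R) < +oo,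
      (0 < fine (weighted_sum mu X false (d%:R + e) z (fun=> 1%R)))%R &
      (`|fine (weighted_sum mu X true (d%:R + e) z h) /
         fine (weighted_sum mu X false (d%:R + e) z (fun=> 1%R)) -
         fine (kernel_mean mu true z h)| <= eps)%R]].
Proof.
move=> z11 B0 eps0; have [K K0 HK] := kernel_mean_bounded mu z11.
have KB0 : (0 <= K * (1 + B))%R by rewrite mulr_ge0// addr_ge0.
have M0 : (0 <= 2 * (K * (1 + B)))%R by rewrite mulr_ge0.
have [r /andP[r1 r2] Hr] := ratio_param M0 eps0.
have r0 : (0 <= r)%R by rewrite ltW// (lt_trans ltr01).
have [del del0 Hdel] := close_near z11 r1.
have [zi [zid zi1 typ]] := typX z11 del0.
set c : R := (4 ^- d * d%:R)%R.
have c0 : (0 < c)%R by rewrite mulr_gt0 ?invr_gt0 ?exprn_gt0 ?ltr0n.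
have rr1 : (1 < r ^+ 2)%R by rewrite exprn_egt1.
have e'0 : (0 < c * (r ^+ 2 - 1) / r ^+ 2)%R.
  apply: divr_gt0; last exact: lt_trans ltr01 rr1.
  by apply: mulr_gt0 => //; rewrite subr_gt0.
have [ea ea0 Ha] := weighted_sum_limit d0 true zi1 typ B0 e'0.
have [eb eb0 Hb] := weighted_sum_limit d0 false zi1 typ ler01 e'0.
exists del, (Num.min 1 (Num.min ea eb))%R; split => //; first by rewrite !lt_min ltr01 ea0.
move=> z e h zz /andP[e0]; rewrite !lt_min => /and3P[e1 e2 e3] hh; have [mh h0 hB] := hh.
have [zb1 cz1 cz2] := Hdel z zz; have [_ ci1 ci2] := Hdel zi zid.
have [foa ha] := Ha e h (introT andP (conj e0 e2)) hh.
have [fog hg] := Hb e (fun=> 1%R) (introT andP (conj e0 e3)) density1.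
have sd : (0 <= d%:R + e <= d.+1%:R)%R.
  by rewrite addr_ge0 ?(ltW e0)//= -natr1 lerD2l ltW.
have m1 : measurable_fun [set: V] (fun=> 1%R : R) by exact: measurable_cst.
have p1 (zeta : V) : (0 <= 1 :> R)%R by [].
(* z and zi are compared through z1, hence the factor r^2 *)
have chain b (k : V -> R) (mk : measurable_fun setT k) (k0 : forall zeta, (0 <= k zeta)%R) w w' :
    close r w z1 -> close r z1 w' ->
    weighted_sum mu X b (d%:R + e) w k <= (r ^+ 2)%:E * weighted_sum mu X b (d%:R + e) w' k.
  move=> ww1 ww2; apply: le_trans (weighted_sum_close mu X b r0 sd ww1 mk k0) _.
  rewrite expr2 EFinM -muleA; apply: lee_wpmul2l; first by rewrite lee_fin.
  exact: weighted_sum_close.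
have fchain b (k : V -> R) (mk : measurable_fun setT k) (k0 : forall zeta, (0 <= k zeta)%R) :
    weighted_sum mu X b (d%:R + e) zi k < +oo ->
    [/\ weighted_sum mu X b (d%:R + e) z k < +oo,
     (fine (weighted_sum mu X b (d%:R + e) z k) <= r ^+ 2 * fine (weighted_sum mu X b (d%:R + e) zi k))%R &
     (fine (weighted_sum mu X b (d%:R + e) zi k) <= r ^+ 2 * fine (weighted_sum mu X b (d%:R + e) z k))%R].
  move=> foi; have c1 := chain b k mk k0 z zi cz1 ci2; have c2 := chain b k mk k0 zi z ci1 cz2.
  have w0 := weighted_sum_ge0 mu X b (d%:R + e) z k0.
  have wi0 := weighted_sum_ge0 mu X b (d%:R + e) zi k0.
  move: c1 c2 w0 wi0 foi; move: (weighted_sum _ _ _ _ z _) (weighted_sum _ _ _ _ zi _).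
  have rp : (0 < r ^+ 2)%R by exact: lt_trans rr1.
  move=> [u| |] [v| |] //=; rewrite -?EFinM ?lee_fin => *; rewrite ?ltry //.
have [foz a1 a2] := fchain true h mh h0 foa.
have [fgz g1 g2] := fchain false (fun=> 1%R) m1 p1 fog.
have qfin w : (cnorm w < 1)%R -> kernel_mean mu true w h \is a fin_num.
  move=> w1; have [K' _ HK'] := kernel_mean_bounded mu w1.
  by rewrite (ge0_fin_numE (kernel_mean_ge0 mu true w1 h0)) (le_lt_trans (HK' true B h B0 hh) (ltry _)).
have qle w w' : (cnorm w < 1)%R -> (cnorm w' < 1)%R -> close r w w' ->
    (fine (kernel_mean mu true w h) <= r * fine (kernel_mean mu true w' h))%R.
  move=> w1 w'1 cw; have := kernel_mean_close mu w1 w'1 r0 cw mh h0.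
  by rewrite -(fineK (qfin _ w1)) -(fineK (qfin _ w'1)) -EFinM lee_fin.
have q2 w w' : (cnorm w < 1)%R -> (cnorm w' < 1)%R -> close r w z1 -> close r z1 w' ->
    (fine (kernel_mean mu true w h) <= r ^+ 2 * fine (kernel_mean mu true w' h))%R.
  move=> w1 w'1 cw cw'; apply: le_trans (qle _ _ w1 z11 cw) _.
  by rewrite expr2 -mulrA ler_wpM2l// qle.
have q0 w : (cnorm w < 1)%R -> (0 <= fine (kernel_mean mu true w h))%R.
  by move=> w1; exact/fine_ge0/(kernel_mean_ge0 mu true w1 h0).
have qM : (fine (kernel_mean mu true z h) <= 2 * (K * (1 + B)))%R.
  apply: le_trans (qle _ _ zb1 z11 cz1) _.
  have : (fine (kernel_mean mu true z1 h) <= K * (1 + B))%R.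
    by rewrite -lee_fin (fineK (qfin _ z11)); exact: HK.
  by move=> hq; apply: ler_pM => //; exact: q0.
rewrite kernel_mean1 /= mulr1 in hg.
have a'0 : (0 <= fine (weighted_sum mu X true (d%:R + e) z h))%R.
  exact/fine_ge0/(weighted_sum_ge0 mu X true _ z h0).
have [gp H] := ratio_stable c0 e0 rr1 ha hg a1 a2 g1 g2 (q2 _ _ zi1 zb1 ci1 cz2)
  (q2 _ _ zb1 zi1 cz1 ci2) a'0 (q0 _ zb1) qM Hr.
by split.
Qed.

End ratio.

(** * Sums over configurations and complex densities *)

Section sums_over_configurations.
Context (R : realType) (d : nat).
Local Notation V := 'rV[R[i]]_d.
Local Notation sphere := (@unit_sphere R d).
Variable mu : probability V R.

Lemma integral_esum (D : set V) (S : set V) (f : V -> V -> \bar R) : countable D -> measurable S ->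
  (forall x, D x -> measurable_fun setT (f x)) -> (forall x w, 0 <= f x w) ->
  (\int[mu]_(w in S) \esum_(x in D) f x w) = \esum_(x in D) \int[mu]_(w in S) f x w.
Proof.
move=> cD mS mf f0; have [F [tF DF F1]] := countable_singletons cD.
rewrite -DF nneseries_sum_bigcup//; last by move=> x; exact: integral_ge0.
transitivity (\int[mu]_(w in S) \sum_(0 <= n <oo) \esum_(x in F n) f x w).
  by apply: eq_integral => w _; rewrite nneseries_sum_bigcup.
rewrite integral_nneseries//.
- apply: eq_eseriesr => n _; have [->|[x Dx ->]] := F1 n.
    by rewrite esum_set0 integral0_eq// => w _; rewrite esum_set0.
  rewrite esum_set1; last exact: integral_ge0.
  by apply: eq_integral => w _; rewrite esum_set1.
- move=> n; have [->|[x Dx ->]] := F1 n.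
    by rewrite (_ : (fun _ => _) = cst 0)//; apply/funext => w; rewrite esum_set0.
  rewrite (_ : (fun _ => _) = f x); first by apply: measurable_funTS; exact: mf.
  by apply/funext => w; rewrite esum_set1.
- by move=> n w _; exact: esum_ge0.
Qed.

Variable X : conf R d.

Lemma conf_ball x : conf_set X x -> (cnorm x < 1)%R.
Proof. by move=> Xx; exact: (conf_sub Xx). Qed.

(** Tonelli, for the sum over X and the integral over zeta. *)
Lemma weighted_sumE b s z (h : V -> R) : (cnorm z < 1)%R -> measurable_fun setT h ->
  (forall zeta, 0 <= h zeta)%R ->
  weighted_sum mu X b s z h = \esum_(x in X) ((weight s z x)%:E * kernel_mean mu b x h).
Proof.
move=> z1 mh h0; have mS := @measurable_unit_sphere R d; have cX := conf_countable X.
have mt x : measurable_fun setT (fun zeta => (h zeta)%:E * (test_fun b s z zeta x)%:E).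
  apply: emeasurable_funM; apply/measurable_EFinP => //.
  exact: (measurableT_comp (measurable_test_fun b s z) (measurable_pair2 x)).
have t0 x zeta : 0 <= (h zeta)%:E * (test_fun b s z zeta x)%:E.
  by rewrite mule_ge0 ?lee_fin ?test_fun_ge0.
transitivity (\int[mu]_(zeta in sphere) \esum_(x in X) ((h zeta)%:E * (test_fun b s z zeta x)%:E)).
  apply: eq_integral => zeta _; rewrite /lin_stat -esumZl//.
  - by rewrite lee_fin.
  - apply/measurable_EFinP.
    exact: (measurableT_comp (measurable_test_fun b s z) (measurable_pair1 zeta)).
  - by move=> x; rewrite lee_fin test_fun_ge0.
rewrite (integral_esum cX mS (fun x _ => mt x) t0).
apply: eq_esum => x /conf_ball x1; rewrite /kernel_mean -ge0_integralZl//.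
- apply: eq_integral => zeta; rewrite inE => /(good_pole_sphere b) gp.
  rewrite -!EFinM /test_fun x1 gp /= weightE//; congr EFin; ring.
- apply/measurable_EFinP; apply: measurable_funTS; apply: measurable_funM => //.
  exact: measurable_pole.
- by move=> zeta _; rewrite lee_fin mulr_ge0 ?pole_kernel_ge0.
- by rewrite lee_fin expR_ge0.
Qed.

Lemma rsumB (u a c : V -> R) : (forall x, conf_set X x -> u x = (a x - c x)%R) ->
  (forall x, conf_set X x -> (0 <= a x)%R) -> (forall x, conf_set X x -> (0 <= c x)%R) ->
  \esum_(x in X) (a x)%:E < +oo -> \esum_(x in X) (c x)%:E < +oo ->
  rsum X u = (fine (\esum_(x in X) (a x)%:E) - fine (\esum_(x in X) (c x)%:E))%R.
Proof.
move=> uE a0 c0 aoo coo; rewrite /rsum.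
have sa : summable X (fun x => (a x)%:E).
  by rewrite /summable (eq_esum (b := fun x => (a x)%:E))// => x Xx; rewrite gee0_abs// lee_fin a0.
have sc : summable X (fun x => (c x)%:E).
  by rewrite /summable (eq_esum (b := fun x => (c x)%:E))// => x Xx; rewrite gee0_abs// lee_fin c0.
have := @esumB R V X (fun x => (a x)%:E) (fun x => (c x)%:E) sa sc a0 c0.
set p := esum _ _; set n := esum _ _ => E.
have -> : esum X (EFin \o u)^\+ = p.
  by apply: eq_esum => x Xx; rewrite !funeposE /= uE.
have -> : esum X (EFin \o u)^\- = n.
  by apply: eq_esum => x Xx; rewrite !funenegE /= uE.
have pf : p \is a fin_num.
  rewrite ge0_fin_numE; last exact: esum_ge0.
  apply: le_lt_trans aoo; apply: le_esum => x Xx; rewrite funeposE ge_max.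
  by apply/andP; split; [rewrite -EFinB lee_fin gerBl c0|rewrite lee_fin a0].
have nf : n \is a fin_num.
  rewrite ge0_fin_numE; last exact: esum_ge0.
  apply: le_lt_trans coo; apply: le_esum => x Xx; rewrite funenegE ge_max.
  by apply/andP; split; [rewrite -EFinB -EFinN lee_fin opprB gerBl a0|rewrite lee_fin c0].
rewrite -(fineB pf nf) E fineB// ge0_fin_numE//; apply: esum_ge0 => x Xx.
  by rewrite lee_fin a0.
by rewrite lee_fin c0.
Qed.

Lemma gX_weighted_sum s z : (cnorm z < 1)%R -> mu sphere = 1 ->
  weighted_sum mu X false s z (fun=> 1%R) < +oo ->
  gX X s z = fine (weighted_sum mu X false s z (fun=> 1%R)) /\
  \esum_(x in X) (weight s z x)%:E < +oo.
Proof.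
move=> z1 hmu; rewrite weighted_sumE//.
have -> : \esum_(x in X) ((weight s z x)%:E * kernel_mean mu false x (fun=> 1%R)) =
    \esum_(x in X) (weight s z x)%:E.
  by apply: eq_esum => x Xx; rewrite kernel_mean1// mule1.
move=> oo; split => //; rewrite /gX (@rsumB _ (weight s z) (fun=> 0%R))//.
- by rewrite (esum1 (a := fun=> 0))// subr0.
- by move=> x _; rewrite subr0.
- by move=> x _; rewrite expR_ge0.
- by rewrite (esum1 (a := fun=> 0)).
Qed.

Lemma integrable_kernel z B (h : V -> R) : (cnorm z < 1)%R -> (0 <= B)%R -> density mu B h ->
  mu.-integrable sphere (EFin \o (fun zeta => poisson_szego z zeta * h zeta)%R).
Proof.
move=> z1 B0 hh; have [mh h0 hB] := hh; apply/integrableP; split.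
  apply/measurable_EFinP; apply: measurable_funTS; apply: measurable_funM => //.
  exact: (measurable_pole true z).
have [K _ HK] := kernel_mean_bounded mu z1.
apply: le_lt_trans (ltry (K * (1 + B))%R); apply: le_trans (HK true B h B0 hh).
rewrite le_eqVlt; apply/orP; left; apply/eqP; apply: eq_integral => zeta _.
by rewrite gee0_abs//= lee_fin mulr_ge0// (@pole_kernel_ge0 R d (Some zeta)).
Qed.

Lemma integral_kernel_parts z B (u p n : V -> R) : (cnorm z < 1)%R -> (0 <= B)%R ->
  density mu B p -> density mu B n -> (forall zeta, u zeta = p zeta - n zeta)%R ->
  (\int[mu]_(zeta in sphere) (poisson_szego z zeta * u zeta))%R =
  (fine (kernel_mean mu true z p) - fine (kernel_mean mu true z n))%R.
Proof.
move=> z1 B0 hp hn uE; rewrite -(RintegralB (@measurable_unit_sphere R d)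
  (integrable_kernel z1 B0 hp) (integrable_kernel z1 B0 hn)).
by apply: eq_Rintegral => zeta _; rewrite uE mulrBr.
Qed.

End sums_over_configurations.

Lemma normc_le_ReIm (R : realType) (x : R[i]) :
  (normc x <= `|complex.Re x| + `|complex.Im x|)%R.
Proof.
rewrite -ler_sqr ?nnegrE ?normc_ge0 ?addr_ge0 ?normr_ge0// normc_sqr sqrrD.
by rewrite !real_normK ?num_real// addrAC lerDl mulrn_wge0// mulr_ge0.
Qed.

Section complex_densities.
Context (R : realType) (d : nat) (d0 : (0 < d)%N).
Local Notation V := 'rV[R[i]]_d.
Local Notation sphere := (@unit_sphere R d).
Variable mu : probability V R.
Hypothesis hmu : mu (@unit_sphere R d) = 1.

Definition pos_part (u : V -> R) (zeta : V) : R := Num.max (u zeta) 0%R.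

Lemma pos_partB u zeta : u zeta = (pos_part u zeta - pos_part (fun x => - u x) zeta)%R.
Proof. by rewrite /pos_part; case: (leP 0%R (u zeta)) => h; [rewrite max_r ?oppr_le0|rewrite max_l ?oppr_ge0 ?ltW]; rewrite ?subr0 ?sub0r ?opprK. Qed.

Definition parts (h : V -> R[i]) (a : bool * bool) : V -> R :=
  let u := if a.1 then (fun zeta => complex.Re (h zeta)) else (fun zeta => complex.Im (h zeta)) in
  pos_part (if a.2 then u else (fun zeta => - u zeta)%R).

Definition L2_le (B : R) (h : V -> R[i]) : Prop :=
  [/\ measurable_fun setT (fun zeta => complex.Re (h zeta)),
      measurable_fun setT (fun zeta => complex.Im (h zeta)) &
      \int[mu]_(zeta in sphere) (normc (h zeta) ^+ 2)%:E <= B%:E].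

Lemma density_parts B h a : L2_le B h -> density mu B (parts h a).
Proof.
move=> [mR mI hB].
have mp : measurable_fun setT (parts h a).
  apply: measurable_funTS; rewrite /parts /pos_part; apply: measurable_maxr => //.
  by case: a => -[] [] //=; exact: measurableT_comp.
have p0 zeta : (0 <= parts h a zeta)%R by rewrite /parts /pos_part le_max lexx orbT.
split => //; apply: le_trans hB; apply: ge0_le_integral => //.
- exact: measurable_unit_sphere.
- by move=> zeta _; rewrite lee_fin sqr_ge0.
- by apply/measurable_EFinP; apply: measurable_funTS; exact: measurable_funX.
- apply/measurable_EFinP; apply: measurable_funTS; apply: measurable_funX.
  exact: measurable_normc.
- move=> zeta _; rewrite lee_fin; apply: lerXn2r; rewrite ?nnegrE ?normc_ge0//.
  rewrite /parts /pos_part ge_max normc_ge0 andbT.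
  have := Re_le_normc (h zeta); have := Im_le_normc (h zeta); rewrite !ler_norml.
  move=> /andP[i1 i2] /andP[r1 r2].
  by case: a {mp p0} => -[] [] //=; rewrite lerNl.
Qed.

Lemma poisson_integral_parts B h z : (cnorm z < 1)%R -> (0 <= B)%R -> L2_le B h ->
  let q a := fine (kernel_mean mu true z (parts h a)) in
  poisson_integral mu h z =
  ((q (true, true) - q (true, false))%R +i* (q (false, true) - q (false, false))%R)%C.
Proof.
move=> z1 B0 hh q; rewrite /poisson_integral /cintegral /q.
have dp a := density_parts a hh.
congr (_ +i* _)%C.
  rewrite -(integral_kernel_parts z1 B0 (dp (true, true)) (dp (true, false)) (fun zeta => pos_partB _ zeta)).
  by apply: eq_Rintegral => zeta _; rewrite ReC.
rewrite -(integral_kernel_parts z1 B0 (dp (false, true)) (dp (false, false)) (fun zeta => pos_partB _ zeta)).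
by apply: eq_Rintegral => zeta _; rewrite ImC.
Qed.

Variable X : conf R d.

(** The sums of the four nonnegative parts converge; their linear combination is the sum of the
    complex values. *)
Lemma gXf_parts B h f s z : (cnorm z < 1)%R -> (0 <= B)%R -> L2_le B h ->
  (forall x, unit_ball x -> f x = poisson_integral mu h x) ->
  (forall a, weighted_sum mu X true s z (parts h a) < +oo) ->
  let t a := fine (weighted_sum mu X true s z (parts h a)) in
  gXf X s z f = ((t (true, true) - t (true, false))%R +i* (t (false, true) - t (false, false))%R)%C /\
  summable X (fun x => (weight s z x * normc (f x))%:E).
Proof.
move=> z1 B0 hh fE too t; have dp a := density_parts a hh.
pose q a x := fine (kernel_mean mu true x (parts h a)).
have qE a x : (cnorm x < 1)%R -> kernel_mean mu true x (parts h a) = (q a x)%:E.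
  move=> x1; have [mh h0 _] := dp a; rewrite fineK//.
  have [K _ HK] := kernel_mean_bounded mu x1.
  by rewrite (ge0_fin_numE (kernel_mean_ge0 mu true x1 h0)) (le_lt_trans (HK true B _ B0 (dp a)) (ltry _)).
have q0 a x : (cnorm x < 1)%R -> (0 <= q a x)%R.
  by move=> x1; have [mh h0 _] := dp a; exact/fine_ge0/(kernel_mean_ge0 mu true x1 h0).
have w0 x : (0 <= weight s z x)%R by exact: expR_ge0.
have tE a : weighted_sum mu X true s z (parts h a) = \esum_(x in X) (weight s z x * q a x)%:E.
  have [mh h0 _] := dp a; rewrite weighted_sumE//.
  by apply: eq_esum => x /conf_ball x1; rewrite qE.
have sE a : \esum_(x in X) (weight s z x * q a x)%:E < +oo by rewrite -tE.
have fq x : conf_set X x ->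
    f x = ((q (true, true) x - q (true, false) x)%R +i* (q (false, true) x - q (false, false) x)%R)%C.
  by move=> /conf_ball x1; rewrite fE// (poisson_integral_parts x1 B0 hh).
have p0 a x : conf_set X x -> (0 <= weight s z x * q a x)%R.
  by move=> /conf_ball x1; rewrite mulr_ge0// q0.
split.
  rewrite /gXf /csum /t !tE; congr (_ +i* _)%C; apply: rsumB => //; try exact: p0.
    by move=> x Xx; rewrite ReC fq//= mulrBr.
  by move=> x Xx; rewrite ImC fq//= mulrBr.
rewrite /summable.
apply: (@le_lt_trans _ _ (\esum_(x in X) (((weight s z x * q (true, true) x)%:E +
  (weight s z x * q (true, false) x)%:E) + ((weight s z x * q (false, true) x)%:E +
  (weight s z x * q (false, false) x)%:E)))).
  apply: le_esum => x Xx; rewrite gee0_abs; last by rewrite lee_fin mulr_ge0 ?normc_ge0.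
  rewrite -!EFinD lee_fin -!mulrDr ler_wpM2l// fq//.
  have x1 := conf_ball Xx.
  apply: le_trans (normc_le_ReIm _) _; apply: lerD.
    by apply: le_trans (ler_normB _ _) _; rewrite !ger0_norm ?q0.
  by apply: le_trans (ler_normB _ _) _; rewrite !ger0_norm ?q0.
rewrite !esumD; try by move=> x Xx; rewrite ?adde_ge0 ?lee_fin ?p0.
by rewrite !lte_add_pinfty.
Qed.

Lemma L2norm_sqr h : L2norm mu h `^ 2 = \int[mu]_zeta (normc (h zeta) ^+ 2)%:E.
Proof.
rewrite /L2norm poweR_Lnorm//; apply: eq_integral => zeta _.
by rewrite /= ger0_norm ?normc_ge0// powR_mulrn ?normc_ge0.
Qed.

Lemma L2_leP h (B : R) : in_L2 mu h -> L2norm mu h `^ 2 <= B%:E -> L2_le B h.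
Proof.
move=> [mR mI _]; rewrite L2norm_sqr => hB; split => //; apply: le_trans hB.
apply: ge0_subset_integral => //.
- exact: measurable_unit_sphere.
- by apply/measurable_EFinP; apply: measurable_funX; exact: measurable_normc.
- by move=> zeta _; rewrite lee_fin sqr_ge0.
Qed.

Lemma in_L2_le h : in_L2 mu h -> exists2 B : R, (0 <= B)%R & L2_le B h.
Proof.
move=> hh; have [_ _ hoo] := hh.
have := poweR_lty 2 hoo; have := poweR_ge0 (L2norm mu h) 2.
move E : (L2norm mu h `^ 2) => I; case: I E => [r| |] // E; rewrite lee_fin => r0 _.
by exists r => //; apply: L2_leP => //; rewrite E.
Qed.

Lemma L2norm_le1 h : in_L2 mu h -> L2norm mu h <= 1 -> L2_le 1 h.
Proof.
move=> hh h1; apply: L2_leP => //; rewrite -(poweR1r 2).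
apply: gt0_ler_poweR => //; rewrite in_itv /= ?leey ?andbT ?lee01//.
exact: Lnorm_ge0.
Qed.

End complex_densities.

Local Close Scope ereal_scope.

(** * The theorem *)

Section dense_points.
Context (R : realType) (d : nat).
Local Notation V := 'rV[R[i]]_d.

Lemma nbhs_cnorm (z1 : V) (del : R) : 0 < del -> nbhs z1 [set z | cnorm (z - z1) < del].
Proof.
move=> del0; apply: open_nbhs_nbhs; split; last by rewrite /= subrr cnorm0.
rewrite (_ : [set z | _] = (fun z : V => cnorm (z - z1)) @^-1` [set t | t < del])//.
apply: open_comp; last exact: open_lt.
move=> z _; apply: (@continuous_comp _ _ _ (fun y : V => y - z1) (@cnorm R d)).
  by apply: continuousB => //; exact: cst_continuous.
exact: cnorm_continuous.
Qed.

(** A dense sequence, since the almost sure statement can only be used countably often. *)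
Definition rat_point (n : nat) : V :=
  if @unpickle ((d + d).-tuple rat) n is Some q
  then vec_of_coords (map_tuple (ratr : rat -> R) q) else 0.

Lemma rat_point_dense (z1 : V) (del : R) : 0 < del -> exists n, cnorm (rat_point n - z1) < del.
Proof.
move=> /(nbhs_cnorm z1)/nbhs_ballP[e /= e0 eA].
have [r r0 eE] : exists2 r : R, 0 < r & e = r%:C.
  move: e0; rewrite ltcE /= => /andP[/eqP ime re0].
  by exists (complex.Re e) => //; case: e {eA re0} ime => a b /= ->.
have /choice[q qx] : forall i, exists p : rat, `|tnth (coords z1) i - ratr p| < r / 2.
  move=> i; have /rat_in_itvoo[p] : tnth (coords z1) i - r / 2 < tnth (coords z1) i + r / 2.
    by rewrite ltrD2l gtrN// divr_gt0.
  by rewrite in_itv /= => /andP[p1 p2]; exists p; rewrite ltr_distlC p1 p2.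
exists (pickle [tuple q i | i < d + d]); apply: eA; rewrite eE /rat_point pickleK.
split; first by rewrite ltcR.
move=> i j; rewrite /ball /= -{1}(coordsK z1) !mxE.
have ha := qx (lshift d j); have hb := qx (rshift d j); move: ha hb.
move: (tnth (coords z1) (lshift d j)) (tnth (coords z1) (rshift d j)) => a b ha hb.
rewrite !tnth_map !tnth_ord_tuple /=.
have -> : (a +i* b) - (ratr (q (lshift d j)) +i* ratr (q (rshift d j))) =
     (a - ratr (q (lshift d j)))%:C + 'i * (b - ratr (q (rshift d j)))%:C :> R[i].
  by apply/eqP; rewrite eq_complex /=; apply/andP; split; apply/eqP => /=; ring.
apply: le_lt_trans (ler_normD _ _) _; rewrite normrM !normc_def /=.
rewrite !expr0n /= !addr0 add0r expr1n sqrtr1 mul1r !sqrtr_sqr -rmorphD ltcR.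
by rewrite [r]splitr ltrD.
Qed.

End dense_points.

Section conclusion.
Context (R : realType) (d : nat) (d0 : (0 < d)%N).
Local Notation V := 'rV[R[i]]_d.
Variable mu : probability V R.
Hypothesis hmu : (mu (@unit_sphere R d) = 1)%E.
Variable X : conf R d.
Hypothesis typX : forall (z1 : V) (del : R), cnorm z1 < 1 -> 0 < del ->
  exists z, [/\ cnorm (z - z1) < del, cnorm z < 1 & typical mu X z].

Lemma near_right_gap (Q : R -> Prop) (e1 : R) : 0 < e1 ->
  (forall e, 0 < e < e1 -> Q (d%:R + e)) -> \forall s \near (d%:R : R)^'+, Q s.
Proof.
move=> e10 H; near=> s; rewrite -(subrKC d%:R s); apply: H; apply/andP; split.
  by rewrite subr_gt0; near: s; exact: nbhs_right_gt.
rewrite ltrBlDl; near: s; apply: nbhs_right_lt; first by rewrite ltrDl.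
Unshelve. all: by end_near. Qed.

(** The sums are finite for s near d, and they decrease in s. *)
Lemma finite_stats z (s B : R) (h : V -> R[i]) : cnorm z < 1 -> d%:R < s -> 0 <= B ->
  L2_le mu B h -> (weighted_sum mu X false s z (fun=> 1%R) < +oo)%E /\
  forall a, (weighted_sum mu X true s z (parts h a) < +oo)%E.
Proof.
move=> z1 ds B0 hh; have [del [e1 [del0 e10 H]]] := ratio_near d0 hmu typX z1 B0 ltr01.
pose e := Num.min (e1 / 2) (s - d%:R).
have e0 : 0 < e by rewrite lt_min divr_gt0//= subr_gt0.
have ee : 0 < e < e1.
  by rewrite e0 /= gt_min ltr_pdivrMr// ltr_pMr// ltr1n.
have es : d%:R + e <= s by rewrite -lerBrDl ge_min lexx orbT.
have zz : cnorm (z - z) < del by rewrite subrr cnorm0.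
split=> [|a].
  have [_ _ oo _ _] := H z e _ zz ee (density_parts (true, true) hh).
  by apply: le_lt_trans oo; apply: weighted_sum_le.
have [_ oo _ _ _] := H z e _ zz ee (density_parts a hh).
have [mh h0 _] := density_parts a hh.
by apply: le_lt_trans oo; apply: weighted_sum_le.
Qed.

(** Each of the four nonnegative parts contributes at most eps / 5. *)
Lemma quotient_near (z1 : V) (B eps : R) : cnorm z1 < 1 -> 0 <= B -> 0 < eps ->
  exists del e1 : R, [/\ 0 < del, 0 < e1 & forall z e h f,
    cnorm (z - z1) < del -> 0 < e < e1 -> L2_le mu B h ->
    (forall x, unit_ball x -> f x = poisson_integral mu h x) ->
    normc (gXf X (d%:R + e) z f / (gX X (d%:R + e) z)%:C - poisson_integral mu h z) < eps].
Proof.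
move=> z11 B0 eps0; have e50 : 0 < eps / 5 by rewrite divr_gt0.
have [del [e1 [del0 e10 H]]] := ratio_near d0 hmu typX z11 B0 e50.
exists del, e1; split => // z e h f zz ee hh fE.
have Ha a := H z e _ zz ee (density_parts a hh).
have [z1' _ oo g0 _] := Ha (true, true).
have [gE _] := gX_weighted_sum z1' hmu oo.
have too a : (weighted_sum mu X true (d%:R + e) z (parts h a) < +oo)%E by have [] := Ha a.
have [-> _] := gXf_parts z1' B0 hh fE too.
rewrite (poisson_integral_parts z1' B0 hh) gE.
pose g := fine (weighted_sum mu X false (d%:R + e) z (fun=> 1%R)).
rewrite -/g in g0 *.
pose t a := fine (weighted_sum mu X true (d%:R + e) z (parts h a)).
pose q a := fine (kernel_mean mu true z (parts h a)).
have tq a : `|t a / g - q a| <= eps / 5 by have [_ _ _ _] := Ha a.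
rewrite -/(t (true, true)) -/(t (true, false)) -/(t (false, true)) -/(t (false, false)).
rewrite -/(q (true, true)) -/(q (true, false)) -/(q (false, true)) -/(q (false, false)).
apply: le_lt_trans (normc_le_ReIm _) _.
have ImB (a b : R[i]) : complex.Im (a - b) = complex.Im a - complex.Im b.
  by case: a => ? ?; case: b.
rewrite ReB ImB -fmorphV mulrC ReC ImC /=.
have -> : g^-1 * (t (false, true) - t (false, false)) - (q (false, true) - q (false, false)) =
   (t (false, true) / g - q (false, true)) - (t (false, false) / g - q (false, false)) by ring.
have -> : g^-1 * (t (true, true) - t (true, false)) - (q (true, true) - q (true, false)) =
   (t (true, true) / g - q (true, true)) - (t (true, false) / g - q (true, false)) by ring.
apply: (@le_lt_trans _ _ ((eps / 5 + eps / 5) + (eps / 5 + eps / 5))); last by lra.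
by apply: lerD; apply: le_trans (ler_normB _ _) _; apply: lerD; exact: tq.
Qed.

Lemma summable_weights (z : V) (s : R) : unit_ball z -> d%:R < s ->
  summable X (fun x => (weight s z x)%:E) /\
  forall f : V -> R[i], in_H2 mu f -> summable X (fun x => (weight s z x * normc (f x))%:E).
Proof.
move=> z1 ds; split.
  have h0 : L2_le mu 0 (fun=> 0 : R[i]).
    split => //; rewrite integral0_eq// => zeta _.
    by rewrite normc0 expr0n.
  have [oo _] := finite_stats z1 ds (lexx 0) h0.
  have [_ woo] := gX_weighted_sum z1 hmu oo.
  apply: le_lt_trans woo; apply: le_esum => x _.
  by rewrite gee0_abs// lee_fin expR_ge0.
move=> f [h hh fE]; have [B B0 hB] := in_L2_le hh.
have [_ oo] := finite_stats z1 ds B0 hB.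
by have [] := gXf_parts z1 B0 hB fE oo.
Qed.

Lemma quotient_limit (f : V -> R[i]) (z : V) : in_H2 mu f -> unit_ball z ->
  gXf X s z f / (gX X s z)%:C @[s --> (d%:R : R)^'+] --> f z.
Proof.
move=> [h hh fE] z1; have [B B0 hB] := in_L2_le hh.
apply/cvgrPdist_lt => eps eps0.
have [r r0 ->] : exists2 r : R, 0 < r & eps = r%:C.
  move: eps0; rewrite ltcE /= => /andP[/eqP ime re0].
  by exists (complex.Re eps) => //; case: eps {re0} ime => a b /= ->.
have [del [e1 [del0 e10 H]]] := quotient_near z1 B0 r0.
apply: (near_right_gap e10) => e ee.
rewrite distrC normcE ltcR (fE z z1); apply: H => //.
by rewrite subrr cnorm0.
Qed.

(** The neighbourhood must not depend on eps: it is a closed ball, and the neighbourhoods given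
    by quotient_near are patched by compactness. *)
Lemma quotient_uniform (z0 : V) : unit_ball z0 -> exists2 U : set V, nbhs z0 U &
  forall eps : R, 0 < eps -> \forall s \near (d%:R : R)^'+, forall (h : V -> R[i]) (z : V),
    in_L2 mu h -> (L2norm mu h <= 1)%E -> U z -> unit_ball z ->
    normc (gXf X s z (poisson_integral mu h) / (gX X s z)%:C - poisson_integral mu h z) < eps.
Proof.
move=> z01; pose r := (1 + cnorm z0) / 2.
have z0' : cnorm z0 < 1 by exact: z01.
have r1 : r < 1 by rewrite /r; lra.
have zr : 0 < r - cnorm z0 by rewrite /r; lra.
exists [set z | cnorm z <= r].
  apply: filterS (nbhs_cnorm z0 zr) => z /= h.
  by rewrite -(subrK z0 z) (le_trans (ler_cnormD _ _))// -lerBrDr ltW.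
move=> eps eps0; have /compact_near_coveringP cU := @compact_cnorm_le R d r.
pose Q (s : R) (z : V) := forall h, in_L2 mu h -> (L2norm mu h <= 1)%E ->
  normc (gXf X s z (poisson_integral mu h) / (gX X s z)%:C - poisson_integral mu h z) < eps.
have : \forall s \near (d%:R : R)^'+, [set z | cnorm z <= r] `<=` Q s.
  apply: cU => z1 /= z1r; have z11 := le_lt_trans z1r r1.
  have [del [e1 [del0 e10 H]]] := quotient_near z11 ler01 eps0.
  exists ([set z | cnorm (z - z1) < del], [set s | d%:R < s < d%:R + e1]).
    split => /=; first exact: nbhs_cnorm.
    by apply: (near_right_gap e10) => e /andP[e0 ee]; rewrite /= ltrDl e0 ltrD2l.
  move=> [z s] [/= zz /andP[s1 s2]] h hh h1; rewrite -(subrKC d%:R s).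
  by apply: H => //; [rewrite subr_gt0 s1 ltrBlDl|exact: L2norm_le1].
by apply: filterS => s HQ h z hh h1 /HQ Qz _; exact: Qz.
Qed.

End conclusion.

Theorem theorem4p15 (R : realType) (d : nat) (hd : (1 <= d)%N)
  (mu : probability 'rV[R[i]]_d R) (hmu : mu (@unit_sphere R d) = 1%E)
  (P : probability (conf R d) R)
  (hP : is_determinantal (@bergman_kernel R d) (ball_measure R d) P) :
  {ae P, forall X : conf R d,
    [/\ (forall (z : 'rV[R[i]]_d) (s : R), unit_ball z -> d%:R < s ->
          summable X (fun x => (weight s z x)%:E) /\
          forall f : 'rV[R[i]]_d -> R[i], in_H2 mu f ->
            summable X (fun x => (weight s z x * normc (f x))%:E)),
        (forall (f : 'rV[R[i]]_d -> R[i]) (z : 'rV[R[i]]_d),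
          in_H2 mu f -> unit_ball z ->
          gXf X s z f / (gX X s z)%:C @[s --> (d%:R : R)^'+] --> f z)
      & (forall z0 : 'rV[R[i]]_d, unit_ball z0 ->
          exists2 U : set 'rV[R[i]]_d, nbhs z0 U &
            forall eps : R, 0 < eps ->
              \forall s \near (d%:R : R)^'+,
                forall (h : 'rV[R[i]]_d -> R[i]) (z : 'rV[R[i]]_d),
                  in_L2 mu h -> (L2norm mu h <= 1)%E -> U z -> unit_ball z ->
                  normc (gXf X s z (poisson_integral mu h) / (gX X s z)%:C
                         - poisson_integral mu h z) < eps)]}.
Proof.
have typ n : {ae P, forall X, cnorm (rat_point R d n) < 1 -> typical mu X (rat_point R d n)}.
  have [z1|_] := ltP (cnorm (rat_point R d n)) 1; last by apply: nearW.
  have Ht := mean_square_ae hd hP mu true z1; have Hf := mean_square_ae hd hP mu false z1.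
  by apply: filterS2 Ht Hf => X ht hf _ [] eps eps0; [exact: ht|exact: hf].
apply: filterS (ae_foralln typ) => X typX.
have dense (z1 : 'rV[R[i]]_d) (del : R) : cnorm z1 < 1 -> 0 < del ->
    exists z, [/\ cnorm (z - z1) < del, cnorm z < 1 & typical mu X z].
  move=> z11 del0; have v0 : 0 < Num.min del (1 - cnorm z1) by rewrite lt_min del0 subr_gt0.
  have [n] := rat_point_dense z1 v0; rewrite lt_min => /andP[n1 n2].
  have z1' : cnorm (rat_point R d n) < 1.
    rewrite -(subrK z1 (rat_point R d n)); apply: le_lt_trans (ler_cnormD _ _) _.
    by rewrite -ltrBrDr.
  by exists (rat_point R d n); split => //; exact: typX.
split.
- by move=> z s; exact: summable_weights.
- by move=> f z; exact: quotient_limit.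
- by move=> z0; exact: quotient_uniform.
Qed.
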